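(* Let $(\Gamma_k)_{k\in\mathbb{N}}$ be the unfolded radii of a rotation-invariant determinantal process as in the context, $N\in\mathbb{N}\cup\{\infty\}$ and $\Xi_R^{(N)}=\sum_{k=1}^N(\mathbf{1}_{\Gamma_k\le R}-\mathbb{P}[\Gamma_k\le R])$. Assume Assumption (A) with $\vartheta=0$ and, if $N<\infty$, that $R=R(N)$ satisfies condition (N). Then, as $R\to\infty$, \[ \Bigl(\frac{\Xi_{tR}^{(N)}}{\sqrt{\Sigma_R}}\Bigr)_{t\in\mathbb{R}_+}\longrightarrow(G_t)_{t\in\mathbb{R}_+} \] in the Skorokhod topology on $\mathbb{R}_+$, where $(G_t)$ is a centred Gaussian process with \[ \operatorname{Cov}(G_s,G_t)=\int_I\Phi\bigl(\tfrac{x}{s}\bigr)\Bigl(1-\Phi\bigl(\tfrac{x}{t}\bigr)\Bigr)\mathrm{d}x\qquad\text{for }0<s\le t, \] and $I=(0,a^+)$.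
   Context: Setting: $\alpha\in\mathbb{N}_0$, $\mu$ a Radon measure on $\mathbb{C}$, $\xi$ a rotation-invariant determinantal point process on $\mathbb{C}$ with kernel $K(z,w)=\sum_{k\ge-\alpha}\rho_k(|z|)z^k\rho_k(|w|)\bar w^k$ w.r.t. $\mu$, with $\int\rho_k(|z|)^2|z|^{2k}\mathrm{d}\mu=1$; $\lambda_k(r)=\int_{|z|<r}\rho_k(|z|)^2|z|^{2k}\mathrm{d}\mu$, with $\sum_k\lambda_k(r)<\infty$; $T(r)=\sum_k\lambda_k(r)=\mathbb{E}[\xi(D_r)]$. Let $(X_k)_{k\ge-\alpha}$ be independent with $\mathbb{P}[X_k<r]=\lambda_k(r)$, $\Gamma_{k+\alpha+1}=T(X_k)$. Assumption (A): there exist $\vartheta\in\{0,1\}$ and an increasing continuous $\Sigma\colon\mathbb{R}_+\to\mathbb{R}_+$ with $\Sigma_R\to\infty$ such that for all $k\in\mathbb{N}$, $\mathbb{P}[\Gamma_k\le R]=\Phi(\tfrac{k-\vartheta R}{\Sigma_R})+\tfrac1{\Sigma_R}\Psi(\tfrac{k-\vartheta R}{\Sigma_R})+O(\theta_{R,k})$ with $\sum_k\theta_{R,k}\to0$, $\Phi(x)=\mathbb{P}[Z>x]$ for an absolutely continuous real random variable $Z$ with $\mathbb{E}|Z|<\infty$, $\Psi\in W^{1,1}(\mathbb{R})$; if $\vartheta=1$ also $\Sigma_R=o(R)$ and there is $m>1$ with $\mathbb{E}|Z|^m<\infty$, $\Sigma_R^{m+1}=o(R^m)$. Condition (N) (for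 $N<\infty$): one of (i) $\Sigma_R\Phi(\frac{N-\vartheta R}{\Sigma_R})\to0$; (ii) $\frac{N-\vartheta R}{\Sigma_R}=a^++o(\Sigma_R^{-1})$, $a^+\in\mathbb{R}$; (iii) $\Sigma_R(1-\Phi(\frac{N-\vartheta R}{\Sigma_R}))\to0$. Here $a^+=\lim\frac{N-\vartheta R}{\Sigma_R}$ if $N<\infty$, and $a^+=+\infty$ if $N=\infty$. *)

(* Defs.v *)
From HB Require Import structures.
From mathcomp Require Import all_boot all_order all_algebra.
From mathcomp Require Import all_classical all_reals all_analysis.
Set Implicit Arguments. Unset Strict Implicit. Unset Printing Implicit Defensive.
Import Order.TTheory GRing.Theory Num.Theory Num.Def.
Import numFieldNormedType.Exports.
Local Open Scope classical_set_scope.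
Local Open Scope ring_scope.

Section Defs.
Context {R : realType}.

(** The complex plane is modelled as R * R (product of Borel sigma-algebras,
    which is the Borel sigma-algebra of C); |z| is the Euclidean modulus. *)
Definition cabs (z : R * R) : R := Num.sqrt (z.1 ^+ 2 + z.2 ^+ 2).

Definition radon_on_C (mu : {measure set (R * R)%type -> \bar R}) : Prop :=
  forall r : R, (mu [set z | (cabs z < r)%R] < +oo)%E.

Definition lam (mu : {measure set (R * R)%type -> \bar R}) (rho : int -> R -> R)
    (k : int) (r : R) : \bar R :=
  (\int[mu]_(z in [set z | (cabs z < r)%R])
      ((rho k (cabs z)) ^+ 2 * (cabs z ^+ 2) ^ k)%R%:E)%E.

Definition lam_total (mu : {measure set (R * R)%type -> \bar R}) (rho : int -> R -> R)
    (k : int) : \bar R :=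
  (\int[mu]_z ((rho k (cabs z)) ^+ 2 * (cabs z ^+ 2) ^ k)%R%:E)%E.

(** T(r) = sum_{k >= -alpha} lambda_k(r) = E[xi(D_r)]  (k = j - alpha) *)
Definition Tfun (alpha : nat) (mu : {measure set (R * R)%type -> \bar R})
    (rho : int -> R -> R) (r : R) : R :=
  fine (\sum_(0 <= j <oo) lam mu rho (j%:Z - alpha%:Z) r)%E.

(** Unfolded radii: Gamma_{k+alpha+1} = T(X_k), i.e. Gamma_j = T(X_{j-alpha-1}), j >= 1. *)
Definition Gam (alpha : nat) (mu : {measure set (R * R)%type -> \bar R})
    (rho : int -> R -> R) {T : Type} (X : int -> T -> R) (j : nat) (w : T) : R :=
  Tfun alpha mu rho (X (j%:Z - alpha%:Z - 1) w).

Definition mutually_independent {d} {T : measurableType d} (P : probability T R)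
    (D : set int) (X : int -> T -> R) : Prop :=
  forall (S : seq int) (B : int -> set R), uniq S ->
    (forall i, i \in S -> D i) -> (forall i, measurable (B i)) ->
    P [set w | forall i, i \in S -> B i (X i w)] =
    (\big[*%E/1%E]_(i <- S) P (X i @^-1` B i))%E.

Definition prob_le {d} {T : measurableType d} (P : probability T R)
    (Gm : nat -> T -> R) (k : nat) (r : R) : R :=
  fine (P [set w | Gm k w <= r]).

Definition XiN {d} {T : measurableType d} (P : probability T R)
    (Gm : nat -> T -> R) (N : nat) (r : R) (w : T) : R :=
  \sum_(1 <= k < N.+1) (((Gm k w <= r)%R)%:R - prob_le P Gm k r).

Definition XiInf {d} {T : measurableType d} (P : probability T R)
    (Gm : nat -> T -> R) (r : R) (w : T) : R :=
  limn (fun n => \sum_(1 <= k < n.+1) (((Gm k w <= r)%R)%:R - prob_le P Gm k r)).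

(** Phi(x) = P[Z > x] for an absolutely continuous real r.v. Z with E|Z| < oo,
    expressed through the law mu_Z of Z. *)
Definition Phi_tail (Phi : R -> R) : Prop :=
  exists muZ : probability R R,
    muZ `<< (@lebesgue_measure R) /\
    (\int[muZ]_x (`|x|)%:E < +oo)%E /\
    forall x, Phi x = fine (muZ `]x, +oo[%classic).

(** Psi in W^{1,1}(R) (continuous representative): Psi integrable and
    absolutely continuous with integrable derivative g. *)
Definition W11 (Psi : R -> R) : Prop :=
  (@lebesgue_measure R).-integrable setT (EFin \o Psi) /\
  exists g : R -> R, (@lebesgue_measure R).-integrable setT (EFin \o g) /\
    forall x y, x <= y ->
      (\int[@lebesgue_measure R]_(u in `[x, y]) (g u)%:E)%E = (Psi y - Psi x)%:E.

Definition assumptionA0 {d} {T : measurableType d} (P : probability T R)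
    (Gm : nat -> T -> R) (Sig Phi Psi : R -> R) (theta : R -> nat -> R) : Prop :=
  (forall x, 0 <= x -> 0 <= Sig x) /\
  (forall x y, 0 <= x -> x < y -> Sig x < Sig y) /\
  {within `[0, +oo[, continuous Sig} /\
  Sig x @[x --> +oo] --> +oo /\
  Phi_tail Phi /\ W11 Psi /\
  (forall r k, 0 <= theta r k) /\
  (fun r => \sum_(1 <= k <oo) (theta r k)%:E)%E x @[x --> +oo] --> 0%E /\
  exists C : R, 0 < C /\
    \forall r \near +oo, forall k : nat, (0 < k)%N ->
      `| prob_le P Gm k r - Phi (k%:R / Sig r) - (Sig r)^-1 * Psi (k%:R / Sig r) |
        <= C * theta r k.

Definition conditionN (Sig Phi : R -> R) (RN : nat -> R) (ap : \bar R) : Prop :=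
  (fun N : nat => Sig (RN N) * Phi (N%:R / Sig (RN N))) n @[n --> \oo] --> 0
  \/ (exists a : R, ap = a%:E /\
        (fun N : nat => Sig (RN N) * (N%:R / Sig (RN N) - a)) n @[n --> \oo] --> 0)
  \/ (fun N : nat => Sig (RN N) * (1 - Phi (N%:R / Sig (RN N)))) n @[n --> \oo] --> 0.

(** Skorokhod space D(R_+): paths are functions R -> R of which only t >= 0 matters. *)
Definition cadlag (x : R -> R) : Prop :=
  (forall t, 0 <= t -> x @ at_right t --> x t) /\
  (forall t, 0 < t -> cvg (x @ at_left t)).

Definition time_change (l : R -> R) : Prop :=
  l 0 = 0 /\ {within `[0, +oo[, continuous l} /\
  (forall s t, 0 <= s -> s < t -> l s < l t) /\
  (forall u, 0 <= u -> exists2 t, 0 <= t & l t = u).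

(** Convergence in the Skorokhod J1 topology on D([0,oo)),
    Ethier-Kurtz, Prop. 3.5.3 (c). *)
Definition skorokhod_cvg (x : nat -> R -> R) (y : R -> R) : Prop :=
  forall T, 0 < T -> exists l : nat -> R -> R, (forall n, time_change (l n)) /\
    forall e, 0 < e -> \forall n \near \oo, forall t, 0 <= t <= T ->
      `|l n t - t| <= e /\ `|x n (l n t) - y t| <= e.

(** (sequential) continuity w.r.t. the Skorokhod topology (metrizable). *)
Definition skorokhod_continuous (H : (R -> R) -> R) : Prop :=
  forall (x : nat -> R -> R) (y : R -> R),
    (forall n, cadlag (x n)) -> cadlag y -> skorokhod_cvg x y ->
    H (x n) @[n --> \oo] --> H y.

Definition cvg_law_skorokhod {I : Type} (F : set_system I)
    {d} {T : measurableType d} (P : probability T R) (X : I -> T -> R -> R)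
    {d'} {T' : measurableType d'} (P' : probability T' R) (G : T' -> R -> R) : Prop :=
  forall H : (R -> R) -> R, (exists M, forall x, `|H x| <= M) -> skorokhod_continuous H ->
    (fun i => \int[P]_w (H (X i w))%:E)%E @ F --> (\int[P']_w (H (G w))%:E)%E.

Definition centred_gaussian_process {d'} {T' : measurableType d'} (P' : probability T' R)
    (G : T' -> R -> R) : Prop :=
  (forall t, 0 <= t -> measurable_fun setT (fun w => G w t)) /\
  (forall w, cadlag (G w)) /\
  forall s : seq (R * R), (forall p, p \in s -> 0 <= p.1) ->
    exists sd : R, 0 <= sd /\ forall A : set R, measurable A ->
      P' [set w | A (\sum_(p <- s) p.2 * G w p.1)] =
      (if sd == 0 then \d_(0 : R) A else normal_prob 0 sd A).

Definition covariance_spec {d'} {T' : measurableType d'} (P' : probability T' R)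
    (G : T' -> R -> R) (Phi : R -> R) (ap : \bar R) : Prop :=
  forall s t : R, 0 < s -> s <= t ->
    (\int[P']_w (G w s * G w t)%R%:E)%E =
    (\int[@lebesgue_measure R]_(x in [set x : R | (0 < x)%R /\ (x%:E < ap)%E])
        (Phi (x / s) * (1 - Phi (x / t)))%R%:E)%E.

End Defs.

(* Main.v *)
Require Import Defs.
From HB Require Import structures.
From mathcomp Require Import all_boot all_order all_algebra.
From mathcomp Require Import all_classical all_reals all_analysis.
From mathcomp Require Import measurable_realfun.
From mathcomp Require Import ring lra zify.
Set Implicit Arguments. Unset Strict Implicit. Unset Printing Implicit Defensive.
Import Order.TTheory GRing.Theory Num.Theory Num.Def.
Import numFieldNormedType.Exports.
Local Open Scope classical_set_scope.
Local Open Scope ring_scope.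

(** The variables 1_{Gamma_k <= r} are independent, so Xi is a sum of independent
    bounded centred terms. Since T is the sum of the distribution functions of the
    moduli X_k, the sum over k of P[Gamma_k <= r] is r up to the jumps of T, while
    assumption (A) gives c Sig_r + O(1) with Sig continuous; hence the jumps are
    bounded and Sig_r = r / c + O(1). Therefore P[Gamma_k <= tR] is close to
    Phi(k / (t Sig_R)), and the covariances of Xi_{tR} / sqrt(Sig_R) are Riemann sums
    of the announced integral. Characteristic functions give the finite-dimensional
    convergence. The number of Gamma_k in (sR, tR] has mean at most (t - s) R + O(1):
    fourth moments and dyadic chaining down to mesh 1/R, plus monotonicity of the
    counting function between grid points, control the modulus of continuity.

    The limiting covariance satisfies E (G_t - G_s)^2 <= c |t - s|. The process is
    built at dyadic times by Cholesky factorization from independent normal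
    variables, which are themselves functions of one uniform variable, and extended
    by chaining.

    A bounded Skorokhod-continuous H is the increasing limit, at cadlag paths, of its
    inf-convolutions with the uniform distance on [0, j]; along a path with small
    modulus these are Lipschitz functions of finitely many coordinates, which
    trigonometric polynomials approximate. This gives liminf E H(X_n) >= E H(G), and
    -H gives the other half. For N = oo the sum is cut at some N(R) beyond which the
    expected number of Gamma_k <= nR is negligible. *)

(** The path space carries no sigma-algebra here, so a test functional is reached only through
    measurable functions of finitely many coordinates. Uniform distance suffices in the
    inf-convolution for two reasons: uniform convergence on compacts implies Skorokhod convergence,
    and both the prelimit and the limit paths are uniformly close to their dyadic discretizations,
    so time changes other than the identity never appear. The constant c is the integral of Phi over
    the positive half-line. That c Sig_r = r + O(1) makes Sig_R / Sig_{tR} tend to 1/t, whence the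
    arguments x/s and x/t of the covariance. It also fixes the scale of increments: after division
    by Sig^2 their fourth moment is of order (t - s)^2 as long as (t - s) R stays above a constant.
    A union over 2^m dyadic intervals then leaves 2^-m, enough for thresholds (9/10)^m. Positivity
    of the limiting kernel and the bound on its increments are inherited from the prelimit
    covariances, not read off the integral formula. Characteristic functions appear as real cosines
    cos(y + b) with an arbitrary phase b, which covers sines and keeps all expectations real. *)

Section Expectation.
Context {R : realType} {d : measure_display} {T : measurableType d}.
Implicit Types (f g : T -> R).

(** Expectations are mostly taken of bounded measurable real functions: integrability is then
    automatic and [Ex] is real-valued and linear. *)
Definition bmf f := measurable_fun setT f /\ exists M : R, forall w, `|f w| <= M.

Lemma bmf_cst (c : R) : bmf (fun=> c).
Proof. by split => //; exists `|c|. Qed.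

Lemma bmfN f : bmf f -> bmf (fun w => - f w).
Proof.
move=> [mf [M fM]]; split; first exact: measurableT_comp.
by exists M => w; rewrite normrN.
Qed.

Lemma bmfD f g : bmf f -> bmf g -> bmf (fun w => f w + g w).
Proof.
move=> [mf [M fM]] [mg [M' gM]]; split; first exact: measurable_funD.
by exists (M + M') => w; rewrite (le_trans (ler_normD _ _))// lerD.
Qed.

Lemma bmfB f g : bmf f -> bmf g -> bmf (fun w => f w - g w).
Proof. by move=> hf hg; apply: bmfD => //; exact: bmfN. Qed.

Lemma bmfM f g : bmf f -> bmf g -> bmf (fun w => f w * g w).
Proof.
move=> [mf [M fM]] [mg [M' gM]]; split; first exact: measurable_funM.
by exists (M * M') => w; rewrite normrM ler_pM.
Qed.

Lemma bmfZ (c : R) f : bmf f -> bmf (fun w => c * f w).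
Proof. by move=> hf; apply: bmfM => //; exact: bmf_cst. Qed.

Lemma bmfX f n : bmf f -> bmf (fun w => f w ^+ n).
Proof.
move=> hf; elim: n => [|n IH].
  by under eq_fun do rewrite expr0; exact: bmf_cst.
by under eq_fun do rewrite exprS; exact: bmfM.
Qed.

Lemma bmf_norm f : bmf f -> bmf (fun w => `|f w|).
Proof.
move=> [mf [M fM]]; split; first exact: measurableT_comp.
by exists M => w; rewrite normr_id.
Qed.

Lemma bmf_sum (I : Type) (s : seq I) (p : pred I) (F : I -> T -> R) :
  (forall i, bmf (F i)) -> bmf (fun w => \sum_(i <- s | p i) F i w).
Proof.
move=> hF; elim: s => [|i s IH].
  by under eq_fun do rewrite big_nil; exact: bmf_cst.
under eq_fun do rewrite big_cons.
by case: (p i) => //; exact: bmfD.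
Qed.

Lemma bmf_indic (A : set T) : measurable A -> bmf (\1_A : T -> R).
Proof.
move=> mA; split; first exact: measurable_indic.
by exists 1 => w; rewrite indicE; case: (w \in A); rewrite /= ?normr1 ?normr0.
Qed.

Lemma bmf_cos f : measurable_fun setT f -> bmf (fun w => cos (f w)).
Proof.
move=> mf; split.
  by apply: (measurableT_comp _ mf); apply: continuous_measurable_fun; exact: continuous_cos.
by exists 1 => w; rewrite ler_norml cos_geN1 cos_le1.
Qed.

Lemma bmf_sin f : measurable_fun setT f -> bmf (fun w => sin (f w)).
Proof.
move=> mf; split.
  by apply: (measurableT_comp _ mf); apply: continuous_measurable_fun; exact: continuous_sin.
by exists 1 => w; rewrite ler_norml sin_geN1 sin_le1.
Qed.

Variable P : probability T R.

Definition Ex f : R := \int[P]_w f w.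

Lemma bmf_integrable f : bmf f -> P.-integrable setT (EFin \o f).
Proof.
move=> [mf [M fM]]; apply: measurable_bounded_integrable => //.
  by rewrite [ltLHS]probability_setT ltry.
exists M; split; first by rewrite num_real.
by move=> x Mx w _ /=; rewrite (le_trans (fM w))// ltW.
Qed.

Lemma ExE f : bmf f -> (\int[P]_w (f w)%:E)%E = (Ex f)%:E.
Proof.
by move=> hf; rewrite /Ex /Rintegral fineK//; apply: integrable_fin_num => //; exact: bmf_integrable.
Qed.

Lemma Ex_cst (c : R) : Ex (fun=> c) = c.
Proof. 
rewrite /Ex Rintegral_cst// -[RHS]mulr1; congr (_ * _).
exact: (congr1 fine (probability_setT P)).
 Qed.

Lemma ExD f g : bmf f -> bmf g -> Ex (fun w => f w + g w) = Ex f + Ex g.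
Proof. by move=> hf hg; rewrite /Ex RintegralD//; exact: bmf_integrable. Qed.

Lemma ExB f g : bmf f -> bmf g -> Ex (fun w => f w - g w) = Ex f - Ex g.
Proof. by move=> hf hg; rewrite /Ex RintegralB//; exact: bmf_integrable. Qed.

Lemma ExZ (c : R) f : bmf f -> Ex (fun w => c * f w) = c * Ex f.
Proof. by move=> hf; rewrite /Ex RintegralZl//; exact: bmf_integrable. Qed.

Lemma ExN f : bmf f -> Ex (fun w => - f w) = - Ex f.
Proof.
move=> hf; rewrite -mulN1r -ExZ//.
by congr Ex; apply/funext => w; rewrite mulN1r.
Qed.

Lemma Ex_sum (I : Type) (s : seq I) (p : pred I) (F : I -> T -> R) :
  (forall i, bmf (F i)) ->
  Ex (fun w => \sum_(i <- s | p i) F i w) = \sum_(i <- s | p i) Ex (F i).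
Proof.
move=> hF; elim: s => [|i s IH].
  by under eq_fun do rewrite big_nil; rewrite big_nil Ex_cst.
under eq_fun do rewrite big_cons; rewrite big_cons.
by case: (p i) => //; rewrite ExD ?IH//; exact: bmf_sum.
Qed.

Lemma Ex_le f g : bmf f -> bmf g -> (forall w, f w <= g w) -> Ex f <= Ex g.
Proof.
by move=> hf hg fg; apply: le_Rintegral => //; exact: bmf_integrable.
Qed.

Lemma Ex_ge0 f : (forall w, 0 <= f w) -> 0 <= Ex f.
Proof. by move=> f0; apply: Rintegral_ge0. Qed.

Lemma Ex_norm f : bmf f -> `|Ex f| <= Ex (fun w => `|f w|).
Proof. by move=> hf; apply: le_normr_Rintegral => //; exact: bmf_integrable. Qed.

Lemma Ex_norm_le f (M : R) : bmf f -> (forall w, `|f w| <= M) -> `|Ex f| <= M.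
Proof.
move=> hf fM; rewrite (le_trans (Ex_norm hf))// -[leRHS]Ex_cst.
by apply: Ex_le => //; [exact: bmf_norm|exact: bmf_cst].
Qed.

Definition Pr (A : set T) : R := fine (P A).

Lemma PrE A : measurable A -> P A = (Pr A)%:E.
Proof.
move=> mA; rewrite /Pr fineK// fin_num_abs.
by rewrite (le_lt_trans _ (ltry 1))// gee0_abs// probability_le1.
Qed.

Lemma Ex_indic (A : set T) : measurable A -> Ex (\1_A : T -> R) = Pr A.
Proof. by move=> mA; rewrite /Ex /Rintegral integral_indic// setIT. Qed.

Lemma Pr_ge0 A : 0 <= Pr A.
Proof. exact: fine_ge0. Qed.

Lemma Pr_le1 A : measurable A -> Pr A <= 1.
Proof. by move=> mA; rewrite -lee_fin -PrE// probability_le1. Qed.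

Lemma Pr_setT : Pr setT = 1.
Proof. by rewrite /Pr probability_setT. Qed.

Lemma Pr_le A B : measurable A -> measurable B -> A `<=` B -> Pr A <= Pr B.
Proof. by move=> mA mB AB; rewrite -lee_fin -!PrE// le_measure// inE. Qed.

Lemma Pr_setC A : measurable A -> Pr (~` A) = 1 - Pr A.
Proof.
move=> mA; apply: EFin_inj; rewrite EFinB -!PrE//; last exact: measurableC.
by rewrite probability_setC.
Qed.

Lemma Pr_setU A B : measurable A -> measurable B -> Pr (A `|` B) <= Pr A + Pr B.
Proof.
move=> mA mB; rewrite -lee_fin EFinD -!PrE//; last exact: measurableU.
exact: measureU2.
Qed.

Lemma Ex_dct (f_ : nat -> T -> R) f (M : R) :
  (forall n, measurable_fun setT (f_ n)) -> measurable_fun setT f ->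
  (forall n w, `|f_ n w| <= M) ->
  {ae P, forall w, f_ n w @[n --> \oo] --> f w} ->
  Ex (f_ n) @[n --> \oo] --> Ex f.
Proof.
move=> mf_ mf fM f_f.
have M0 : 0 <= M by rewrite (le_trans _ (fM 0%N point)).
have [iF _ cF] : [/\ P.-integrable setT (EFin \o f),
    (\int[P]_w `|(f_ n w)%:E - (f w)%:E|)%E @[n --> \oo] --> 0%E &
    (\int[P]_w (f_ n w)%:E)%E @[n --> \oo] --> (\int[P]_w (f w)%:E)%E].
  apply: (@dominated_convergence _ _ _ P setT measurableT
    (fun n w => (f_ n w)%:E) (EFin \o f) (EFin \o cst M)).
  - by move=> n; exact/measurable_EFinP.
  - exact/measurable_EFinP.
  - move: f_f; apply: filterS => w h _ /=.
    exact: cvg_EFin (nearW _ _) h.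
  - exact: bmf_integrable (bmf_cst M).
  - by apply/aeW => w n _ /=; rewrite lee_fin.
apply: fine_cvg; rewrite fineK//.
exact: integrable_fin_num.
Qed.

Lemma markov4 f (e : R) : bmf f -> 0 < e ->
  Pr [set w | e < `|f w|] <= Ex (fun w => f w ^+ 4) / e ^+ 4.
Proof.
move=> hf e0.
have mA : measurable [set w | e < `|f w|].
  have -> : [set w | e < `|f w|] = (fun w => `|f w|) @^-1` `]e, +oo[.
    by apply/seteqP; split => w /=; rewrite in_itv/= andbT.
  by rewrite -[X in measurable X]setTI; apply: (bmf_norm hf).1.
rewrite ler_pdivlMr ?exprn_gt0// mulrC -Ex_indic// -ExZ; last exact: bmf_indic.
apply: Ex_le; [exact/bmfZ/bmf_indic|exact: bmfX|move=> w].
rewrite indicE; have [|] := boolP (w \in _).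
  rewrite inE /= mulr1 => h; rewrite -(ger0_norm (_ : 0 <= f w ^+ 4)) ?exprn_even_ge0// normrX.
  by apply: lerXn2r; rewrite ?nnegrE ?normr_ge0// ltW.
by rewrite mulr0 exprn_even_ge0.
Qed.

(** The integral of a nonnegative function is a supremum over the simple functions below it, hence
    monotone even for nonmeasurable functions. *)
Lemma integral_ge0_mono f g : (forall w, 0 <= f w) -> (forall w, f w <= g w) ->
  ((\int[P]_w (f w)%:E) <= \int[P]_w (g w)%:E)%E.
Proof.
move=> f0 fg; rewrite !ge0_integralTE; last 2 first.
- by move=> w; rewrite lee_fin (le_trans (f0 w)).
- by move=> w; rewrite lee_fin.
apply: le_ereal_sup => _ [h /= hf <-]; exists h => //= w.
by rewrite (le_trans (hf w))// lee_fin.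
Qed.

(* Test functionals on the path space are not known to be measurable along a process,
   so their expectations are only lower integrals. *)
Lemma integral_sandwich f g1 g2 : bmf g1 -> bmf g2 ->
  (forall w, g1 w <= f w) -> (forall w, f w <= g2 w) ->
  ((Ex g1)%:E <= \int[P]_w (f w)%:E)%E /\ ((\int[P]_w (f w)%:E) <= (Ex g2)%:E)%E.
Proof.
move=> h1 h2 g1f fg2; rewrite -!ExE// !(integralE _ _ (EFin \o _)).
have E1 (u : T -> R) : (EFin \o u)^\+%E = (fun w => (maxr (u w) 0)%:E).
  by apply/funext => w; rewrite funeposE /= EFin_max.
have E2 (u : T -> R) : (EFin \o u)^\-%E = (fun w => (maxr (- u w) 0)%:E).
  by apply/funext => w; rewrite funenegE /= EFin_max.
rewrite !E1 !E2.
have mx (a b : R) : a <= b -> maxr a 0 <= maxr b 0 by move=> ab; rewrite ge_max !le_max ab lexx orbT.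
have p0 (a : R) : 0 <= maxr a 0 by rewrite le_max lexx orbT.
by split; apply: leeB; apply: integral_ge0_mono => w //; apply: mx; rewrite ?lerN2.
Qed.

End Expectation.

(** * Taylor bounds for sine and cosine *)

Section TrigBounds.
Context {R : realType}.
Implicit Types y : R.

Lemma sin_le_id y : 0 <= y -> sin y <= y.
Proof.
rewrite le_eqVlt => /predU1P[<-|y0]; first by rewrite sin0.
have [c _] := @MVT _ (@sin R) (@cos R) 0 y y0 (fun x _ => is_derive_sin x)
  (continuous_subspaceT (@continuous_sin R)).
rewrite sin0 !subr0 => ->.
by rewrite ler_piMl ?cos_le1// ltW.
Qed.

Lemma norm_sin_le y : `|sin y| <= `|y|.
Proof.
wlog y0 : y / 0 <= y => [H|].
  have [/H//|/ltW y0] := leP 0 y.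
  by rewrite -normrN -sinN -(normrN y) H// oppr_ge0.
rewrite (ger0_norm y0) ler_norml sin_le_id// andbT.
have [y1|y1] := leP y pi; first by rewrite (le_trans _ (sin_ge0_pi _))// ?oppr_le0 ?y0.
by rewrite (le_trans _ (sin_geN1 _))// lerN2 (le_trans _ (ltW y1))// (le_trans _ (pi_ge2 _))// ler1n.
Qed.

(** From cos y = 1 - 2 sin(y/2)^2 and |sin x| <= |x|. *)
Lemma cos_ge_quad y : 1 - y ^+ 2 / 2 <= cos y.
Proof.
have -> : cos y = 1 - 2 * (sin (y / 2)) ^+ 2.
  have := @cos_mulr2n _ (y / 2); have -> : (y / 2) *+ 2 = y by rewrite -mulr_natr divfK.
  move=> ->.
  by have := cos2Dsin2 (y / 2); lra.
have : `|sin (y / 2)| ^+ 2 <= `|y / 2| ^+ 2 by rewrite lerXn2r ?nnegrE// norm_sin_le.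
by rewrite !real_normK ?num_real//; lra.
Qed.

(** The mean value theorem gives sin y = y cos c with c between 0 and y, so the gap is y (1 - cos c)
    <= y c^2 / 2. The constant 1/2 in place of 1/6 is good enough. *)
Lemma sin_sub_le y : `|sin y - y| <= `|y| ^+ 3 / 2.
Proof.
wlog y0 : y / 0 <= y => [H|].
  have [/H//|/ltW y0] := leP 0 y.
  have -> : sin y - y = - (sin (- y) - (- y)) by rewrite sinN; ring.
  by rewrite normrN -(normrN y) H// oppr_ge0.
rewrite (ger0_norm y0).
have : sin y - y <= 0 by rewrite subr_le0 sin_le_id.
move/ler0_norm ->.
move: y0; rewrite le_eqVlt => /predU1P[<-|y0].
  by rewrite sin0 expr0n/= mul0r subrr oppr0.
have [c cin] := @MVT _ (@sin R) (@cos R) 0 y y0 (fun x _ => is_derive_sin x)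
  (continuous_subspaceT (@continuous_sin R)).
rewrite sin0 !subr0 => ->.
move: cin; rewrite in_itv/= => /andP[c0 cy].
have := cos_ge_quad c => hc.
have : c ^+ 2 <= y ^+ 2 by rewrite lerXn2r ?nnegrE// ltW.
by rewrite expr2 => c2; rewrite !exprS expr0 in hc *; nra.
Qed.

(** Mean value theorem for cos x - 1 + x^2 / 2, whose derivative x - sin x is controlled by the
    cubic bound above. *)
Lemma cos_sub_le y : `|cos y - 1 + y ^+ 2 / 2| <= `|y| ^+ 4 / 2.
Proof.
wlog y0 : y / 0 <= y => [H|].
  have [/H//|/ltW y0] := leP 0 y.
  by have := H (- y); rewrite cosN sqrrN normrN; apply; rewrite oppr_ge0.
rewrite (ger0_norm y0) ger0_norm; last by have := cos_ge_quad y; lra.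
move: y0; rewrite le_eqVlt => /predU1P[<-|y0].
  by rewrite cos0 !expr0n/= !mul0r addr0 subrr.
pose f (x : R) := cos x - 1 + x ^+ 2 / 2.
have df x : is_derive x (1 : R) f (x - sin x).
  rewrite /f; apply: is_derive_eq.
  by rewrite /GRing.scale/=; lra.
have cf : {within `[0, y], continuous f}.
  apply: derivable_within_continuous => x _.
  by have [] := df x.
have [c cin] := @MVT _ f (fun x => x - sin x) 0 y y0 (fun x _ => df x) cf.
rewrite /f cos0 expr0n/= mul0r subrr addr0 !subr0 => ->.
move: cin; rewrite in_itv/= => /andP[c0 cy].
have := sin_sub_le c; rewrite distrC (ger0_norm (ltW c0)).
move/(le_trans (ler_norm _)) => h.
have c3 : c ^+ 3 <= y ^+ 3 by rewrite lerXn2r ?nnegrE// ltW.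
rewrite (exprS y 3); nra.
Qed.

End TrigBounds.

(** * Approximation of Lipschitz functions of finitely many coordinates by trigonometric
    polynomials *)

Section TrigPoly.
Context {R : realType}.
Implicit Types (x y : R -> R) (D : R -> Prop).

Definition lfun (s : seq (R * R)) x : R := \sum_(p <- s) p.2 * x p.1.

Definition lneg (s : seq (R * R)) := [seq (p.1, - p.2) | p <- s].

Lemma lfun_cat s s' x : lfun (s ++ s') x = lfun s x + lfun s' x.
Proof. by rewrite /lfun big_cat. Qed.

Lemma lfun_neg s x : lfun (lneg s) x = - lfun s x.
Proof.
by rewrite /lfun big_map -sumrN; apply: eq_bigr => p _; rewrite mulNr.
Qed.

Definition times_in D (s : seq (R * R)) := forall p, p \in s -> D p.1.

Lemma times_in_cat D s s' : times_in D s -> times_in D s' -> times_in D (s ++ s').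
Proof. by move=> h h' p; rewrite mem_cat => /orP[/h|/h']. Qed.

Lemma times_in_neg D s : times_in D s -> times_in D (lneg s).
Proof. by move=> h p /mapP[q /h hq ->]. Qed.

(** Real trigonometric polynomials in the coordinates with times in D. The phase b makes the class
    contain sines as well, so that it is an algebra. *)
Inductive trig D : ((R -> R) -> R) -> Prop :=
| trig_cos s b : times_in D s -> trig D (fun x => cos (lfun s x + b))
| trigD f g : trig D f -> trig D g -> trig D (fun x => f x + g x)
| trigZ c f : trig D f -> trig D (fun x => c * f x).

Lemma trig_cst D c : trig D (fun=> c).
Proof.
have -> : (fun=> c) = (fun x : R -> R => c * cos (lfun [::] x + 0)).
  by apply/funext => x; rewrite /lfun big_nil add0r cos0 mulr1.
by apply: trigZ; apply: trig_cos.
Qed.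

Lemma trigB D f g : trig D f -> trig D g -> trig D (fun x => f x - g x).
Proof.
move=> hf hg; have -> : (fun x => f x - g x) = (fun x => f x + (-1) * g x).
  by apply/funext => x; rewrite mulN1r.
by apply: trigD => //; apply: trigZ.
Qed.

(** Product-to-sum formula on the generators: frequencies add (concatenation of lists) or subtract
    (concatenation with [lneg]). *)
Lemma trigM D f g : trig D f -> trig D g -> trig D (fun x => f x * g x).
Proof.
move=> hf; elim: hf g => {f} [s b hs g hg|f f' hf IH hf' IH' g hg|c f hf IH g hg].
- elim: hg => {g} [s' b' hs'|g g' hg IH hg' IH'|c g hg IH].
  + have -> : (fun x => cos (lfun s x + b) * cos (lfun s' x + b')) =
      (fun x => 2^-1 * (cos (lfun (s ++ s') x + (b + b')) +
         cos (lfun (s ++ lneg s') x + (b - b')))).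
      apply/funext => x; rewrite !lfun_cat lfun_neg.
      have -> : lfun s x + lfun s' x + (b + b') = (lfun s x + b) + (lfun s' x + b') by ring.
      have -> : lfun s x - lfun s' x + (b - b') = (lfun s x + b) - (lfun s' x + b') by ring.
      by move: (lfun s x + b) (lfun s' x + b') => u v; rewrite cosD cosB; field.
    by apply/trigZ/trigD; apply: trig_cos; apply: times_in_cat => //; apply: times_in_neg.
  + under eq_fun do rewrite mulrDr; exact: trigD.
  + under eq_fun do rewrite mulrCA; exact: trigZ.
- by under eq_fun do rewrite mulrDl; apply: trigD; [exact: IH|exact: IH'].
- by under eq_fun do rewrite -mulrA; apply: trigZ; exact: IH.
Qed.

Lemma trig_sin D t a : D t -> trig D (fun x => sin (a * x t)).
Proof.
move=> Dt; have -> : (fun x => sin (a * x t)) =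
    (fun x : R -> R => cos (lfun [:: (t, a)] x + (- (pi / 2)))).
  by apply/funext => x; rewrite /lfun big_seq1/= cosB cos_pihalf sin_pihalf mulr0 add0r mulr1.
by apply: trig_cos => p; rewrite inE => /eqP ->.
Qed.

(* Bop n u f = E f(Binomial(n, u)), the Bernstein operator; at u = (1 + sin (a x_t)) / 2
   it produces trigonometric polynomials of the path x. *)
Fixpoint Bop (n : nat) (u : R) (f : nat -> R) : R :=
  if n is n'.+1 then (1 - u) * Bop n' u f + u * Bop n' u (fun k => f k.+1) else f 0%N.

Lemma Bop_le n u f g : 0 <= u <= 1 -> (forall k, (k <= n)%N -> f k <= g k) -> Bop n u f <= Bop n u g.
Proof.
move=> /andP[u0 u1]; elim: n f g => /= [|n IH] f g fg; first exact: fg.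
apply: lerD; apply: ler_wpM2l; rewrite ?subr_ge0//; apply: IH => k kn; apply: fg => //.
exact: leqW.
Qed.

Lemma BopD n u f g : Bop n u (fun k => f k + g k) = Bop n u f + Bop n u g.
Proof. by elim: n f g => //= n IH f g; rewrite !IH; ring. Qed.

Lemma BopZ n u c f : Bop n u (fun k => c * f k) = c * Bop n u f.
Proof. by elim: n f => //= n IH f; rewrite !IH; ring. Qed.

Lemma Bop_cst n u c : Bop n u (fun=> c) = c.
Proof. by elim: n => //= n ->; ring. Qed.

(** Mean square of a binomial variable about a: squared bias plus variance. *)
Lemma Bop_sqr n u a : Bop n u (fun k => (k%:R - a) ^+ 2) = (n%:R * u - a) ^+ 2 + n%:R * u * (1 - u).
Proof.
elim: n a => [|n IH] a /=; first by rewrite !mul0r; ring.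
have -> : (fun k : nat => (k.+1%:R - a) ^+ 2) = (fun k => (k%:R - (a - 1)) ^+ 2).
  by apply/funext => k; rewrite -natr1; congr (_ ^+ 2); ring.
by rewrite !IH -natr1; ring.
Qed.

Lemma Bop_norm n u f : 0 <= u <= 1 -> `|Bop n u f| <= Bop n u (fun k => `|f k|).
Proof.
move=> u01; rewrite ler_norml; apply/andP; split.
  rewrite -mulN1r -BopZ; apply: Bop_le => // k _.
  by rewrite mulN1r lerNl ler_normr lexx orbT.
by apply: Bop_le => // k _; rewrite ler_norm.
Qed.

Lemma Bop_dist n u (e : R) : (0 < n)%N -> 0 <= u <= 1 -> 0 < e ->
  Bop n u (fun k => `|u - k%:R / n%:R|) <= e + (n%:R * e)^-1.
Proof.
move=> n0 u01 e0.
have nr0 : 0 < n%:R :> R by rewrite ltr0n.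
(* From e |v| <= e^2 + v^2: a linear deviation is traded for a quadratic one, whose binomial mean is
   the variance. *)
have h k : `|u - k%:R / n%:R| <= e + (n%:R ^+ 2 * e)^-1 * (k%:R - n%:R * u) ^+ 2.
  set v := u - k%:R / n%:R.
  have -> : (k%:R - n%:R * u) ^+ 2 = n%:R ^+ 2 * `|v| ^+ 2.
    by rewrite real_normK ?num_real// /v; field; rewrite gt_eqF.
  have -> : (n%:R ^+ 2 * e)^-1 * (n%:R ^+ 2 * `|v| ^+ 2) = `|v| ^+ 2 / e.
    by field; rewrite !gt_eqF.
  rewrite -(ler_pM2r e0) mulrDl mulfVK ?gt_eqF//.
  by have := sqr_ge0 (`|v| - e); have := normr_ge0 v; nra.
apply: (le_trans (Bop_le u01 (fun k _ => h k))).
rewrite BopD Bop_cst BopZ Bop_sqr subrr expr0n/= add0r lerD2l.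
case/andP: u01 => u0 u1.
have -> : (n%:R * e)^-1 = (n%:R ^+ 2 * e)^-1 * n%:R by field; rewrite !gt_eqF.
apply: ler_wpM2l; first by rewrite invr_ge0 mulr_ge0 ?ltW// exprn_gt0.
by nra.
Qed.

Lemma ex_large_inv (eta : R) : 0 < eta -> exists n : nat, (0 < n)%N /\ (n%:R * eta)^-1 <= eta.
Proof.
move=> eta0; exists (Num.truncn ((eta * eta)^-1)).+1; split => //.
have := truncnS_gt ((eta * eta)^-1); set m := (_.+1%:R : R) => h.
have m0 : 0 < m by rewrite ltr0n.
have ee0 : 0 < eta * eta by rewrite mulr_gt0.
have h1 : 1 < m * (eta * eta) by rewrite -ltr_pdivrMr// mul1r.
by rewrite -[leLHS]mul1r ler_pdivrMr ?mulr_gt0// mulrCA ltW.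
Qed.

Definition upd x (t v : R) : R -> R := fun s => if s == t then v else x s.

Lemma trig_Bop D n t a (F : nat -> (R -> R) -> R) : D t ->
  (forall k, trig D (F k)) ->
  trig D (fun x => Bop n ((1 + sin (a * x t)) / 2) (fun k => F k x)).
Proof.
move=> Dt; elim: n F => [|n IH] F hF /=; first exact: hF.
have hu : trig D (fun x => (1 + sin (a * x t)) / 2).
  under eq_fun do rewrite mulrC; apply/trigZ/trigD; [exact: trig_cst|exact: trig_sin].
apply: trigD; apply: trigM => //; last exact: (IH (fun k => F k.+1)).
  by apply: trigB => //; exact: trig_cst.
exact: IH.
Qed.

(** Induction on the coordinates. The coordinate x t is replaced by B sin(x t / B), close to it on
    the box when B is large, and the dependence on u = (1 + sin(x t / B)) / 2 by a Bernstein
    operator whose k-th coefficient is L with x t frozen at the k-th node, itself approximated by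
    induction. As an averaging operator it keeps the bound M for all paths, which is what controls
    the error outside the box. *)
Lemma trig_approx D (s : seq R) (L : (R -> R) -> R) (C M : R) :
  uniq s -> (forall t, t \in s -> D t) -> 0 <= C ->
  (forall x y, `|L x - L y| <= C * \sum_(t <- s) `|x t - y t|) ->
  (forall x, `|L x| <= M) ->
  forall A e : R, 0 < A -> 0 < e -> exists T, [/\ trig D T, (forall x, `|T x| <= M) &
    forall x, (forall t, t \in s -> `|x t| <= A) -> `|L x - T x| <= e].
Proof.
move=> us Ds C0 Llip LM A e A0 e0.
elim: s us Ds L Llip LM e e0 => [|t s IH] us Ds L Llip LM e e0.
  exists (fun=> L (fun=> 0)); split => [|x|x _]; [exact: trig_cst|exact: LM|].
  by rewrite (le_trans (Llip _ _))// big_nil mulr0 ltW.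
have /andP[ts us'] := us.
(* Error budget: q is allowed for the sine substitution and q for the Bernstein operator, each
   costing at most e/4 through the Lipschitz constant C; the coefficients take the remaining e/2. B
   makes the cubic Taylor error at most q on the box. *)
pose q := (C + 1)^-1 * (e / 4).
have q0 : 0 < q by rewrite /q mulr_gt0 ?invr_gt0; lra.
pose B := (A + 1) ^+ 2 + (A + 1) ^+ 3 / q.
have B0 : 0 < B by rewrite /B addr_gt0 ?exprn_gt0 ?divr_gt0 ?exprn_gt0; lra.
have B1 : 1 <= B.
  rewrite (le_trans (_ : 1 <= (A + 1) ^+ 2))//; first by rewrite expr_ge1//; lra.
  by rewrite /B lerDl divr_ge0 ?exprn_ge0 ?ltW//; lra.
pose eta := q / (4 * B).
have eta0 : 0 < eta by rewrite /eta divr_gt0// mulr_gt0.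
have hq : C * q <= e / 4.
  by rewrite /q mulrA; apply: ler_piMl; [rewrite divr_ge0// ltW|rewrite ler_pdivrMr; lra].
have h4 : (A + 1) ^+ 3 <= q * B.
  rewrite /B mulrDr [X in _ <= _ + X]mulrC divfK ?gt_eqF// lerDr mulr_ge0 ?exprn_ge0 ?ltW//; lra.
have heta : q = 2 * B * (eta + eta) by rewrite /eta; field; rewrite gt_eqF.
clearbody eta B q.
have [n nP] : exists n : nat, (0 < n)%N /\ (n%:R * eta)^-1 <= eta.
  exact: ex_large_inv.
(* Since B sin(x t / B) = B (2 u - 1), the node u = k / n corresponds to this frozen value. *)
pose y k : R := B * (2 * (k%:R / n%:R) - 1).
have [F hF] : {F : nat -> (R -> R) -> R & forall k, [/\ trig D (F k), (forall x, `|F k x| <= M) &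
    forall x, (forall t, t \in s -> `|x t| <= A) -> `|L (upd x t (y k)) - F k x| <= e / 2]}.
  apply: (@choice _ _ (fun k T => [/\ trig D T, (forall x, `|T x| <= M) & forall x,
    (forall t, t \in s -> `|x t| <= A) -> `|L (upd x t (y k)) - T x| <= e / 2])) => k.
  apply: (IH us' _ (fun x => L (upd x t (y k)))); last by rewrite divr_gt0.
  - by move=> u us0; apply: Ds; rewrite inE us0 orbT.
  - move=> x z; rewrite (le_trans (Llip _ _))// ler_wpM2l// big_cons /upd eqxx subrr normr0 add0r.
    rewrite big_seq [leRHS]big_seq; apply: ler_sum => u us0.
    by case: eqP => // ->; rewrite subrr normr0.
  - by move=> x; exact: LM.
have u01 (x : R -> R) : 0 <= (1 + sin (B^-1 * x t)) / 2 <= 1.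
  by have := sin_geN1 (B^-1 * x t); have := sin_le1 (B^-1 * x t); lra.
exists (fun x => Bop n ((1 + sin (B^-1 * x t)) / 2) (fun k => F k x)); split.
- apply: trig_Bop; first by apply: Ds; rewrite inE eqxx.
  by move=> k; have [] := hF k.
- move=> x; rewrite (le_trans (Bop_norm _ _ (u01 x)))// -[leRHS](Bop_cst n ((1 + sin (B^-1 * x t)) / 2)).
  by apply: Bop_le => // k _; have [] := hF k.
move=> x xA.
set u := (1 + sin (B^-1 * x t)) / 2.
have xtA : `|x t| <= A by apply: xA; rewrite inE eqxx.
have step1 : `|x t - B * sin (B^-1 * x t)| <= q.
  have := sin_sub_le (B^-1 * x t); rewrite distrC.
  have -> : x t - B * sin (B^-1 * x t) = B * (B^-1 * x t - sin (B^-1 * x t)).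
    by rewrite mulrBr mulVKf// gt_eqF.
  move=> h; rewrite normrM (gtr0_norm B0).
  apply: (le_trans (ler_wpM2l (ltW B0) h)).
  rewrite normrM gtr0_norm ?invr_gt0// exprMn.
  have -> : B * (B^-1 ^+ 3 * `|x t| ^+ 3 / 2) = `|x t| ^+ 3 / 2 / B ^+ 2.
    by field; rewrite gt_eqF.
  rewrite ler_pdivrMr ?exprn_gt0//.
  have h3 : `|x t| ^+ 3 <= (A + 1) ^+ 3 by rewrite lerXn2r ?nnegrE//; lra.
  have h5 : q * B <= q * B ^+ 2 by rewrite ler_pM2l// expr2 ler_peMl// ltW.
  have h6 : 0 <= `|x t| ^+ 3 by rewrite exprn_ge0.
  by lra.
have xy k : `|x t - y k| <= q + 2 * B * `|u - k%:R / n%:R|.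
  have -> : x t - y k = (x t - B * sin (B^-1 * x t)) + 2 * B * (u - k%:R / n%:R).
    by rewrite /y /u; field; rewrite pnatr_eq0 -lt0n; exact: nP.1.
  rewrite (le_trans (ler_normD _ _))// lerD// normrM gtr0_norm ?mulr_gt0//.
have LF k : `|L x - F k x| <= C * (q + 2 * B * `|u - k%:R / n%:R|) + e / 2.
  have -> : L x - F k x = (L x - L (upd x t (y k))) + (L (upd x t (y k)) - F k x) by ring.
  rewrite (le_trans (ler_normD _ _))// lerD//; last first.
    by have [_ _] := hF k; apply=> v vs; apply: xA; rewrite inE vs orbT.
  rewrite (le_trans (Llip _ _))// ler_wpM2l// big_cons /upd eqxx big_seq big1 ?addr0// => v vs.
  by case: eqP => [vt|_]; [rewrite vt (negbTE ts) in vs|rewrite subrr normr0].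
have -> : L x - Bop n u (F ^~ x) = Bop n u (fun k => L x + (-1) * F k x).
  by rewrite BopD Bop_cst BopZ mulN1r.
rewrite (le_trans (Bop_norm _ _ (u01 x)))//.
apply: (le_trans (Bop_le (u01 x) _ (g := fun k => C * (q + 2 * B * `|u - k%:R / n%:R|) + e / 2))).
  by move=> k _; rewrite mulN1r; exact: LF.
rewrite BopD Bop_cst BopZ BopD Bop_cst BopZ.
have := Bop_dist nP.1 (u01 x) eta0 => /le_trans/(_ (lerD (lexx eta) nP.2)) hd.
have hd2 : 2 * B * Bop n u (fun k => `|u - k%:R / n%:R|) <= q.
  rewrite heta.
  by rewrite ler_wpM2l// mulr_ge0// ltW.
have : C * (q + 2 * B * Bop n u (fun k => `|u - k%:R / n%:R|)) <= C * (q + q).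
  by rewrite ler_wpM2l// lerD2l.
rewrite /u in hd2 *.
lra.
Qed.

End TrigPoly.

(** * A criterion for convergence in law on the Skorokhod space *)

Section Regularization.
Context {R : realType}.
Implicit Types (x y : R -> R).

Lemma cadlag_cst (c : R) : cadlag (fun=> c).
Proof.
split => t _; first exact: cvg_cst.
by apply/cvg_ex; exists c; exact: cvg_cst.
Qed.

Variables (H : (R -> R) -> R) (M : R).
Hypothesis HM : forall x, `|H x| <= M.
Hypothesis Hc : skorokhod_continuous H.

(* Inf-convolution of H with j times the uniform distance on [0, j]. *)
Definition regset (j : nat) x : set R := [set v | exists (y : R -> R) (e : R), [/\ cadlag y, 0 <= e,
  1 <= e \/ (forall t : R, 0 <= t <= j%:R -> `|y t - x t| <= e) & v = H y + j%:R * e]].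

Definition Hreg (j : nat) x : R := inf (regset j x).

Let M0 : 0 <= M. Proof. exact: le_trans (HM (fun=> 0)). Qed.

Lemma regset_lb j x : lbound (regset j x) (- M).
Proof.
move=> v [y [e [_ e0 _ ->]]].
have := HM y; rewrite ler_norml => /andP[h _].
by rewrite (le_trans h)// lerDl mulr_ge0.
Qed.

Lemma regset_has_inf j x : has_inf (regset j x).
Proof.
split; last by exists (- M); exact: regset_lb.
exists (H (fun=> 0) + j%:R * 1), (fun=> 0), 1; split => //; last by left.
exact: cadlag_cst.
Qed.

Lemma Hreg_ge j x : - M <= Hreg j x.
Proof. by apply: lb_le_inf; [have [] := regset_has_inf j x|exact: regset_lb]. Qed.

Lemma Hreg_le_near j x y (e : R) : cadlag y -> 0 <= e ->
  (forall t : R, 0 <= t <= j%:R -> `|y t - x t| <= e) -> Hreg j x <= H y + j%:R * e.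
Proof.
move=> cy e0 ye; apply: inf_lbound; first by have [] := regset_has_inf j x.
by exists y, e; split => //; right.
Qed.

(** The clause [1 <= e] in [regset] caps the distance at 1, so the zero path is always a competitor,
    at cost j. *)
Lemma Hreg_le j x : Hreg j x <= M + j%:R.
Proof.
apply: (@le_trans _ _ (H (fun=> 0) + j%:R * 1)).
  apply: inf_lbound; first by have [] := regset_has_inf j x.
  by exists (fun=> 0), 1; split => //; [exact: cadlag_cst|left].
by rewrite mulr1 lerD2r (le_trans (ler_norm _)).
Qed.

Lemma Hreg_norm j x : `|Hreg j x| <= M + j%:R.
Proof.
by rewrite ler_norml Hreg_le andbT (le_trans _ (Hreg_ge j x))// lerN2 lerDl.
Qed.

(** By the triangle inequality a competitor for x at distance d is one for x' at distance d + e. *)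
Lemma Hreg_lip1 j x x' (e : R) : 0 <= e ->
  (forall t : R, 0 <= t <= j%:R -> `|x t - x' t| <= e) -> Hreg j x' - j%:R * e <= Hreg j x.
Proof.
move=> e0 xx'; apply: lb_le_inf; first by have [] := regset_has_inf j x.
move=> v [y [d [cy d0 yd ->]]].
rewrite lerBlDr -addrA -mulrDr; apply: inf_lbound; first by have [] := regset_has_inf j x'.
exists y, (d + e); split => //; first exact: addr_ge0.
case: yd => [d1|yd]; first by left; rewrite (le_trans d1)// lerDl.
right => t tj; rewrite (le_trans (ler_distD (x t) _ _))// lerD//; [exact: yd|exact: xx'].
Qed.

Lemma Hreg_lip j x x' (e : R) : 0 <= e ->
  (forall t : R, 0 <= t <= j%:R -> `|x t - x' t| <= e) -> `|Hreg j x - Hreg j x'| <= j%:R * e.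
Proof.
move=> e0 xx'; rewrite ler_distl (Hreg_lip1 e0 xx')/=.
rewrite -lerBlDr; apply: Hreg_lip1 => // t tj.
by rewrite distrC; exact: xx'.
Qed.

Lemma Hreg_le_cadlag j x : cadlag x -> Hreg j x <= H x.
Proof.
move=> cx; have := @Hreg_le_near j x x 0 cx (lexx _).
by rewrite mulr0 addr0; apply => t _; rewrite subrr normr0.
Qed.

Lemma time_change_id : time_change (id : R -> R).
Proof.
split => //; split; first by apply: continuous_subspaceT => x; exact: cvg_id.
by split => // u u0; exists u.
Qed.

(** Take near-minimizers y_j with cost j e_j. As H is bounded, j e_j is bounded, so e_j tends to 0
    and y_j converges to x uniformly on compacts, hence in the Skorokhod topology. Continuity of H
    gives the lower bound; the upper one is [Hreg_le_cadlag]. *)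
Lemma Hreg_cvg x : cadlag x -> Hreg j x @[j --> \oo] --> H x.
Proof.
move=> cx.
have [y yP] : {y : nat -> R -> R & forall j, exists e : R, [/\ cadlag (y j), 0 <= e,
    1 <= e \/ (forall t : R, 0 <= t <= j%:R -> `|y j t - x t| <= e) &
    H (y j) + j%:R * e <= Hreg j x + j.+1%:R^-1]}.
  apply: (@choice _ _ (fun j y => exists e : R, [/\ cadlag y, 0 <= e,
    1 <= e \/ (forall t : R, 0 <= t <= j%:R -> `|y t - x t| <= e) &
    H y + j%:R * e <= Hreg j x + j.+1%:R^-1])) => j.
  have j0 : 0 < j.+1%:R^-1 :> R by rewrite invr_gt0.
  have [v [y [e [cy e0 ye ->]]] h] := inf_adherent j0 (regset_has_inf j x).
  by exists y, e; split => //; exact: ltW.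
have cy n : cadlag (y n) by have [e []] := yP n.
have je n : exists e : R, [/\ 0 <= e, 1 <= e \/ (forall t : R, 0 <= t <= n%:R -> `|y n t - x t| <= e),
    H (y n) <= Hreg n x + n.+1%:R^-1 & n%:R * e <= 2 * M + 1].
  have [e [_ e0 ye h]] := yP n; exists e; split => //.
    by apply: le_trans h; rewrite lerDl mulr_ge0.
  have h1 := Hreg_le_cadlag n cx.
  have := HM x; rewrite ler_norml => /andP[_ h2].
  have := HM (y n); rewrite ler_norml => /andP[h3 _].
  have h4 : n.+1%:R^-1 <= 1 :> R by rewrite invf_le1 ?ltr0n// ler1n.
  by move: h h4; move: (n.+1%:R^-1) (n%:R * e) => q z; lra.
have : skorokhod_cvg y x.
  move=> T T0; exists (fun=> id); split; first by move=> _; exact: time_change_id.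
  move=> e e0; near=> n => t /andP[t0 tT]; rewrite subrr normr0; split; first exact: ltW.
  have [d [d0 yd _ nd]] := je n.
  have nn : 0 < n%:R :> R by rewrite ltr0n; near: n; exact: nbhs_infty_gt.
  have ne : 2 * M + 2 <= n%:R * e.
    rewrite -ler_pdivrMr//; near: n; exact: nbhs_infty_ger.
  have nM : 2 * M + 2 <= n%:R :> R by near: n; exact: nbhs_infty_ger.
  have Tn : T <= n%:R by near: n; exact: nbhs_infty_ger.
  (* The bound n d <= 2 M + 1 excludes [1 <= d] for large n, so [y n] is a genuine uniform
     approximation with error O(1/n). *)
  case: yd => [d1|yd]; first by exfalso; have : n%:R <= n%:R * d; [rewrite ler_peMr// ltW|lra].
  apply: (@le_trans _ _ d); first by apply: yd; rewrite t0 (le_trans tT).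
  rewrite -(ler_pM2l nn); lra.
move/(Hc cy cx) => Hyx.
apply: (@squeeze_cvgr _ _ _ _ (fun n => H (y n) - n.+1%:R^-1) (fun=> H x)).
- near=> n; rewrite Hreg_le_cadlag// andbT lerBlDr.
  by have [d []] := je n.
- rewrite -[X in _ --> X]subr0; apply: cvgB => //; exact: cvg_harmonic.
- exact: cvg_cst.
Unshelve. all: by end_near. Qed.

End Regularization.

Section Grid.
Context {R : realType}.

(** Rounding down to the dyadic grid of level m. Paths are discretized by composing with it. *)
Definition pim (m : nat) (t : R) : R := (Num.truncn (2 ^+ m * t))%:R / 2 ^+ m.

Lemma pim_ge0 m (t : R) : 0 <= pim m t.
Proof. by rewrite divr_ge0// exprn_ge0. Qed.

Lemma pim_itv m (t : R) : 0 <= t -> pim m t <= t < pim m t + 2 ^- m.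
Proof.
move=> t0; have p0 : 0 < 2 ^+ m :> R by rewrite exprn_gt0.
have := truncn_itv (mulr_ge0 (ltW p0) t0); rewrite /pim => /andP[h1 h2].
rewrite ler_pdivrMr// (mulrC t) h1/=.
by rewrite -[X in _ + X]mul1r -mulrDl ltr_pdivlMr// natr1 (mulrC t).
Qed.

Definition grid (j m : nat) : seq R := [seq k%:R / 2 ^+ m | k <- iota 0 (j * 2 ^ m).+1].

Lemma grid_uniq j m : uniq (grid j m).
Proof.
rewrite map_inj_uniq ?iota_uniq// => a b /mulIf h.
by apply/eqP; rewrite -(eqr_nat R); apply/eqP/h; rewrite invr_eq0 expf_neq0.
Qed.

Lemma grid_ge0 j m (t : R) : t \in grid j m -> 0 <= t.
Proof. by move=> /mapP[k _ ->]; rewrite divr_ge0// exprn_ge0. Qed.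

Lemma pim_grid j m (t : R) : 0 <= t <= j%:R -> pim m t \in grid j m.
Proof.
move=> /andP[t0 tj]; apply/mapP; exists (Num.truncn (2 ^+ m * t)) => //.
rewrite mem_iota add0n leq0n/= ltnS -(ler_nat R) natrM natrX (mulrC j%:R).
have p0 : 0 < 2 ^+ m :> R by rewrite exprn_gt0.
have /andP[h _] := truncn_itv (mulr_ge0 (ltW p0) t0).
by rewrite (le_trans h)// ler_pM2l.
Qed.

Definition pth (m : nat) (x : R -> R) : R -> R := fun t => x (pim m t).

(** On [0, j] the discretized path only sees the values on [grid j m]. This turns the
    inf-convolution into a Lipschitz function of finitely many coordinates. *)
Lemma Hreg_pth_lip (H : (R -> R) -> R) (M : R) (HM : forall x, `|H x| <= M) j m x y :
  `|Hreg H j (pth m x) - Hreg H j (pth m y)| <= j%:R * \sum_(t <- grid j m) `|x t - y t|.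
Proof.
apply: (Hreg_lip HM); first exact: sumr_ge0.
move=> t tj; rewrite /pth (bigD1_seq (pim m t)) ?pim_grid ?grid_uniq//=.
by rewrite lerDl sumr_ge0.
Qed.

End Grid.

Section LipMeasurable.
Context {R : realType} {d : measure_display} {T : measurableType d}.
Variable Z : T -> R -> R.
Hypothesis mZ : forall t : R, 0 <= t -> measurable_fun setT (Z ^~ t).

Let nn : R -> Prop := fun t => 0 <= t.

Lemma lfun_measurable s : times_in nn s -> measurable_fun setT (fun w => lfun s (Z w)).
Proof.
rewrite /lfun; elim: s => [|p s IH] hs; first by under eq_fun do rewrite big_nil; exact: measurable_cst.
under eq_fun do rewrite big_cons.
apply: measurable_funD; last by apply: IH => q qs; apply: hs; rewrite inE qs orbT.
by apply: measurable_funM => //; apply: mZ; apply: hs; rewrite inE eqxx.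
Qed.

Lemma trig_bmf f : trig nn f -> bmf (fun w => f (Z w)).
Proof.
elim => {f} [s b hs|f g _ hf _ hg|c f _ hf].
- by apply: bmf_cos; apply: measurable_funD => //; exact: lfun_measurable.
- exact: bmfD.
- exact: bmfZ.
Qed.

Variables (s : seq R) (L : (R -> R) -> R) (C M : R).
Hypotheses (us : uniq s) (s0 : forall t, t \in s -> 0 <= t) (C0 : 0 <= C).
Hypothesis Llip : forall x y, `|L x - L y| <= C * \sum_(t <- s) `|x t - y t|.
Hypothesis LM : forall x, `|L x| <= M.

(** Measurability along the process comes from a pointwise limit: trigonometric polynomials,
    measurable as functions of finitely many coordinates, approximate L within 1/(n+1) on the box of
    size n+1, and each path eventually lies in the box. *)
Lemma lip_bmf : bmf (fun w => L (Z w)).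
Proof.
split; last by exists M => w.
have [F FP] : {F : nat -> (R -> R) -> R & forall n, trig nn (F n) /\
    forall x, (forall t, t \in s -> `|x t| <= n.+1%:R) -> `|L x - F n x| <= n.+1%:R^-1}.
  apply: (@choice _ _ (fun n F => trig nn F /\
    forall x, (forall t, t \in s -> `|x t| <= n.+1%:R) -> `|L x - F x| <= n.+1%:R^-1)) => n.
  have n0 : 0 < n.+1%:R^-1 :> R by rewrite invr_gt0.
  have [F [h1 _ h2]] := trig_approx us s0 C0 Llip LM (ltr0Sn _ n) n0.
  by exists F.
apply: (@measurable_fun_cvg _ _ _ setT (fun n w => F n (Z w))) => //.
  by move=> n; have [/trig_bmf[]] := FP n.
move=> w _; apply/cvgrPdist_le => e e0; near=> n.
have [_ h] := FP n.
apply: (@le_trans _ _ (n.+1%:R^-1)).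
  apply: h => t ts; apply: (@le_trans _ _ (\sum_(t <- s) `|Z w t|)).
    by rewrite (bigD1_seq t)//= lerDl sumr_ge0.
  apply: (@le_trans _ _ n%:R); first by near: n; exact: nbhs_infty_ger.
  by rewrite ler_nat.
near: n; have /cvgrPdist_le/(_ _ e0) := @cvg_harmonic R.
apply: filterS => n; rewrite sub0r normrN ger0_norm//.
by rewrite /harmonic/= invr_ge0.
Unshelve. all: by end_near. Qed.

End LipMeasurable.

Lemma measurable_norm_gt {R : realType} {d : measure_display} {T : measurableType d}
  (f : T -> R) (e : R) : measurable_fun setT f -> measurable [set w | e < `|f w|].
Proof.
move=> mf.
have -> : [set w | e < `|f w|] = (fun w => `|f w|) @^-1` `]e, +oo[.
  by apply/seteqP; split => w /=; rewrite in_itv/= andbT.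
by rewrite -[X in measurable X]setTI; apply: (measurableT_comp _ mf).
Qed.

Lemma Pr_norm_gt_mono {R : realType} {d : measure_display} {T : measurableType d}
  (P : probability T R) (f : T -> R) (a b : R) : measurable_fun setT f -> a <= b ->
  Pr P [set w | b < `|f w|] <= Pr P [set w | a < `|f w|].
Proof.
move=> mf ab; apply: Pr_le; [exact: measurable_norm_gt..|].
by move=> w /=; exact: le_lt_trans.
Qed.

Lemma tight_rv {R : realType} {d : measure_display} {T : measurableType d}
  (P : probability T R) (f : T -> R) : measurable_fun setT f ->
  forall e : R, 0 < e -> exists A : R, 0 < A /\ Pr P [set w | A < `|f w|] <= e.
Proof.
move=> mf e e0.
have mA (a : R) := @measurable_norm_gt _ _ _ f a mf.
have : Ex P (\1_[set w | n.+1%:R < `|f w|] : T -> R) @[n --> \oo] --> Ex P (fun=> 0).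
  apply: (@Ex_dct _ _ _ _ _ _ 1) => //.
  - by move=> n w; rewrite indicE; case: (w \in _); rewrite ?normr1 ?normr0.
  apply/aeW => w; apply/cvgrPdist_le => q q0; near=> n.
  rewrite indicE memNset ?subrr ?normr0 ?ltW//=.
  apply/negP; rewrite -leNgt (@le_trans _ _ n%:R)// ?ler_nat//.
  by near: n; exact: nbhs_infty_ger.
rewrite Ex_cst => /cvgrPdist_le/(_ _ e0)[n _ /(_ n (leqnn n))] /=.
rewrite Ex_indic// sub0r normrN => h.
by exists n.+1%:R; split => //; rewrite (le_trans (ler_norm _)).
Unshelve. all: by end_near. Qed.

Section Criterion.
Context {R : realType} {d : measure_display} {T : measurableType d} (P : probability T R).
Context {d' : measure_display} {T' : measurableType d'} (P' : probability T' R).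
Variables (X Y : nat -> T -> R -> R) (G : T' -> R -> R).

Let nn : R -> Prop := fun t => 0 <= t.

Hypothesis mX : forall n (t : R), 0 <= t -> measurable_fun setT (fun w => X n w t).
Hypothesis mG : forall t : R, 0 <= t -> measurable_fun setT (G ^~ t).
Hypothesis hcos : forall s b, times_in nn s ->
  Ex P (fun w => cos (lfun s (X n w) + b)) @[n --> \oo] --> Ex P' (fun w => cos (lfun s (G w) + b)).
Hypothesis Xtight : forall t e : R, 0 <= t -> 0 < e -> exists A : R, 0 < A /\
  \forall n \near \oo, Pr P [set w | A < `|X n w t|] <= e.

Lemma trig_cvg f : trig nn f ->
  Ex P (fun w => f (X n w)) @[n --> \oo] --> Ex P' (fun w => f (G w)).
Proof.
have bX g n : trig nn g -> bmf (fun w => g (X n w)) by move=> hg; apply: trig_bmf hg => t; exact: mX.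
have bG g : trig nn g -> bmf (fun w => g (G w)) by move=> hg; apply: trig_bmf hg => t; exact: mG.
elim => {f} [s b hs|f g tf hf tg hg|c f tf hf]; first exact: hcos.
- rewrite ExD; [|exact: bG..].
  by under eq_fun do rewrite (ExD _ (bX _ _ tf) (bX _ _ tg)); exact: cvgD.
- rewrite ExZ; last exact: bG.
  by under eq_fun do rewrite (ExZ _ _ (bX _ _ tf)); exact: cvgMr.
Qed.

(** The two functions differ by at most e when all coordinates are below A, and by at most 2 M
    otherwise; a union bound over the coordinates gives the second term. *)
Lemma lip_diff {d0 : measure_display} {T0 : measurableType d0} (Q : probability T0 R)
    (Z : T0 -> R -> R) (s : seq R) (L F : (R -> R) -> R) (M A e q : R) :
  (forall t : R, 0 <= t -> measurable_fun setT (Z ^~ t)) ->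
  (forall t, t \in s -> 0 <= t) ->
  bmf (fun w => L (Z w)) -> bmf (fun w => F (Z w)) -> (forall x, `|L x| <= M) -> (forall x, `|F x| <= M) ->
  (forall x, (forall t, t \in s -> `|x t| <= A) -> `|L x - F x| <= e) -> 0 <= e ->
  (forall t, t \in s -> Pr Q [set w | A < `|Z w t|] <= q) ->
  `|Ex Q (fun w => L (Z w)) - Ex Q (fun w => F (Z w))| <= e + 2 * M * ((size s)%:R * q).
Proof.
move=> mZ s0 bL bF LM FM LF e0 hq.
rewrite -ExB// (le_trans (Ex_norm _ (bmfB bL bF)))//.
have mA t : t \in s -> measurable [set w | A < `|Z w t|].
  by move=> ts; apply: measurable_norm_gt; apply: mZ; exact: s0.
pose I t : T0 -> R := if t \in s then \1_[set w | A < `|Z w t|] else fun=> 0.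
have bI t : bmf (I t).
  by rewrite /I; case: ifPn => [ts|_]; [exact/bmf_indic/mA|exact: bmf_cst].
have M0 : 0 <= M by exact: le_trans (LM (fun=> 0)).
have I0 t w : 0 <= I t w by rewrite /I; case: ifP => // _; rewrite indicE.
apply: (@le_trans _ _ (Ex Q (fun w => e + 2 * M * \sum_(t <- s) I t w))).
  apply: Ex_le; first exact/bmf_norm/bmfB.
    by apply: bmfD; [exact: bmf_cst|apply/bmfZ/bmf_sum].
  move=> w.
  have [ok|/existsNP[t /not_implyP[ts /negP]]] := pselect (forall t, t \in s -> `|Z w t| <= A).
    by rewrite (le_trans (LF _ ok))// lerDl mulr_ge0 ?mulr_ge0// sumr_ge0.
  rewrite -ltNge => h.
  have : 1 <= \sum_(t <- s) I t w.
    rewrite (big_rem t)//= {1}/I ts indicE mem_set//= lerDl sumr_ge0//.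
  move=> h1; rewrite (le_trans (ler_normB _ _))// (le_trans (lerD (LM _) (FM _)))//.
  by nra.
rewrite ExD; [|exact: bmf_cst|by apply/bmfZ/bmf_sum].
rewrite Ex_cst ExZ ?Ex_sum//; last exact: bmf_sum.
rewrite lerD2l ler_wpM2l ?mulr_ge0//.
have -> : (size s)%:R * q = \sum_(t <- s) q.
  by rewrite big_const_seq count_predT iter_addr addr0 mulr_natl.
rewrite big_seq [leRHS]big_seq; apply: ler_sum => t ts.
by rewrite /I ts Ex_indic; [exact: hq|exact: mA].
Qed.

(** Plays the role of the continuity theorem for characteristic functions: tightness of each
    coordinate confines the paths to a box, where a trigonometric polynomial replaces L. *)
Lemma lip_cvg (s : seq R) (L : (R -> R) -> R) (C M : R) :
  uniq s -> (forall t, t \in s -> 0 <= t) -> 0 <= C ->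
  (forall x y, `|L x - L y| <= C * \sum_(t <- s) `|x t - y t|) ->
  (forall x, `|L x| <= M) ->
  Ex P (fun w => L (X n w)) @[n --> \oo] --> Ex P' (fun w => L (G w)).
Proof.
move=> us s0 C0 Llip LM.
have M0 : 0 <= M by exact: le_trans (LM (fun=> 0)).
have bLX n : bmf (fun w => L (X n w)).
  by apply: (@lip_bmf _ _ _ _ _ s L C M) => // t; exact: mX.
have bLG : bmf (fun w => L (G w)).
  by apply: (@lip_bmf _ _ _ _ _ s L C M) => // t; exact: mG.
apply/cvgrPdist_le => e e0.
(* Tail probability allowed per coordinate, so that leaving the box costs at most e/8 in total. *)
pose q := (2 * (M + 1) * (size s).+1%:R)^-1 * (e / 8).
have q0 : 0 < q.
  rewrite /q mulr_gt0 ?invr_gt0 ?mulr_gt0 ?ltr0n//; lra.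
have qe : 2 * (M + 1) * (size s).+1%:R * q = e / 8.
  by rewrite /q mulVKf// mulf_neq0// ?mulf_neq0// ?pnatr_eq0// gt_eqF//; lra.
clearbody q.
have hq : 2 * M * ((size s)%:R * q) <= e / 8.
  rewrite -qe -[(size s).+1%:R]natr1; have : 0 <= (size s)%:R :> R by [].
  move: ((size s)%:R) => k k0.
  have : 0 <= k * q by rewrite mulr_ge0// ltW.
  have : 0 <= M * q by rewrite mulr_ge0// ltW.
  lra.
have [A [A0 AX AG]] : exists A : R, [/\ 0 < A,
    (\forall n \near \oo, forall t, t \in s -> Pr P [set w | A < `|X n w t|] <= q) &
    forall t, t \in s -> Pr P' [set w | A < `|G w t|] <= q].
  elim: s s0 {us Llip hq qe} => [|t s IH] s0.
    by exists 1; split => //; exact: nearW.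
  have [|A [A0 AX AG]] := IH; first by move=> u us; apply: s0; rewrite inE us orbT.
  have t0 : 0 <= t by apply: s0; rewrite inE eqxx.
  have [B [B0 BX]] := Xtight t0 q0.
  have [D [D0 DG]] := tight_rv P' (mG t0) q0.
  exists (A + B + D); split; first by rewrite !addr_gt0.
    near=> n => u; rewrite inE => /orP[/eqP ->|us].
      rewrite (@le_trans _ _ (Pr P [set w | B < `|X n w t|]))//; last by near: n.
      by apply: Pr_norm_gt_mono; [exact: mX|lra].
    have u0 : 0 <= u by apply: s0; rewrite inE us orbT.
    rewrite (@le_trans _ _ (Pr P [set w | A < `|X n w u|]))//; last first.
      by move: u us {u0}; near: n.
    by apply: Pr_norm_gt_mono; [exact: mX|lra].
  move=> u; rewrite inE => /orP[/eqP ->|us].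
    by rewrite (le_trans _ DG)//; apply: Pr_norm_gt_mono; [exact: mG|lra].
  have u0 : 0 <= u by apply: s0; rewrite inE us orbT.
  by rewrite (le_trans _ (AG _ us))//; apply: Pr_norm_gt_mono; [exact: mG|lra].
have e8 : 0 < e / 8 by rewrite divr_gt0.
have [F [tF FM LF]] := trig_approx us s0 C0 Llip LM A0 e8.
have bFX n : bmf (fun w => F (X n w)) by apply: trig_bmf tF => t; exact: mX.
have bFG : bmf (fun w => F (G w)) by apply: trig_bmf tF => t; exact: mG.
have hG := lip_diff mG s0 bLG bFG LM FM LF (ltW e8) AG.
have := trig_cvg tF => /cvgrPdist_le/(_ _ e8) hF.
near=> n.
have AXn : forall t, t \in s -> Pr P [set w | A < `|X n w t|] <= q by near: n.
have hX := lip_diff (mX n) s0 (bLX n) (bFX n) LM FM LF (ltW e8) AXn.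
have hFn : `|Ex P' (fun w => F (G w)) - Ex P (fun w => F (X n w))| <= e / 8 by near: n.
move: hG hX hFn; rewrite !ler_norml => /andP[? ?] /andP[? ?] /andP[? ?]; apply/andP; split; lra.
Unshelve. all: by end_near. Qed.

(** Y is the process of interest and X an array with known finite-dimensional limits. The grid level
    m is chosen before n, so only finitely many coordinates of X matter as n grows. Paths of Y are
    asked to be cadlag on A only, because an infinite sum has cadlag paths almost surely. *)
Hypothesis hY : forall (j : nat) (dl e : R), 0 < dl -> 0 < e -> exists m0 : nat,
  forall m, (m0 <= m)%N -> \forall n \near \oo, exists A : set T, [/\ measurable A, Pr P (~` A) <= e &
  forall w, A w -> cadlag (Y n w) /\
    forall t, 0 <= t <= j%:R -> `|Y n w t - X n w (pim m t)| <= dl].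
Hypothesis cG : forall w, cadlag (G w).
Hypothesis hG : forall w (j : nat) (dl : R), 0 < dl -> exists m0 : nat, forall m, (m0 <= m)%N ->
  forall t, 0 <= t <= j%:R -> `|G w t - G w (pim m t)| <= dl.

Section OneFunctional.
Variables (H : (R -> R) -> R) (M : R).
Hypothesis HM : forall x, `|H x| <= M.
Hypothesis Hc : skorokhod_continuous H.

Let L j m x := Hreg H j (pth m x).

Let bL {d0 : measure_display} {T0 : measurableType d0} (Z : T0 -> R -> R) j m :
  (forall t : R, 0 <= t -> measurable_fun setT (Z ^~ t)) -> bmf (fun w => L j m (Z w)).
Proof.
move=> mZ; apply: (@lip_bmf _ _ _ _ mZ (grid j m) (L j m) j%:R (M + j%:R)) => //.
- exact: grid_uniq.
- by move=> t; exact: grid_ge0.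
- by move=> x y; exact: (Hreg_pth_lip HM).
- by move=> x; exact: (Hreg_norm HM).
Qed.

Let pthG_cvg j w : L j m (G w) @[m --> \oo] --> Hreg H j (G w).
Proof.
apply/cvgrPdist_le => e e0.
have e1 : 0 < e / j.+1%:R by rewrite divr_gt0.
have [m0 hm] := hG w j e1.
near=> m.
have : (m0 <= m)%N by near: m; exact: nbhs_infty_ge.
move/(hm _)/(Hreg_lip HM (ltW e1)) => /le_trans; apply.
by rewrite mulrA ler_pdivrMr// mulrC ler_pM2l// ler_nat.
Unshelve. all: by end_near. Qed.

Let bHreg j : bmf (fun w => Hreg H j (G w)).
Proof.
split; last by exists (M + j%:R) => w; exact: (Hreg_norm HM).
apply: (@measurable_fun_cvg _ _ _ setT (fun m w => L j m (G w))) => //.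
  by move=> m; have [] := @bL _ _ G j m mG.
Qed.

(** Two successive pointwise limits: discretizations as m grows, then inf-convolutions as j
    grows. *)
Lemma bHG : bmf (fun w => H (G w)).
Proof.
split; last by exists M.
apply: (@measurable_fun_cvg _ _ _ setT (fun j w => Hreg H j (G w))) => //.
  by move=> j; have [] := bHreg j.
by move=> w _; exact: (Hreg_cvg HM Hc).
Qed.

(** Choose j so that the inf-convolution loses little at G, then m so that the discretization does,
    then n for the convergence of the resulting Lipschitz function of finitely many coordinates. *)
Lemma minorant (e : R) : 0 < e -> \forall n \near \oo, exists g : T -> R,
  [/\ bmf g, forall w, g w <= H (Y n w) & Ex P' (fun w => H (G w)) - e <= Ex P g].
Proof.
move=> e0.
have M0 : 0 <= M by exact: le_trans (HM (fun=> 0)).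
have e4 : 0 < e / 4 by rewrite divr_gt0.
have : Ex P' (fun w => Hreg H j (G w)) @[j --> \oo] --> Ex P' (fun w => H (G w)).
  apply: (@Ex_dct _ _ _ _ _ _ M).
  - by move=> j; have [] := bHreg j.
  - by have [] := bHG.
  - move=> j w; rewrite ler_norml (Hreg_ge HM)/= (le_trans (Hreg_le_cadlag HM _ (cG w)))//.
    by rewrite (le_trans (ler_norm _)).
  - by apply/aeW => w; exact: (Hreg_cvg HM Hc).
move=> /cvgrPdist_le/(_ _ e4)[j _ /(_ j (leqnn j))/=].
rewrite ler_norml => /andP[_ hj].
pose dl := (e / 8) / j.+1%:R.
have dl0 : 0 < dl by rewrite !divr_gt0.
have jdl : j%:R * dl <= e / 8.
  by rewrite /dl mulrA ler_pdivrMr// mulrC ler_pM2l ?divr_gt0// ler_nat.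
pose q := (e / 8) / (2 * M + j%:R + 1).
have jM0 : 0 < 2 * M + j%:R + 1 by have : 0 <= j%:R :> R by []; lra.
have q0 : 0 < q by rewrite !divr_gt0.
have hq : (2 * M + j%:R) * q <= e / 8.
  rewrite /q mulrA ler_pdivrMr// mulrC ler_pM2l ?divr_gt0//; lra.
clearbody dl q.
have [m0 hm0] := hY j dl0 q0.
have : Ex P' (fun w => L j m (G w)) @[m --> \oo] --> Ex P' (fun w => Hreg H j (G w)).
  apply: (@Ex_dct _ _ _ _ _ _ (M + j%:R)).
  - by move=> m; have [] := @bL _ _ G j m mG.
  - by have [] := bHreg j.
  - by move=> m w; exact: (Hreg_norm HM).
  - by apply/aeW => w; exact: pthG_cvg.
move=> /cvgrPdist_le/(_ _ e4)[m1 _ hm1].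
pose m := maxn m0 m1.
have := hm1 m (leq_maxr _ _); rewrite /= ler_norml => /andP[_ hm].
have := hm0 m (leq_maxl _ _) => hA.
have : Ex P (fun w => L j m (X n w)) @[n --> \oo] --> Ex P' (fun w => L j m (G w)).
  apply: (@lip_cvg (grid j m) (L j m) j%:R (M + j%:R)) => //.
  - exact: grid_uniq.
  - by move=> t; exact: grid_ge0.
  - by move=> x y; exact: (Hreg_pth_lip HM).
  - by move=> x; exact: (Hreg_norm HM).
move=> /cvgrPdist_le/(_ _ e4) hX.
near=> n.
have [A [mA PA AP]] : exists A : set T, [/\ measurable A, Pr P (~` A) <= q &
  forall w, A w -> cadlag (Y n w) /\
    forall t, 0 <= t <= j%:R -> `|Y n w t - X n w (pim m t)| <= dl] by near: n.
have : `|Ex P' (fun w => L j m (G w)) - Ex P (fun w => L j m (X n w))| <= e / 4 by near: n.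
rewrite ler_norml => /andP[_ hXn].
have bLX : bmf (fun w => L j m (X n w)) by apply: bL => t; exact: mX.
have mCA : measurable (~` A) by exact: measurableC.
have bC : bmf (\1_(~` A) : T -> R) by exact: bmf_indic.
(* Equal to [L j m (X n w) - j%:R * dl] on A, where Y is a competitor in the infimum defining
   [Hreg], and to -M off A. *)
pose g w := (L j m (X n w) - j%:R * dl) - (L j m (X n w) - j%:R * dl + M) * \1_(~` A) w.
exists g; split.
- apply: bmfB; first by apply: bmfB => //; exact: bmf_cst.
  apply: bmfM => //; apply: bmfD; last exact: bmf_cst.
  by apply: bmfB => //; exact: bmf_cst.
- move=> w; rewrite /g indicE; have [Aw|nAw] := pselect (A w).
    have -> : (w \in ~` A) = false by apply/negbTE/negP; rewrite inE => /(_ Aw).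
    rewrite mulr0 subr0.
    have [cY hYw] := AP w Aw.
    rewrite lerBlDr; apply: (Hreg_le_near HM cY (ltW dl0)).
    by move=> t tj; rewrite /pth; exact: hYw.
  rewrite mem_set//= mulr1 opprD addrA subrr sub0r.
  by have := HM (Y n w); rewrite ler_norml => /andP[].
apply: (@le_trans _ _ (Ex P (fun w => (L j m (X n w) - j%:R * dl) - (2 * M + j%:R) * \1_(~` A) w))).
  rewrite ExB; [|by apply: bmfB => //; exact: bmf_cst|exact: bmfZ].
  rewrite ExB//; last exact: bmf_cst.
  rewrite Ex_cst ExZ// Ex_indic//.
  have : (2 * M + j%:R) * Pr P (~` A) <= (2 * M + j%:R) * q.
    by rewrite ler_wpM2l// addr_ge0// mulr_ge0.
  lra.
apply: Ex_le.
- apply: bmfB; last exact: bmfZ.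
  by apply: bmfB => //; exact: bmf_cst.
- apply: bmfB; first by apply: bmfB => //; exact: bmf_cst.
  apply: bmfM => //; apply: bmfD; last exact: bmf_cst.
  by apply: bmfB => //; exact: bmf_cst.
move=> w; rewrite /g lerD2l lerN2; apply: ler_wpM2r; first by rewrite indicE.
have := Hreg_le HM j (pth m (X n w)); rewrite -/(L j m (X n w)).
by have : 0 <= j%:R * dl; [rewrite mulr_ge0// ltW|lra].
Unshelve. all: by end_near. Qed.

End OneFunctional.

Theorem cvg_law_criterion : cvg_law_skorokhod \oo P Y P' G.
Proof.
move=> H [M HM] Hc.
have HM' x : `|- H x| <= M by rewrite normrN.
have Hc' : skorokhod_continuous (fun x => - H x).
  by move=> x y cx cy xy; apply: cvgN; exact: Hc.
have bG := bHG HM Hc.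
rewrite ExE//.
apply: cvg_EFin.
(* [H (Y n w)] is not known to be measurable in w, so even the finiteness of its integral is drawn
   from measurable bounds on both sides, given by [minorant] for H and for -H. *)
- near=> n.
  have [g1 [b1 h1 _]] : exists g : T -> R, [/\ bmf g, forall w, g w <= H (Y n w) & Ex P' (fun w => H (G w)) - 1 <= Ex P g].
    by near: n; exact: (minorant HM Hc).
  have [g2 [b2 h2 _]] : exists g : T -> R, [/\ bmf g, forall w, g w <= - H (Y n w) & Ex P' (fun w => - H (G w)) - 1 <= Ex P g].
    by near: n; exact: (minorant HM' Hc').
  have h2' w : H (Y n w) <= - g2 w by rewrite lerNr; exact: h2.
  have [l1 l2] := integral_sandwich P b1 (bmfN b2) h1 h2'.
  by rewrite fin_numE -ltNye -ltey (lt_le_trans (ltNyr _) l1) (le_lt_trans l2 (ltry _)).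
apply/cvgrPdist_le => e e0; near=> n.
have [g1 [b1 h1 E1]] : exists g : T -> R, [/\ bmf g, forall w, g w <= H (Y n w) & Ex P' (fun w => H (G w)) - e <= Ex P g].
  by near: n; exact: (minorant HM Hc).
have [g2 [b2 h2 E2]] : exists g : T -> R, [/\ bmf g, forall w, g w <= - H (Y n w) & Ex P' (fun w => - H (G w)) - e <= Ex P g].
  by near: n; exact: (minorant HM' Hc').
have h2' w : H (Y n w) <= - g2 w by rewrite lerNr; exact: h2.
have [l1 l2] := integral_sandwich P b1 (bmfN b2) h1 h2'.
move: l1 l2; rewrite /=; case: (integral P setT _) => [r| |] //=.
rewrite !lee_fin => l1 l2.
rewrite ExN in l2 => //; rewrite ExN in E2 => //.
rewrite ler_norml; apply/andP; split; lra.
Unshelve. all: by end_near. Qed.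

End Criterion.

(** * Sums of independent variables *)

(** The sum counts the integers in [1, v], that is, the integer part of v. *)
Lemma sum_thresholds (R : realType) (N : nat) (v : R) : 0 <= v <= N%:R ->
  `|v - \sum_(i < N) ((i.+1%:R <= v)%R%:R : R)| <= 1.
Proof.
elim: N v => [|N IH] v /andP[v0 vN].
  by rewrite big_ord0 subr0 (_ : v = 0) ?normr0//; apply/eqP; rewrite eq_le vN v0.
rewrite big_ord_recr/=; have [h|h] := leP N.+1%:R v.
  have -> : v = N.+1%:R by apply/eqP; rewrite eq_le vN h.
  rewrite (eq_bigr (fun=> 1)); last first.
    by move=> i _; rewrite ler_nat ltnS ltnW.
  by rewrite sumr_const card_ord natr1 subrr normr0.
rewrite addr0; have [h'|h'] := leP v N%:R; first by apply: IH; rewrite v0.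
rewrite (eq_bigr (fun=> 1)); last first.
  by move=> i _; rewrite (@le_trans _ _ N%:R) ?ler_nat// ltW.
rewrite sumr_const card_ord -natr1 in h *.
by rewrite ger0_norm; lra.
Qed.

(** Once g is rescaled to take values in [0, 1], it is within 1/N of the average of the indicators
    of the sets where N g >= i + 1, for i < N. This serves as the standard machine that extends
    identities between expectations from indicators to bounded functions. *)
Lemma functional_zero {R : realType} {d : measure_display} {T : measurableType d}
    (F : (T -> R) -> R) (K : R) :
  (forall f g, bmf f -> bmf g -> F (fun w => f w + g w) = F f + F g) ->
  (forall c f, bmf f -> F (fun w => c * f w) = c * F f) ->
  (forall f (M : R), bmf f -> (forall w, `|f w| <= M) -> `|F f| <= K * M) ->
  (forall B, measurable B -> F (\1_B) = 0) ->
  forall g, bmf g -> F g = 0.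
Proof.
move=> FD FZ FK F0.
have F1 : F (fun=> 1) = 0.
  by rewrite -(F0 setT)//; congr F; apply/funext => w; rewrite indicE in_setT.
have main (g : T -> R) : bmf g -> (forall x, 0 <= g x <= 1) -> F g = 0.
  move=> bg g01.
  apply/eqP; rewrite -normr_le0; apply/ler_addgt0Pr => e e0; rewrite add0r.
  pose N := (Num.truncn (`|K| / e)).+1.
  have N0 : 0 < N%:R :> R by rewrite ltr0n.
  have NM : K * N%:R^-1 <= e.
    rewrite (@le_trans _ _ (`|K| / N%:R))//.
      by rewrite ler_wpM2r ?ler_norm// invr_ge0.
    rewrite ler_pdivrMr// mulrC -ler_pdivrMr// ltW//.
    exact: truncnS_gt.
  pose B (i : nat) := [set x : T | i.+1%:R <= N%:R * g x].
  have mB i : measurable (B i).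
    have -> : B i = (fun x => N%:R * g x) @^-1` `[i.+1%:R, +oo[.
      by apply/seteqP; split => x /=; rewrite /B/= in_itv/= andbT.
    by rewrite -[X in measurable X]setTI; apply: (bmfZ N%:R bg).1.
  pose gN w := N%:R^-1 * \sum_(i < N) (\1_(B i) w : R).
  have bI i : bmf (\1_(B i) : T -> R) by exact/bmf_indic.
  have bgN : bmf gN by apply/bmfZ/bmf_sum.
  have close w : `|g w - gN w| <= N%:R^-1.
    have -> : g w - gN w = N%:R^-1 * (N%:R * g w - \sum_(i < N) ((i.+1%:R <= N%:R * g w)%R%:R : R)).
      rewrite mulrBr mulKf ?gt_eqF//; congr (_ - _ * _).
      by apply: eq_bigr => i _; rewrite indicE; congr ((nat_of_bool _)%:R); apply/idP/idP; rewrite inE.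
    rewrite normrM ger0_norm ?invr_ge0// -[leRHS]mulr1 ler_wpM2l ?invr_ge0//.
    apply: sum_thresholds; have /andP[g0 g1] := g01 w.
    by rewrite mulr_ge0//= -[leRHS]mulr1 ler_wpM2l.
  have FgN : F gN = 0.
    rewrite FZ; last exact: bmf_sum.
    suff -> : F (fun w => \sum_(i < N) (\1_(B i) w : R)) = 0 by rewrite mulr0.
    elim: (N) => [|n IH].
      under eq_fun do rewrite big_ord0.
      have -> : (fun=> 0) = (fun _ : T => 0 * 1 :> R) by apply/funext => w; rewrite mul0r.
      by rewrite (FZ 0 (fun=> 1) (bmf_cst 1)) mul0r.
    by under eq_fun do rewrite big_ord_recr; rewrite FD ?IH ?add0r ?F0//; exact: bmf_sum.
  have -> : F g = F (fun w => (g w + (-1) * gN w)).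
    by rewrite (FD g _ bg (bmfZ (-1) bgN)) (FZ (-1) gN bgN) FgN mulr0 addr0.
  apply: le_trans NM; apply: FK; first by apply: bmfD => //; exact: bmfZ.
  by move=> w; rewrite mulN1r; exact: close.
move=> g bg; have [mg [M gM]] := bg.
have M0 : 0 <= M by exact: le_trans (gM point).
(* g + M + 1 lies between 1 and 2 M + 1, so division by K' brings it into [0, 1]. *)
pose K' := 2 * (M + 1).
have K0 : 0 < K' by rewrite /K'; lra.
have b1 := @bmf_cst R d T 1.
have bg1 : bmf (fun x => g x + (M + 1) * 1) by apply: bmfD => //; exact: bmfZ.
have : F (fun x => K'^-1 * (g x + (M + 1) * 1)) = 0.
  apply: main; first exact: bmfZ.
  move=> x; have := gM x; rewrite ler_norml => /andP[h1 h2].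
  apply/andP; split; last by rewrite mulrC ler_pdivrMr// mul1r /K'; lra.
  by rewrite mulr_ge0 ?invr_ge0; lra.
rewrite FZ// FD//; last exact: bmfZ.
rewrite FZ// F1 mulr0 addr0 => /eqP; rewrite mulf_eq0 invr_eq0 gt_eqF//= => /eqP.
by [].
Qed.

Section Independence.
Context {R : realType} {d : measure_display} {T : measurableType d} (P : probability T R).

Lemma preim_measurable (V : T -> R) (B : set R) :
  measurable_fun setT V -> measurable B -> measurable (V @^-1` B).
Proof. by move=> mV mB; rewrite -[X in measurable X]setTI; exact: mV. Qed.

Definition bmR (g : R -> R) := bmf g.

Lemma bmR_comp g (V : T -> R) : bmR g -> measurable_fun setT V -> bmf (fun w => g (V w)).
Proof.
move=> [mg [M gM]] mV; split; first exact: measurableT_comp mg mV.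
by exists M.
Qed.

(** The difference of the two sides is a bounded linear functional of g that vanishes on
    indicators. *)
Lemma indep_ext (W V : T -> R) (c : R) : bmf W -> measurable_fun setT V ->
  (forall B : set R, measurable B -> Ex P (fun w => W w * \1_(V @^-1` B) w) = c * Pr P (V @^-1` B)) ->
  forall g, bmR g -> Ex P (fun w => W w * g (V w)) = c * Ex P (fun w => g (V w)).
Proof.
move=> bW mV hB g bg; apply/eqP; rewrite -subr_eq0; apply/eqP.
have [_ [M WM]] := bW.
have M0 : 0 <= M by exact: le_trans (WM point).
pose F (g : R -> R) := Ex P (fun w => W w * g (V w)) - c * Ex P (fun w => g (V w)).
apply: (@functional_zero _ _ _ F (M + `|c|)) => //.
- move=> f h bf bh; rewrite /F.
  have bfV := bmR_comp bf mV; have bhV := bmR_comp bh mV.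
  under eq_fun do rewrite mulrDr.
  by rewrite (ExD P (bmfM bW bfV) (bmfM bW bhV)) ExD//; ring.
- move=> a f bf; rewrite /F.
  have bfV := bmR_comp bf mV.
  under eq_fun do rewrite mulrCA.
  by rewrite (ExZ P a (bmfM bW bfV)) ExZ//; ring.
- move=> f K bf fK; rewrite /F mulrDl (le_trans (ler_normB _ _))// lerD//.
    apply: Ex_norm_le; first by apply: bmfM => //; exact: (bmR_comp bf mV).
    by move=> w; rewrite normrM ler_pM.
  rewrite normrM ler_wpM2l//; apply: Ex_norm_le => //; exact: (bmR_comp bf mV).
- move=> B mB; rewrite /F.
  have E : (fun w => \1_B (V w)) = (\1_(V @^-1` B) : T -> R).
    by apply/funext => w; rewrite !indicE; congr ((nat_of_bool _)%:R); apply/idP/idP; rewrite !inE.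
  rewrite E Ex_indic; last exact: preim_measurable.
  rewrite -hB// -[X in X - _]/(Ex P _); apply/eqP; rewrite subr_eq0; apply/eqP.
  by congr Ex; apply/funext => w; rewrite -[\1_B (V w)]/((fun w => \1_B (V w)) w) E.
Qed.

Variable z : nat -> T -> R.
Hypothesis mz : forall i, measurable_fun setT (z i).
Hypothesis iz : forall n (B : nat -> set R), (forall i, measurable (B i)) ->
  Pr P [set w | forall i, (i < n)%N -> B i (z i w)] = \prod_(i < n) Pr P (z i @^-1` B i).

Definition later (m n : nat) (B : nat -> set R) : set T :=
  [set w | forall i, (m <= i < m + n)%N -> B i (z i w)].

Lemma later_measurable m n (B : nat -> set R) : (forall i, measurable (B i)) -> measurable (later m n B).
Proof.
move=> mB; have -> : later m n B = \bigcap_(i in [set i | (m <= i < m + n)%N]) (z i @^-1` B i).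
  by apply/seteqP; split => w h i /=; exact: h.
by apply: bigcap_measurableType => i _; exact: preim_measurable.
Qed.

(** Independence of Z from the variables of index at least m, tested on finite rectangles. Z is not
    exhibited as a function of the earlier variables, which makes the class stable under sums and
    products in an induction on m. *)
Definition indepZ (m : nat) (Z : T -> R) := bmf Z /\
  forall n (B : nat -> set R), (forall i, measurable (B i)) ->
  Ex P (fun w => Z w * \1_(later m n B) w) = Ex P Z * \prod_(m <= i < m + n) Pr P (z i @^-1` B i).

Lemma indepZ_bmf m Z : indepZ m Z -> bmf Z. Proof. by case. Qed.

Lemma indepZ1 : indepZ 0 (fun=> 1).
Proof.
split; first exact: bmf_cst.
move=> n B mB; rewrite Ex_cst mul1r add0n big_mkord -iz// -Ex_indic; last first.
  have -> : [set w | forall i, (i < n)%N -> B i (z i w)] = later 0 n B by apply/seteqP; split => w h i; exact: h.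
  exact: later_measurable.
by congr Ex; apply/funext => w; rewrite mul1r.
Qed.

Lemma indepZD m Z Z' : indepZ m Z -> indepZ m Z' -> indepZ m (fun w => Z w + Z' w).
Proof.
move=> [bZ hZ] [bZ' hZ']; split; first exact: bmfD.
move=> n B mB; have bI : bmf (\1_(later m n B) : T -> R) by exact/bmf_indic/later_measurable.
under eq_fun do rewrite mulrDl.
by rewrite (ExD P (bmfM bZ bI) (bmfM bZ' bI)) hZ// hZ'// ExD// mulrDl.
Qed.

Lemma indepZZ m c Z : indepZ m Z -> indepZ m (fun w => c * Z w).
Proof.
move=> [bZ hZ]; split; first exact: bmfZ.
move=> n B mB; have bI : bmf (\1_(later m n B) : T -> R) by exact/bmf_indic/later_measurable.
under eq_fun do rewrite -mulrA.
by rewrite (ExZ P c (bmfM bZ bI)) hZ// ExZ// mulrA.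
Qed.

(** For a fixed rectangle in the variables after m, inserting a Borel set at index m gives a
    rectangle starting at m, so the identity holds for indicators of z m and extends to g by
    [indep_ext]. *)
Lemma indepZ_mul m Z g : indepZ m Z -> bmR g ->
  indepZ m.+1 (fun w => Z w * g (z m w)) /\
  Ex P (fun w => Z w * g (z m w)) = Ex P Z * Ex P (fun w => g (z m w)).
Proof.
move=> [bZ hZ] bg.
have bgz := bmR_comp bg (mz m).
have key n (B : nat -> set R) : (forall i, measurable (B i)) ->
    Ex P (fun w => Z w * \1_(later m.+1 n B) w * g (z m w)) =
    (Ex P Z * \prod_(m.+1 <= i < m.+1 + n) Pr P (z i @^-1` B i)) * Ex P (fun w => g (z m w)).
  move=> mB; have bI : bmf (\1_(later m.+1 n B) : T -> R) by exact/bmf_indic/later_measurable.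
  apply: indep_ext => //; first exact: bmfM.
  move=> A mA.
  pose B' i := if i == m then A else B i.
  have mB' i : measurable (B' i) by rewrite /B'; case: ifP.
  have := hZ n.+1 B' mB'; rewrite big_ltn ?addnS ?ltnS ?leq_addr//.
  rewrite {2}/B' eqxx (eq_big_nat _ _ (F2 := fun i => Pr P (z i @^-1` B i))); last first.
    by move=> i /andP[mi _]; rewrite /B' gt_eqF.
  rewrite -addSn -mulrA [_ * Pr _ _]mulrC => <-.
  congr Ex; apply/funext => w; rewrite -mulrA; congr (_ * _).
  rewrite !indicE -natrM mulnb; congr ((nat_of_bool _)%:R).
  apply/andP/idP; rewrite !inE.
    move=> [h1 h2] i; rewrite addnS ltnS => /andP[mi im]; rewrite /B'.
    case: eqP => [->//|/eqP nim]; apply: h1.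
    by rewrite ltn_neqAle eq_sym nim mi addSn ltnS im.
  move=> h; split.
    move=> i /andP[mi im]; have := h i; rewrite /B' gt_eqF//; apply.
    by rewrite ltnW//= addnS -addSn.
  by have := h m; rewrite /B' eqxx leqnn addnS ltnS leq_addr; apply.
have E0 : Ex P (fun w => Z w * g (z m w)) = Ex P Z * Ex P (fun w => g (z m w)).
  have := key 0%N (fun=> setT) (fun=> measurableT).
  rewrite addn0 big_geq// mulr1 => <-; congr Ex; apply/funext => w.
  rewrite indicE mem_set ?mulr1//= /later => i /=; rewrite addn0 => /andP[h1 h2].
split => //; split; first exact: bmfM.
move=> n B mB; rewrite E0 -[RHS]mulrA (mulrC (Ex P (fun w => g _))) mulrA -key//.
by congr Ex; apply/funext => w; ring.
Qed.

Lemma indepZS m Z : indepZ m Z -> indepZ m.+1 Z.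
Proof.
move=> hZ; have [] := @indepZ_mul m Z (fun=> 1) hZ.
  by split => //; exists 1 => _; rewrite normr1.
by under eq_fun do rewrite mulr1.
Qed.

Variable phi : nat -> R -> R.
Hypothesis mphi : forall i, measurable_fun setT (phi i).

Definition psum n w := \sum_(i < n) phi i (z i w).

Lemma psumS n w : psum n.+1 w = psum n w + phi n (z n w).
Proof. by rewrite /psum big_ord_recr. Qed.

Lemma bmR_cos (g : R -> R) : measurable_fun setT g -> bmR (fun x => cos (g x)).
Proof. exact: bmf_cos. Qed.

Lemma bmR_sin (g : R -> R) : measurable_fun setT g -> bmR (fun x => sin (g x)).
Proof. exact: bmf_sin. Qed.

(** The addition formulas propagate the pair (cos, sin), which stands for the complex exponential of
    the partial sum. *)
Lemma indep_cos_sin n : indepZ n (fun w => cos (psum n w)) /\ indepZ n (fun w => sin (psum n w)).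
Proof.
elim: n => [|n [IHc IHs]].
  have -> : psum 0 = fun=> 0 by apply/funext => w; rewrite /psum big_ord0.
  under eq_fun do rewrite cos0; under [in X in _ /\ X]eq_fun do rewrite sin0.
  split; first exact: indepZ1.
  by have := indepZZ 0 indepZ1; under eq_fun do rewrite mul0r.
have hc := bmR_cos (mphi n); have hs := bmR_sin (mphi n).
split.
  under eq_fun do rewrite psumS cosD -mulN1r.
  apply: indepZD; first exact: (indepZ_mul IHc hc).1.
  exact: indepZZ (indepZ_mul IHs hs).1.
under eq_fun do rewrite psumS sinD.
by apply: indepZD; [exact: (indepZ_mul IHs hc).1|exact: (indepZ_mul IHc hs).1].
Qed.

Lemma Ex_cos_psumS n : Ex P (fun w => cos (psum n.+1 w)) =
  Ex P (fun w => cos (psum n w)) * Ex P (fun w => cos (phi n (z n w))) -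
  Ex P (fun w => sin (psum n w)) * Ex P (fun w => sin (phi n (z n w))).
Proof.
have [IHc IHs] := indep_cos_sin n.
have hc := bmR_cos (mphi n); have hs := bmR_sin (mphi n).
under eq_fun do rewrite psumS cosD.
rewrite ExB; [|exact: indepZ_bmf (indepZ_mul IHc hc).1|exact: indepZ_bmf (indepZ_mul IHs hs).1].
by rewrite (indepZ_mul IHc hc).2 (indepZ_mul IHs hs).2.
Qed.

Lemma Ex_sin_psumS n : Ex P (fun w => sin (psum n.+1 w)) =
  Ex P (fun w => sin (psum n w)) * Ex P (fun w => cos (phi n (z n w))) +
  Ex P (fun w => cos (psum n w)) * Ex P (fun w => sin (phi n (z n w))).
Proof.
have [IHc IHs] := indep_cos_sin n.
have hc := bmR_cos (mphi n); have hs := bmR_sin (mphi n).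
under eq_fun do rewrite psumS sinD.
rewrite ExD; [|exact: indepZ_bmf (indepZ_mul IHs hc).1|exact: indepZ_bmf (indepZ_mul IHc hs).1].
by rewrite (indepZ_mul IHs hc).2 (indepZ_mul IHc hs).2.
Qed.

Hypothesis bphi : forall i, bmR (phi i).

Lemma psum_bmf n : bmf (psum n).
Proof. by apply: bmf_sum => i; exact: bmR_comp. Qed.

Lemma bmRX g k : bmR g -> bmR (fun x => g x ^+ k).
Proof. by move=> hg; exact: (bmfX k hg). Qed.

Lemma indep_pow n k : indepZ n (fun w => psum n w ^+ k).
Proof.
elim: n k => [|n IH] k.
  have -> : psum 0 = fun=> 0 by apply/funext => w; rewrite /psum big_ord0.
  case: k => [|k]; first by under eq_fun do rewrite expr0; exact: indepZ1.
  by have := indepZZ 0 indepZ1; under eq_fun do rewrite mul0r; under [in X in _ -> X]eq_fun do rewrite expr0n/=.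
have -> : (fun w => psum n.+1 w ^+ k) =
    (fun w => \sum_(i < k.+1) 'C(k, i)%:R * (psum n w ^+ (k - i) * phi n (z n w) ^+ i)).
  by apply/funext => w; rewrite psumS exprDn; apply: eq_bigr => i _; rewrite mulr_natl.
elim: (k.+1) => [|j IHj].
  under eq_fun do rewrite big_ord0.
  have := indepZZ 0 indepZ1; under eq_fun do rewrite mul0r.
  by elim: n.+1 => // m hm /hm /indepZS.
under eq_fun do rewrite big_ord_recr.
apply: indepZD => //; apply: indepZZ.
exact: (indepZ_mul (IH _) (bmRX j (bphi n))).1.
Qed.

Lemma Ex_pow_psumS n k : Ex P (fun w => psum n.+1 w ^+ k) =
  \sum_(i < k.+1) 'C(k, i)%:R * (Ex P (fun w => psum n w ^+ (k - i)) * Ex P (fun w => phi n (z n w) ^+ i)).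
Proof.
have -> : (fun w => psum n.+1 w ^+ k) =
    (fun w => \sum_(i < k.+1) 'C(k, i)%:R * (psum n w ^+ (k - i) * phi n (z n w) ^+ i)).
  by apply/funext => w; rewrite psumS exprDn; apply: eq_bigr => i _; rewrite mulr_natl.
rewrite Ex_sum; last first.
  by move=> i; apply: bmfZ; exact: indepZ_bmf (indepZ_mul (indep_pow n (k - i)) (bmRX i (bphi n))).1.
apply: eq_bigr => i _; rewrite ExZ; last first.
  by exact: indepZ_bmf (indepZ_mul (indep_pow n (k - i)) (bmRX i (bphi n))).1.
by rewrite (indepZ_mul (indep_pow n (k - i)) (bmRX i (bphi n))).2.
Qed.

Hypothesis phi0 : forall i, Ex P (fun w => phi i (z i w)) = 0.

Let sg i := Ex P (fun w => phi i (z i w) ^+ 2).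

Lemma sg_ge0 i : 0 <= sg i.
Proof. by apply: Ex_ge0 => w; exact: sqr_ge0. Qed.

Lemma Ex_psum1 n : Ex P (fun w => psum n w) = 0.
Proof.
rewrite /psum Ex_sum; last by move=> i; exact: bmR_comp.
by rewrite big1.
Qed.

Lemma Ex_psum2 n : Ex P (fun w => psum n w ^+ 2) = \sum_(i < n) sg i.
Proof.
elim: n => [|n IH].
  rewrite big_ord0; under eq_fun do rewrite /psum big_ord0 expr0n/=; exact: Ex_cst.
rewrite Ex_pow_psumS [RHS]big_ord_recr/= -IH !big_ord_recr big_ord0/= add0r.
rewrite bin0 binn !mul1r.
have -> : Ex P (fun w => phi n (z n w) ^+ 0) = 1 by under eq_fun do rewrite expr0; exact: Ex_cst.
have -> : Ex P (fun w => phi n (z n w) ^+ 1) = 0 by under eq_fun do rewrite expr1; exact: phi0.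
by rewrite subn0 !mulr0 mulr1 addr0 mul1r.
Qed.

(** Expanding the fourth power of the next partial sum, the terms of degree 1 and 3 in the new
    centred variable vanish, which leaves E S^4 + 6 E S^2 s + E phi^4, and E phi^4 <= s because
    |phi| <= 1. The right-hand side grows by at least this amount when q n is added. *)
Lemma Ex_psum4 (q : nat -> R) n : (forall i x, `|phi i x| <= 1) -> (forall i, sg i <= q i) ->
  Ex P (fun w => psum n w ^+ 4) <= 3 * (\sum_(i < n) q i) ^+ 2 + \sum_(i < n) q i.
Proof.
move=> phi1 sgq; elim: n => [|n IH].
  rewrite !big_ord0 expr0n/= mulr0 addr0; under eq_fun do rewrite /psum big_ord0 expr0n/=.
  by rewrite Ex_cst.
rewrite Ex_pow_psumS !(big_ord_recr n)/= !big_ord_recr big_ord0/= add0r.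
have -> : Ex P (fun w => phi n (z n w) ^+ 0) = 1 by under eq_fun do rewrite expr0; exact: Ex_cst.
have -> : Ex P (fun w => phi n (z n w) ^+ 1) = 0 by under eq_fun do rewrite expr1; exact: phi0.
have -> : Ex P (fun w => psum n w ^+ (4 - 3)) = 0.
  by under eq_fun do rewrite expr1; exact: Ex_psum1.
have -> : (4 - 2 = 2)%N by [].
rewrite Ex_psum2 subn0 -/(sg n).
have q4 : Ex P (fun w => phi n (z n w) ^+ 4) <= sg n.
  apply: Ex_le; [exact/(bmR_comp (bmRX 4 (bphi n)))|exact/(bmR_comp (bmRX 2 (bphi n)))|].
  move=> w; have := phi1 n (z n w); move: (phi _ _) => y y1.
  have y2 : y ^+ 2 <= 1 by rewrite -real_normK ?num_real// expr_le1.
  by rewrite -[4%N]/(2 * 2)%N exprM; have := sqr_ge0 y; nra.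
have s0 : 0 <= \sum_(i < n) sg i by apply: sumr_ge0 => i _; exact: sg_ge0.
have sq : \sum_(i < n) sg i <= \sum_(i < n) q i by apply: ler_sum => i _.
have := sg_ge0 n; have := sgq n.
have -> : 'C(4, 0)%:R = 1 :> R by []. have -> : 'C(4, 2)%:R = 6 :> R by [].
rewrite !mulr0 !mul0r !mulr0 !addr0 !mulr1 !mul1r.
move: IH s0 sq q4; move: (\sum_(i < n) sg i) (\sum_(i < n) q i) (sg n) (q n) => S Q s r.
move: (Ex _ _) (Ex _ _) => A B h1 h2 h3 h4 h5 h6; nra.
Qed.

Lemma expR_quad (x : R) : 0 <= x -> `|1 - x - expR (- x)| <= x ^+ 2.
Proof.
move=> x0; have h1 := expR_ge1Dx (- x).
rewrite ler0_norm; last by lra.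
have h2 := expR_ge1Dx x.
have h3 : expR (- x) * expR x = 1 by rewrite -expRD addNr expR0.
have h4 := expR_gt0 (- x).
rewrite opprB lerBlDr.
have : expR (- x) * (1 + x) <= 1 by rewrite -[leRHS]h3 ler_pM2l.
move: (expR (- x)) h4 => y y0 hy.
have : y * (1 + x) <= (x ^+ 2 + (1 - x)) * (1 + x).
  have : 0 <= x ^+ 3 by rewrite exprn_ge0.
  by rewrite !exprS expr0; lra.
by rewrite ler_pM2r//; lra.
Qed.

(** Quantitative Lindeberg argument on the pair (E cos, E sin). Each new variable multiplies E cos
    by exp(-s/2) up to an error b s, and its own E sin is at most b s / 2 because it is centred;
    since all factors are bounded by 1, the errors add up to multiples of b V. *)
Lemma clt_bound (b : R) n : 0 <= b <= 1 -> (forall i x, `|phi i x| <= b) ->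
  let V := \sum_(i < n) sg i in
  `|Ex P (fun w => cos (psum n w)) - expR (- (V / 2))| <= 2 * b * V /\
  `|Ex P (fun w => sin (psum n w))| <= b * V.
Proof.
move=> /andP[b0 b1] phib /=; elim: n => [|n [IHc IHs]].
  rewrite !big_ord0 !mulr0 mul0r oppr0 expR0.
  have -> : psum 0 = fun=> 0 by apply/funext => w; rewrite /psum big_ord0.
  by rewrite cos0 sin0 !Ex_cst subrr normr0.
rewrite !big_ord_recr/= Ex_cos_psumS Ex_sin_psumS.
have bp := bmR_comp (bphi n) (mz n).
set s := sg n; have s0 : 0 <= s by exact: sg_ge0.
(* With b <= 1 this makes s at most b, so the quadratic remainder of the exponential is also of
   order b s. *)
have sb : s <= b ^+ 2.
  rewrite -[leRHS](@Ex_cst _ _ _ P); apply: Ex_le; [exact: bmfX|exact: bmf_cst|move=> w].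
  by rewrite -real_normK ?num_real// lerXn2r ?nnegrE.
have bb : b ^+ 2 <= b by rewrite expr2 ler_piMl.
have hc : `|Ex P (fun w => cos (phi n (z n w))) - expR (- (s / 2))| <= b * s.
  have h1 : `|Ex P (fun w => cos (phi n (z n w))) - (1 - s / 2)| <= b ^+ 2 / 2 * s.
    have -> : Ex P (fun w => cos (phi n (z n w))) - (1 - s / 2) =
        Ex P (fun w => cos (phi n (z n w)) - 1 + 2^-1 * phi n (z n w) ^+ 2).
      rewrite ExD; [|by apply: bmfB; [exact/bmf_cos/(proj1 bp)|exact: bmf_cst]|exact/bmfZ/bmfX].
      rewrite ExB; [|exact/bmf_cos/(proj1 bp)|exact: bmf_cst].
      rewrite Ex_cst ExZ; last exact: bmfX.
      by rewrite -[Ex P (fun w => phi n (z n w) ^+ 2)]/s; lra.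
    have bc : bmf (fun w => cos (phi n (z n w)) - 1 + 2^-1 * phi n (z n w) ^+ 2).
      apply: bmfD; last exact/bmfZ/bmfX.
      by apply: bmfB; [exact/bmf_cos/(proj1 bp)|exact: bmf_cst].
    rewrite (le_trans (Ex_norm _ bc))// /s /sg -ExZ; last exact: bmfX.
    apply: Ex_le; [exact: bmf_norm|exact/bmfZ/bmfX|move=> w].
    rewrite (mulrC 2^-1) (le_trans (cos_sub_le _))// -[phi n (z n w) ^+ 2]real_normK ?num_real//.
    have := phib n (z n w); have := normr_ge0 (phi n (z n w)); move: (`|_|) => y y0 yb.
    rewrite -[4%N]/(2 + 2)%N exprD.
    have : y ^+ 2 <= b ^+ 2 by rewrite lerXn2r ?nnegrE.
    have := sqr_ge0 y; nra.
  have h2 : `|1 - s / 2 - expR (- (s / 2))| <= (s / 2) ^+ 2 by apply: expR_quad; lra.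
  rewrite (le_trans (ler_distD (1 - s / 2) _ _))// (le_trans (lerD h1 h2))//.
  rewrite expr2; nra.
have hs : `|Ex P (fun w => sin (phi n (z n w)))| <= b / 2 * s.
  have -> : Ex P (fun w => sin (phi n (z n w))) = Ex P (fun w => sin (phi n (z n w)) - phi n (z n w)).
    by rewrite ExB//; [rewrite phi0 subr0|exact/bmf_sin/(proj1 bp)].
  have bs : bmf (fun w => sin (phi n (z n w)) - phi n (z n w)).
    by apply: bmfB => //; exact/bmf_sin/(proj1 bp).
  rewrite (le_trans (Ex_norm _ bs))// /s /sg -ExZ; last exact: bmfX.
  apply: Ex_le; [exact: bmf_norm|exact/bmfZ/bmfX|move=> w].
  rewrite (le_trans (sin_sub_le _))// -real_normK ?num_real//.
  have := phib n (z n w); have := normr_ge0 (phi n (z n w)); move: (`|_|) => y y0 yb.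
  by rewrite exprS; have := sqr_ge0 y; nra.
have c1 : `|Ex P (fun w => cos (phi n (z n w)))| <= 1.
  by apply: Ex_norm_le; [exact/bmf_cos/(proj1 bp)|move=> w; rewrite ler_norml cos_geN1 cos_le1].
have mp := (psum_bmf n).1.
have C1 : `|Ex P (fun w => cos (psum n w))| <= 1.
  by apply: Ex_norm_le; [exact/bmf_cos|move=> w; rewrite ler_norml cos_geN1 cos_le1].
have S1 : `|Ex P (fun w => sin (psum n w))| <= 1.
  by apply: Ex_norm_le; [exact/bmf_sin|move=> w; rewrite ler_norml sin_geN1 sin_le1].
have e1 : expR (- (s / 2)) <= 1 by rewrite -[leRHS]expR0 ler_expR; lra.
have e0 := expR_ge0 (- (s / 2)).
rewrite -/s mulrDl opprD expRD.
move: IHc IHs hc hs c1 C1 S1 e1 e0.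
move: (Ex P _) (Ex P _) (Ex P _) (Ex P _) (\sum_(i < n) sg i) => t c S C V.
move: (expR (- (V / 2))) (expR (- (s / 2))) => E e IHc IHs hc hs c1 C1 S1 e1 e0.
clearbody s; split.
  have -> : C * c - S * t - E * e = C * (c - e) + (C - E) * e - S * t by ring.
  rewrite (le_trans (ler_normB _ _))//.
  have t1 : `|C * (c - e) + (C - E) * e| <= b * s + 2 * b * V.
    rewrite (le_trans (ler_normD _ _))// !normrM lerD//.
      by rewrite -[leRHS]mul1r ler_pM.
    by rewrite (ger0_norm e0) -[leRHS]mulr1 ler_pM.
  have t2 : `|S * t| <= b / 2 * s by rewrite normrM -[leRHS]mul1r ler_pM.
  have : 0 <= b * s by rewrite mulr_ge0.
  by move=> ?; rewrite (le_trans (lerD t1 t2))//; lra.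
rewrite (le_trans (ler_normD _ _))// !normrM.
have t1 : `|S| * `|c| <= b * V by rewrite -[leRHS]mulr1 ler_pM.
have t2 : `|C| * `|t| <= b / 2 * s by rewrite -[leRHS]mul1r ler_pM.
have : 0 <= b * s by rewrite mulr_ge0.
by move=> ?; rewrite (le_trans (lerD t1 t2))//; lra.
Qed.

End Independence.

(** * Laws on the line and Gaussian variables *)

Lemma clamp_lip {R : realType} (a c : R) (x y : R) : 0 <= c ->
  `|minr (maxr (c * (x - a)) 0) 1 - minr (maxr (c * (y - a)) 0) 1| <= c * `|x - y|.
Proof.
move=> c0; have -> : c * `|x - y| = `|c * (x - a) - c * (y - a)|.
  by rewrite -mulrBr normrM (ger0_norm c0); congr (_ * `|_|); ring.
move: (c * (x - a)) (c * (y - a)) => u v.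
wlog uv : u v / v <= u => [H|].
  have [/H//|/ltW /H] := leP v u.
  by rewrite distrC [leRHS]distrC.
rewrite [X in _ <= X]ger0_norm ?subr_ge0//.
rewrite /Order.max /Order.min.
by repeat case: ifPn; rewrite -?leNgt => *; rewrite ler_norml; apply/andP; split; lra.
Qed.

Section DctFunctional.
Context {R : realType}.
Implicit Types (F : (R -> R) -> R).

(** The action of a finite signed measure on bounded Borel functions: linear, bounded, and
    continuous for bounded pointwise convergence. *)
Definition dctf F := [/\ (forall f g, bmR f -> bmR g -> F (fun x => f x + g x) = F f + F g),
  (forall c f, bmR f -> F (fun x => c * f x) = c * F f),
  (exists K : R, forall f (M : R), bmR f -> (forall x, `|f x| <= M) -> `|F f| <= K * M) &
  (forall (f_ : nat -> R -> R) (f : R -> R) (M : R), (forall n, measurable_fun setT (f_ n)) ->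
     measurable_fun setT f -> (forall n x, `|f_ n x| <= M) ->
     (forall x, f_ n x @[n --> \oo] --> f x) -> F (f_ n) @[n --> \oo] --> F f)].

Lemma dctfD F G : dctf F -> dctf G -> dctf (fun f => F f + G f).
Proof.
move=> [F1 F2 [K F3] F4] [G1 G2 [L G3] G4]; split.
- by move=> f g bf bg; rewrite F1// G1//; ring.
- by move=> c f bf; rewrite F2// G2//; ring.
- exists (K + L) => f M bf fM; rewrite mulrDl (le_trans (ler_normD _ _))// lerD//; [exact: F3|exact: G3].
- by move=> f_ f M m1 m2 b c; apply: cvgD; [exact: (F4 f_ f M)|exact: (G4 f_ f M)].
Qed.

Lemma dctfZ c F : dctf F -> dctf (fun f => c * F f).
Proof.
move=> [F1 F2 [K F3] F4]; split.
- by move=> f g bf bg; rewrite F1//; ring.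
- by move=> a f bf; rewrite F2//; ring.
- by exists (`|c| * K) => f M bf fM; rewrite normrM -mulrA ler_wpM2l//; exact: F3.
- by move=> f_ f M m1 m2 b cv; apply: cvgMr; exact: (F4 f_ f M).
Qed.

Lemma dctfB F G : dctf F -> dctf G -> dctf (fun f => F f - G f).
Proof.
move=> hF hG; have -> : (fun f => F f - G f) = (fun f => F f + (-1) * G f).
  by apply/funext => f; rewrite mulN1r.
by apply: dctfD => //; exact: dctfZ.
Qed.

Lemma dctf_Ex {d : measure_display} {T : measurableType d} (P : probability T R) (W Y : T -> R) :
  bmf W -> measurable_fun setT Y -> dctf (fun f => Ex P (fun w => W w * f (Y w))).
Proof.
move=> bW mY; have [mW [M WM]] := bW; split.
- move=> f g bf bg; under eq_fun do rewrite mulrDr.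
  by rewrite (ExD P (bmfM bW (bmR_comp bf mY)) (bmfM bW (bmR_comp bg mY))).
- move=> c f bf; under eq_fun do rewrite mulrCA.
  by rewrite (ExZ P c (bmfM bW (bmR_comp bf mY))).
- exists M => f K bf fK; apply: Ex_norm_le; first by apply: bmfM => //; exact: bmR_comp.
  by move=> w; rewrite normrM ler_pM.
- move=> f_ f K m1 m2 b c; apply: (@Ex_dct _ _ _ _ _ _ (M * K)).
  + by move=> n; apply: measurable_funM => //; exact: (measurableT_comp (m1 n) mY).
  + by apply: measurable_funM => //; exact: (measurableT_comp m2 mY).
  + by move=> n w; rewrite normrM ler_pM.
  + by apply/aeW => w; apply: cvgMr; exact: c.
Qed.

Lemma dctf_Ex1 {d : measure_display} {T : measurableType d} (P : probability T R) (Y : T -> R) :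
  measurable_fun setT Y -> dctf (fun f => Ex P (fun w => f (Y w))).
Proof.
move=> mY; have := @dctf_Ex _ _ P (fun=> 1) Y (bmf_cst 1) mY.
congr dctf; apply/funext => f; congr Ex; apply/funext => w; exact: mul1r.
Qed.

(** Rays are stable under intersection and generate the Borel sets, and the sets on whose indicators
    F vanishes form a lambda-system; [functional_zero] then passes from indicators to functions. *)
Lemma dctf_rays F : dctf F -> F (fun=> 1) = 0 ->
  (forall a : R, F (\1_(`]a, +oo[%classic)) = 0) -> forall f, bmR f -> F f = 0.
Proof.
move=> [F1 F2 [K F3] F4] FT Fr; apply: (@functional_zero _ _ _ F K) => //.
have bI (A : set R) : measurable A -> bmR (\1_A : R -> R) by exact: bmf_indic.
pose H := [set A : set R | measurable A /\ F (\1_A) = 0].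
suff GH : <<s (@RGenOInfty.G R) >> `<=` H.
  by move=> B mB; have [] : H B by apply: GH; rewrite -[X in X B]RGenOInfty.measurableE.
apply: lambda_system_subset => //.
- move=> B C [x ->] [y ->]; exists (Order.max x y).
  apply/seteqP; split => u /=; rewrite !in_itv/= !andbT gt_max; first by move=> [-> ->].
  by move=> /andP[].
- split => //.
  + split => //; rewrite -FT; congr F; apply/funext => x.
    by rewrite indicE in_setT.
  + move=> A B BA [mA FA] [mB FB]; split; first exact: measurableD.
    have -> : (\1_(A `\` B) : R -> R) = (fun x => \1_A x + (-1) * \1_B x).
      apply/funext => x; rewrite !indicE in_setD mulN1r.
      have [Bx|nBx] := boolP (x \in B); last by rewrite andbT subr0.
      by rewrite andbF (_ : x \in A) ?subrr// inE; apply: BA; exact/set_mem.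
    by rewrite F1 ?F2 ?FA ?FB ?mulr0 ?addr0//; [exact: bI|exact: bI|exact/bmfZ/bI].
  + move=> A ndA HA.
    have mA n : measurable (A n) by have [] := HA n.
    have mU : measurable (\bigcup_i A i) by exact: bigcupT_measurable.
    split => //.
    have : F (\1_(A n)) @[n --> \oo] --> F (\1_(\bigcup_i A i)).
      apply: (F4 _ _ 1).
      * by move=> n; exact: (bI _ (mA n)).1.
      * exact: (bI _ mU).1.
      * by move=> n x; rewrite indicE; case: (x \in _); rewrite ?normr1 ?normr0.
      * move=> x; have [[n _ Anx]|nx] := pselect ((\bigcup_i A i) x).
          apply: cvg_near_cst; near=> k; rewrite !indicE !mem_set//; first by exists n.
          have : (A n `<=` A k)%classic by apply/subsetPset/ndA; near: k; exact: nbhs_infty_ge.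
          exact.
        apply: cvg_near_cst; near=> k; rewrite !indicE !memNset// => Akx; apply: nx.
        by exists k.
    have -> : (fun n => F (\1_(A n))) = (fun=> 0) by apply/funext => n; have [] := HA n.
    by move=> h; apply/esym; apply: (cvg_unique _ (cvg_cst _) h).
- by move=> A [x ->]; split => //; exact: Fr.
Unshelve. all: by end_near. Qed.

Definition ramp (a : R) (k : nat) (x : R) := minr (maxr (k%:R * (x - a)) 0) 1.

Lemma ramp01 a k x : 0 <= ramp a k x <= 1.
Proof. by rewrite /ramp ge_min lexx orbT andbT le_min le_max lexx orbT ler01. Qed.

Lemma ramp_measurable a k : measurable_fun setT (ramp a k).
Proof.
apply: measurable_minr => //; apply: measurable_maxr => //.
by apply: measurable_funM => //; exact: measurable_funB.
Qed.

Lemma ramp_cvg a x : ramp a k x @[k --> \oo] --> (\1_(`]a, +oo[%classic) x : R).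
Proof.
rewrite indicE; have [xa|ax] := leP x a.
  rewrite memNset; last by rewrite /= in_itv/= andbT ltNge xa.
  have -> : ramp a ^~ x = fun=> 0.
    apply/funext => k; rewrite /ramp max_r ?min_l//.
    by rewrite mulr_ge0_le0// subr_le0.
  exact: cvg_cst.
rewrite mem_set; last by rewrite /= in_itv/= andbT.
apply/cvgrPdist_le => e e0; near=> k.
have h : 1 <= k%:R * (x - a).
  by rewrite -ler_pdivrMr ?subr_gt0//; near: k; exact: nbhs_infty_ger.
rewrite /ramp min_r; last by rewrite le_max h.
by rewrite subrr normr0 ltW.
Unshelve. all: by end_near. Qed.

(** The indicator of an open ray is the pointwise limit of the Lipschitz functions [ramp a k]. *)
Lemma dctf_lip F : dctf F ->
  (forall (f : R -> R) (C M : R), 0 <= C -> (forall x y, `|f x - f y| <= C * `|x - y|) ->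
     (forall x, `|f x| <= M) -> F f = 0) -> forall f, bmR f -> F f = 0.
Proof.
move=> hF Fl; apply: dctf_rays => //.
  by apply: (Fl _ 0 1) => //; [move=> x y; rewrite subrr normr0 mul0r|move=> x; rewrite normr1].
move=> a; have [_ _ _ F4] := hF.
have : F (ramp a k) @[k --> \oo] --> F (\1_(`]a, +oo[%classic)).
  apply: (F4 _ _ 1).
  - exact: ramp_measurable.
  - exact: measurable_indic.
  - by move=> k w; have /andP[h0 h1] := ramp01 a k w; rewrite ger0_norm.
  - exact: ramp_cvg.
have -> : (fun k => F (ramp a k)) = (fun=> 0).
  apply/funext => k; apply: (Fl _ k%:R 1) => //.
  - by move=> x y; exact: clamp_lip.
  - by move=> x; have /andP[h0 h1] := ramp01 a k x; rewrite ger0_norm.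
by move=> h; apply/esym; apply: (cvg_unique _ (cvg_cst _) h).
Qed.

End DctFunctional.

Section LawLip.
Context {R : realType} {d : measure_display} {T : measurableType d} (P : probability T R).
Context {d' : measure_display} {T' : measurableType d'} (P' : probability T' R).
Variables (Y : T -> R) (Y' : T' -> R).
Hypotheses (mY : measurable_fun setT Y) (mY' : measurable_fun setT Y').

Lemma Ex_eq_law : (forall f, bmR f -> Ex P (fun w => f (Y w)) = Ex P' (fun w => f (Y' w))) ->
  forall A, measurable A -> P (Y @^-1` A) = P' (Y' @^-1` A).
Proof.
move=> H A mA.
have m1 := preim_measurable mY mA; have m2 := preim_measurable mY' mA.
by rewrite !PrE// -!Ex_indic//; congr (_%:E); exact: (H \1_A (bmf_indic mA)).
Qed.

Lemma law_eq_lip :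
  (forall (f : R -> R) (C M : R), 0 <= C -> (forall x y, `|f x - f y| <= C * `|x - y|) ->
     (forall x, `|f x| <= M) -> Ex P (fun w => f (Y w)) = Ex P' (fun w => f (Y' w))) ->
  forall f, bmR f -> Ex P (fun w => f (Y w)) = Ex P' (fun w => f (Y' w)).
Proof.
move=> H f bf; apply/eqP; rewrite -subr_eq0; apply/eqP.
apply: (dctf_lip (dctfB (dctf_Ex1 P mY) (dctf_Ex1 P' mY'))) => // g C M C0 gC gM.
by rewrite (H g C M)// subrr.
Qed.

(** Uniqueness of characteristic functions, read off [lip_cvg] for a constant sequence of processes
    whose paths are constant in time. *)
Lemma law_eq_cos :
  (forall a b : R, Ex P (fun w => cos (a * Y w + b)) = Ex P' (fun w => cos (a * Y' w + b))) ->
  forall f, bmR f -> Ex P (fun w => f (Y w)) = Ex P' (fun w => f (Y' w)).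
Proof.
move=> hc; apply: law_eq_lip => f C M C0 fC fM.
have H : Ex P (fun w => f (Y w)) @[n --> \oo] --> Ex P' (fun w => f (Y' w)).
  apply: (@lip_cvg _ _ _ P _ _ P' (fun n w t => Y w) (fun w t => Y' w) _ _ _ _
    [:: 0] (fun x => f (x 0)) C M) => //.
  - move=> s b _; have E y : lfun s (fun=> y) = (\sum_(p <- s) p.2) * y by rewrite /lfun mulr_suml.
    have -> : Ex P' (fun w => cos (lfun s (fun=> Y' w) + b)) = Ex P (fun w => cos (lfun s (fun=> Y w) + b)).
      under eq_fun do rewrite E; under [in RHS]eq_fun do rewrite E.
      by rewrite hc.
    exact: cvg_cst.
  - move=> t e _ e0; have [A [A0 PA]] := tight_rv P mY e0.
    by exists A; split => //; exact: nearW.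
  - by move=> t; rewrite inE => /eqP ->.
  - by move=> x y; rewrite big_seq1; exact: fC.
by apply: (cvg_unique _ (cvg_cst _) H).
Qed.

End LawLip.

(** * The characteristic function of a normal law *)

Section NormalChar.
Context {R : realType}.
Notation mu := (@lebesgue_measure R).
Variable s : R.
Hypothesis s0 : 0 < s.

Let pdf := normal_pdf 0 s.
Let sn : s != 0. Proof. by rewrite gt_eqF. Qed.

Let pdfE x : pdf x = normal_peak s * expR (- x ^+ 2 / (s ^+ 2 *+ 2)).
Proof. by rewrite /pdf normal_pdfE// /normal_fun subr0. Qed.

Let pdf_ge0 x : 0 <= pdf x. Proof. exact: normal_pdf_ge0. Qed.

Let int_bpdf (f : R -> R) : bmf f -> mu.-integrable setT (EFin \o (fun x => f x * pdf x)).
Proof.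
move=> [mf [M fM]].
have M0 : 0 <= M by exact: le_trans (fM 0).
have h := integrableZl measurableT M (integrable_normal_pdf 0 s).
apply: le_integrable h => //.
  by apply/measurable_EFinP; apply: measurable_funM => //; exact: measurable_normal_pdf.
move=> x _ /=; rewrite lee_fin !normrM ler_wpM2r// (le_trans (fM x))// ler_norm//.
Qed.

(** Both sides are linear and bounded by the sup norm, and they agree on indicators by definition of
    the normal law. *)
Lemma Ex_normal (f : R -> R) : bmf f -> Ex (normal_prob 0 s) f = \int[mu]_x (f x * pdf x).
Proof.
move=> bf; apply/eqP; rewrite -subr_eq0; apply/eqP.
pose F (f : R -> R) := Ex (normal_prob 0 s) f - \int[mu]_x (f x * pdf x).
apply: (@functional_zero _ _ _ F 2) => //.
- move=> g h bg bh; rewrite /F ExD//.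
  under eq_Rintegral do rewrite mulrDl.
  by rewrite RintegralD//; [ring|exact: int_bpdf..].
- move=> c g bg; rewrite /F ExZ//.
  under eq_Rintegral do rewrite -mulrA.
  by rewrite RintegralZl//; [ring|exact: int_bpdf].
- move=> g M bg gM; rewrite /F mulr_natl mulr2n (le_trans (ler_normB _ _))// lerD//.
    exact: Ex_norm_le.
  rewrite (le_trans (le_normr_Rintegral _ _))//; first exact: int_bpdf.
  have -> : M = \int[mu]_x (M * pdf x).
    rewrite RintegralZl//; last exact: integrable_normal_pdf.
    by rewrite /Rintegral integral_normal_pdf mulr1.
  apply: le_Rintegral => //.
  + have := int_bpdf (bmf_norm bg); apply: eq_integrable => // x _ /=.
    by rewrite normrM [X in _ = (_ * X)%:E]ger0_norm.
  + exact: int_bpdf (bmf_cst M).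
  + by move=> x _; rewrite normrM [X in _ * X]ger0_norm// ler_wpM2r.
- move=> B mB; rewrite /F Ex_indic//.
  have -> : \int[mu]_x (\1_B x * pdf x) = \int[mu]_(x in B) pdf x.
    rewrite [RHS]Rintegral_mkcond; apply: eq_Rintegral => x _; rewrite /patch indicE.
    by case: (x \in B); rewrite ?mul1r ?mul0r.
  exact: subrr.
Qed.

Let quad_aux (v : R) : v <= 1 + 3 * (v ^+ 2 / 8).
Proof. by have := sqr_ge0 (3 * v - 4); rewrite !expr2; lra. Qed.

(** Domination by a wider Gaussian: with y = x^2 / (8 s^2) the exponent 4 y splits into 3 y, which
    absorbs the factor |x|, and y, which is the exponent of deviation 2 s. Integrability of x times
    the density follows at once. *)
Let xpdf_bound (x : R) : `|x| * pdf x <= (s * normal_peak s / normal_peak (2 * s)) * normal_pdf 0 (2 * s) x.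
Proof.
have s20 : 2 * s != 0 by rewrite mulf_neq0.
rewrite pdfE normal_pdfE// /normal_fun subr0 (mulrA _ (normal_peak (2 * s))) divfK; last first.
  by rewrite gt_eqF// normal_peak_gt0.
rewrite mulrCA -(mulrA s) (mulrCA s); apply: ler_wpM2l; first exact: normal_peak_ge0.
pose y := x ^+ 2 / (8 * s ^+ 2).
have -> : - x ^+ 2 / (s ^+ 2 *+ 2) = - (3 * y) + (- y) by rewrite /y; field.
have -> : - x ^+ 2 / ((2 * s) ^+ 2 *+ 2) = - y by rewrite /y; field.
rewrite expRD mulrA; apply: ler_wpM2r; first exact: expR_ge0.
have h := expR_ge1Dx (3 * y).
have e0 := expR_gt0 (3 * y).
rewrite expRN ler_pdivrMr//; apply: (@le_trans _ _ (s * (1 + 3 * y))); last by rewrite ler_pM2l.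
have yv : y = (`|x| / s) ^+ 2 / 8 by rewrite /y exprMn real_normK ?num_real//; field.
have xv : `|x| = s * (`|x| / s) by rewrite mulrCA mulfV// mulr1.
by rewrite {1}xv ler_pM2l// yv; exact: quad_aux.
Qed.

Let int_xpdf (f : R -> R) : bmf f -> mu.-integrable setT (EFin \o (fun x => x * f x * pdf x)).
Proof.
move=> [mf [M fM]].
have M0 : 0 <= M by exact: le_trans (fM 0).
have h := integrableZl measurableT (M * (s * normal_peak s / normal_peak (2 * s))) (integrable_normal_pdf 0 (2 * s)).
apply: le_integrable h => //.
  apply/measurable_EFinP; apply: measurable_funM; last exact: measurable_normal_pdf.
  exact: measurable_funM.
move=> x _ /=; rewrite lee_fin (le_trans _ (ler_norm _))//.
have -> : `|x * f x * pdf x| = `|f x| * (`|x| * pdf x).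
  by rewrite !normrM (ger0_norm (pdf_ge0 x)); ring.
by rewrite -[leRHS]mulrA; apply: ler_pM; [by []|by rewrite mulr_ge0|exact: fM|exact: xpdf_bound].
Qed.

Let is_derive_pdf (x : R) : is_derive x (1 : R) pdf (- (x / s ^+ 2) * pdf x).
Proof.
have -> : pdf = (fun x => normal_peak s * expR (- x ^+ 2 / (s ^+ 2 *+ 2))).
  by apply/funext => y; rewrite pdfE.
apply: is_derive_eq.
by rewrite /GRing.scale/=; field; exact: sn.
Qed.

Let pdf_cvg0 : pdf n%:R @[n --> \oo] --> 0.
Proof.
apply: (@squeeze_cvgr _ _ _ _ (fun=> 0) (fun n => s * normal_peak s * n%:R^-1)).
- near=> n; rewrite pdf_ge0/=.
  have n0 : 0 < n%:R :> R by rewrite ltr0n; near: n; exact: nbhs_infty_gt.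
  rewrite ler_pdivlMr//.
  have := xpdf_bound n%:R; rewrite ger0_norm// mulrC => /le_trans; apply.
  rewrite -[leRHS]mulr1 -mulrA ler_wpM2l//.
    by rewrite mulr_ge0 ?normal_peak_ge0// ltW.
  rewrite mulrC ler_pdivrMr ?mul1r; last by rewrite normal_peak_gt0// mulf_neq0.
  by apply: normal_pdf_ub; rewrite mulf_neq0.
- exact: cvg_cst.
- rewrite -[X in _ --> X](mulr0 (s * normal_peak s)); apply: cvgMr.
  by rewrite -cvg_shiftS; exact: cvg_harmonic.
Unshelve. all: by end_near. Qed.

Let bmf_cosl (a b : R) : bmf (fun x : R => cos (a * x + b)).
Proof. by apply: bmf_cos; apply: measurable_funD => //; exact: measurable_funM. Qed.

Let bmf_sinl (a b : R) : bmf (fun x : R => sin (a * x + b)).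
Proof. by apply: bmf_sin; apply: measurable_funD => //; exact: measurable_funM. Qed.

(** Integration by parts: h' is integrable over the line, and its integral is the limit of the
    boundary values of h at n and -n, which vanish with the density. *)
Let parts (a b : R) :
  \int[mu]_x (x * sin (a * x + b) * pdf x) = a * s ^+ 2 * \int[mu]_x (cos (a * x + b) * pdf x).
Proof.
pose h x := sin (a * x + b) * pdf x.
pose h' x := a * (cos (a * x + b) * pdf x) - s ^- 2 * (x * sin (a * x + b) * pdf x).
have dh (x : R) : is_derive x (1 : R) h (h' x).
  have d1 : is_derive x (1 : R) (fun x => sin (a * x + b)) (a * cos (a * x + b)).
    have -> : (fun x => sin (a * x + b)) = sin \o (fun x => a * x + b) by [].
    apply: is_derive_eq; rewrite /GRing.scale/=; ring.
  rewrite /h; apply: (@is_derive_eq _ _ _ _ _ _ _ _ (is_deriveM d1 (is_derive_pdf x))).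
  by rewrite /GRing.scale/= /h'; field; exact: sn.
have ih' : mu.-integrable setT (EFin \o h').
  have -> : EFin \o h' = (fun x => (a%:E * (cos (a * x + b) * pdf x)%:E - (s ^- 2)%:E * (x * sin (a * x + b) * pdf x)%:E)%E).
    by apply/funext => x; rewrite /h' /= EFinB !EFinM.
  apply: integrableB => //; apply: integrableZl => //.
    exact: int_bpdf (bmf_cosl a b).
  exact: int_xpdf (bmf_sinl a b).
have mh' : measurable_fun setT h' by case/integrableP : ih' => /measurable_EFinP.
have cl : continuous (fun x : R => a * x + b).
  by move=> x; apply: cvgD; [apply: cvgMr; exact: cvg_id|exact: cvg_cst].
have cc : continuous (cos \o (fun x : R => a * x + b)).
  by move=> x; apply: continuous_comp; [exact: cl|exact: continuous_cos].
have cs : continuous (sin \o (fun x : R => a * x + b)).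
  by move=> x; apply: continuous_comp; [exact: cl|exact: continuous_sin].
have cp : continuous pdf by exact: continuous_normal_pdf.
have ch' : continuous h'.
  move=> x; apply: cvgB; apply: cvgMr; apply: cvgM; last exact: cp.
  - exact: cc.
  - exact: cp.
  - by apply: cvgM; [exact: cvg_id|exact: cs].
have chh : continuous h.
  move=> x; apply: cvgM; last exact: cp.
  exact: cs.
pose D (n : nat) : set R := `[(- n.+1%:R), n.+1%:R]%classic.
have int0 : \int[mu]_x h' x = 0.
  have c1 : (\int[mu]_(x in D n) (h' x)%:E)%E @[n --> \oo] --> (\int[mu]_x (h' x)%:E)%E.
    under eq_fun do rewrite integral_mkcond.
    have [|||||_ _ cv] := @dominated_convergence _ _ _ mu setT measurableT
      (fun n => (EFin \o h') \_ (D n)) (EFin \o h') (fun x => `|h' x|%:E); last exact: cv.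
    - move=> n; have mD : measurable (D n) by exact: measurable_itv.
      apply: (proj1 (measurable_restrictT (EFin \o h') mD)).
      by apply: (@measurable_funS _ _ _ _ setT) => //; exact/measurable_EFinP.
    - exact/measurable_EFinP.
    - apply/aeW => x _; apply: cvg_near_cst; near=> n.
      rewrite patchE mem_set//= /D/= in_itv/= -ler_norml.
      by rewrite (@le_trans _ _ n%:R) ?ler_nat//; near: n; exact: nbhs_infty_ger.
    - by have /integrable_norm := ih'.
    - by apply/aeW => x n _; rewrite patchE; case: ifP; rewrite /= ?lee_fin// normr0.
  have c2 : (\int[mu]_(x in D n) (h' x)%:E)%E @[n --> \oo] --> 0%E.
    have E n : (\int[mu]_(x in D n) (h' x)%:E)%E = (h n.+1%:R - h (- n.+1%:R))%:E.
      rewrite EFinB; apply: continuous_FTC2.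
      - by rewrite ltrNl (lt_trans (_ : _ < 0))// ?oppr_lt0 ltr0n.
      - exact: continuous_subspaceT.
      - split.
        + by move=> x _; have [] := dh x.
        + exact: cvg_at_right_filter (chh _).
        + exact: cvg_at_left_filter (chh _).
      - by move=> x _; rewrite derive1E; exact: derive_val.
    under eq_fun do rewrite E.
    apply: cvg_EFin; first exact: nearW.
    have hb x : `|h x| <= pdf x.
      by rewrite /h normrM (ger0_norm (pdf_ge0 x)) ler_piMl// ler_norml sin_geN1 sin_le1.
    have pN x : pdf (- x) = pdf x by rewrite !pdfE sqrrN.
    apply: (@squeeze_cvgr _ _ _ _ (fun n => - (2 * pdf n.+1%:R)) (fun n => 2 * pdf n.+1%:R)).
    - apply: nearW => n /=; rewrite -ler_norml (le_trans (ler_normB _ _))//.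
      have := hb n.+1%:R; have := hb (- n.+1%:R); rewrite pN; lra.
    - rewrite -oppr0 -[X in _ --> - X](mulr0 2); apply: cvgN; apply: cvgMr.
      by rewrite (cvg_shiftS (fun n => pdf n%:R)).
    - rewrite -[X in _ --> X](mulr0 2); apply: cvgMr.
      by rewrite (cvg_shiftS (fun n => pdf n%:R)).
  by rewrite /Rintegral; have -> : (\int[mu]_x (h' x)%:E)%E = 0%E by exact: (cvg_unique _ c1 c2).
have i1 := int_bpdf (bmf_cosl a b); have i2 := int_xpdf (bmf_sinl a b).
move: int0; rewrite /h' RintegralB//; last 2 first.
- exact: (integrableZl measurableT a i1).
- exact: (integrableZl measurableT (s ^- 2) i2).
rewrite RintegralZl// RintegralZl// => /eqP; rewrite subr_eq0 => /eqP e.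
apply: (@mulfI _ (s ^- 2)); first by rewrite invr_eq0 expf_neq0.
by rewrite -e; field; exact: sn.
Unshelve. all: by end_near. Qed.

(** Differentiation under the integral and [parts] give f' = - a s^2 f; hence f(a) exp(a^2 s^2 / 2)
    is constant, equal to its value cos b at 0. *)
Lemma normal_char (a b : R) :
  Ex (normal_prob 0 s) (fun x => cos (a * x + b)) = expR (- (a ^+ 2 * s ^+ 2 / 2)) * cos b.
Proof.
pose f a := \int[mu]_x (cos (a * x + b) * pdf x).
rewrite (Ex_normal (bmf_cosl a b)).
have df (a0 : R) : is_derive a0 (1 : R) f (- (a0 * s ^+ 2 * f a0)).
  have Ia : `]a0 - 1, a0 + 1[%classic a0 by rewrite /= in_itv/=; lra.
  have dd (x y : R) : is_derive x (1 : R) (fun x : R => cos (x * y + b) * pdf y) (- (y * sin (x * y + b)) * pdf y).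
    have -> : (fun x => cos (x * y + b) * pdf y) = (fun x => (cos \o (fun x => x * y + b)) x * pdf y) by [].
    by apply: is_derive_eq; rewrite /GRing.scale/=; ring.
  have d1E x y : partial1of2 (fun x y => cos (x * y + b) * pdf y) x y = - (y * sin (x * y + b)) * pdf y.
    by rewrite partial1of2E; exact: derive_val.
  have g1 x : mu.-integrable setT (EFin \o (fun y => cos (x * y + b) * pdf y)) by exact: int_bpdf (bmf_cosl x b).
  have g2 (x y : R) : derivable (fun x : R => cos (x * y + b) * pdf y) x (1 : R) by have [] := dd x y.
  pose Gb y := `|y * 1 * pdf y|.
  have g3 : mu.-integrable setT (EFin \o Gb).
    by have /integrable_norm := int_xpdf (bmf_cst 1).
  have g4 x y : `|partial1of2 (fun x y => cos (x * y + b) * pdf y) x y| <= Gb y.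
    rewrite d1E /Gb !normrM normrN normrM normr1 mulr1 ler_wpM2r//.
    by rewrite ler_piMr// ler_norml sin_geN1 sin_le1.
  have H1 := @derivable_under_integral _ _ _ mu (fun x y => cos (x * y + b) * pdf y) setT measurableT
     a0 (a0 - 1) (a0 + 1) Ia (fun x _ => g1 x) (fun x y _ _ => g2 x y) Gb (fun y => normr_ge0 _) g3 (fun x y _ _ => g4 x y).
  have H2 := @differentiation_under_integral _ _ _ mu (fun x y => cos (x * y + b) * pdf y) setT measurableT
     a0 (a0 - 1) (a0 + 1) Ia (fun x _ => g1 x) (fun x y _ _ => g2 x y) Gb (fun y => normr_ge0 _) g3 (fun x y _ _ => g4 x y).
  split; first exact: H1.
  rewrite -derive1E H2.
  under eq_Rintegral do rewrite d1E mulNr -mulN1r.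
  rewrite RintegralZl//; last exact: int_xpdf (bmf_sinl a0 b).
  by rewrite parts mulN1r.
have : (fun a => f a * expR (a ^+ 2 * (s ^+ 2 / 2))) a = (fun a => f a * expR (a ^+ 2 * (s ^+ 2 / 2))) 0.
  apply: (@is_derive_0_is_cst _ (fun a => f a * expR (a ^+ 2 * (s ^+ 2 / 2)))) => x.
  have de : is_derive x (1 : R) (fun a => expR (a ^+ 2 * (s ^+ 2 / 2))) (x * s ^+ 2 * expR (x ^+ 2 * (s ^+ 2 / 2))).
    have -> : (fun a => expR (a ^+ 2 * (s ^+ 2 / 2))) = expR \o (fun a => a ^+ 2 * (s ^+ 2 / 2)) by [].
    by apply: is_derive_eq; rewrite /GRing.scale/=; field.
  apply: (@is_derive_eq _ _ _ _ _ _ _ _ (is_deriveM (df x) de)).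
  by rewrite /GRing.scale/=; ring.
have f0 : f 0 = cos b.
  rewrite /f; under eq_Rintegral do rewrite mul0r add0r.
  rewrite RintegralZl//; last exact: integrable_normal_pdf.
  by rewrite /Rintegral integral_normal_pdf mulr1.
rewrite /= f0 expr0n/= mul0r expR0 mulr1 -/(f a) => fa.
rewrite -fa mulrCA -expRD (_ : _ + _ = 0) ?expR0 ?mulr1//; ring.
Qed.
End NormalChar.

(* The type [measurableTypeR R] carrying the library measures and [R] itself have
   the same measurable sets but are not unifiable structures: transport by [id]. *)
Lemma prob_on_R {R : realType} (U : probability (measurableTypeR R) R) :
  exists U' : probability R R, forall V : set R, measurable V -> U' V = U V.
Proof.
pose f (x : measurableTypeR R) : R := x.
have mid : measurable_fun setT f by move=> _ Y mY; rewrite setTI.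
pose U' : probability R R := distribution U (mfun_Sub (mem_set mid)).
by exists U'.
Qed.

Lemma exists_unif {R : realType} : exists U : probability R R,
  forall V : set R, measurable V -> U V = @lebesgue_measure R (V `&` `[0, 1]%classic).
Proof.
have [U UE] := prob_on_R (uniform_prob (@ltr01 R)).
exists U => V mV; rewrite UE// [LHS]integral_uniform_pdf.
rewrite (eq_integral (fun=> 1%:E)); last first.
  move=> x; rewrite inE/= in_itv/= => -[_ h].
  by rewrite /uniform_pdf h subr0 invr1.
by rewrite integral_cst ?mul1e//; exact: measurableI.
Qed.

Lemma exists_normal {R : realType} (s : R) : exists U : probability R R,
  forall V : set R, measurable V -> U V = normal_prob 0 s V.
Proof. exact: (prob_on_R (normal_prob 0 s)). Qed.

Lemma le_half_pow {R : realType} (x c : R) : (forall n, x <= c / 2 ^+ n) -> x <= 0.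
Proof.
move=> h; have c0 : c / 2 ^+ n @[n --> \oo] --> 0.
  rewrite -[X in _ --> X](mulr0 c); apply: cvgMr.
  under eq_fun do rewrite -exprVn.
  by apply: cvg_expr; rewrite ger0_norm ?invr_ge0// invf_lt1// ltr1n.
rewrite -(cvg_lim (@Rhausdorff R) c0); apply: limr_ge; first by apply/cvg_ex; exists 0.
exact: nearW.
Qed.

Lemma lip_bmR {R : realType} (g : R -> R) (L M : R) :
  (forall x y, `|g x - g y| <= L * `|x - y|) -> (forall x, `|g x| <= M) -> bmR g.
Proof.
move=> gL gM; split; last by exists M.
apply: continuous_measurable_fun => x; apply/cvgrPdist_le => e e0.
have L1 : 0 < `|L| + 1 by have := normr_ge0 L; lra.
near=> y; rewrite (le_trans (gL _ _))// (@le_trans _ _ ((`|L| + 1) * `|x - y|))//.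
  by rewrite ler_wpM2r// (le_trans (ler_norm L))// lerDl.
rewrite mulrC -ler_pdivlMr//; near: y.
by apply: cvgr_dist_le; [exact: cvg_id|rewrite divr_gt0].
Unshelve. all: by end_near. Qed.

(** * Independent uniform variables from the binary digits of a single one *)

Section Uniform.
Context {R : realType}.
Notation mu := (@lebesgue_measure R).

Variable unif : probability R R.
Hypothesis unif_setI : forall V : set R, measurable V -> unif V = mu (V `&` `[0, 1]%classic).

Lemma unif_ray (a : R) : Pr unif `]a, +oo[%classic = 1 - minr (maxr a 0) 1.
Proof.
rewrite /Pr unif_setI//.
have [a0|a0] := ltP a 0.
  rewrite (min_l ler01) subr0.
  have -> : `]a, +oo[%classic `&` `[0, 1]%classic = `[0, 1]%classic :> set R.
    apply/seteqP; split => x /=; rewrite !in_itv/= ?andbT; first by case.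
    by move=> /andP[x0 x1]; rewrite x0 x1; split => //; exact: lt_le_trans x0.
  by rewrite lebesgue_measure_itv/= lte_fin ltr01 -EFinB subr0.
have -> : `]a, +oo[%classic `&` `[0, 1]%classic = `]a, 1]%classic :> set R.
  apply/seteqP; split => x /=; rewrite !in_itv/= ?andbT; first by move=> [-> /andP[]].
  by move=> /andP[ax x1]; rewrite ax x1 (le_trans a0 (ltW ax)).
rewrite lebesgue_measure_itv/= lte_fin; have [a1|a1] := ltP a 1.
  by rewrite -EFinB.
by rewrite subrr.
Qed.

Lemma unif_lt (s : R) : 0 <= s <= 1 -> Pr unif `]-oo, s[%classic = s.
Proof.
move=> /andP[s0 s1]; rewrite /Pr unif_setI//.
have -> : `]-oo, s[%classic `&` `[0, 1]%classic = `[0, s[%classic :> set R.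
  apply/seteqP; split => x /=; rewrite !in_itv/=; first by move=> [-> /andP[->]].
  by move=> /andP[x0 xs]; rewrite x0 xs (le_trans (ltW xs) s1).
rewrite lebesgue_measure_itv/= lte_fin; have [a1|a1] := ltP 0 s.
  by rewrite -EFinB subr0.
by apply/eqP; rewrite eq_le a1 s0.
Qed.

Lemma unif_ext (f g : R -> R) : bmR f -> bmR g -> (forall x, 0 < x < 1 -> f x = g x) ->
  Ex unif f = Ex unif g.
Proof.
move=> bf bg fg; apply/eqP; rewrite -subr_eq0 -ExB// -normr_le0.
have [_ [M hM]] := bmfB bf bg.
have mI : measurable (~` `]0, 1[%classic : set R) by exact: measurableC.
rewrite (le_trans (Ex_norm _ (bmfB bf bg)))//.
rewrite (@le_trans _ _ (Ex unif (fun x => M * \1_(~` `]0, 1[%classic) x)))//.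
  apply: Ex_le; [exact/bmf_norm/bmfB|exact/bmfZ/bmf_indic|move=> x].
  rewrite indicE; have [h|h] := boolP (0 < x < 1).
    rewrite fg// subrr normr0.
    have -> : (x \in ~` `]0, 1[%classic) = false by apply/negbTE/negP; rewrite inE/= in_itv/= h.
    by rewrite mulr0.
  rewrite mem_set ?mulr1//= in_itv/=; exact/negP.
rewrite ExZ; last exact: bmf_indic.
rewrite Ex_indic// Pr_setC//.
suff -> : Pr unif `]0, 1[%classic = 1 by rewrite subrr mulr0.
rewrite /Pr unif_setI// setIidl; last exact: subset_itv_oo_cc.
by rewrite lebesgue_measure_itv/= lte_fin ltr01 -EFinB subr0.
Qed.

(** The uniform law is the equal mixture of its images under the two contractions onto the halves of
    [0, 1]; it is enough to check this on rays. *)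
Lemma unif_self (f : R -> R) : bmR f ->
  Ex unif f = 2^-1 * Ex unif (fun x => f (x / 2)) + 2^-1 * Ex unif (fun x => f ((1 + x) / 2)).
Proof.
move=> bf; apply/eqP; rewrite -subr_eq0; apply/eqP.
have m0 : measurable_fun setT (fun x : R => x / 2) by exact: measurable_funM.
have m1 : measurable_fun setT (fun x : R => (1 + x) / 2).
  by apply: measurable_funM => //; exact: measurable_funD.
have mid : measurable_fun setT (fun x : R => x) by exact: measurable_id.
have H := dctfB (dctf_Ex1 unif mid) (dctfD (dctfZ 2^-1 (dctf_Ex1 unif m0)) (dctfZ 2^-1 (dctf_Ex1 unif m1))).
apply: (dctf_rays H) => //; first by rewrite !Ex_cst; lra.
move=> a.
have E (h : R -> R) (c : R) : (forall x, (a < h x) = (c < x)) ->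
    Ex unif (fun x => \1_(`]a, +oo[%classic) (h x)) = 1 - minr (maxr c 0) 1.
  move=> hc; rewrite -unif_ray -Ex_indic//; congr Ex; apply/funext => x.
  by rewrite !indicE; congr ((nat_of_bool _)%:R); apply/idP/idP; rewrite !inE/= !in_itv/= !andbT hc.
rewrite (E (fun x => x) a)// (E _ (2 * a)); last by move=> x; rewrite ltr_pdivlMr// mulrC.
rewrite (E _ (2 * a - 1)); last first.
  by move=> x; rewrite ltr_pdivlMr// mulrC ltrBlDl.
rewrite /Order.max /Order.min.
by repeat case: ifPn; rewrite -?leNgt => *; lra.
Qed.

(** For u in [0, 1[, the first binary digit; [dbl] is the shift of the digits. *)
Definition bit (u : R) : R := if 2^-1 <= u then 1 else 0.
Definition dbl (u : R) : R := 2 * u - bit u.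

Lemma bit_measurable : measurable_fun setT bit.
Proof. by apply: measurable_fun_if => //; exact: measurable_fun_ler. Qed.

Lemma dbl_measurable : measurable_fun setT dbl.
Proof. by apply: measurable_funB; [exact: measurable_funM|exact: bit_measurable]. Qed.

Lemma bit01 u : 0 <= bit u <= 1.
Proof. by rewrite /bit; case: ifP; rewrite lexx ler01. Qed.

(** The first digit is a fair coin independent of the shifted number. This is [unif_self] read on
    each half of the interval. *)
Lemma unif_bit (g : R -> R -> R) : bmR (g 0) -> bmR (g 1) -> bmR (fun u => g (bit u) (dbl u)) ->
  Ex unif (fun u => g (bit u) (dbl u)) = 2^-1 * Ex unif (g 0) + 2^-1 * Ex unif (g 1).
Proof.
move=> b0 b1 b; rewrite unif_self//; congr (_ * _ + _ * _).
  apply: unif_ext => //.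
    have m0 : measurable_fun setT (fun x : R => x / 2) by exact: measurable_funM.
    exact: (bmR_comp b m0).
  move=> x /andP[x0 x1]; rewrite /dbl /bit; case: ifPn; rewrite -?ltNge => h; first by lra.
  by congr g; lra.
apply: unif_ext => //.
  have m0 : measurable_fun setT (fun x : R => (1 + x) / 2).
    by apply: measurable_funM => //; exact: measurable_funD.
  exact: (bmR_comp b m0).
move=> x /andP[x0 x1]; rewrite /dbl /bit; case: ifPn; rewrite -?ltNge => h; last by lra.
by congr g; lra.
Qed.

(* th1 u and th2 u collect the binary digits of u of odd and even rank. *)
Fixpoint t1 (n : nat) (u : R) : R := if n is n'.+1 then (bit u + t1 n' (dbl (dbl u))) / 2 else 0.

Lemma t1_bound n u : 0 <= t1 n u <= 1.
Proof.
elim: n u => [|n IH] u /=; first by rewrite lexx ler01.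
by have := IH (dbl (dbl u)); have := bit01 u; move: (t1 _ _) (bit _) => a b; lra.
Qed.

Lemma t1_nd n u : t1 n u <= t1 n.+1 u.
Proof.
elim: n u => [|n IH] u; first by have /andP[] := t1_bound 1 u.
rewrite -[t1 n.+2 u]/((bit u + t1 n.+1 (dbl (dbl u))) / 2).
rewrite -[t1 n.+1 u]/((bit u + t1 n (dbl (dbl u))) / 2).
by have := IH (dbl (dbl u)); lra.
Qed.

Definition th1 (u : R) : R := limn (t1 ^~ u).

Lemma th1_cvg u : t1 n u @[n --> \oo] --> th1 u.
Proof.
apply: nondecreasing_is_cvgn; first by apply/nondecreasing_seqP => n; exact: t1_nd.
by exists 1 => _ [n _ <-]; have /andP[] := t1_bound n u.
Qed.

Lemma t1_measurable n : measurable_fun setT (t1 n).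
Proof.
elim: n => [|n IH]; first exact: measurable_cst.
apply: measurable_funM => //; apply: measurable_funD; first exact: bit_measurable.
apply: (measurableT_comp IH); apply: (measurableT_comp dbl_measurable); exact: dbl_measurable.
Qed.

Lemma th1_measurable : measurable_fun setT th1.
Proof.
apply: (@measurable_fun_cvg _ _ _ setT t1) => //; first by move=> n; exact: t1_measurable.
by move=> u _; exact: th1_cvg.
Qed.

Lemma th1_bound u : 0 <= th1 u <= 1.
Proof.
apply/andP; split.
  by apply: limr_ge; [exact: th1_cvg|apply: nearW => n; have /andP[] := t1_bound n u].
by apply: limr_le; [exact: th1_cvg|apply: nearW => n; have /andP[] := t1_bound n u].
Qed.

Lemma th1E u : th1 u = (bit u + th1 (dbl (dbl u))) / 2.
Proof.
have c1 : t1 n.+1 u @[n --> \oo] --> th1 u by rewrite (cvg_shiftS (t1 ^~ u)); exact: th1_cvg.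
apply: (cvg_unique _ c1) => //=; rewrite ![_ / 2]mulrC.
under eq_fun do rewrite mulrC.
by apply: cvgMr; apply: cvgD; [exact: cvg_cst|exact: th1_cvg].
Qed.

Definition th2 (u : R) : R := th1 (dbl u).

Lemma th2_measurable : measurable_fun setT th2.
Proof. exact: (measurableT_comp th1_measurable dbl_measurable). Qed.

Lemma unif_dbl f : bmR f -> Ex unif (fun u => f (dbl u)) = Ex unif f.
Proof.
move=> bf; rewrite (unif_bit (g := fun _ x => f x))//; first by lra.
exact: (bmR_comp bf dbl_measurable).
Qed.

Definition half (e : R) (f : R -> R) : R -> R := fun x => f ((e + x) / 2).

Lemma half_bmR e f : bmR f -> bmR (half e f).
Proof.
move=> bf; apply: (@bmR_comp _ _ _ f (fun x => (e + x) / 2)) => //.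
by apply: measurable_funM => //; exact: measurable_funD.
Qed.

(** Since th1 u = (bit u + th2 (dbl u)) / 2 and th2 has the law of th1, the law of th1 satisfies the
    same self-similarity equation as the uniform law. *)
Lemma Ex_th1 f : bmR f -> Ex unif (fun u => f (th1 u)) =
  2^-1 * Ex unif (fun u => half 0 f (th1 u)) + 2^-1 * Ex unif (fun u => half 1 f (th1 u)).
Proof.
move=> bf.
have b e : bmR (fun u => half e f (th2 u)) by exact: (bmR_comp (half_bmR e bf) th2_measurable).
have E e : Ex unif (fun u => half e f (th2 u)) = Ex unif (fun u => half e f (th1 u)).
  apply: (unif_dbl (f := fun u => half e f (th1 u))).
  exact: (bmR_comp (half_bmR e bf) th1_measurable).
rewrite -!E -(unif_bit (g := fun e x => half e f (th2 x)))//.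
  by congr Ex; apply/funext => u; rewrite /half /th2 -th1E.
under eq_fun do rewrite /half /th2 -th1E.
exact: (bmR_comp bf th1_measurable).
Qed.

(** Two digits are peeled off, one for each coordinate; after each digit th1 and th2 exchange
    roles. *)
Lemma Ex_th12 h k : bmR h -> bmR k -> Ex unif (fun u => h (th1 u) * k (th2 u)) =
  2^-1 * (2^-1 * Ex unif (fun u => half 0 h (th1 u) * half 0 k (th2 u)) +
          2^-1 * Ex unif (fun u => half 0 h (th1 u) * half 1 k (th2 u))) +
  2^-1 * (2^-1 * Ex unif (fun u => half 1 h (th1 u) * half 0 k (th2 u)) +
          2^-1 * Ex unif (fun u => half 1 h (th1 u) * half 1 k (th2 u))).
Proof.
move=> bh bk.
have b1 f : bmR f -> bmR (fun u => f (th1 u)) by move=> bf; exact: (bmR_comp bf th1_measurable).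
have b2 f : bmR f -> bmR (fun u => f (th2 u)) by move=> bf; exact: (bmR_comp bf th2_measurable).
have step e : Ex unif (fun v => half e h (th2 v) * k (th1 v)) =
    2^-1 * Ex unif (fun u => half e h (th1 u) * half 0 k (th2 u)) +
    2^-1 * Ex unif (fun u => half e h (th1 u) * half 1 k (th2 u)).
  have bb e' : bmR (fun u => half e h (th1 u) * half e' k (th2 u)).
    by apply: bmfM; [exact/b1/half_bmR|exact/b2/half_bmR].
  rewrite -(unif_bit (g := fun e' u => half e h (th1 u) * half e' k (th2 u)))//.
    by congr Ex; apply/funext => u; rewrite /th2 {3}/half -th1E.
  under eq_fun do rewrite /th2 {2}/half -th1E.
  by apply: bmfM; [exact/b2/half_bmR|exact: b1].
rewrite -(step 0) -(step 1).
have bb e : bmR (fun v => half e h (th2 v) * k (th1 v)).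
  by apply: bmfM; [exact/b2/half_bmR|exact: b1].
rewrite -(unif_bit (g := fun e v => half e h (th2 v) * k (th1 v)))//.
  by congr Ex; apply/funext => u; rewrite /th2 {1}/half -th1E.
under eq_fun do rewrite /th2 {1}/half -th1E.
by apply: bmfM; [exact: b1|exact: b2].
Qed.

Lemma half_lip e f (C : R) : (forall x y, `|f x - f y| <= C * `|x - y|) ->
  forall x y, `|half e f x - half e f y| <= C / 2 * `|x - y|.
Proof.
move=> fC x y; rewrite (le_trans (fC _ _))//.
have -> : (e + x) / 2 - (e + y) / 2 = 2^-1 * (x - y) by lra.
by rewrite normrM ger0_norm ?invr_ge0// mulrA.
Qed.

Let b1 f : bmR f -> bmR (fun u => f (th1 u)).
Proof. by move=> bf; exact: (bmR_comp bf th1_measurable). Qed.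

Let b2 f : bmR f -> bmR (fun u => f (th2 u)).
Proof. by move=> bf; exact: (bmR_comp bf th2_measurable). Qed.

(** Contraction argument: both laws solve the same self-similarity equation, and each use of it
    halves the Lipschitz constant of the test function, so the two expectations differ by at most 2
    L / 2^n for every n. *)
Lemma Ex_th1_id f : bmR f -> Ex unif (fun u => f (th1 u)) = Ex unif f.
Proof.
apply: (law_eq_lip th1_measurable (@measurable_id _ _ setT)) => {}f C M C0 fC fM.
have key n : forall (g : R -> R) (L : R), 0 <= L -> (forall x y, `|g x - g y| <= L * `|x - y|) ->
    (forall x, `|g x| <= M) -> `|Ex unif (fun u => g (th1 u)) - Ex unif g| <= 2 * L / 2 ^+ n.
  elim: n => [|n IH] g L L0 gL gM; have bg := lip_bmR gL gM.
    rewrite expr0 divr1.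
    have h1 : `|Ex unif (fun u => g (th1 u)) - g 0| <= L.
      rewrite -[X in _ - X](Ex_cst unif) -ExB//; [|exact: b1|exact: bmf_cst].
      apply: Ex_norm_le; first by apply: bmfB; [exact: b1|exact: bmf_cst].
      move=> u; rewrite (le_trans (gL _ _))// subr0 ler_piMr//.
      by have /andP[t0 t1'] := th1_bound u; rewrite ger0_norm.
    have h2 : `|Ex unif g - g 0| <= L.
      (* Clamping to [0, 1] changes g on a null set only, and makes its distance to g 0 at most L
         everywhere. *)
      pose g' (x : R) := g (minr (maxr x 0) 1).
      have bg' : bmR g'.
        have m0 : measurable_fun setT (fun x : R => minr (maxr x 0) 1).
          by apply: measurable_minr => //; exact: measurable_maxr.
        exact: (bmR_comp bg m0).
      have -> : Ex unif g = Ex unif g'.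
        by apply: unif_ext => // x /andP[x0 x1]; rewrite /g' max_l ?min_l ?ltW.
      rewrite -[X in _ - X](Ex_cst unif) -ExB//; last exact: bmf_cst.
      apply: Ex_norm_le; first by apply: bmfB => //; exact: bmf_cst.
      move=> u; rewrite (le_trans (gL _ _))// subr0 ler_piMr//.
      by rewrite ger0_norm ?ge_min ?lexx ?orbT// le_min le_max lexx orbT ler01.
    have -> : Ex unif (fun u => g (th1 u)) - Ex unif g =
      (Ex unif (fun u => g (th1 u)) - g 0) - (Ex unif g - g 0) by ring.
    by rewrite (le_trans (ler_normB _ _))//; lra.
  rewrite (Ex_th1 bg) (unif_self bg).
  have L2 : 0 <= L / 2 by lra.
  have h0 := IH (half 0 g) (L / 2) L2 (half_lip 0 gL) (fun x => gM _).
  have h1 := IH (half 1 g) (L / 2) L2 (half_lip 1 gL) (fun x => gM _).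
  have -> : (fun x => g (x / 2)) = half 0 g by apply/funext => x; rewrite /half add0r.
  rewrite -[(fun x => g ((1 + x) / 2))]/(half 1 g).
  set A := Ex _ _ in h0 *; set B := Ex _ _ in h0 *; set C1 := Ex _ _ in h1 *; set D := Ex _ _ in h1 *.
  have -> : 2^-1 * A + 2^-1 * C1 - (2^-1 * B + 2^-1 * D) = 2^-1 * (A - B) + 2^-1 * (C1 - D) by ring.
  rewrite (le_trans (ler_normD _ _))// !normrM ger0_norm ?invr_ge0//.
  have -> : 2 * L / 2 ^+ n.+1 = 2 * (L / 2) / 2 ^+ n by rewrite exprS; field; rewrite expf_neq0.
  by lra.
apply/eqP; rewrite -subr_eq0 -normr_le0.
by apply: (@le_half_pow _ _ (2 * C)) => n; exact: (key n f C).
Qed.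

Lemma Ex_th2_id f : bmR f -> Ex unif (fun u => f (th2 u)) = Ex unif f.
Proof.
move=> bf; rewrite (unif_dbl (f := fun u => f (th1 u))); last exact: b1.
exact: Ex_th1_id.
Qed.

(** The same contraction, applied to the covariance of g(th1) and p(th2): four half-scale pairs
    replace each pair, the Lipschitz constant of g is halved, and p merely keeps its bound K. *)
Lemma Ex_th12_indep h k : bmR h -> bmR k ->
  Ex unif (fun u => h (th1 u) * k (th2 u)) = Ex unif h * Ex unif k.
Proof.
move=> bh bk; apply/eqP; rewrite -subr_eq0; apply/eqP.
have mid : measurable_fun setT (fun x : R => x) by exact: measurable_id.
have E : (fun u => h (th1 u) * k (th2 u)) = (fun u => k (th2 u) * h (th1 u)).
  by apply/funext => u; rewrite mulrC.
rewrite E (mulrC (Ex unif h)).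
apply: (dctf_lip (dctfB (dctf_Ex unif (b2 bk) th1_measurable) (dctfZ (Ex unif k) (dctf_Ex1 unif mid)))) => // {E h bh}.
move=> f C M C0 fC fM.
have [_ [K kK]] := bk.
have K0 : 0 <= K by exact: le_trans (kK 0).
have key n : forall (g p : R -> R) (L : R), 0 <= L -> (forall x y, `|g x - g y| <= L * `|x - y|) ->
    (forall x, `|g x| <= M) -> bmR p -> (forall x, `|p x| <= K) ->
    `|Ex unif (fun u => g (th1 u) * p (th2 u)) - Ex unif (fun u => g (th1 u)) * Ex unif (fun u => p (th2 u))| <= 2 * L * K / 2 ^+ n.
  elim: n => [|n IH] g p L L0 gL gM bp pK; have bg := lip_bmR gL gM.
    rewrite expr0 divr1.
    have bg1 := b1 bg; have bp2 := b2 bp.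
    have br : bmf (fun u => g (th1 u) - g 0) by apply: bmfB => //; exact: bmf_cst.
    have rL u : `|g (th1 u) - g 0| <= L.
      rewrite (le_trans (gL _ _))// subr0 ler_piMr//.
      by have /andP[t0 t1'] := th1_bound u; rewrite ger0_norm.
    have -> : Ex unif (fun u => g (th1 u) * p (th2 u)) - Ex unif (fun u => g (th1 u)) * Ex unif (fun u => p (th2 u)) =
        Ex unif (fun u => (g (th1 u) - g 0) * p (th2 u)) - Ex unif (fun u => g (th1 u) - g 0) * Ex unif (fun u => p (th2 u)).
      rewrite [X in _ = X - _](_ : _ = Ex unif (fun u => g (th1 u) * p (th2 u) - g 0 * p (th2 u))); last first.
        by congr Ex; apply/funext => u; rewrite mulrBl.
      rewrite (ExB unif (bmfM bg1 bp2) (bmfZ (g 0) bp2)) ExZ// (ExB unif bg1 (bmf_cst (g 0))) Ex_cst.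
      by ring.
    rewrite (le_trans (ler_normB _ _))//.
    have h1 : `|Ex unif (fun u => (g (th1 u) - g 0) * p (th2 u))| <= L * K.
      by apply: Ex_norm_le; [exact: bmfM|move=> u; rewrite normrM ler_pM].
    have h2 : `|Ex unif (fun u => g (th1 u) - g 0) * Ex unif (fun u => p (th2 u))| <= L * K.
      by rewrite normrM; apply: ler_pM => //; exact: Ex_norm_le.
    by lra.
  rewrite (Ex_th12 bg bp) (Ex_th1 bg) (Ex_th2_id bp) -(Ex_th1_id bp) (Ex_th1 bp).
  have L2 : 0 <= L / 2 by lra.
  have H e e' := IH (half e g) (half e' p) (L / 2) L2 (half_lip e gL) (fun x => gM _) (half_bmR e' bp) (fun x => pK _).
  have h00 := H 0 0; have h01 := H 0 1; have h10 := H 1 0; have h11 := H 1 1.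
  rewrite !(Ex_th2_id (half_bmR _ bp)) -!(Ex_th1_id (half_bmR _ bp)) in h00 h01 h10 h11.
  have -> : 2 * L * K / 2 ^+ n.+1 = 2 * (L / 2) * K / 2 ^+ n by rewrite exprS; field; rewrite expf_neq0.
  move: h00 h01 h10 h11; rewrite !ler_norml; move: (2 * (L / 2) * K / 2 ^+ n) => b.
  move=> /andP[? ?] /andP[? ?] /andP[? ?] /andP[? ?]; apply/andP; split; lra.
apply/eqP; rewrite -normr_le0.
apply: (@le_half_pow _ _ (2 * C * K)) => n; have := key n f k C C0 fC fM bk kK.
rewrite (Ex_th2_id bk) (Ex_th1_id (lip_bmR fC fM)) mulrC.
have -> // : (fun u => f (th1 u) * k (th2 u)) = (fun u => k (th2 u) * f (th1 u)).
by apply/funext => u; rewrite mulrC.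
Qed.

(** th1 reads off one uniform variable, and th2 leaves an independent uniform one to be split
    again. *)
Definition uj (j : nat) (u : R) : R := th1 (iter j th2 u).

Lemma uj_measurable j : measurable_fun setT (uj j).
Proof.
apply: (measurableT_comp th1_measurable); elim: j => [|j IH]; first exact: measurable_id.
exact: (measurableT_comp th2_measurable IH).
Qed.

Lemma ujS j u : uj j.+1 u = uj j (th2 u).
Proof. by rewrite /uj iterSr. Qed.

Lemma Ex_uj j f : bmR f -> Ex unif (fun u => f (uj j u)) = Ex unif f.
Proof.
move=> bf; elim: j => [|j IH]; first exact: Ex_th1_id.
under eq_fun do rewrite ujS.
rewrite (Ex_th2_id (f := fun u => f (uj j u)))//.
exact: (bmR_comp bf (uj_measurable j)).
Qed.

(** The first variable is a function of th1 and all later ones of th2, so independence of these two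
    digit streams drives the induction. *)
Lemma uj_indep n (B : nat -> set R) : (forall i, measurable (B i)) ->
  Pr unif [set u | forall i, (i < n)%N -> B i (uj i u)] = \prod_(i < n) Pr unif (uj i @^-1` B i).
Proof.
elim: n B => [|n IH] B mB.
  rewrite big_ord0 -[RHS](Pr_setT unif); congr Pr; apply/seteqP; split => //.
rewrite big_ord_recl/=.
have mI m (C : nat -> set R) : (forall i, measurable (C i)) -> measurable [set u | forall i, (i < m)%N -> C i (uj i u)].
  move=> mC; have -> : [set u | forall i, (i < m)%N -> C i (uj i u)] = \bigcap_(i in [set i | (i < m)%N]) (uj i @^-1` C i).
    by apply/seteqP; split => w h i /=; exact: h.
  by apply: bigcap_measurableType => i _; apply: preim_measurable => //; exact: uj_measurable.
have mB' i : measurable (B i.+1) by [].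
rewrite -Ex_indic; last exact: mI.
have -> : (\1_[set u | forall i, (i < n.+1)%N -> B i (uj i u)] : R -> R) =
    (fun u => \1_(B 0%N) (th1 u) * \1_[set u | forall i, (i < n)%N -> B i.+1 (uj i u)] (th2 u)).
  apply/funext => u; rewrite !indicE -natrM mulnb; congr ((nat_of_bool _)%:R).
  apply/idP/andP; rewrite !inE/=.
    by move=> h; split; [exact: (h 0%N)|move=> i ni; rewrite -ujS; exact: h].
  by move=> [h0 h] [|i] ni//; rewrite ujS; exact: h.
rewrite (Ex_th12_indep (bmf_indic (mB 0%N)) (bmf_indic (mI n (fun i => B i.+1) mB'))).
rewrite -(Ex_th1_id (bmf_indic (mB 0%N))) (Ex_indic unif (mI n (fun i => B i.+1) mB')).
rewrite (IH (fun i => B i.+1))//; congr (_ * _).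
  rewrite -Ex_indic; last exact: (preim_measurable (uj_measurable 0)).
  by congr Ex; apply/funext => u; rewrite !indicE; congr ((nat_of_bool _)%:R); apply/idP/idP; rewrite !inE.
apply: eq_bigr => i _.
have E j C : measurable C -> Pr unif (uj j @^-1` C) = Ex unif (\1_C : R -> R).
  move=> mC; rewrite -(Ex_uj j (bmf_indic mC)) -Ex_indic; last exact: (preim_measurable (uj_measurable j)).
  by congr Ex; apply/funext => u; rewrite !indicE; congr ((nat_of_bool _)%:R); apply/idP/idP; rewrite !inE.
by rewrite !E.
Qed.

(** * Quantile transform *)

Variable nu : probability R R.

Let S (x : R) : R := Pr nu `]x, +oo[%classic.

Let S_le x y : x <= y -> S y <= S x.
Proof. by move=> xy; apply: Pr_le => // z /=; rewrite !in_itv/= !andbT; exact: le_lt_trans. Qed.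

(** Used with A equal to the whole line, the empty set and an open ray, for the two limits at
    infinity and the right-continuity of S. *)
Let S_cvg (x_ : nat -> R) (l : R) (A : set R) : measurable A ->
  (forall z, \forall n \near \oo, (x_ n < z) = (z \in A)) -> S (x_ n) @[n --> \oo] --> Pr nu A.
Proof.
move=> mA h; rewrite -Ex_indic//; under eq_fun do rewrite /S -Ex_indic//.
apply: (@Ex_dct _ _ _ _ _ _ 1).
- by move=> n; exact: measurable_indic.
- exact: measurable_indic.
- by move=> n w; rewrite indicE; case: (w \in _); rewrite ?normr1 ?normr0.
- apply/aeW => z; apply: cvg_near_cst; have := h z; apply: filterS => n hn.
  rewrite !indicE -hn; congr ((nat_of_bool _)%:R).
  by apply/idP/idP; rewrite inE/= in_itv/= andbT.
Qed.

Definition quant (u : R) : R := if 0 < u < 1 then sup [set x | u < S x] else 0.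

(** Galois connection between S and its generalized inverse. Right-continuity of S gives a point
    strictly beyond a that still satisfies u < S, which makes the inequality strict. *)
Lemma quant_gt u a : 0 < u < 1 -> (a < quant u) = (u < S a).
Proof.
move=> u01; rewrite /quant u01; case/andP: u01 => u0 u1.
have hs : has_sup [set x | u < S x].
  split.
    have := @S_cvg (fun n => - n%:R) 0 setT measurableT; rewrite Pr_setT.
    case/(_ _)/cvgrPdist_lt/(_ (1 - u)); rewrite ?subr_gt0//.
      move=> z; near=> n; rewrite in_setT ltrNl; near: n; exact: nbhs_infty_gtr.
    move=> n _ /(_ n (leqnn n)) /=; rewrite ltr_norml => /andP[_ h].
    by exists (- n%:R) => /=; lra.
  have := @S_cvg (fun n => n%:R) 0 set0 measurable0.
  have -> : Pr nu set0 = 0 by rewrite /Pr measure0.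
  case/(_ _)/cvgrPdist_lt/(_ u u0).
    move=> z; near=> n; rewrite in_set0 ltNge; apply/negbTE; rewrite negbK; near: n; exact: nbhs_infty_ger.
  move=> n _ /(_ n (leqnn n)) /=; rewrite sub0r normrN ger0_norm ?Pr_ge0// => h.
  exists n%:R => x /= ux; rewrite leNgt; apply/negP => /ltW/S_le; lra.
apply/idP/idP.
  have h0 : 0 < sup [set x | u < S x] - a -> exists2 x, u < S x & a < x.
    move=> h; have [x ux] := sup_adherent h hs; rewrite opprB addrCA subrr addr0 => ax.
    by exists x.
  by rewrite -subr_gt0 => /h0[x ux /ltW/S_le]; exact: lt_le_trans.
move=> ua.
have : S (a + n.+1%:R^-1) @[n --> \oo] --> S a.
  apply: (@S_cvg _ 0) => // z.
  have [az|za] := ltP a z.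
    near=> n; rewrite mem_set/= ?in_itv/= ?az// -ltrBrDl.
    near: n; have := @cvg_harmonic R => /cvgrPdist_lt/(_ (z - a)); rewrite subr_gt0 => /(_ az).
    by apply: filterS => n; rewrite sub0r normrN; apply: le_lt_trans; exact: ler_norm.
  near=> n; rewrite memNset/=; last by rewrite in_itv/= ltNge za.
  by apply/negbTE; rewrite -leNgt (le_trans za)// lerDl invr_ge0.
move=> /cvgrPdist_lt/(_ (S a - u)); rewrite subr_gt0 => /(_ ua)[n _ /(_ n (leqnn n))] /=.
rewrite ltr_norml => /andP[_ h].
apply: (@lt_le_trans _ _ (a + n.+1%:R^-1)); first by rewrite ltrDl invr_gt0.
by apply: ub_le_sup; [exact: hs.2|rewrite /=; lra].
Unshelve. all: by end_near. Qed.

Lemma quant_measurable : measurable_fun setT quant.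
Proof.
apply: (measurability (@RGenOInfty.G R) (@RGenOInfty.measurableE R)).
move=> _ [_ [a ->] <-]; rewrite setTI.
have -> : quant @^-1` `]a, +oo[%classic =
    (`]0, 1[%classic `&` `]-oo, S a[%classic) `|` (~` `]0, 1[%classic `&` (if a < 0 then setT else set0)).
  apply/seteqP; split => u /=; rewrite !in_itv/= ?andbT.
    have [u01|u01] := boolP (0 < u < 1); first by rewrite quant_gt// => h; left.
    by rewrite /quant (negbTE u01) => a0; right; rewrite a0.
  move=> [[u01 uS]|[/negP u01]]; first by rewrite quant_gt.
  by rewrite /quant (negbTE u01); case: ifP.
by apply: measurableU; apply: measurableI => //; [exact: measurableC|case: ifP].
Qed.

Lemma Ex_quant f : bmR f -> Ex unif (fun u => f (quant u)) = Ex nu f.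
Proof.
move=> bf; apply/eqP; rewrite -subr_eq0; apply/eqP.
have mid : measurable_fun setT (fun x : R => x) by exact: measurable_id.
apply: (dctf_rays (dctfB (dctf_Ex1 unif quant_measurable) (dctf_Ex1 nu mid))) => //.
  by rewrite !Ex_cst subrr.
move=> a; rewrite [X in _ - X]Ex_indic// -/(S a).
have S01 : 0 <= S a <= 1 by rewrite Pr_ge0 Pr_le1.
rewrite -[X in _ - X](unif_lt S01) -Ex_indic//; apply/eqP; rewrite subr_eq0; apply/eqP.
apply: unif_ext; [|exact: bmf_indic|].
  exact: (bmR_comp (bmf_indic (measurable_itv _)) quant_measurable).
move=> u u01; rewrite !indicE; congr ((nat_of_bool _)%:R).
by apply/idP/idP; rewrite !inE/= !in_itv/= andbT quant_gt.
Qed.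

End Uniform.

Lemma exists_iid_normals {R : realType} : exists (P : probability R R) (xi : nat -> R -> R),
  [/\ forall i, measurable_fun setT (xi i),
      (forall n (B : nat -> set R), (forall i, measurable (B i)) ->
         Pr P [set w | forall i, (i < n)%N -> B i (xi i w)] = \prod_(i < n) Pr P (xi i @^-1` B i)) &
      forall i a b, Ex P (fun w => cos (a * xi i w + b)) = expR (- (a ^+ 2 / 2)) * cos b].
Proof.
have [U UE] := @exists_unif R.
have [nu nuE] := @exists_normal R 1.
pose xi i u := quant nu (uj i u).
have mxi i : measurable_fun setT (xi i) by exact: (measurableT_comp (quant_measurable nu) (uj_measurable i)).
exists U, xi; split => //.
- move=> n B mB.
  have mq i : measurable (quant nu @^-1` B i) by exact: (preim_measurable (quant_measurable nu)).
  exact: (uj_indep UE n mq).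
- move=> i a b.
  have bc : bmR (fun x => cos (a * x + b)).
    by apply: bmf_cos; apply: measurable_funD => //; exact: measurable_funM.
  have bq : bmR (fun u => cos (a * quant nu u + b)) by exact: (bmR_comp bc (quant_measurable nu)).
  rewrite (Ex_uj UE i bq) (Ex_quant UE nu bc).
  have := normal_char (@ltr01 R) a b; rewrite expr1n mulr1 => <-.
  apply/eqP; rewrite -subr_eq0; apply/eqP.
  pose F (f : R -> R) := Ex nu f - Ex (normal_prob 0 1) f.
  apply: (@functional_zero _ _ _ F 2) => //.
  + by move=> f g bf bg; rewrite /F !ExD//; ring.
  + by move=> c f bf; rewrite /F !ExZ//; ring.
  + move=> f M bf fM; rewrite /F mulr_natl mulr2n (le_trans (ler_normB _ _))// lerD//; exact: Ex_norm_le.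
  + by move=> B mB; rewrite /F !Ex_indic// /Pr nuE// subrr.
Qed.

(** * Construction of the Gaussian limit *)

Section QuadraticForm.
Context {R : realType}.
Implicit Types (K : R -> R -> R) (s : seq (R * R)).

Definition quad K s : R := \sum_(p <- s) \sum_(r <- s) p.2 * r.2 * K p.1 r.1.

Definition nonneg_def K := forall s, times_in (fun t => 0 <= t) s -> 0 <= quad K s.

Lemma quad_cons K (q l : R) s : (forall a b, K a b = K b a) ->
  quad K ((q, l) :: s) = l ^+ 2 * K q q + 2 * l * lfun s (K q) + quad K s.
Proof.
move=> symK; rewrite /quad big_cons/= big_cons/= /lfun.
have -> : \sum_(r <- s) l * r.2 * K q r.1 = l * \sum_(r <- s) r.2 * K q r.1.
  by rewrite mulr_sumr; apply: eq_bigr => r _; rewrite mulrA.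
have -> : \sum_(p <- s) \sum_(r <- (q, l) :: s) p.2 * r.2 * K p.1 r.1 =
    l * \sum_(r <- s) r.2 * K q r.1 + \sum_(p <- s) \sum_(r <- s) p.2 * r.2 * K p.1 r.1.
  rewrite mulr_sumr -big_split; apply: eq_bigr => p _ /=.
  by rewrite big_cons/= (symK p.1 q); ring.
by ring.
Qed.

Lemma quad_rank1 (a : R -> R) s : quad (fun x y => a x * a y) s = (lfun s a) ^+ 2.
Proof.
rewrite expr2 /lfun /quad mulr_suml; apply: eq_bigr => p _.
by rewrite mulr_sumr; apply: eq_bigr => r _; ring.
Qed.

Lemma quadD K K' s : quad (fun x y => K x y + K' x y) s = quad K s + quad K' s.
Proof.
rewrite /quad -big_split; apply: eq_bigr => p _; rewrite -big_split; apply: eq_bigr => r _ /=.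
by ring.
Qed.

Lemma quadZ (c : R) K s : quad (fun x y => c * K x y) s = c * quad K s.
Proof.
rewrite /quad mulr_sumr; apply: eq_bigr => p _; rewrite mulr_sumr; apply: eq_bigr => r _ /=.
by ring.
Qed.

Lemma nonneg_diag K (t : R) : nonneg_def K -> 0 <= t -> 0 <= K t t.
Proof.
move=> pK t0; have := pK [:: (t, 1)]; rewrite /quad !big_seq1 /= !mul1r; apply.
by move=> p; rewrite inE => /eqP ->.
Qed.

Lemma nonneg_two K (s t l : R) : (forall a b, K a b = K b a) -> nonneg_def K ->
  0 <= s -> 0 <= t -> 0 <= l ^+ 2 * K s s + 2 * l * K s t + K t t.
Proof.
move=> symK pK s0 t0; have := pK [:: (s, l); (t, 1)].
rewrite quad_cons// /quad /lfun !big_seq1/= !mul1r; apply.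
by move=> p; rewrite !inE => /orP[] /eqP ->.
Qed.

Lemma nonneg_null K (q s : R) : (forall a b, K a b = K b a) -> nonneg_def K ->
  0 <= s -> 0 <= q -> K q q = 0 -> K s q = 0.
Proof.
move=> symK pK s0 q0 Kq; apply/eqP/negP => /negP Ksq.
(* If K s q were nonzero, this coefficient at q would give the form the value -1. *)
have := nonneg_two (- ((K s s + 1) / (2 * K s q))) symK pK q0 s0.
rewrite Kq mulr0 add0r (symK q s).
have -> : 2 * - ((K s s + 1) / (2 * K s q)) * K s q + K s s = -1 by field.
lra.
Qed.

(** Schur complement: for a Gaussian covariance K, the covariance after conditioning on the value at
    q. If K q q = 0 the quotient is 0 by convention and K is unchanged. *)
Definition schur K (q : R) : R -> R -> R := fun a b => K a b - K a q * K q b / K q q.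

Section OneStep.
Variables (K : R -> R -> R) (q : R).
Hypotheses (symK : forall a b, K a b = K b a) (pK : nonneg_def K) (q0 : 0 <= q).

Lemma schur_sym a b : schur K q a b = schur K q b a.
Proof. by rewrite /schur (symK a b) (symK a q) (symK q b); congr (_ - _ / _); rewrite mulrC. Qed.

(** The form of the Schur complement is the minimum of the form of K over the coefficient placed at
    q. *)
Lemma schur_nonneg : nonneg_def (schur K q).
Proof.
move=> s ts.
have Es : quad (schur K q) s = quad K s - (lfun s (K q)) ^+ 2 / K q q.
  rewrite -quad_rank1 [X in _ - X]mulrC -mulNr -quadZ -quadD /schur; congr quad.
  by apply/funext => a; apply/funext => b; rewrite (symK a q); ring.
rewrite Es; have [Kn|Kn] := eqVneq (K q q) 0; first by rewrite Kn invr0 mulr0 subr0; exact: pK.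
have := pK (_ : times_in _ ((q, - (lfun s (K q) / K q q)) :: s)).
rewrite quad_cons//.
have -> : (- (lfun s (K q) / K q q)) ^+ 2 * K q q + 2 * - (lfun s (K q) / K q q) * lfun s (K q) + quad K s
  = quad K s - lfun s (K q) ^+ 2 / K q q by field.
apply; move=> p; rewrite inE => /orP[/eqP -> //|]; exact: ts.
Qed.

Lemma schur_kill (s : R) : 0 <= s -> schur K q s q = 0.
Proof.
move=> s0; rewrite /schur; have [Kn|Kn] := eqVneq (K q q) 0.
  by rewrite (nonneg_null symK pK s0 q0 Kn) mul0r mul0r subr0.
by rewrite mulfK// subrr.
Qed.

Lemma schur_keep (u : R) : (forall s : R, 0 <= s -> K s u = 0) -> forall s : R, 0 <= s -> schur K q s u = 0.
Proof. by move=> h s s0; rewrite /schur !h// mulr0 mul0r subr0. Qed.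

End OneStep.

Section Cholesky.
Variables (C : R -> R -> R) (q : nat -> R).
Hypotheses (symC : forall a b, C a b = C b a) (pC : nonneg_def C) (q0 : forall n, 0 <= q n).

Fixpoint resid n : R -> R -> R := if n is n'.+1 then schur (resid n') (q n') else C.

Lemma residP n : (forall a b, resid n a b = resid n b a) /\ nonneg_def (resid n).
Proof.
elim: n => [//|n [h1 h2]]; split => [a b|]; first exact: schur_sym.
exact: schur_nonneg.
Qed.

Lemma resid0 n i (s : R) : (i < n)%N -> 0 <= s -> resid n s (q i) = 0.
Proof.
elim: n s => [//|n IH] s; have [h1 h2] := residP n; rewrite ltnS leq_eqVlt => /orP[/eqP ->|ni] s0.
  exact: schur_kill.
by apply: schur_keep => // u u0; exact: IH.
Qed.

(** Column j of the Cholesky factor along the times q, taken from the j-th residual kernel. A zero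
    pivot gives a zero column. *)
Definition chol j (s : R) := resid j s (q j) / Num.sqrt (resid j (q j) (q j)).

Lemma chol_resid n (s t : R) : C s t = \sum_(j < n) chol j s * chol j t + resid n s t.
Proof.
elim: n => [|n ->]; first by rewrite big_ord0 add0r.
rewrite big_ord_recr/= -addrA; congr (_ + _); rewrite /schur.
have [h1 h2] := residP n.
have -> : chol n s * chol n t = resid n s (q n) * resid n (q n) t / resid n (q n) (q n).
  rewrite /chol (h1 t) -[in RHS](sqr_sqrtr (nonneg_diag h2 (q0 n))) expr2 invfM; ring.
by ring.
Qed.

Lemma chol0 n i j : (i < n)%N -> (n <= j)%N -> chol j (q i) = 0.
Proof. 
move=> ni nj; have [h1 h2] := residP j.
by rewrite /chol h1 resid0 ?mul0r//; exact: leq_trans nj.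
Qed.

(** The residual kernel after n steps vanishes at the first n times, so the rank-one terms carry the
    whole form. *)
Lemma quad_chol n s : (forall p, p \in s -> exists2 i, (i < n)%N & p.1 = q i) ->
  quad C s = \sum_(j < n) (lfun s (chol j)) ^+ 2.
Proof.
move=> sn; transitivity (quad (fun a b => \sum_(j < n) chol j a * chol j b) s).
  rewrite /quad big_seq [RHS]big_seq; apply: eq_bigr => p ps.
  rewrite big_seq [RHS]big_seq; apply: eq_bigr => r rs.
  rewrite (chol_resid n); have [i ni ->] := sn r rs; have [k _ ->] := sn p ps.
  by rewrite resid0// addr0.
elim: n {sn} => [|n IH].
  by rewrite big_ord0 /quad big1// => p _; rewrite big1// => r _; rewrite big_ord0 mulr0.
rewrite big_ord_recr/= -IH -quad_rank1 -quadD; congr quad.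
by apply/funext => a; apply/funext => b; rewrite big_ord_recr.
Qed.

End Cholesky.
End QuadraticForm.

Section Dyadic.
Context {R : realType}.
Implicit Types (m : nat) (t : R) (x y : R -> R).

Lemma pim_eq m n (t : R) : n%:R / 2 ^+ m <= t -> t < n.+1%:R / 2 ^+ m -> pim m t = n%:R / 2 ^+ m.
Proof.
have p0 : 0 < 2 ^+ m :> R by rewrite exprn_gt0.
rewrite ler_pdivrMr// ltr_pdivlMr// => h1 h2; rewrite /pim (@truncn_def _ _ n)//.
by rewrite mulrC h1.
Qed.

Lemma pim_dyadic m p k : (m <= p)%N -> pim p (k%:R / 2 ^+ m : R) = k%:R / 2 ^+ m.
Proof.
move=> mp; have E : k%:R / 2 ^+ m = (k * 2 ^ (p - m))%:R / 2 ^+ p :> R.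
  rewrite natrM natrX -{2}(subnK mp) exprD; field.
  by rewrite !expf_neq0.
by rewrite E; apply: pim_eq => //; rewrite ltr_pM2r ?ltr_nat// invr_gt0 exprn_gt0.
Qed.

(** The finer rounding of t is either the coarser one or its right neighbour on the finer grid. *)
Lemma pim_step m j (y : R -> R) (e : R) : 0 <= e ->
  (forall k, (k < j * 2 ^ m.+1)%N -> `|y (k.+1%:R / 2 ^+ m.+1) - y (k%:R / 2 ^+ m.+1)| <= e) ->
  forall t, 0 <= t <= j%:R -> `|y (pim m.+1 t) - y (pim m t)| <= e.
Proof.
move=> e0 hy t /andP[t0 tj].
have p0 : 0 < 2 ^+ m :> R by rewrite exprn_gt0.
have p1 : 0 < 2 ^+ m.+1 :> R by rewrite exprn_gt0.
set k := Num.truncn (2 ^+ m * t).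
have /andP[h1 h2] := truncn_itv (mulr_ge0 (ltW p0) t0); rewrite -/k in h1 h2.
have E : pim m t = (2 * k)%:R / 2 ^+ m.+1.
  rewrite /pim -/k natrM exprS; field; exact: expf_neq0.
have [h|h] := ltP (2 ^+ m.+1 * t) (2 * k).+1%:R.
  rewrite E (@pim_eq m.+1 (2 * k)) ?subrr ?normr0//.
  - by rewrite ler_pdivrMr// natrM exprS [X in _ <= X]mulrCA ler_pM2l// mulrC.
  - by rewrite ltr_pdivlMr// mulrC.
rewrite E (@pim_eq m.+1 (2 * k).+1).
- apply: hy; rewrite -(ltr_nat R) (natrM R j) natrX.
  apply: (@lt_le_trans _ _ (2 ^+ m.+1 * t)); first by rewrite (lt_le_trans _ h)// ltr_nat.
  by rewrite mulrC ler_pM2r.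
- by rewrite ler_pdivrMr// mulrC.
- rewrite ltr_pdivlMr// mulrC exprS -mulrA.
  have -> : (2 * k).+2%:R = 2 * k.+1%:R :> R by rewrite -natrM; congr (_%:R); lia.
  by rewrite ltr_pM2l.
Qed.

(** Sum of the geometric series of ratio 9/10; the factor 10 is 1 / (1 - 9/10). *)
Lemma pim_chain m j i (y : R -> R) (e : R) : 0 <= e ->
  (forall p k, (m <= p < m + i)%N -> (k < j * 2 ^ p.+1)%N ->
    `|y (k.+1%:R / 2 ^+ p.+1) - y (k%:R / 2 ^+ p.+1)| <= e * (9 / 10) ^+ p) ->
  forall t, 0 <= t <= j%:R ->
  `|y (pim (m + i) t) - y (pim m t)| <= 10 * e * ((9 / 10) ^+ m - (9 / 10) ^+ (m + i)).
Proof.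
move=> e0; elim: i => [|i IH] hy t tj; first by rewrite addn0 !subrr normr0 mulr0.
have h1 : `|y (pim (m + i) t) - y (pim m t)| <= 10 * e * ((9 / 10) ^+ m - (9 / 10) ^+ (m + i)).
  apply: IH => // p k /andP[mp pi]; apply: hy; rewrite mp/= (leq_trans pi)//; lia.
have h2 : `|y (pim (m + i).+1 t) - y (pim (m + i) t)| <= e * (9 / 10) ^+ (m + i).
  apply: (@pim_step _ j) => //; first by rewrite mulr_ge0// exprn_ge0//; lra.
  by move=> k; apply: hy; lia.
rewrite addnS -(subrKA (y (pim (m + i) t))) (le_trans (ler_normD _ _))//.
rewrite (le_trans (lerD h2 h1))//.
have -> : (9 / 10) ^+ (m + i).+1 = (9 / 10) * (9 / 10) ^+ (m + i) :> R by rewrite exprS.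
by move: ((9 / 10) ^+ (m + i)) ((9 / 10) ^+ m) => u v; lra.
Qed.

(** Rounding is constant just to the left of t. At a grid point t the constant is the preceding grid
    point, not t itself. *)
Lemma pim_left m (t : R) : 0 < t -> exists a : R, a < t /\ forall u, a <= u -> u < t -> pim m u = a.
Proof.
move=> t0; have p0 : 0 < 2 ^+ m :> R by rewrite exprn_gt0.
set k := Num.truncn (2 ^+ m * t).
have /andP[h1 h2] := truncn_itv (mulr_ge0 (ltW p0) (ltW t0)); rewrite -/k in h1 h2.
have [h|h] := ltP (k%:R / 2 ^+ m) t.
  exists (k%:R / 2 ^+ m); split => // u ku ut; apply: pim_eq => //.
  by rewrite (lt_trans ut)// ltr_pdivlMr// mulrC.
have tE : t = k%:R / 2 ^+ m.
  by apply/eqP; rewrite eq_le h/= ler_pdivrMr// mulrC.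
have k0 : (0 < k)%N.
  rewrite lt0n; apply/eqP => k0; move: t0; rewrite tE k0 mul0r; lra.
exists (k.-1%:R / 2 ^+ m); split.
  by rewrite tE ltr_pM2r ?invr_gt0// ltr_nat prednK.
by move=> u ku ut; apply: pim_eq => //; rewrite prednK// -tE.
Qed.

(** Locally uniform limits of step functions: [pim m] is constant on a right neighbourhood of t,
    which gives right-continuity, and on a left one, which gives the Cauchy property there. *)
Lemma cadlag_pim (x : R -> R) :
  (forall (j : nat) (dl : R), 0 < dl -> exists m, forall t, 0 <= t <= j%:R -> `|x t - x (pim m t)| <= dl) ->
  cadlag x.
Proof.
move=> hx; split => t t0.
  apply/cvgrPdist_le => e e0.
  have [m hm] := hx (Num.truncn t).+2 _ (divr_gt0 e0 (@ltr0n R 2)).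
  have /andP[h1 h2] := pim_itv m t0.
  have /andP[_ h4] := truncn_itv t0.
  have tj : t < (Num.truncn t).+2%:R by rewrite (lt_trans h4)// ltr_nat.
  near=> u.
  have tu : t < u by near: u; exact: nbhs_right_gt.
  have uj : u <= (Num.truncn t).+2%:R by near: u; exact: nbhs_right_le.
  have up : u < pim m t + 2 ^- m by near: u; exact: nbhs_right_lt.
  have Eu : pim m u = pim m t.
    rewrite {2}/pim; apply: pim_eq; first exact: le_trans h1 (ltW tu).
    by rewrite -natr1 mulrDl mul1r.
  have := hm t; have := hm u; rewrite Eu => hu ht.
  rewrite -(subrKA (x (pim m t))) (le_trans (ler_normD _ _))// [leRHS]splitr lerD//.
    by apply: ht; rewrite t0 ltW.
  by rewrite distrC; apply: hu; rewrite uj (ltW (le_lt_trans t0 tu)).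
apply: cauchy_cvg; apply: cauchy_exP => e e0.
have [m hm] := hx (Num.truncn t).+1 _ (divr_gt0 e0 (@ltr0n R 2)).
have [a [at_ ha]] := pim_left m t0.
have /andP[_ h4] := truncn_itv (ltW t0).
exists (x a); rewrite /nbhs/=; near=> u.
have ut : u < t by near: u; exact: nbhs_left_lt.
have au : a <= u by near: u; exact: nbhs_left_ge.
have u0 : 0 < u by near: u; exact: nbhs_left_gt.
have := hm u; rewrite (ha u)// => hu.
rewrite -ball_normE/= distrC (le_lt_trans (hu _))//; last by lra.
by rewrite (ltW u0) (ltW (lt_trans ut h4)).
Unshelve. all: by end_near. Qed.

End Dyadic.

Lemma Pr_union {R : realType} {d : measure_display} {T : measurableType d} (P : probability T R)
    (A : nat -> set T) (n : nat) (c : R) : (forall k, measurable (A k)) ->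
  (forall k, (k < n)%N -> Pr P (A k) <= c) ->
  measurable [set w | exists2 k, (k < n)%N & A k w] /\ Pr P [set w | exists2 k, (k < n)%N & A k w] <= n%:R * c.
Proof.
move=> mA hA; have -> : [set w | exists2 k, (k < n)%N & A k w] = \big[setU/set0]_(i < n) A i.
  rewrite -bigcup_mkord; apply/seteqP; split => w.
    by move=> [k kn Ak]; exists k.
  by move=> [k kn Ak]; exists k.
have mU : measurable (\big[setU/set0]_(i < n) A i) by exact: bigsetU_measurable.
split => //; rewrite -lee_fin -PrE//; apply: le_trans (Boole_inequality _ _) _ => //.
rewrite (eq_bigr (fun i : 'I_n => (Pr P (A i))%:E)); last by move=> i _; exact: PrE.
rewrite sumEFin lee_fin.
have -> : n%:R * c = \sum_(i < n) c by rewrite sumr_const card_ord mulr_natl.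
by apply: ler_sum => i _; exact: hA.
Qed.

(** * Tail of a Gaussian variable from its characteristic function *)

Section GaussTail.
Context {R : realType} {d : measure_display} {T : measurableType d} (P : probability T R).
Variables (Z : T -> R) (V : R).
Hypotheses (mZ : measurable_fun setT Z) (V0 : 0 <= V)
  (hZ : forall a : R, Ex P (fun w => cos (a * Z w)) = expR (- (a ^+ 2 * V / 2))).

Let maZ (a : R) : measurable_fun setT (fun w => a * Z w).
Proof. exact: measurable_funM. Qed.

(** A bounded substitute for the fourth moment. The square expands into cosines at a and 2 a, and
    with y = exp(-x), x = a^2 V / 2, the expectation is (1 - y)^2 (y^2 + 2 y + 3) / 2, where 1 - y
    <= x. *)
Lemma gauss_one_sub_cos (a : R) : Ex P (fun w => (1 - cos (a * Z w)) ^+ 2) <= 3 * (a ^+ 2 * V / 2) ^+ 2.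
Proof.
have -> : (fun w => (1 - cos (a * Z w)) ^+ 2) =
    (fun w => (3 / 2 - 2 * cos (a * Z w)) + 2^-1 * cos (2 * a * Z w)).
  apply/funext => w; have -> : 2 * a * Z w = (a * Z w) + (a * Z w) by ring.
  rewrite cosD; have := cos2Dsin2 (a * Z w); move: (cos _) (sin _) => c s h.
  have -> : s * s = 1 - c ^+ 2 by rewrite -h; ring.
  by field.
have b1 := bmf_cos (maZ a); have b2 := bmf_cos (maZ (2 * a)).
rewrite ExD; [|by apply: bmfB; [exact: bmf_cst|exact: bmfZ]|exact: bmfZ].
rewrite ExB; [|exact: bmf_cst|exact: bmfZ].
rewrite Ex_cst !ExZ// !hZ.
have -> : - ((2 * a) ^+ 2 * V / 2) = 4%:R * - (a ^+ 2 * V / 2) by field.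
rewrite expRM_natl; set x := a ^+ 2 * V / 2.
have x0 : 0 <= x by rewrite divr_ge0// mulr_ge0// sqr_ge0.
have h1 : 1 - x <= expR (- x) by exact: expR_ge1Dx.
have h2 : expR (- x) <= 1 by rewrite -expR0 ler_expR oppr_le0.
have h3 := expR_gt0 (- x).
move: (expR (- x)) h1 h2 h3 => y h1 h2 h3.
have -> : 3 / 2 - 2 * y + 2^-1 * y ^+ 4 = (1 - y) ^+ 2 * ((y ^+ 2 + 2 * y + 3) / 2) by field.
have g1 : (1 - y) ^+ 2 <= x ^+ 2 by rewrite ler_sqr ?nnegrE//; lra.
have g2 : (y ^+ 2 + 2 * y + 3) / 2 <= 3 by nra.
rewrite [leRHS]mulrC; apply: ler_pM => //; first exact: sqr_ge0.
by have := sqr_ge0 y; lra.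
Qed.

(** Where e < |Z| <= A and a = 1 / (2 A), the angle a Z is at most 1/2 in modulus and 1 - cos(a Z)
    >= (a e)^2 / 4. The powers of a cancel in the Markov inequality, and the event |Z| > A costs an
    arbitrarily small eta. *)
Lemma gauss_tail (e : R) : 0 < e -> Pr P [set w | e < `|Z w|] <= 12 * V ^+ 2 / e ^+ 4.
Proof.
move=> e0; apply/ler_addgt0Pr => eta eta0.
have [A [A0 hA]] := tight_rv P mZ eta0.
have mE := measurable_norm_gt e mZ; have mA := measurable_norm_gt A mZ.
pose B := [set w | e < `|Z w|] `\` [set w | A < `|Z w|].
have mB : measurable B by exact: measurableD.
have h1 : Pr P [set w | e < `|Z w|] <= Pr P (B `|` [set w | A < `|Z w|]).
  apply: Pr_le => //; first exact: measurableU.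
  by move=> w Aw; have [h|h] := pselect (A < `|Z w|); [right|left].
apply: (le_trans h1); apply: le_trans (Pr_setU _ _ _) _ => //; apply: lerD => //.
have a0 : 0 < (2 * A)^-1 by rewrite invr_gt0 mulr_gt0.
move: (gauss_one_sub_cos (2 * A)^-1).
have aE : (2 * A)^-1 * A = 2^-1 by field; lra.
move: (2 * A)^-1 a0 aE => a a0 aE hh.
have bQ : bmf (fun w => (1 - cos (a * Z w)) ^+ 2).
  by apply: bmfX; apply: bmfB; [exact: bmf_cst|exact: bmf_cos].
have : Ex P (fun w => (a * e) ^+ 4 / 16 * \1_B w) <= Ex P (fun w => (1 - cos (a * Z w)) ^+ 2).
  apply: Ex_le => //; first exact/bmfZ/bmf_indic.
  move=> w; rewrite indicE; have [|] := boolP (w \in B); last by rewrite mulr0 sqr_ge0.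
  rewrite inE => -[/= ew /negP]; rewrite -leNgt => wA; rewrite mulr1.
  have g := cos_sub_le (a * Z w).
  have y1 : `|a * Z w| <= 2^-1 by rewrite normrM (gtr0_norm a0) -aE ler_pM2l.
  have y2 : a * e <= `|a * Z w| by rewrite normrM (gtr0_norm a0) ler_pM2l// ltW.
  have ae : 0 < a * e by exact: mulr_gt0.
  have -> : (a * e) ^+ 4 / 16 = ((a * e) ^+ 2 / 4) ^+ 2 by field.
  have g3 : (a * e) ^+ 2 / 4 <= 1 - cos (a * Z w).
    move: g; rewrite ler_norml => /andP[_].
    have -> : (a * Z w) ^+ 2 = `|a * Z w| ^+ 2 by rewrite real_normK// num_real.
    move: (cos (a * Z w)) (`|a * Z w|) y1 y2 => c y y1 y2 hc.
    have : y ^+ 4 / 2 <= y ^+ 2 / 8.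
      have -> : y ^+ 4 / 2 = y ^+ 2 * (y ^+ 2 / 2) by field.
      by apply: ler_wpM2l; [exact: sqr_ge0|nra].
    have : (a * e) ^+ 2 <= y ^+ 2 by rewrite ler_sqr ?nnegrE; lra.
    by nra.
  rewrite ler_sqr// nnegrE; last by apply: le_trans g3; rewrite divr_ge0// sqr_ge0.
  by rewrite divr_ge0// sqr_ge0.
rewrite ExZ; last exact: bmf_indic.
rewrite Ex_indic// => /le_trans/(_ hh).
have e4 : 0 < e ^+ 4 by rewrite exprn_gt0.
have a4 : 0 < a ^+ 4 by rewrite exprn_gt0.
rewrite ler_pdivlMr// exprMn => h.
rewrite -(ler_pM2l a4).
have -> : a ^+ 4 * (12 * V ^+ 2) = 16 * (3 * (a ^+ 2 * V / 2) ^+ 2) by field.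
have -> : a ^+ 4 * (Pr P B * e ^+ 4) = 16 * (a ^+ 4 * e ^+ 4 / 16 * Pr P B) by field.
by rewrite ler_pM2l.
Qed.

End GaussTail.

Lemma gauss_sum {R : realType} (P : probability R R) (xi : nat -> R -> R) (a : nat -> R) n (b : R) :
  (forall i, measurable_fun setT (xi i)) ->
  (forall n (B : nat -> set R), (forall i, measurable (B i)) ->
     Pr P [set w | forall i, (i < n)%N -> B i (xi i w)] = \prod_(i < n) Pr P (xi i @^-1` B i)) ->
  (forall i a b, Ex P (fun w => cos (a * xi i w + b)) = expR (- (a ^+ 2 / 2)) * cos b) ->
  Ex P (fun w => cos (\sum_(i < n) a i * xi i w + b)) = expR (- ((\sum_(i < n) a i ^+ 2) / 2)) * cos b.
Proof.
move=> mxi ixi cxi.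
pose phi i (x : R) := a i * x.
have mphi i : measurable_fun setT (phi i) by exact: measurable_funM.
have Ec i : Ex P (fun w => cos (phi i (xi i w))) = expR (- (a i ^+ 2 / 2)).
  by have := cxi i (a i) 0; rewrite cos0 mulr1 => <-; congr Ex; apply/funext => w; rewrite addr0.
have Es i : Ex P (fun w => sin (phi i (xi i w))) = 0.
  have := cxi i (a i) (- (pi / 2)); rewrite cosN cos_pihalf mulr0 => <-; congr Ex; apply/funext => w.
  by rewrite cosB cos_pihalf sin_pihalf mulr0 add0r mulr1.
have [h1 h2] : Ex P (fun w => cos (psum xi phi n w)) = expR (- ((\sum_(i < n) a i ^+ 2) / 2)) /\
    Ex P (fun w => sin (psum xi phi n w)) = 0.
  elim: n => [|n [IH1 IH2]].
    rewrite big_ord0 mul0r oppr0 expR0; split.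
      by rewrite -[RHS](Ex_cst P); congr Ex; apply/funext => w; rewrite /psum big_ord0 cos0.
    by rewrite -[RHS](Ex_cst P); congr Ex; apply/funext => w; rewrite /psum big_ord0 sin0.
  rewrite (Ex_cos_psumS mxi ixi mphi) (Ex_sin_psumS mxi ixi mphi) IH1 IH2 Ec Es !mul0r mulr0 addr0 subr0; split => //.
  by rewrite -expRD big_ord_recr/=; congr expR; ring.
have mp : measurable_fun setT (psum xi phi n).
  apply: measurable_sum => i.
  exact: measurableT_comp.
have -> : (fun w => cos (\sum_(i < n) a i * xi i w + b)) =
  (fun w => cos b * cos (psum xi phi n w) - sin b * sin (psum xi phi n w)).
  by apply/funext => w; rewrite cosD /psum /phi; ring.
have b1 := bmf_cos mp; have b2 := bmf_sin mp.
by rewrite ExB ?ExZ ?h1 ?h2 ?mulr0 ?subr0 1?mulrC//; exact: bmfZ.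
Qed.

Lemma cvg_sum_seq {R : realType} (I : eqType) (s : seq I) (F : nat -> I -> R) (L : I -> R) :
  (forall i, i \in s -> F n i @[n --> \oo] --> L i) ->
  \sum_(i <- s) F n i @[n --> \oo] --> \sum_(i <- s) L i.
Proof.
elim: s => [|i s IH] h.
  by rewrite big_nil; under eq_fun do rewrite big_nil; exact: cvg_cst.
rewrite big_cons; under eq_fun do rewrite big_cons.
apply: cvgD; first by apply: h; rewrite inE eqxx.
by apply: IH => k ks; apply: h; rewrite inE ks orbT.
Qed.

Lemma cvg0_dominated_sqr {R : realType} (u v : nat -> R) :
  (forall n, u n ^+ 2 <= v n) -> v n @[n --> \oo] --> 0 -> u n @[n --> \oo] --> 0.
Proof.
move=> uv v0; apply/cvgr0Pnorm_lt => e e0.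
have /cvgr0Pnorm_lt/(_ _ (exprn_gt0 2 e0)) := v0.
apply: filterS => n h; rewrite -(@ltr_pXn2r _ 2)// ?nnegrE ?(ltW e0)//.
rewrite real_normK ?num_real// (le_lt_trans (uv n))//.
exact: le_lt_trans (ler_norm _) h.
Qed.

Lemma borel_cantelli_geometric {R : realType} {d : measure_display} {T : measurableType d}
    (P : probability T R) (F : nat -> set T) (a rho : R) : 0 <= a -> 0 < rho < 1 ->
  (forall n, measurable (F n)) -> (forall n, Pr P (F n) <= a * rho ^+ n) -> P (lim_sup_set F) = 0%E.
Proof.
move=> a0 /andP[r0 r1] mF hF; apply: lim_sup_set_cvg0 => //.
apply: (@le_lt_trans _ _ (a / (1 - rho))%:E); last exact: ltry.
apply: lime_le; first by apply: is_cvg_nneseries => n _ _.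
apply: nearW => n.
rewrite (@le_trans _ _ (\sum_(0 <= i < n) (a * rho ^+ i)%:E)%E)//.
  by apply: lee_sum => i _; have := hF i; rewrite -lee_fin -(PrE P (mF i)).
rewrite sumEFin lee_fin.
have := @geometric_le_lim R n a rho a0 r0; rewrite (ger0_norm (ltW r0)) => /(_ r1).
by rewrite /series/=.
Qed.

Section GaussianProcess.
Context {R : realType}.
Variables (C : R -> R -> R) (c0 : R).
Hypotheses (symC : forall a b, C a b = C b a) (pC : nonneg_def C) (c00 : 0 <= c0)
  (C0 : forall t, C 0 t = 0)
  (hC : forall s t : R, 0 <= s -> s <= t -> C s s + C t t - 2 * C s t <= c0 * (t - s)).

Lemma cov_diag_le (t : R) : 0 <= t -> C t t <= c0 * t.
Proof. by move=> t0; have := hC (lexx 0) t0; rewrite !C0 mulr0 subr0 add0r subr0. Qed.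

(** Cauchy-Schwarz inequality for the form C, between the unit mass at t and the increment from s to
    s'. The discriminant argument treats C t t = 0 apart. *)
Lemma cov_cont1 (s s' t : R) : 0 <= s -> s <= s' -> 0 <= t ->
  (C s' t - C s t) ^+ 2 <= (c0 * t) * (c0 * (s' - s)).
Proof.
move=> s0 ss t0; have s'0 := le_trans s0 ss.
have Ct := nonneg_diag pC t0.
have ts : times_in (fun t => 0 <= t) [:: (s', 1); (s, -1 : R)].
  by move=> p; rewrite !inE => /orP[] /eqP ->.
have Q : quad C [:: (s', 1); (s, -1)] = C s s + C s' s' - 2 * C s s'.
  by rewrite quad_cons// /quad /lfun !big_seq1/= (symC s'); ring.
have := hC s0 ss; rewrite -Q => hV.
have V0 := pC ts.
have L : lfun [:: (s', 1); (s, -1)] (C t) = C s' t - C s t.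
  by rewrite /lfun !big_cons big_nil/= !(symC t); ring.
have H l : 0 <= l ^+ 2 * C t t + 2 * l * (C s' t - C s t) + quad C [:: (s', 1); (s, -1)].
  rewrite -L -quad_cons//; apply: pC => p; rewrite inE => /orP[/eqP ->//|]; exact: ts.
have : (C s' t - C s t) ^+ 2 <= C t t * quad C [:: (s', 1); (s, -1)].
  move: V0 H; move: (quad C _) (C s' t - C s t) => V x V0 H.
  have [C00|Cn] := eqVneq (C t t) 0.
    have [->|x0] := eqVneq x 0; first by rewrite expr0n C00 mul0r.
    have := H (- ((V + 1) / (2 * x))); rewrite C00 mulr0 add0r.
    have -> : 2 * - ((V + 1) / (2 * x)) * x + V = -1 by field.
    lra.
  have Cp : 0 < C t t by rewrite lt_neqAle eq_sym Cn.
  have := H (- (x / C t t)).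
  have -> : (- (x / C t t)) ^+ 2 * C t t + 2 * - (x / C t t) * x + V = (C t t * V - x ^+ 2) / C t t by field.
  by rewrite pmulr_lge0 ?invr_gt0// subr_ge0.
move=> /le_trans; apply; apply: ler_pM => //; exact: cov_diag_le.
Qed.

Lemma cvg_half_pow (B : R) : B * 2 ^- m @[m --> \oo] --> 0.
Proof.
rewrite -(mulr0 B); apply: cvgMr; under eq_fun do rewrite -exprVn.
by apply: cvg_expr; rewrite ger0_norm ?invf_lt1 ?invr_ge0 ?ltr1n.
Qed.

Lemma cov_cvg (s t : R) : 0 <= s -> 0 <= t -> C (pim m s) (pim m t) @[m --> \oo] --> C s t.
Proof.
move=> s0 t0.
have step (u v : nat -> R) (a b : R) : (forall m, 0 <= v m <= b) -> 0 <= b -> 0 <= a ->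
    (forall m, 0 <= u m) -> (forall m, u m <= a <= u m + 2 ^- m) ->
    C a (v m) - C (u m) (v m) @[m --> \oo] --> 0.
  move=> hv b0 a0 u0 hu.
  apply: (@cvg0_dominated_sqr _ _ (fun m => (c0 * b * c0) * 2 ^- m)); last exact: cvg_half_pow.
  move=> m; have /andP[h1 h2] := hu m; have /andP[v0 vb] := hv m.
  apply: (le_trans (cov_cont1 (u0 m) h1 v0)).
  have -> : c0 * b * c0 * 2 ^- m = (c0 * b) * (c0 * 2 ^- m) by ring.
  apply: ler_pM; rewrite ?mulr_ge0// ?subr_ge0//.
    exact: ler_wpM2l.
  by apply: ler_wpM2l => //; lra.
have pimP (x : R) m : 0 <= x -> 0 <= pim m x /\ (pim m x <= x <= pim m x + 2 ^- m).
  by move=> x0; split; [exact: pim_ge0|have /andP[-> /ltW ->] := pim_itv m x0].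
have c1 := step (pim ^~ s) (pim ^~ t) s t.
have c2 := step (pim ^~ t) (fun=> s) t s.
have {}c1 : C s (pim m t) - C (pim m s) (pim m t) @[m --> \oo] --> 0.
  apply: c1 => // m; [|exact: pim_ge0|by have [] := pimP s m s0].
  by have [-> /andP[-> _]] := pimP t m t0.
have {}c2 : C t s - C (pim m t) s @[m --> \oo] --> 0.
  apply: c2 => // m; [by rewrite s0 lexx|exact: pim_ge0|by have [] := pimP t m t0].
have -> : (fun m => C (pim m s) (pim m t)) =
   (fun m => C s t - ((C t s - C (pim m t) s) + (C s (pim m t) - C (pim m s) (pim m t)))).
  by apply/funext => m; rewrite !(symC _ s); ring.
rewrite -[X in _ --> X]subr0; apply: cvgB; first exact: cvg_cst.
by rewrite -[X in _ --> X]addr0; exact: cvgD.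
Qed.

(** The factorization runs along a sequence of times; this one enumerates all dyadic numbers, with
    repetitions. *)
Definition dyq (n : nat) : R := if unpickle n is Some km then (km : nat * nat).1%:R / 2 ^+ km.2 else 0.

Lemma dyq_ge0 n : 0 <= dyq n.
Proof. by rewrite /dyq; case: unpickle => // km; rewrite divr_ge0// exprn_ge0. Qed.

Lemma dyqE k m : dyq (pickle (k, m)) = k%:R / 2 ^+ m.
Proof. by rewrite /dyq pickleK. Qed.

Variables (P : probability R R) (xi : nat -> R -> R).
Hypotheses (mxi : forall i, measurable_fun setT (xi i))
  (ixi : forall n (B : nat -> set R), (forall i, measurable (B i)) ->
     Pr P [set w | forall i, (i < n)%N -> B i (xi i w)] = \prod_(i < n) Pr P (xi i @^-1` B i))
  (cxi : forall i a b, Ex P (fun w => cos (a * xi i w + b)) = expR (- (a ^+ 2 / 2)) * cos b).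

Let L := chol C dyq.

(** At a time [dyq i] the series is a finite sum because the Cholesky factor is triangular. Only
    these values are used. *)
Definition dyproc (w s : R) : R := limn (fun n => \sum_(j < n) L j s * xi j w).

Lemma dyproc_sum n i w : (i < n)%N -> dyproc w (dyq i) = \sum_(j < n) L j (dyq i) * xi j w.
Proof.
move=> ni; apply: (cvg_lim (@Rhausdorff R)); apply: cvg_near_cst; near=> p.
have np : (n <= p)%N by near: p; exact: nbhs_infty_ge.
rewrite -(subnKC np) big_split_ord/= [X in _ + X]big1 ?addr0// => j _.
rewrite /L (chol0 symC pC dyq_ge0 ni) ?mul0r//=; exact: leq_addr.
Unshelve. all: by end_near. Qed.

Definition isdy (s : R) := exists i, s = dyq i.

Lemma isdy_dyadic k m : isdy (k%:R / 2 ^+ m).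
Proof. by exists (pickle (k, m)); rewrite dyqE. Qed.

Lemma isdy_pim m t : isdy (pim m t).
Proof. exact: isdy_dyadic. Qed.

Lemma isdy_bound (s : seq (R * R)) : times_in isdy s ->
  exists n, forall p, p \in s -> exists2 i, (i < n)%N & p.1 = dyq i.
Proof.
elim: s => [|p s IH] hs; first by exists 0%N.
have [|n hn] := IH; first by move=> r rs; apply: hs; rewrite inE rs orbT.
have [i pi] := hs p (mem_head _ _).
exists (maxn n i.+1) => r; rewrite inE => /orP[/eqP ->|/hn[k kn rk]].
  by exists i => //; rewrite leq_max ltnSn orbT.
by exists k => //; rewrite leq_max kn.
Qed.

Lemma dyproc_char s b : times_in isdy s ->
  Ex P (fun w => cos (lfun s (dyproc w) + b)) = expR (- (quad C s / 2)) * cos b.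
Proof.
move=> hs; have [n hn] := isdy_bound hs.
rewrite (quad_chol symC pC dyq_ge0 hn) -(gauss_sum (fun j => lfun s (L j)) n b mxi ixi cxi).
congr Ex; apply/funext => w; congr (cos (_ + _)).
rewrite /lfun; under [RHS]eq_bigr do rewrite mulr_suml.
rewrite exchange_big/= big_seq [RHS]big_seq; apply: eq_bigr => p ps.
have [i ni ->] := hn p ps; rewrite (dyproc_sum w ni) mulr_sumr; apply: eq_bigr => j _.
by rewrite mulrA.
Qed.

Lemma dyproc_measurable (s : R) : isdy s -> measurable_fun setT (fun w => dyproc w s).
Proof.
move=> [i ->]; under eq_fun do rewrite (dyproc_sum _ (ltnSn i)).
by apply: measurable_sum => j; exact: measurable_funM.
Qed.

Let inc m k w := dyproc w (k.+1%:R / 2 ^+ m) - dyproc w (k%:R / 2 ^+ m).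

Let inc_measurable m k : measurable_fun setT (inc m k).
Proof. by apply: measurable_funB; apply: dyproc_measurable; exact: isdy_dyadic. Qed.

Let inc_tail m k (e : R) : 0 < e -> Pr P [set w | e < `|inc m k w|] <= 12 * (c0 * 2 ^- m) ^+ 2 / e ^+ 4.
Proof.
move=> e0; pose s : seq (R * R) := [:: (k.+1%:R / 2 ^+ m, 1); (k%:R / 2 ^+ m, -1)].
have k0 : 0 <= k%:R / 2 ^+ m :> R by rewrite divr_ge0// exprn_ge0.
have kE : k.+1%:R / 2 ^+ m - k%:R / 2 ^+ m = 2 ^- m :> R by rewrite -natr1 mulrDl mul1r addrAC subrr add0r.
have p0 : 0 <= 2 ^- m :> R by rewrite invr_ge0 exprn_ge0.
have kk : k%:R / 2 ^+ m <= k.+1%:R / 2 ^+ m :> R by lra.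
have ts : times_in (fun t => 0 <= t) s.
  by move=> p; rewrite !inE => /orP[] /eqP -> //=; exact: le_trans kk.
have V0 := pC ts.
have hV : quad C s <= c0 * 2 ^- m.
  rewrite -kE; apply: le_trans (hC k0 kk).
  by rewrite quad_cons// /quad /lfun !big_seq1/= (symC (k.+1%:R / _)); lra.
have h := @gauss_tail _ _ _ P (inc m k) (quad C s) (inc_measurable m k) V0.
apply: le_trans (h _ e e0) _.
  move=> a; pose s' : seq (R * R) := [seq (p.1, a * p.2) | p <- s].
  have := @dyproc_char s' 0; rewrite cos0 mulr1 (_ : quad C s' = a ^+ 2 * quad C s); last first.
    rewrite /quad big_map mulr_sumr; apply: eq_bigr => p _.
    by rewrite big_map mulr_sumr; apply: eq_bigr => r _ /=; ring.
  move=> <-; last by move=> p /mapP[r]; rewrite !inE => /orP[] /eqP -> -> /=; exact: isdy_dyadic.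
  congr Ex; apply/funext => w; congr cos.
  by rewrite /lfun !big_cons big_nil/= /inc; ring.
rewrite ler_pM2r ?invr_gt0 ?exprn_gt0// ler_pM2l// ler_sqr// nnegrE//.
by rewrite mulr_ge0.
Qed.

Let bad j m := [set w | exists2 k, (k < j * 2 ^ m.+1)%N & (9 / 10) ^+ m < `|inc m.+1 k w|].

(** Union over j 2^(m+1) increments, each with tail at most 12 (c0 2^-(m+1))^2 / (9/10)^(4m). The
    ratio is 1 / (2 (9/10)^4) = 10000 / 13122 < 1, so the events are summable. *)
Let badP j m : measurable (bad j m) /\ Pr P (bad j m) <= (6 * c0 ^+ 2 * j%:R) * (10000 / 13122) ^+ m.
Proof.
have r0 : 0 < (9 / 10) ^+ m :> R by rewrite exprn_gt0.
have [mB hB] := @Pr_union _ _ _ P (fun k => [set w | (9 / 10) ^+ m < `|inc m.+1 k w|]) (j * 2 ^ m.+1)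
  _ (fun k => measurable_norm_gt _ (inc_measurable m.+1 k)) (fun k _ => inc_tail m.+1 k r0).
split => //; apply: (le_trans hB).
rewrite le_eqVlt; apply/orP; left; apply/eqP.
have -> : (10000 / 13122) ^+ m = (2 ^- m) * ((9 / 10) ^+ m) ^- 4 :> R.
  have -> : 10000 / 13122 = 2^-1 * (9 / 10) ^- 4 :> R by field.
  by rewrite exprMn !exprVn -!exprM mulnC.
have p0 : 2 ^+ m != 0 :> R by rewrite expf_neq0.
move: r0; move: ((9 / 10) ^+ m) => r r0; rewrite natrM natrX exprS.
by move: (2 ^+ m) p0 => x p0; field; rewrite p0 lt0r_neq0.
Qed.

Let Nset := \bigcup_j lim_sup_set (bad j).

Let mNset : measurable Nset.
Proof.
apply: bigcup_measurable => j _; apply: bigcap_measurable => // n _.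
by apply: bigcup_measurable => m _; have [] := badP j m.
Qed.

Let PNset : P Nset = 0%E.
Proof.
apply/(negligibleP _ mNset)/negligible_bigcup => j.
apply/negligibleP.
  apply: bigcap_measurable => // n _.
  by apply: bigcup_measurable => m _; have [] := badP j m.
apply: (@borel_cantelli_geometric _ _ _ _ _ (6 * c0 ^+ 2 * j%:R) (10000 / 13122)).
- by rewrite !mulr_ge0// sqr_ge0.
- lra.
- by move=> n; have [] := badP j n.
- by move=> n; have [] := badP j n.
Qed.

Let goodP w : ~ Nset w -> forall j, exists m0, forall m i, (m0 <= m)%N ->
  forall t, 0 <= t <= j%:R -> `|dyproc w (pim (m + i) t) - dyproc w (pim m t)| <= 10 * (9 / 10) ^+ m.
Proof.
move=> nN j.
have [m0 hm0] : exists m0, forall m, (m0 <= m)%N -> ~ bad j m w.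
  apply: contra_notP nN => /forallNP h; exists j => // n _.
  by have /existsNP[m /not_implyP[nm /contrapT hb]] := h n; exists m.
exists m0 => m i mm t tj.
apply: (@le_trans _ _ (10 * 1 * ((9 / 10) ^+ m - (9 / 10) ^+ (m + i)))).
  apply: (@pim_chain _ m j i (dyproc w) 1) => // p k /andP[mp _] kj.
  rewrite mul1r leNgt; apply/negP => hh.
  by apply: (hm0 p); [exact: leq_trans mp|exists k].
have : 0 <= (9 / 10) ^+ (m + i) :> R by rewrite exprn_ge0.
by lra.
Qed.

(** The value 0 on the null set makes every path cadlag, as the definition of the process
    requires. *)
Definition gproc (w t : R) : R := if w \in Nset then 0 else limn (fun m => dyproc w (pim m t)).

Let gproc_good w : ~ Nset w -> forall j, exists m0, forall m, (m0 <= m)%N ->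
  forall t, 0 <= t <= j%:R -> dyproc w (pim p t) @[p --> \oo] --> gproc w t /\
    `|gproc w t - dyproc w (pim m t)| <= 10 * (9 / 10) ^+ m.
Proof.
move=> nN j; have [m0 hm0] := goodP nN j; exists m0 => m mm t tj.
have r0 : 10 * (9 / 10) ^+ m @[m --> \oo] --> (0 : R).
  by rewrite -(mulr0 10); apply: cvgMr; apply: cvg_expr; rewrite ger0_norm; lra.
have cv : cvgn (fun p => dyproc w (pim p t)).
  apply: cauchy_cvg; apply: cauchy_exP => e e0.
  have /cvgr0Pnorm_lt/(_ _ e0)[m1 _ hm1] := r0.
  exists (dyproc w (pim (maxn m0 m1) t)); exists (maxn m0 m1) => // p /= hp.
  rewrite -ball_normE/= distrC -(subnKC hp) (le_lt_trans (hm0 _ _ _ _ tj)) ?leq_maxl//.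
  by apply: le_lt_trans (ler_norm _) (hm1 _ _); rewrite /= leq_maxr.
have gE : gproc w t = limn (fun m => dyproc w (pim m t)).
  by rewrite /gproc; case: ifP => //; rewrite inE.
have cg : dyproc w (pim p t) @[p --> \oo] --> gproc w t by rewrite gE.
split => //.
have cn : `|dyproc w (pim p t) - dyproc w (pim m t)| @[p --> \oo] --> `|gproc w t - dyproc w (pim m t)|.
  by apply: cvg_norm; apply: cvgB => //; exact: cvg_cst.
rewrite -(cvg_lim (@Rhausdorff R) cn); apply: limr_le; first by apply/cvg_ex; eexists; exact: cn.
exists m => // p /= mp; rewrite -(subnKC mp); exact: hm0.
Qed.

(** The indicator makes the convergence hold for every w, hence the measurability of the limit. *)
Lemma gproc_cvg w t : 0 <= t -> \1_(~` Nset) w * dyproc w (pim m t) @[m --> \oo] --> gproc w t.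
Proof.
move=> t0; rewrite indicE; have [Nw|nNw] := pselect (Nset w).
  have -> : (w \in ~` Nset) = false by apply/negbTE/negP; rewrite inE => /(_ Nw).
  rewrite /gproc mem_set//; under eq_fun do rewrite mul0r; exact: cvg_cst.
rewrite mem_set//=; under eq_fun do rewrite mul1r.
have /andP[_ h4] := truncn_itv t0.
have [m0 /(_ _ (leqnn _) t)[]] := gproc_good nNw (Num.truncn t).+1; last by [].
by rewrite t0 ltW.
Qed.

Lemma gproc_measurable (t : R) : 0 <= t -> measurable_fun setT (fun w => gproc w t).
Proof.
move=> t0; apply: (@measurable_fun_cvg _ _ _ _ (fun m w => \1_(~` Nset) w * dyproc w (pim m t))).
  move=> m; apply: measurable_funM; last by apply: dyproc_measurable; exact: isdy_pim.
  exact/measurable_indic/measurableC.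
by move=> w _; exact: gproc_cvg.
Qed.

Lemma gproc_pim w (j : nat) (dl : R) : 0 < dl -> exists m0, forall m, (m0 <= m)%N ->
  forall t, 0 <= t <= j%:R -> `|gproc w t - gproc w (pim m t)| <= dl.
Proof.
move=> dl0; have [Nw|nNw] := pselect (Nset w).
  by exists 0%N => m _ t _; rewrite /gproc mem_set// subrr normr0 ltW.
have [m0 hm0] := gproc_good nNw j.
have r0 : 10 * (9 / 10) ^+ m @[m --> \oo] --> (0 : R).
  by rewrite -(mulr0 10); apply: cvgMr; apply: cvg_expr; rewrite ger0_norm; lra.
have /cvgr0Pnorm_lt/(_ _ dl0)[m1 _ hm1] := r0.
exists (maxn m0 m1) => m; rewrite geq_max => /andP[mm0 mm1] t tj.
have [_ h] := hm0 m mm0 t tj.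
have -> : gproc w (pim m t) = dyproc w (pim m t).
  rewrite /gproc; case: ifP => [|_]; first by rewrite inE.
  apply: (cvg_lim (@Rhausdorff R)); apply: cvg_near_cst; exists m => // p /= mp.
  by rewrite pim_dyadic.
by apply: (le_trans h); apply: ltW; apply: le_lt_trans (ler_norm _) (hm1 m mm1).
Qed.

Lemma gproc_cadlag w : cadlag (gproc w).
Proof.
by apply: cadlag_pim => j dl dl0; have [m0 h] := gproc_pim w j dl0; exists m0; exact: h.
Qed.

(** Passage to the limit from times rounded to the grid: dominated convergence on the left,
    continuity of the covariance ([cov_cvg]) on the right. *)
Lemma gproc_char s b : times_in (fun t => 0 <= t) s ->
  Ex P (fun w => cos (lfun s (gproc w) + b)) = expR (- (quad C s / 2)) * cos b.
Proof.
move=> hs; pose s_ m : seq (R * R) := [seq (pim m p.1, p.2) | p <- s].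
have ts m : times_in isdy (s_ m) by move=> p /mapP[r _ ->] /=; exact: isdy_pim.
have e m w : lfun (s_ m) (dyproc w) = \sum_(p <- s) p.2 * dyproc w (pim m p.1) by rewrite /lfun big_map.
have ms m : measurable_fun setT (fun w => lfun (s_ m) (dyproc w)).
  under eq_fun do rewrite e; apply: measurable_sum => p; apply: measurable_funM => //.
  by apply: dyproc_measurable; exact: isdy_pim.
have c1 : Ex P (fun w => cos (lfun (s_ m) (dyproc w) + b)) @[m --> \oo] -->
    Ex P (fun w => cos (lfun s (gproc w) + b)).
  apply: (@Ex_dct _ _ _ _ _ _ 1).
  - by move=> m; apply: (bmf_cos _).1; apply: measurable_funD.
  - by apply: (bmf_cos _).1; apply: measurable_funD => //; apply: lfun_measurable => //; exact: gproc_measurable.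
  - by move=> m w; rewrite ler_norml cos_geN1 cos_le1.
  - exists Nset; split => // w /= h; apply: contrapT => nN; apply: h.
    apply: continuous_cvg; first exact: continuous_cos.
    apply: cvgD; last exact: cvg_cst.
    under eq_fun do rewrite e; apply: cvg_sum_seq => p ps; apply: cvgMr.
    have := @gproc_cvg w _ (hs p ps); rewrite indicE mem_set//=.
    by under eq_fun do rewrite mul1r.
have c2 : expR (- (quad C (s_ m) / 2)) * cos b @[m --> \oo] --> expR (- (quad C s / 2)) * cos b.
  apply: cvgMl; apply: continuous_cvg; first exact: continuous_expR.
  apply: cvgN; apply: cvgMl; rewrite /quad; under eq_fun do rewrite big_map.
  apply: cvg_sum_seq => p ps; under eq_fun do rewrite big_map.
  apply: (@cvg_sum_seq _ _ _ (fun m r => p.2 * r.2 * C (pim m p.1) (pim m r.1))) => r rs.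
  apply: cvgMr; apply: cov_cvg; exact: hs.
rewrite -(cvg_lim (@Rhausdorff R) c2) -(cvg_lim (@Rhausdorff R) c1).
by f_equal; f_equal; apply/funext => m; rewrite dyproc_char.
Qed.

End GaussianProcess.

Theorem exists_gaussian_process {R : realType} (C : R -> R -> R) (c0 : R) :
  (forall a b, C a b = C b a) -> nonneg_def C -> 0 <= c0 -> (forall t, C 0 t = 0) ->
  (forall s t : R, 0 <= s -> s <= t -> C s s + C t t - 2 * C s t <= c0 * (t - s)) ->
  exists (P : probability R R) (G : R -> R -> R),
  [/\ forall t, 0 <= t -> measurable_fun setT (fun w => G w t),
      forall w, cadlag (G w),
      (forall w (j : nat) (dl : R), 0 < dl -> exists m0, forall m, (m0 <= m)%N ->
         forall t, 0 <= t <= j%:R -> `|G w t - G w (pim m t)| <= dl) &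
      forall s b, times_in (fun t => 0 <= t) s ->
        Ex P (fun w => cos (lfun s (G w) + b)) = expR (- (quad C s / 2)) * cos b].
Proof.
move=> symC pC c00 C0 hC; have [P [xi [mxi ixi cxi]]] := @exists_iid_normals R.
have mG := @gproc_measurable _ C c0 symC pC c00 hC P xi mxi ixi cxi.
exists P, (gproc C xi); split => //.
- exact: gproc_cadlag.
- exact: gproc_pim.
- exact: (gproc_char symC pC c00 C0 hC mxi ixi cxi).
Qed.

Lemma exists_normal_char {R : realType} (s : R) : 0 < s -> exists nu : probability R R,
  (forall V : set R, measurable V -> nu V = normal_prob 0 s V) /\
  forall a b, Ex nu (fun x => cos (a * x + b)) = expR (- (a ^+ 2 * s ^+ 2 / 2)) * cos b.
Proof.
move=> s0; have [nu nuE] := exists_normal s; exists nu; split => // a b.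
rewrite -(normal_char s0 a b); apply/eqP; rewrite -subr_eq0; apply/eqP.
pose F (f : R -> R) := Ex nu f - Ex (normal_prob 0 s) f.
apply: (@functional_zero _ _ _ F 2) => //.
- by move=> f g bf bg; rewrite /F !ExD//; ring.
- by move=> c f bf; rewrite /F !ExZ//; ring.
- move=> f M bf fM; rewrite /F mulr_natl mulr2n (le_trans (ler_normB _ _))// lerD//; exact: Ex_norm_le.
- by move=> B mB; rewrite /F !Ex_indic// /Pr nuE// subrr.
- by apply: bmf_cos; apply: measurable_funD => //; exact: measurable_funM.
Qed.

(** * Moments and laws read off the characteristic function *)

Section SecondMoment.
Context {R : realType} {d : measure_display} {T : measurableType d} (P : probability T R).
Variables (Y : T -> R) (V : R).
Hypotheses (mY : measurable_fun setT Y) (V0 : 0 <= V)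
  (hY : forall a : R, Ex P (fun w => cos (a * Y w)) = expR (- (a ^+ 2 * V / 2))).

Let a n : R := 2 ^- n.
(** Bounded functions increasing to the square of Y as the frequency 2^-n decreases. Monotone
    convergence then yields the second moment from the characteristic function, with no
    integrability of Y assumed beforehand. *)
Let f n w := 2 / a n ^+ 2 * (1 - cos (a n * Y w)).

Let a0 n : 0 < a n. Proof. by rewrite invr_gt0 exprn_gt0. Qed.

Let a_cvg (B : R) : B * a n ^+ 2 @[n --> \oo] --> 0.
Proof.
rewrite -(mulr0 B); apply: cvgMr.
have -> : (fun n => a n ^+ 2) = (fun n => 4^-1 ^+ n :> R).
  by apply/funext => n; rewrite /a -exprVn -exprM mulnC exprM; congr (_ ^+ _); field.
by apply: cvg_expr; rewrite ger0_norm ?invr_ge0//; lra.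
Qed.

(** Monotonicity is the double-angle formula: 1 - cos 2x = 2 (1 - cos x)(1 + cos x) <= 4 (1 - cos
    x). *)
Let f_nd w n : f n w <= f n.+1 w.
Proof.
have E : a n = 2 * a n.+1 by rewrite /a exprS; field; exact: expf_neq0.
rewrite /f E; move: (a n.+1) (a0 n.+1) => b b0.
have -> : 2 * b * Y w = (b * Y w) + (b * Y w) by ring.
rewrite cosD; have := cos2Dsin2 (b * Y w); have := cos_le1 (b * Y w); have := cos_geN1 (b * Y w).
move: (cos _) (sin _) => c s c1 c2 h.
have -> : s * s = 1 - c ^+ 2 by rewrite -h; ring.
have -> : 2 / (2 * b) ^+ 2 * (1 - (c * c - (1 - c ^+ 2))) = b ^- 2 * (1 - c) * (1 + c) by field; lra.
have -> : 2 / b ^+ 2 * (1 - c) = b ^- 2 * (1 - c) * 2 by ring.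
by apply: ler_wpM2l; [rewrite mulr_ge0 ?invr_ge0 ?sqr_ge0//|]; lra.
Qed.

Let f_cvg w : f n w @[n --> \oo] --> Y w ^+ 2.
Proof.
apply/cvgrPdist_le => e e0.
have /cvgr0Pnorm_lt/(_ _ e0) := a_cvg (Y w ^+ 4).
apply: filterS => n /ltW; rewrite ger0_norm; last by rewrite mulr_ge0 ?sqr_ge0// exprn_even_ge0.
apply: le_trans; have := cos_sub_le (a n * Y w); have := a0 n.
rewrite /f; move: (a n) => b b0 h.
have b2 : 0 < b ^+ 2 by rewrite exprn_gt0.
have -> : Y w ^+ 2 - 2 / b ^+ 2 * (1 - cos (b * Y w)) =
  (2 / b ^+ 2) * (cos (b * Y w) - 1 + (b * Y w) ^+ 2 / 2) by field; lra.
rewrite normrM ger0_norm; last by rewrite divr_ge0// ltW.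
have -> : Y w ^+ 4 * b ^+ 2 = (2 / b ^+ 2) * (`|b * Y w| ^+ 4 / 2).
  rewrite normrM exprMn (gtr0_norm b0) -normrX (ger0_norm (_ : 0 <= Y w ^+ 4)) ?exprn_even_ge0//.
  by field; lra.
by rewrite ler_wpM2l// divr_ge0// ltW.
Qed.

Let f_int n : Ex P (f n) = 2 / a n ^+ 2 * (1 - expR (- (a n ^+ 2 * V / 2))).
Proof.
have b1 : bmf (fun w => cos (a n * Y w)) by apply: bmf_cos; exact: measurable_funM.
rewrite /f ExZ; last by apply: bmfB => //; exact: bmf_cst.
by rewrite ExB// ?Ex_cst ?hY//; exact: bmf_cst.
Qed.

Let f_bmf n : bmf (f n).
Proof.
by apply: bmfZ; apply: bmfB; [exact: bmf_cst|apply: bmf_cos; exact: measurable_funM].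
Qed.

Let Exf_cvg : Ex P (f n) @[n --> \oo] --> V.
Proof.
apply/cvgrPdist_le => e e0.
have /cvgr0Pnorm_lt/(_ _ e0) := a_cvg (V ^+ 2 / 2).
apply: filterS => n /ltW; rewrite ger0_norm; last by rewrite mulr_ge0 ?sqr_ge0// divr_ge0// sqr_ge0.
apply: le_trans; rewrite f_int; have := a0 n; move: (a n) => b b0.
have b2 : 0 < b ^+ 2 by rewrite exprn_gt0.
have x0 : 0 <= b ^+ 2 * V / 2 by rewrite divr_ge0// mulr_ge0// ltW.
have h := expR_quad x0.
have -> : V - 2 / b ^+ 2 * (1 - expR (- (b ^+ 2 * V / 2))) =
  - (2 / b ^+ 2) * (1 - (b ^+ 2 * V / 2) - expR (- (b ^+ 2 * V / 2))) by field; lra.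
have b3 : 0 <= 2 / b ^+ 2 by rewrite divr_ge0// ltW.
rewrite normrM normrN (ger0_norm b3).
have -> : V ^+ 2 / 2 * b ^+ 2 = (2 / b ^+ 2) * (b ^+ 2 * V / 2) ^+ 2 by field; lra.
by rewrite ler_wpM2l// divr_ge0// ltW.
Qed.

Lemma gauss_second_moment : (\int[P]_w (Y w ^+ 2)%:E)%E = V%:E.
Proof.
have m n : measurable_fun setT (EFin \o f n) by exact/measurable_EFinP/(f_bmf n).1.
have h := @cvg_monotone_convergence _ _ _ P setT measurableT (fun n w => (f n w)%:E) m.
have hh : (\int[P]_w (f n w)%:E)%E @[n --> \oo] --> (\int[P]_w (Y w ^+ 2)%:E)%E.
  have -> : (fun w => (Y w ^+ 2)%:E) = (fun w => limn (fun n => (f n w)%:E)).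
    apply/funext => w; apply/esym; apply: (cvg_lim (@ereal_hausdorff R)).
    by apply: cvg_EFin; [exact: nearW|exact: f_cvg].
  apply: h.
    move=> n w _; rewrite lee_fin; apply: mulr_ge0; last by rewrite subr_ge0 cos_le1.
    by rewrite divr_ge0// sqr_ge0.
  move=> w _ p q pq; rewrite lee_fin.
  exact: (@homo_leq _ (fun n => f n w) <=%R (@lexx _ _) (@le_trans _ _) (f_nd w)).
have h2 : (\int[P]_w (f n w)%:E)%E @[n --> \oo] --> V%:E.
  under eq_fun do rewrite ExE//.
  by apply: cvg_EFin; [exact: nearW|exact: Exf_cvg].
exact: (cvg_unique (@ereal_hausdorff R) hh h2).
Qed.

End SecondMoment.

Section GaussianSpec.
Context {R : realType} {d : measure_display} {T : measurableType d} (P : probability T R).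
Variables (G : T -> R -> R) (C : R -> R -> R).
Hypotheses (symC : forall a b, C a b = C b a) (pC : nonneg_def C)
  (mG : forall t, 0 <= t -> measurable_fun setT (fun w => G w t))
  (cG : forall w, cadlag (G w))
  (hG : forall s b, times_in (fun t => 0 <= t) s ->
        Ex P (fun w => cos (lfun s (G w) + b)) = expR (- (quad C s / 2)) * cos b).

Let scale_char s (a b : R) : times_in (fun t => 0 <= t) s ->
  Ex P (fun w => cos (a * lfun s (G w) + b)) = expR (- (a ^+ 2 * quad C s / 2)) * cos b.
Proof.
move=> ts; have h : times_in (fun t => 0 <= t) [seq (p.1, a * p.2) | p <- s].
  by move=> p /mapP[r rs ->] /=; exact: ts.
have -> : a ^+ 2 * quad C s = quad C [seq (p.1, a * p.2) | p <- s].
  rewrite /quad big_map mulr_sumr; apply: eq_bigr => p _.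
  by rewrite big_map mulr_sumr; apply: eq_bigr => r _ /=; ring.
rewrite -hG//; congr Ex; apply/funext => w; congr (cos (_ + _)).
by rewrite /lfun big_map mulr_sumr; apply: eq_bigr => p _ /=; ring.
Qed.

Lemma gaussian_process_spec : centred_gaussian_process P G.
Proof.
split => //; split => // s ts.
have Q0 := pC ts; exists (Num.sqrt (quad C s)); split; first exact: sqrtr_ge0.
have mY : measurable_fun setT (fun w => lfun s (G w)) by exact: lfun_measurable.
move=> A mA; have [s0|s0] := eqVneq (Num.sqrt (quad C s)) 0.
  have Qs : quad C s = 0 by apply/eqP; rewrite eq_le Q0 andbT -sqrtr_eq0 s0.
  have mc : measurable_fun setT (fun _ : T => (0 : R)) by exact: measurable_cst.
  have := Ex_eq_law mY mc (@law_eq_cos _ _ _ P _ _ P _ _ mY mc _) mA; rewrite /preimage => ->; last first.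
    move=> a b; rewrite scale_char// Qs mulr0 mul0r oppr0 expR0 mul1r.
    by rewrite -[LHS](Ex_cst P); congr Ex; apply/funext => w; rewrite mulr0 add0r.
  rewrite diracE; have [h|h] := pselect (A 0).
    rewrite mem_set//; have -> : [set _ | A 0] = [set: T] by apply/seteqP; split.
    exact: probability_setT.
  rewrite memNset//; have -> : [set _ | A 0] = set0 :> set T by apply/seteqP; split.
  exact: measure0.
have sp : 0 < Num.sqrt (quad C s) by rewrite lt_neqAle eq_sym s0 sqrtr_ge0.
have [nu [nuE nuc]] := exists_normal_char sp.
have mi : measurable_fun setT (fun x : R => x) by exact: measurable_id.
rewrite -nuE//; apply: (Ex_eq_law mY mi (law_eq_cos mY mi _) mA).
by move=> a b; rewrite scale_char// nuc sqr_sqrtr.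
Qed.

(** Polarization: the product is half of the square of the sum minus both squares, each square being
    that of a linear functional with known second moment. *)
Lemma gaussian_covariance (s t : R) : 0 <= s -> 0 <= t -> (\int[P]_w (G w s * G w t)%:E)%E = (C s t)%:E.
Proof.
move=> s0 t0.
have key r : times_in (fun t => 0 <= t) r ->
    P.-integrable setT (EFin \o (fun w => (lfun r (G w)) ^+ 2)) /\
    \int[P]_w ((lfun r (G w)) ^+ 2) = quad C r.
  move=> tr; have mY : measurable_fun setT (fun w => lfun r (G w)) by exact: lfun_measurable.
  have E : (\int[P]_w ((lfun r (G w)) ^+ 2)%:E)%E = (quad C r)%:E.
    apply: gauss_second_moment => //; first exact: pC.
    move=> a; have := scale_char a 0 tr; rewrite cos0 mulr1 => <-.
    by congr Ex; apply/funext => w; rewrite addr0.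
  split; last by rewrite /Rintegral E.
  apply/integrableP; split; first by apply/measurable_EFinP; exact: measurable_funX.
  rewrite (_ : (fun x => _) = (fun w => (lfun r (G w) ^+ 2)%:E)) ?E ?ltry//.
  by apply/funext => w /=; rewrite ger0_norm// sqr_ge0.
have [|i1 e1] := key [:: (s, 1); (t, 1)].
  by move=> p; rewrite !inE => /orP[] /eqP ->.
have [|i2 e2] := key [:: (s, 1)]; first by move=> p; rewrite inE => /eqP ->.
have [|i3 e3] := key [:: (t, 1)]; first by move=> p; rewrite inE => /eqP ->.
have i4 := integrableB measurableT (integrableB measurableT i1 i2) i3.
have i5 := integrableZl measurableT 2^-1 i4.
pose g w := 2^-1 * (lfun [:: (s, 1); (t, 1)] (G w) ^+ 2 - lfun [:: (s, 1)] (G w) ^+ 2 - lfun [:: (t, 1)] (G w) ^+ 2).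
have -> : (fun w => (G w s * G w t)%:E) = EFin \o g.
  by apply/funext => w; rewrite /= /g /lfun !big_cons !big_nil/=; congr (_%:E); field.
have i6 : P.-integrable setT (EFin \o g) by exact: i5.
rewrite -(fineK (integrable_fin_num measurableT i6)); congr (_%:E).
have i12 : P.-integrable setT (EFin \o (fun w => lfun [:: (s, 1); (t, 1)] (G w) ^+ 2 - lfun [:: (s, 1)] (G w) ^+ 2)).
  exact: (integrableB measurableT i1 i2).
have i123 : P.-integrable setT (EFin \o (fun w => lfun [:: (s, 1); (t, 1)] (G w) ^+ 2 - lfun [:: (s, 1)] (G w) ^+ 2 -
   lfun [:: (t, 1)] (G w) ^+ 2)) by exact: i4.
transitivity (\int[P]_w g w) => //.
rewrite /g (RintegralZl _ measurableT i123) (RintegralB measurableT i12 i3).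
rewrite (RintegralB measurableT i1 i2) e1 e2 e3 quad_cons//.
by rewrite /quad /lfun !big_seq1/=; field.
Qed.

End GaussianSpec.

(** * Unfolded radii *)

Section OneVariable.
Context {R : realType} {d : measure_display} {T : measurableType d} (P : probability T R).
Variable z : T -> R.
Hypothesis mz : measurable_fun setT z.

Lemma measurable_lt (x : R) : measurable [set w | z w < x].
Proof.
have -> : [set w | z w < x] = z @^-1` `]-oo, x[%classic by apply/seteqP; split => w /=; rewrite in_itv.
exact: preim_measurable.
Qed.

Lemma measurable_le (x : R) : measurable [set w | z w <= x].
Proof.
have -> : [set w | z w <= x] = z @^-1` `]-oo, x]%classic by apply/seteqP; split => w /=; rewrite in_itv.
exact: preim_measurable.
Qed.

Lemma Pr_cvg_ae (A_ : nat -> set T) (A : set T) : (forall n, measurable (A_ n)) -> measurable A ->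
  {ae P, forall w, \forall n \near \oo, (w \in A_ n) = (w \in A)} -> Pr P (A_ n) @[n --> \oo] --> Pr P A.
Proof.
move=> mA_ mA h; rewrite -Ex_indic//; under eq_fun do rewrite -Ex_indic//.
apply: (@Ex_dct _ _ _ _ _ _ 1).
- by move=> n; exact: measurable_indic.
- exact: measurable_indic.
- by move=> n w; rewrite indicE; case: (_ \in _); rewrite ?normr0 ?normr1.
- move: h; apply: filterS => w h; apply: cvg_near_cst; move: h; apply: filterS => n h.
  by rewrite !indicE h.
Qed.

Lemma Pr_lt_left (x : R) : Pr P [set w | z w < x - n.+1%:R^-1] @[n --> \oo] --> Pr P [set w | z w < x].
Proof.
apply: Pr_cvg_ae => //; [by move=> n; exact: measurable_lt|exact: measurable_lt|apply/aeW => w].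
have [h|h] := ltP (z w) x; last first.
  apply: nearW => n; have n0 : (0 : R) <= n.+1%:R^-1 by rewrite invr_ge0.
  by apply/idP/idP; rewrite !inE/=; move: (n.+1%:R^-1) n0 => y y0 ?; lra.
have : (n.+1%:R^-1 : R) @[n --> \oo] --> (0 : R) by exact: cvg_harmonic.
move/cvgr0Pnorm_lt => /(_ (x - z w)); rewrite subr_gt0 => /(_ h).
apply: filterS => n; rewrite ger0_norm ?invr_ge0// => hn.
by apply/idP/idP; rewrite !inE/=; move: (n.+1%:R^-1) hn => y hy ?; lra.
Qed.

Lemma Pr_lt_right (x : R) : Pr P [set w | z w < x + n.+1%:R^-1] @[n --> \oo] --> Pr P [set w | z w <= x].
Proof.
apply: Pr_cvg_ae => //; [by move=> n; exact: measurable_lt|exact: measurable_le|apply/aeW => w].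
have [h|h] := leP (z w) x.
  by apply: nearW => n; rewrite !mem_set//= (le_lt_trans h)// ltrDl invr_gt0.
have : (n.+1%:R^-1 : R) @[n --> \oo] --> (0 : R) by exact: cvg_harmonic.
move/cvgr0Pnorm_lt => /(_ (z w - x)); rewrite subr_gt0 => /(_ h).
apply: filterS => n; rewrite ger0_norm ?invr_ge0// => hn.
by apply/idP/idP; rewrite !inE/=; move: (n.+1%:R^-1) hn => y hy ?; lra.
Qed.

Lemma Pr_lt_infty : Pr P [set w | z w < n%:R] @[n --> \oo] --> (1 : R).
Proof.
rewrite -[X in _ --> X](Pr_setT P); apply: Pr_cvg_ae => //; first by move=> n; exact: measurable_lt.
apply/aeW => w; near=> n; rewrite !mem_set//=.
by near: n; exact: nbhs_infty_gtr.
Unshelve. all: by end_near. Qed.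

End OneVariable.

Section Unfolding.
Context {R : realType} {d : measure_display} {T : measurableType d} (P : probability T R).
Variables (z : nat -> T -> R) (Tf : R -> R).
Hypothesis mz : forall j, measurable_fun setT (z j).
Let F j (x : R) := Pr P [set w | z j w < x].
(** Together with T2: [Tf] is the pointwise supremum of the partial sums of the distribution
    functions. *)
Hypothesis T1 : forall n (x : R), \sum_(j < n) F j x <= Tf x.
Hypothesis T2 : forall x e : R, 0 < e -> exists n, Tf x - e <= \sum_(j < n) F j x.
Hypothesis T0 : forall x : R, x <= 0 -> Tf x = 0.

Definition unfp j (r : R) := Pr P [set w | Tf (z j w) <= r].

Let F_mono j (x y : R) : x <= y -> F j x <= F j y.
Proof.
move=> xy; apply: Pr_le; [exact: measurable_lt..|].
by move=> w /= h; exact: lt_le_trans xy.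
Qed.

Let Tf_sup (x c : R) : (forall n, \sum_(j < n) F j x <= c) -> Tf x <= c.
Proof.
move=> h; apply/ler_addgt0Pr => e e0; have [n hn] := T2 x e0.
by have := h n; lra.
Qed.

Lemma Tf_mono (x y : R) : x <= y -> Tf x <= Tf y.
Proof.
move=> xy; apply: Tf_sup => n; apply: le_trans (T1 n y).
by apply: ler_sum => i _; exact: F_mono.
Qed.

(** Left-continuity: the distribution functions use strict inequalities, so their partial sums are
    left-continuous, and [Tf] is the supremum of these. *)
Let Tf_left (x r : R) : (forall y, y < x -> Tf y <= r) -> Tf x <= r.
Proof.
move=> h; apply: Tf_sup => n.
have : \sum_(j < n) F j (x - m.+1%:R^-1) @[m --> \oo] --> \sum_(j < n) F j x.
  apply: cvg_sum_seq => j _; exact: Pr_lt_left.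
move=> c; rewrite -(cvg_lim (@Rhausdorff R) c).
apply: limr_le; first by apply/cvg_ex; eexists; exact: c.
apply: nearW => m; apply: le_trans (T1 n _) _; apply: h.
by rewrite gtrBl invr_gt0.
Qed.

Let Tf_unbounded (r : R) : exists x, r < Tf x.
Proof.
pose n := (Num.truncn `|r|).+2.
have : \sum_(j < n) F j m%:R @[m --> \oo] --> \sum_(j < n) (1 : R).
  apply: cvg_sum_seq => j _; exact: Pr_lt_infty.
rewrite sumr_const card_ord => /cvgrPdist_lt/(_ 1 ltr01)[m _ /(_ m (leqnn _))].
rewrite ltr_norml => /andP[_ h]; exists m%:R; apply: lt_le_trans (T1 n _).
have /andP[_ hr] := truncn_itv (normr_ge0 r).
have : n%:R = (Num.truncn `|r|).+1%:R + 1 :> R by rewrite natr1.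
have := ler_norm r; rewrite /= in h; lra.
Qed.

(** A nondecreasing, left-continuous, unbounded function has closed half-lines as sublevel sets; T0
    makes the set nonempty for r >= 0. *)
Lemma unf_level (r : R) : 0 <= r -> exists x0, forall x, (Tf x <= r) = (x <= x0).
Proof.
move=> r0; pose A := [set x | Tf x <= r].
have [u ru] := Tf_unbounded r.
have A0 : A 0 by rewrite /A/= T0.
have Au : ubound A u.
  by move=> x; rewrite /A/= => xr; rewrite leNgt; apply/negP => ux; have := Tf_mono (ltW ux); lra.
have hA : has_sup A by split; [exists 0|exists u].
exists (sup A) => x; apply/idP/idP => [h|h]; first exact: sup_upper_bound.
apply: le_trans (Tf_mono h) _; apply: Tf_left => y ys.
have [v /= vr yv] : exists2 v, A v & y < v.
  have e0 : 0 < sup A - y by rewrite subr_gt0.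
  have [v Av hv] := sup_adherent e0 hA; exists v => //; lra.
by apply: le_trans (Tf_mono (ltW yv)) vr.
Qed.

Section Level.
Variables (r x0 : R).
Hypotheses (r0 : 0 <= r) (x0P : forall x, (Tf x <= r) = (x <= x0)).

Let unfpE j : unfp j r = Pr P [set w | z j w <= x0].
Proof. by congr Pr; apply/seteqP; split => w /=; rewrite x0P. Qed.

Let unfp_cvg n : \sum_(j < n) F j (x0 + m.+1%:R^-1) @[m --> \oo] --> \sum_(j < n) unfp j r.
Proof. by apply: cvg_sum_seq => j _; rewrite unfpE; exact: Pr_lt_right. Qed.

Let inv_le1 m : (m.+1%:R^-1 : R) <= 1.
Proof. by rewrite invf_le1 ?ltr0n// ler1n. Qed.

(** In the limit the sum is the right limit of Tf at x0, and Tf exceeds r to the right of x0. The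
    limits may be exchanged because the tails of the series at x0 + 1/(m+1) are dominated by those
    at x0 + 1, uniformly in m. *)
Let unfp_lower (e : R) : 0 < e -> exists N, forall n, (N <= n)%N -> r - e <= \sum_(j < n) unfp j r.
Proof.
move=> e0; have [N hN] := T2 (x0 + 1) e0; exists N => n Nn.
rewrite -(cvg_lim (@Rhausdorff R) (@unfp_cvg n)); apply: limr_ge.
  by apply/cvg_ex; eexists; exact: unfp_cvg.
apply: nearW => m.
have h1 : r < Tf (x0 + m.+1%:R^-1).
  by rewrite ltNge x0P -ltNge ltrDl invr_gt0.
have h2 : Tf (x0 + m.+1%:R^-1) <= \sum_(j < n) F j (x0 + m.+1%:R^-1) + e.
  apply: Tf_sup => k; have [kn|nk] := leqP k n.
    rewrite -(subnKC kn) big_split_ord/= -addrA lerDl addr_ge0// ?(ltW e0)// sumr_ge0// => i _; exact: Pr_ge0.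
  rewrite -(subnKC (ltnW nk)) big_split_ord/= lerD2l.
  have h3 : \sum_(i < k - n) F (n + i) (x0 + m.+1%:R^-1) <= \sum_(i < k - n) F (n + i) (x0 + 1).
    by apply: ler_sum => i _; apply: F_mono; rewrite lerD2l.
  apply: (le_trans h3).
  have := T1 k (x0 + 1); rewrite -(subnKC (ltnW nk)) big_split_ord/= => h4.
  have : \sum_(j < N) F j (x0 + 1) <= \sum_(j < n) F j (x0 + 1).
    by rewrite -(subnKC Nn) big_split_ord/= lerDl sumr_ge0// => i _; exact: Pr_ge0.
  have -> : (n + (k - n) - n = k - n)%N by lia.
  lra.
lra.
Qed.

Let unfp_bounded n : \sum_(j < n) unfp j r <= Tf (x0 + 1).
Proof.
apply: le_trans (T1 n _); apply: ler_sum => j _; rewrite unfpE; apply: Pr_le.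
- exact: measurable_le.
- exact: measurable_lt.
- by move=> w /=; lra.
Qed.

Let unfp_at n : \sum_(j < n) unfp j r <= \sum_(j < n) unfp j (Tf x0).
Proof.
apply: ler_sum => j _; rewrite unfpE; apply: Pr_le; first exact: measurable_le.
  apply: measurable_le; have := mz j; apply: measurableT_comp.
  apply: nondecreasing_measurable => // x y; exact: Tf_mono.
by move=> w /= h; exact: Tf_mono.
Qed.

(** If Tf (z j w) <= r' < Tf x0 then z j w < x0, so the sum is at most Tf x0. With [unfp_at] this
    brackets a jump of Tf: below the level Tf x0 the sum stays at most r, at that level it already
    dominates the sum at r. *)
Let unfp_below n (r' : R) : r' < Tf x0 -> \sum_(j < n) unfp j r' <= r.
Proof.
move=> h; have Tr : Tf x0 <= r by rewrite x0P.
apply: le_trans Tr; apply: le_trans (T1 n _); apply: ler_sum => j _; apply: Pr_le.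
- apply: measurable_le; have := mz j; apply: measurableT_comp.
  apply: nondecreasing_measurable => // x y; exact: Tf_mono.
- exact: measurable_lt.
- move=> w /= hw; rewrite ltNge; apply/negP => hx.
  by have := Tf_mono hx; lra.
Qed.

Definition unf_level_facts := (unfp_lower, unfp_bounded, unfp_at, unfp_below).

End Level.

Lemma unf_measurable j : measurable_fun setT (fun w => Tf (z j w)).
Proof.
have := mz j; apply: measurableT_comp.
by apply: nondecreasing_measurable => // x y; exact: Tf_mono.
Qed.

Lemma unfp_mono j (r r' : R) : r <= r' -> unfp j r <= unfp j r'.
Proof.
move=> rr; apply: Pr_le; [apply: measurable_le; exact: unf_measurable..|].
by move=> w /= /le_trans; exact.
Qed.

Lemma unfp_lb (r e : R) : 0 <= r -> 0 < e ->
  exists N, forall n, (N <= n)%N -> r - e <= \sum_(j < n) unfp j r.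
Proof. by move=> r0 e0; have [x0 x0P] := unf_level r0; exact: (unf_level_facts r0 x0P).1.1.1. Qed.

Lemma unfp_bdd (r : R) : 0 <= r -> exists M : R, forall n, \sum_(j < n) unfp j r <= M.
Proof.
by move=> r0; have [x0 x0P] := unf_level r0; exists (Tf (x0 + 1)); exact: (unf_level_facts r0 x0P).1.1.2.
Qed.

(* The jumps of T are bounded because the sum is c Sig(r) + O(1) with Sig continuous. *)
Lemma unfp_ub (Sig : R -> R) (c E r0 : R) : 0 <= c -> 0 <= r0 ->
  (forall (r : R) n, r0 <= r -> \sum_(j < n) unfp j r <= c * Sig r + E) ->
  (forall r : R, r0 <= r -> exists n, c * Sig r - E <= \sum_(j < n) unfp j r) ->
  (forall r : R, r0 < r -> Sig x @[x --> r^'-] --> Sig r) ->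
  exists M : R, 0 <= M /\ forall (r : R) n, 0 <= r -> \sum_(j < n) unfp j r <= r + M.
Proof.
move=> c0 r00 hu hl hS.
have [M0 hM0] := unfp_bdd r00.
exists (maxr (2 * E) (maxr M0 0)); split; first by rewrite !le_max lexx !orbT.
move=> r n rp; have [x0 x0P] := unf_level rp.
have [[[_ _] h1] h2] := unf_level_facts rp x0P.
apply: le_trans (h1 n) _.
have Tr : Tf x0 <= r by rewrite x0P.
have [h|h] := leP (Tf x0) r0.
  apply: (@le_trans _ _ (\sum_(j < n) unfp j r0)); first by apply: ler_sum => j _; exact: unfp_mono.
  apply: (le_trans (hM0 n)); apply: (@le_trans _ _ (maxr (2 * E) (maxr M0 0))); last by rewrite lerDr.
  by rewrite !le_max lexx !orbT.
have h3 : c * Sig (Tf x0) <= r + E.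
  have cv : c * Sig x @[x --> (Tf x0)^'-] --> c * Sig (Tf x0) by apply: cvgMr; exact: hS.
  rewrite -(cvg_lim (@Rhausdorff R) cv); apply: limr_le; first by apply/cvg_ex; eexists; exact: cv.
  near=> y.
  have yT : y < Tf x0 by near: y; exact: nbhs_left_lt.
  have ry : r0 <= y by near: y; exact: nbhs_left_ge.
  have [k hk] := hl y ry; have := h2 k y yT; lra.
have := hu (Tf x0) n (ltW h).
have : 2 * E <= maxr (2 * E) (maxr M0 0) by rewrite le_max lexx.
lra.
Unshelve. all: by end_near. Qed.

End Unfolding.

(** * Riemann sums and asymptotic covariances *)

Section TailFunction.
Context {R : realType}.
Variables (Phi : R -> R) (muZ : probability R R).
Hypotheses (dom : muZ `<< (@lebesgue_measure R)) (EZ : (\int[muZ]_x (`|x|)%:E < +oo)%E)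
  (PhiE : forall x, Phi x = fine (muZ `]x, +oo[%classic)).

Lemma Phi_ge0 (x : R) : 0 <= Phi x.
Proof. by rewrite PhiE fine_ge0. Qed.

Lemma Phi_le1 (x : R) : Phi x <= 1.
Proof. by rewrite PhiE; exact: (@Pr_le1 _ _ _ muZ). Qed.

Lemma Phi_mono (x y : R) : x <= y -> Phi y <= Phi x.
Proof.
move=> xy; rewrite !PhiE; apply: (@Pr_le _ _ _ muZ) => // u /=.
by rewrite !in_itv/= !andbT; exact: le_lt_trans.
Qed.

(** Absolute continuity excludes an atom of the law at x, so the indicators of the rays converge
    almost everywhere. *)
Lemma Phi_cvg (x_ : nat -> R) (x : R) : x_ n @[n --> \oo] --> x -> Phi (x_ n) @[n --> \oo] --> Phi x.
Proof.
move=> xx; rewrite PhiE; under eq_fun do rewrite PhiE.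
apply: (@Pr_cvg_ae _ _ _ muZ) => //.
have m0 : muZ [set x] = 0%E.
  by move/null_content_dominatesP: dom; apply => //; exact: lebesgue_measure_set1.
exists [set x]; split => // y /= hy; apply: contrapT => /eqP yx; apply: hy.
have [h|h] := ltP x y.
  have yx0 : 0 < y - x by rewrite subr_gt0.
  move/cvgrPdist_lt: xx => /(_ _ yx0); apply: filterS => n; rewrite ltr_norml => /andP[h1 h2].
  by rewrite !mem_set//= in_itv/= andbT; lra.
have {}h : y < x by rewrite lt_neqAle yx.
have yx0 : 0 < x - y by rewrite subr_gt0.
move/cvgrPdist_lt: xx => /(_ _ yx0); apply: filterS => n; rewrite ltr_norml => /andP[h1 h2].
by rewrite !memNset//= in_itv/= andbT; apply/negP; rewrite -leNgt; lra.
Qed.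

(** The number of integers j + 1 < x with j < n is at most |x|; integrate against the law of Z. *)
Lemma Phi_sum : exists K : R, 0 <= K /\ forall n, \sum_(j < n) Phi j.+1%:R <= K.
Proof.
exists (fine (\int[muZ]_x (`|x|)%:E)); split.
  by apply: fine_ge0; apply: integral_ge0 => x _; rewrite lee_fin.
move=> n; have bI j : bmf (\1_(`]j.+1%:R, +oo[%classic) : R -> R) by exact: bmf_indic.
have -> : \sum_(j < n) Phi j.+1%:R = Ex muZ (fun x => \sum_(j < n) \1_(`]j.+1%:R, +oo[%classic) x).
  by rewrite Ex_sum//; apply: eq_bigr => j _; rewrite Ex_indic// PhiE.
have fin : (\int[muZ]_x (`|x|)%:E)%E \is a fin_num.
  by rewrite ge0_fin_numE//; apply: integral_ge0 => x _; rewrite lee_fin.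
have bS : bmf (fun x : R => \sum_(j < n) (\1_(`]j.+1%:R, +oo[%classic) x : R)) by exact: (bmf_sum _ _ (fun j : 'I_n => bI j)).
suff : (\int[muZ]_x (\sum_(j < n) (\1_(`]j.+1%:R, +oo[%classic) x : R))%:E <= \int[muZ]_x (`|x|)%:E)%E.
  by rewrite (ExE muZ bS) -[X in (_ <= X)%E](fineK fin) lee_fin.
apply: ge0_le_integral => //.
- by move=> x _; rewrite lee_fin sumr_ge0.
- by apply/measurable_EFinP; apply: measurable_sum => j; exact: measurable_indic.
- by apply/measurable_EFinP; exact: normr_measurable.
- move=> x _; rewrite lee_fin.
  elim: n {bS} => [|n IH]; first by rewrite big_ord0.
  rewrite big_ord_recr/=; have [h|h] := ltP n.+1%:R x; last first.
    rewrite [X in _ + X](_ : _ = 0) ?addr0//.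
    by rewrite indicE memNset//= in_itv/= andbT; apply/negP; rewrite -leNgt.
  have h1 : \sum_(j < n) \1_(`]j.+1%:R, +oo[%classic) x <= n%:R :> R.
    rewrite -[X in _ <= X%:R](card_ord n) -sumr_const; apply: ler_sum => j _.
    by rewrite indicE; case: (_ \in _).
  apply: (@le_trans _ _ (n%:R + 1)); first by apply: lerD => //; rewrite indicE; case: (_ \in _).
  by rewrite natr1 (le_trans (ltW h))// ler_norm.
Qed.

End TailFunction.

Section Riemann.
Context {R : realType}.
Local Notation leb := (@lebesgue_measure R).

Lemma integral_itv_cst (a b c : R) : a <= b -> 0 <= c ->
  (\int[leb]_(x in `]a, b]%classic) c%:E)%E = (c * (b - a))%:E.
Proof.
move=> ab c0; rewrite integral_cst//.
transitivity (c%:E * (if (a%:E < b%:E)%E then (b%:E - a%:E)%E else 0%E))%E.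
  by congr (_ * _)%E; exact: lebesgue_measure_itv.
rewrite lte_fin.
case: ltP => h; first by rewrite -EFinB -EFinM.
have -> : b = a by apply/eqP; rewrite eq_le ab h.
by rewrite subrr mulr0 mule0.
Qed.

Variable g : R -> R.
Hypotheses (g0 : forall x, 0 <= g x) (gm : forall x y : R, x <= y -> g y <= g x).

Lemma mono_measurable (D : set R) : measurable D -> measurable_fun D (EFin \o g).
Proof. by move=> mD; apply/measurable_EFinP; apply: nonincreasing_measurable. Qed.

Lemma riemann_sums (a : R) n : 0 < a ->
  ((\sum_(j < n) a * g (a * j.+1%:R))%:E <= \int[leb]_(x in `]0%R, (a * n%:R)%R]%classic) (g x)%:E)%E /\
  ((\int[leb]_(x in `]0%R, (a * n%:R)%R]%classic) (g x)%:E) <= (\sum_(j < n) a * g (a * j%:R))%:E)%E.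
Proof.
move=> a0; elim: n => [|n [IH1 IH2]].
  by rewrite !big_ord0 mulr0 set_itvoc0 integral_set0.
have an : 0 <= a * n%:R by rewrite mulr_ge0// ltW.
have anS : a * n%:R <= a * n.+1%:R by rewrite ler_pM2l// ler_nat.
have E : `]0, (a * n.+1%:R)]%classic = `]0, (a * n%:R)]%classic `|` `](a * n%:R), (a * n.+1%:R)]%classic :> set R.
  apply/seteqP; split => x /=; rewrite !in_itv/=.
    by move=> /andP[x0 xn]; have [h|h] := leP x (a * n%:R); [left|right]; rewrite ?x0 ?xn ?h.
  by move=> [/andP[-> /le_trans h]|/andP[h ->]]; rewrite ?andbT ?h// (le_lt_trans an h).
have d : [disjoint `]0, (a * n%:R)]%classic & `](a * n%:R), (a * n.+1%:R)]%classic].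
  apply/disj_set2P/seteqP; split => x //=; rewrite !in_itv/= => -[/andP[_ h1] /andP[h2 _]]; lra.
rewrite E ge0_integral_setU//; last 2 first.
  by apply: mono_measurable; exact: measurableU.
  by move=> x _; rewrite lee_fin.
rewrite !big_ord_recr/= !EFinD.
have aE : a * n.+1%:R - a * n%:R = a by rewrite -mulrBr -natr1 addrAC subrr add0r mulr1.
split; apply: leeD => //.
- rewrite (_ : a * g _ = g (a * n.+1%:R) * (a * n.+1%:R - a * n%:R)); last by rewrite aE mulrC.
  rewrite -integral_itv_cst//; apply: ge0_le_integral => //.
  + by move=> x _; rewrite lee_fin.
  + exact: mono_measurable.
  + by move=> x /=; rewrite in_itv/= => /andP[_ h]; rewrite lee_fin gm.
- rewrite (_ : a * g _ = g (a * n%:R) * (a * n.+1%:R - a * n%:R)); last by rewrite aE mulrC.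
  rewrite -integral_itv_cst//; apply: ge0_le_integral => //.
  + by move=> x _; rewrite lee_fin.
  + exact: mono_measurable.
  + by move=> x /=; rewrite in_itv/= => /andP[h _]; rewrite lee_fin gm// ltW.
Qed.

Lemma riemann_shift (a : R) n : 0 < a ->
  \sum_(j < n) a * g (a * j%:R) <= \sum_(j < n) a * g (a * j.+1%:R) + a * g 0.
Proof.
move=> a0; suff -> : \sum_(j < n) a * g (a * j%:R) = \sum_(j < n) a * g (a * j.+1%:R) + a * g 0 - a * g (a * n%:R).
  by rewrite gerBl mulr_ge0// ltW.
elim: n => [|n IH]; first by rewrite !big_ord0 mulr0 add0r subrr.
by rewrite !big_ord_recr/= IH; ring.
Qed.

End Riemann.

Section ScaledTail.
Context {R : realType}.
Local Notation leb := (@lebesgue_measure R).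
Variables (Phi : R -> R) (K : R).
Hypotheses (P0 : forall x, 0 <= Phi x) (P1 : forall x, Phi x <= 1)
  (Pm : forall x y : R, x <= y -> Phi y <= Phi x)
  (PK : forall n, \sum_(j < n) Phi j.+1%:R <= K).

(** Integral test: the upper Riemann sums of mesh 1/k are k^-1 times sums of Phi at integers. *)
Lemma tail_integrable (k : R) : 0 < k -> leb.-integrable `]0, +oo[%classic (EFin \o (fun x => Phi (k * x))).
Proof.
move=> k0; have gm (x y : R) : x <= y -> Phi (k * y) <= Phi (k * x) by move=> xy; apply: Pm; rewrite ler_pM2l.
have mg := mono_measurable gm.
apply/integrableP; split; first exact: mg.
under eq_integral do rewrite /= (ger0_norm (P0 _)).
have a0 : 0 < k^-1 by rewrite invr_gt0.
have := @ge0_nondecreasing_set_cvg_integral _ (measurableTypeR R) R (fun n => `]0, (k^-1 * n%:R)]%classic)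
  (fun x => (Phi (k * x))%:E) leb.
have -> : \bigcup_n `]0, (k^-1 * n%:R)]%classic = `]0, +oo[%classic :> set R.
  apply/seteqP; split => x; first by move=> [n _] /=; rewrite !in_itv/= andbT => /andP[].
  rewrite /= in_itv/= andbT => x0; exists (Num.truncn (k * x)).+1 => //=.
  rewrite in_itv/= x0/= -(ler_pM2l k0) mulrA divff ?lt0r_neq0// mul1r ltW//.
  by have /andP[] := truncn_itv (mulr_ge0 (ltW k0) (ltW x0)).
move=> h; have {h}c : (\int[leb]_(x in `]0%R, (k^-1 * n%:R)%R]%classic) (Phi (k * x))%:E)%E @[n --> \oo] -->
   (\int[leb]_(x in `]0%R, +oo[%classic) (Phi (k * x))%:E)%E.
  apply: h.
  - move=> m n mn; apply/subsetPset => x /=; rewrite !in_itv/= => /andP[-> /le_trans]; apply.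
    by rewrite ler_pM2l// ler_nat.
  - by move=> n; exact: measurable_itv.
  - by move=> n; exact: mg.
  - by move=> n x _; rewrite lee_fin.
apply: (@le_lt_trans _ _ (k^-1 * K + k^-1)%:E); last exact: ltry.
rewrite -(cvg_lim (@ereal_hausdorff R) c); apply: lime_le; first by apply/cvg_ex; eexists; exact: c.
apply: nearW => n; have [_ h2] := riemann_sums (fun x => P0 (k * x)) gm n a0.
apply: (le_trans h2); rewrite lee_fin; apply: le_trans (riemann_shift (fun x => P0 (k * x)) n a0) _.
apply: lerD; last by rewrite ger_pMr.
rewrite -mulr_sumr ler_pM2l//; apply: le_trans (PK n); apply: ler_sum => j _.
by rewrite mulrA divff ?lt0r_neq0// mul1r.
Qed.

Definition cutset (ap : \bar R) : set R := [set x : R | (0 < x)%R /\ (x%:E < ap)%E].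

Lemma cutset_measurable ap : measurable (cutset ap).
Proof.
case: ap => [a| |].
- have -> : cutset a%:E = `]0, a[%classic.
    by rewrite /cutset; apply/seteqP; split => x /=; rewrite in_itv/= lte_fin; [move=> [-> ->]|move=> /andP[]].
  exact: measurable_itv.
- have -> : cutset +oo%E = `]0, +oo[%classic.
    by rewrite /cutset; apply/seteqP; split => x /=; rewrite in_itv/= ltry andbT; [case|].
  exact: measurable_itv.
- have -> : cutset -oo%E = set0 by apply/seteqP; split => x //= [_]; rewrite ltNge leNye.
  exact: measurable0.
Qed.

(** Dominated convergence on the positive half-line with majorant Phi(k x), the domains of
    integration being turned into restrictions of the integrand. *)
Lemma cutset_cvg (g_ : nat -> R -> R) (g : R -> R) (b_ : nat -> R) (ap : \bar R) (k : R) : 0 < k ->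
  (forall n (x y : R), x <= y -> g_ n y <= g_ n x) -> (forall x y : R, x <= y -> g y <= g x) ->
  (forall n x, 0 <= g_ n x) -> (forall n x, 0 < x -> g_ n x <= Phi (k * x)) ->
  (forall x, g_ n x @[n --> \oo] --> g x) -> (b_ n)%:E @[n --> \oo] --> ap ->
  (\int[leb]_(x in `]0%R, b_ n]%classic) (g_ n x)%:E)%E @[n --> \oo] -->
  (\int[leb]_(x in cutset ap) (g x)%:E)%E.
Proof.
move=> k0 gm_ gm g0 gP gg bb.
have iP := tail_integrable k0.
have E1 n : (\int[leb]_(x in `]0%R, b_ n]%classic) (g_ n x)%:E)%E =
   (\int[leb]_(x in `]0%R, +oo[%classic) (((EFin \o g_ n) \_ `]0%R, b_ n]%classic) x))%E.
  by rewrite -integral_mkcondr; congr integral; apply/seteqP; split => x /=; rewrite !in_itv/= andbT; [move=> /andP[-> ->]|case].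
have E2 : (\int[leb]_(x in cutset ap) (g x)%:E)%E =
   (\int[leb]_(x in `]0%R, +oo[%classic) (((EFin \o g) \_ (cutset ap)) x))%E.
  rewrite -integral_mkcondr; congr integral; apply/seteqP; split => x /=.
    by move=> [x0 xa]; rewrite in_itv/= x0.
  by case.
rewrite E2; under eq_fun do rewrite E1.
have mo : measurable (`]0%R, +oo[%classic : set R) by exact: measurable_itv.
have [] := @dominated_convergence _ _ _ leb _ mo
  (fun n => (EFin \o g_ n) \_ `]0%R, b_ n]%classic) ((EFin \o g) \_ (cutset ap)) (EFin \o (fun x => Phi (k * x))).
- move=> n; apply: measurable_funTS; apply/(measurable_restrictT _ _).1 => //.
  by apply: mono_measurable => //; exact: gm_.
- have mc := cutset_measurable ap; apply: measurable_funTS; apply/(measurable_restrictT _ _).1 => //.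
  exact: mono_measurable.
(* The endpoint is the only positive point where the restrictions to the sets of endpoint b_n may
   fail to converge. For infinite ap this set is just {0}. *)
- exists [set fine ap]; split; [exact: measurable_set1|exact: lebesgue_measure_set1|].
  move=> x /= hx; apply: contrapT => /eqP xap; apply: hx; rewrite /= in_itv/= andbT => x0.
  have {}xap : x%:E <> ap by move=> xE; move: xap; rewrite -xE/= eqxx.
  have nb : \forall n \near \oo, ((x \in `]0%R, b_ n]%classic) = (x \in cutset ap)).
    suff : \forall n \near \oo, (x <= b_ n) = (x%:E < ap)%E.
      by apply: filterS => n h; apply/idP/idP; rewrite !inE/= in_itv/= x0 h //= => -[].
    case: ap bb xap {E2} => [a| |] bb xap.
    - have {}bb : b_ n @[n --> \oo] --> a by exact: (fine_cvg bb).
      have xa : x <> a by move=> xa; apply: xap; rewrite xa.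
      rewrite lte_fin; have [h|h] := ltP x a.
        have h0 : 0 < a - x by rewrite subr_gt0.
        move/cvgrPdist_lt: bb => /(_ _ h0); apply: filterS => n; rewrite ltr_norml => /andP[h1 h2]; lra.
      have h0 : 0 < x - a by rewrite subr_gt0 lt_neqAle h andbT eq_sym; exact/eqP.
      move/cvgrPdist_lt: bb => /(_ _ h0); apply: filterS => n; rewrite ltr_norml => /andP[h1 h2]; lra.
    - move/cvgeyPge: bb => /(_ x); apply: filterS => n; rewrite lee_fin ltry => ->//.
    - move/cvgeNyPle: bb => /(_ (x - 1)); apply: filterS => n; rewrite lee_fin ltNge leNye/= => h; lra.
  have cg : (g_ n x)%:E @[n --> \oo] --> (g x)%:E by apply: cvg_EFin; [exact: nearW|exact: gg].
  rewrite /patch; case: ifPn => hx.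
    apply: cvg_trans cg; apply: near_eq_cvg; move: nb; apply: filterS => n ->.
    by rewrite hx.
  apply: cvg_near_cst; move: nb; apply: filterS => n ->.
  by rewrite (negbTE hx).
- exact: iP.
- apply/aeW => x n; rewrite /= in_itv/= andbT => x0.
  rewrite /patch; case: ifPn => _; last by rewrite abse0 lee_fin.
  by rewrite /= lee_fin ger0_norm// gP.
by move=> _ _; exact.
Qed.

End ScaledTail.

(** * Riemann sums of a function in W^{1,1} *)

Section SobolevSum.
Context {R : realType}.
Local Notation leb := (@lebesgue_measure R).
Variables (Psi g : R -> R).
Hypotheses (iPsi : leb.-integrable setT (EFin \o Psi)) (ig : leb.-integrable setT (EFin \o g))
  (hg : forall x y : R, x <= y -> (\int[leb]_(u in `[x, y]) (g u)%:E)%E = (Psi y - Psi x)%:E).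

Let mPsi : measurable_fun setT Psi.
Proof. by have := measurable_int _ iPsi; move/measurable_EFinP. Qed.

Let mg : measurable_fun setT g.
Proof. by have := measurable_int _ ig; move/measurable_EFinP. Qed.

Let mnorm (f : R -> R) (D : set R) : measurable_fun setT f -> measurable_fun D (fun x => (`|f x|)%:E).
Proof.
move=> mf; apply: (@measurable_funTS _ _ _ _ D); apply/measurable_EFinP.
by apply: measurableT_comp.
Qed.

Let fin_norm (f : R -> R) (D : set R) : measurable D -> leb.-integrable setT (EFin \o f) ->
  (\int[leb]_(x in D) (`|f x|)%:E)%E \is a fin_num.
Proof.
move=> mD fi; have mf : measurable_fun setT f by have := measurable_int _ fi; move/measurable_EFinP.
rewrite ge0_fin_numE; last by apply: integral_ge0 => x _; rewrite lee_fin.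
have [_] := integrableP _ _ _ fi; apply: le_lt_trans.
by apply: ge0_subset_integral => //; exact: mnorm.
Qed.

Let Psi_le (x y : R) (b : R) : b < x -> x <= y ->
  `|Psi y| <= `|Psi x| + fine (\int[leb]_(u in `]b, y]%classic) (`|g u|)%:E).
Proof.
move=> bx xy.
have h1 : `|Psi y - Psi x| <= fine (\int[leb]_(u in `]b, y]%classic) (`|g u|)%:E).
  rewrite -lee_fin fineK; last by apply: fin_norm => //; exact: measurable_itv.
  have -> : (`|Psi y - Psi x|)%:E = (`|\int[leb]_(u in `[x, y]) (g u)%:E|)%E by rewrite hg.
  apply: (@le_trans _ _ (\int[leb]_(u in `[x, y]) (`|g u|)%:E)%E).
    have mi : measurable (`[x, y]%classic : set R) by exact: measurable_itv.
    apply: (le_abse_integral leb mi).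
    by apply/measurable_EFinP; exact: measurable_funTS.
  apply: ge0_subset_integral => //.
  - exact: mnorm.
  - by move=> u /=; rewrite !in_itv/= => /andP[xu ->]; rewrite andbT (lt_le_trans bx xu).
have := ler_normD (Psi x) (Psi y - Psi x); rewrite addrC subrK; lra.
Qed.

(** On a cell of length a, the value at the right end is at most |Psi x| plus the integral of |g|
    over the cell, for each x of the cell; integrating in x over the cell gives the extra factor a
    in front of |g|. *)
Lemma sobolev_riemann (a : R) n : 0 < a ->
  ((\sum_(j < n) a * `|Psi (a * j.+1%:R)|)%:E <=
   \int[leb]_(x in `]0%R, (a * n%:R)%R]%classic) ((`|Psi x|)%:E + (a * `|g x|)%:E))%E.
Proof.
move=> a0; elim: n => [|n IH].
  by rewrite big_ord0 mulr0 set_itvoc0 integral_set0.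
have an : 0 <= a * n%:R by rewrite mulr_ge0// ltW.
have anS : a * n%:R <= a * n.+1%:R by rewrite ler_pM2l// ler_nat.
have E : `]0, (a * n.+1%:R)]%classic = `]0, (a * n%:R)]%classic `|` `](a * n%:R), (a * n.+1%:R)]%classic :> set R.
  apply/seteqP; split => x /=; rewrite !in_itv/=.
    by move=> /andP[x0 xn]; have [h|h] := leP x (a * n%:R); [left|right]; rewrite ?x0 ?xn ?h.
  by move=> [/andP[-> /le_trans h]|/andP[h ->]]; rewrite ?andbT ?h// (le_lt_trans an h).
have d : [disjoint `]0, (a * n%:R)]%classic & `](a * n%:R), (a * n.+1%:R)]%classic].
  apply/disj_set2P/seteqP; split => x //=; rewrite !in_itv/= => -[/andP[_ h1] /andP[h2 _]]; lra.
have ma (D : set R) : measurable_fun D (fun x => (a * `|g x|)%:E).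
  apply: (@measurable_funTS _ _ _ _ D); apply/measurable_EFinP; apply: measurable_funM => //.
  by apply: measurableT_comp.
have mh (D : set R) : measurable_fun D (fun x => ((`|Psi x|)%:E + (a * `|g x|)%:E)%E).
  by apply: emeasurable_funD => //; exact: mnorm.
rewrite E ge0_integral_setU//; do ?[exact: mh|by move=> x _; rewrite adde_ge0 ?lee_fin// mulr_ge0// ltW].
rewrite !big_ord_recr/= !EFinD.
apply: leeD => //.
have aE : a * n.+1%:R - a * n%:R = a by rewrite -mulrBr -natr1 addrAC subrr add0r mulr1.
set I := `](a * n%:R), (a * n.+1%:R)]%classic.
have mI : measurable I by exact: measurable_itv.
set ga := fine (\int[leb]_(u in I) (`|g u|)%:E).
have ga0 : 0 <= ga by apply: fine_ge0; apply: integral_ge0 => x _; rewrite lee_fin.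
apply: (@le_trans _ _ (\int[leb]_(x in I) ((`|Psi x|)%:E + ga%:E))%E).
  rewrite (_ : a * _ = `|Psi (a * n.+1%:R)| * (a * n.+1%:R - a * n%:R)); last by rewrite aE mulrC.
  rewrite -integral_itv_cst//; apply: ge0_le_integral => //.
  + by apply: emeasurable_funD => //; exact: mnorm.
  + move=> x /=; rewrite in_itv/= => /andP[h1 h2]; rewrite -EFinD lee_fin; exact: Psi_le.
rewrite ge0_integralD//; do ?[exact: mnorm|by move=> x _; rewrite lee_fin].
rewrite [leRHS]ge0_integralD//; do ?[exact: mnorm|exact: ma|by move=> x _; rewrite lee_fin mulr_ge0// ltW].
apply: leeD => //.
rewrite integral_itv_cst// aE.
have -> : (\int[leb]_(x in I) (a * `|g x|)%:E)%E = (a%:E * \int[leb]_(x in I) (`|g x|)%:E)%E.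
  under eq_integral do rewrite EFinM.
  rewrite ge0_integralZl//; [exact: mnorm|by rewrite lee_fin ltW].
by rewrite -(fineK (fin_norm mI ig)) -/ga -EFinM mulrC.
Qed.

Lemma sobolev_sum : exists K : R, 0 <= K /\ forall (a : R) n, 0 < a -> a <= 1 ->
  \sum_(j < n) a * `|Psi (a * j.+1%:R)| <= K.
Proof.
exists (fine (\int[leb]_x (`|Psi x|)%:E) + fine (\int[leb]_x (`|g x|)%:E)); split.
  by apply: addr_ge0; apply: fine_ge0; apply: integral_ge0 => x _; rewrite lee_fin.
move=> a n a0 a1; have := sobolev_riemann n a0; rewrite -lee_fin => /le_trans; apply.
have mI : measurable (`]0, (a * n%:R)]%classic : set R) by exact: measurable_itv.
rewrite EFinD !fineK; [|exact: fin_norm..].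
apply: (@le_trans _ _ (\int[leb]_(x in `]0%R, (a * n%:R)%R]%classic) ((`|Psi x|)%:E + (`|g x|)%:E))%E).
  apply: ge0_le_integral => //.
  - by move=> x _; rewrite adde_ge0 ?lee_fin// mulr_ge0// ltW.
  - apply: emeasurable_funD; first exact: mnorm.
    apply: measurable_funTS; apply/measurable_EFinP; apply: measurable_funM => //.
    by apply: measurableT_comp.
  - by apply: emeasurable_funD; exact: mnorm.
  - by move=> x _; rewrite leeD2lE// lee_fin ler_piMl.
rewrite ge0_integralD//; do ?[exact: mnorm|by move=> x _; rewrite lee_fin].
by apply: leeD; apply: ge0_subset_integral => //; exact: mnorm.
Qed.

End SobolevSum.

Section TailSums.
Context {R : realType}.
Local Notation leb := (@lebesgue_measure R).
Variables (Phi : R -> R) (K : R).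
Hypotheses (P0 : forall x, 0 <= Phi x) (P1 : forall x, Phi x <= 1)
  (Pm : forall x y : R, x <= y -> Phi y <= Phi x)
  (PK : forall n, \sum_(j < n) Phi j.+1%:R <= K).

Let K0 : 0 <= K. Proof. by have := PK 0; rewrite big_ord0. Qed.

(** c is the integral of Phi over the positive half-line. The loss 2 a is a for passing from left to
    right endpoints and a for cutting the integral at a finite point. *)
Lemma sum_Phi_bounds : exists c : R, 0 <= c /\ forall a : R, 0 < a ->
  (forall n, \sum_(j < n) a * Phi (a * j.+1%:R) <= c) /\
  exists n, c - 2 * a <= \sum_(j < n) a * Phi (a * j.+1%:R).
Proof.
have iP := tail_integrable P0 P1 Pm PK (@ltr01 R).
set c := fine (\int[leb]_(x in `]0%R, +oo[%classic) (Phi x)%:E).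
have mo : measurable (`]0, +oo[%classic : set R) by exact: measurable_itv.
have cfin : (\int[leb]_(x in `]0%R, +oo[%classic) (Phi x)%:E)%E = c%:E.
  rewrite fineK// ge0_fin_numE; last by apply: integral_ge0 => x _; rewrite lee_fin.
  have [_] := integrableP _ _ _ iP.
  by under eq_integral do rewrite /= mul1r (ger0_norm (P0 _)).
exists c; split; first by apply: fine_ge0; apply: integral_ge0 => x _; rewrite lee_fin.
move=> a a0; split => [n|].
  rewrite -lee_fin -cfin; have [h _] := riemann_sums P0 Pm n a0; apply: (le_trans h).
  apply: ge0_subset_integral => //.
  - by apply: mono_measurable.
  - by move=> x _; rewrite lee_fin.
  - by move=> x /=; rewrite !in_itv/= andbT => /andP[].
have cv : (\int[leb]_(x in `]0%R, (a * n%:R)%R]%classic) (Phi x)%:E)%E @[n --> \oo] --> c%:E.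
  have -> : c%:E = (\int[leb]_(x in cutset +oo%E) (Phi x)%:E)%E.
    rewrite -cfin; congr integral; apply/seteqP; split => x; rewrite /cutset/= in_itv/= andbT ltry; by [|case].
  apply: (@cutset_cvg _ Phi K P0 P1 Pm PK (fun=> Phi) Phi (fun n => a * n%:R) +oo%E 1) => //.
  - by move=> n x x0; rewrite mul1r.
  - by move=> x; exact: cvg_cst.
  - apply/cvgeyPge => A; near=> n; rewrite lee_fin mulrC -ler_pdivrMr//.
    by near: n; exact: nbhs_infty_ger.
have {}cv : fine (\int[leb]_(x in `]0%R, (a * n%:R)%R]%classic) (Phi x)%:E) @[n --> \oo] --> c by exact: (fine_cvg cv).
move/cvgrPdist_lt: cv => /(_ _ a0)[n _ /(_ n (leqnn _))] /=; rewrite ltr_norml => /andP[_ hn].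
exists n; have [_ h2] := riemann_sums P0 Pm n a0.
have h3 := riemann_shift P0 n a0.
have h4 : fine (\int[leb]_(x in `]0%R, (a * n%:R)%R]%classic) (Phi x)%:E) <= \sum_(j < n) a * Phi (a * j%:R).
  rewrite -lee_fin fineK// ge0_fin_numE; first exact: le_lt_trans h2 (ltry _).
  by apply: integral_ge0 => x _; rewrite lee_fin.
have h5 : a * Phi 0 <= a by rewrite ger_pMr.
lra.
Unshelve. all: by end_near. Qed.

(** For a monotone function bounded by 1 the Riemann sum lies within one mesh of the integral,
    uniformly in n, so the convergence of the integrals carries over. *)
Lemma riemann_cvg (a_ : nat -> R) (N_ : nat -> nat) (g_ : nat -> R -> R) (g : R -> R) (ap : \bar R) (k : R) :
  0 < k -> (forall n, 0 < a_ n) -> a_ n @[n --> \oo] --> 0 ->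
  (forall n (x y : R), x <= y -> g_ n y <= g_ n x) -> (forall x y : R, x <= y -> g y <= g x) ->
  (forall n x, 0 <= g_ n x) -> (forall n x, g_ n x <= 1) -> (forall x, 0 <= g x) ->
  (forall n (x : R), 0 < x -> g_ n x <= Phi (k * x)) -> (forall x : R, 0 < x -> g x <= Phi (k * x)) ->
  (forall x, g_ n x @[n --> \oo] --> g x) -> (a_ n * (N_ n)%:R)%:E @[n --> \oo] --> ap ->
  \sum_(j < N_ n) a_ n * g_ n (a_ n * j.+1%:R) @[n --> \oo] --> fine (\int[leb]_(x in cutset ap) (g x)%:E).
Proof.
move=> k0 a0 aC gm_ gm g0_ g1_ g0 gP_ gP gg bb.
have mo : measurable (`]0, +oo[%classic : set R) by exact: measurable_itv.
have mc := cutset_measurable ap.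
have fin : (\int[leb]_(x in cutset ap) (g x)%:E)%E \is a fin_num.
  rewrite ge0_fin_numE; last by apply: integral_ge0 => x _; rewrite lee_fin.
  apply: (@le_lt_trans _ _ (\int[leb]_(x in `]0%R, +oo[%classic) (Phi (k * x))%:E)%E).
    apply: (@le_trans _ _ (\int[leb]_(x in `]0%R, +oo[%classic) (g x)%:E)%E).
      apply: ge0_subset_integral => //.
      - by apply: mono_measurable.
      - by move=> x _; rewrite lee_fin.
      - by move=> x [x0 _]; rewrite /= in_itv/= x0.
    apply: ge0_le_integral => //.
    - by move=> x _; rewrite lee_fin.
    - by apply: mono_measurable.
    - by apply: (@mono_measurable _ (fun x => Phi (k * x))) => // x y xy; apply: Pm; rewrite ler_pM2l.
    - by move=> x; rewrite /= in_itv/= andbT => x0; rewrite lee_fin gP.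
  have [_] := integrableP _ _ _ (tail_integrable P0 P1 Pm PK k0).
  by under eq_integral do rewrite /= (ger0_norm (P0 _)).
have cv := cutset_cvg P0 P1 Pm PK k0 gm_ gm g0_ gP_ gg bb.
rewrite -(fineK fin) in cv; have {}cv := fine_cvg cv.
pose J := fun n => fine (\int[leb]_(x in `]0%R, (a_ n * (N_ n)%:R)%R]%classic) (g_ n x)%:E).
have JP n : \sum_(j < N_ n) a_ n * g_ n (a_ n * j.+1%:R) <= J n <= \sum_(j < N_ n) a_ n * g_ n (a_ n * j.+1%:R) + a_ n.
  have [h1 h2] := riemann_sums (g0_ n) (gm_ n) (N_ n) (a0 n).
  have h3 := riemann_shift (g0_ n) (N_ n) (a0 n).
  have h5 : a_ n * g_ n 0 <= a_ n by rewrite ger_pMr.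
  have fJ : (\int[leb]_(x in `]0%R, (a_ n * (N_ n)%:R)%R]%classic) (g_ n x)%:E)%E = (J n)%:E.
    rewrite /J fineK// ge0_fin_numE; first exact: le_lt_trans h2 (ltry _).
    by apply: integral_ge0 => x _; rewrite lee_fin.
  rewrite fJ !lee_fin in h1 h2; apply/andP; split => //; lra.
have cJ : J n @[n --> \oo] --> fine (\int[leb]_(x in cutset ap) (g x)%:E) by exact: cv.
apply: (@squeeze_cvgr _ _ _ _ (fun n => J n - a_ n) J) => //.
- by apply: nearW => n; have /andP[h1 h2] := JP n; apply/andP; split => //; lra.
- by rewrite -[X in _ --> X]subr0; apply: cvgB.
Qed.

End TailSums.

(** * Asymptotic linearity of Sig and the limiting covariance *)

Section Asymptotics.
Context {R : realType}.
Local Notation leb := (@lebesgue_measure R).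
Variables (p : nat -> R -> R) (Sig Phi : R -> R) (K E2 r0 : R).
Hypotheses (P0 : forall x, 0 <= Phi x) (P1 : forall x, Phi x <= 1)
  (Pm : forall x y : R, x <= y -> Phi y <= Phi x)
  (Pc : forall (x_ : nat -> R) (x : R), x_ n @[n --> \oo] --> x -> Phi (x_ n) @[n --> \oo] --> Phi x)
  (PK : forall n, \sum_(j < n) Phi j.+1%:R <= K).
Hypotheses (p0 : forall j r, 0 <= p j r) (p1 : forall j r, p j r <= 1) (r00 : 0 < r0)
  (Sig1 : forall r : R, r0 <= r -> 1 <= Sig r)
  (pPhi : forall (r : R) n, r0 <= r -> \sum_(j < n) `|p j r - Phi (j.+1%:R / Sig r)| <= E2).

Lemma sum_p_bounds : exists c : R, 0 <= c /\ forall r : R, r0 <= r ->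
  (forall n, \sum_(j < n) p j r <= c * Sig r + E2) /\
  exists n, c * Sig r - (E2 + 2) <= \sum_(j < n) p j r.
Proof.
have [c [c0 hc]] := sum_Phi_bounds P0 P1 Pm PK; exists c; split => // r rr.
have S1 := Sig1 rr.
have a0 : 0 < (Sig r)^-1 by rewrite invr_gt0; lra.
have [h1 [n0 h2]] := hc _ a0.
have E n : \sum_(j < n) Phi (j.+1%:R / Sig r) = Sig r * \sum_(j < n) (Sig r)^-1 * Phi ((Sig r)^-1 * j.+1%:R).
  rewrite mulr_sumr; apply: eq_bigr => j _; rewrite mulrA divff ?mul1r; last by rewrite lt0r_neq0//; lra.
  by rewrite mulrC.
have D n : `|\sum_(j < n) p j r - \sum_(j < n) Phi (j.+1%:R / Sig r)| <= E2.
  by apply: le_trans (pPhi n rr); rewrite -sumrB; exact: ler_norm_sum.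
split => [n|].
  have := D n; rewrite ler_norml => /andP[_ h].
  have : Sig r * \sum_(j < n) (Sig r)^-1 * Phi ((Sig r)^-1 * j.+1%:R) <= Sig r * c.
    by rewrite ler_wpM2l//; lra.
  rewrite -E; lra.
exists n0; have := D n0; rewrite ler_norml => /andP[h _].
have : Sig r * (c - 2 * (Sig r)^-1) <= Sig r * \sum_(j < n0) (Sig r)^-1 * Phi ((Sig r)^-1 * j.+1%:R).
  by rewrite ler_wpM2l//; lra.
rewrite -E mulrBr (mulrCA (Sig r)) divff; last by rewrite lt0r_neq0//; lra.
lra.
Qed.

Variables (c E3 M : R) (R_ : nat -> R) (N_ : nat -> nat) (ap : \bar R).
Hypotheses (c0 : 0 < c) (hc : forall r : R, r0 <= r -> `|c * Sig r - r| <= E3)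
  (B0 : forall n, \sum_(j < n) p j 0 <= M)
  (B3 : forall n (s t : R), 0 <= s -> s <= t -> \sum_(j < n) (p j t - p j s) <= (t - s) + M)
  (RL : forall n, r0 <= R_ n) (Roo : R_ n @[n --> \oo] --> +oo)
  (hap : ((N_ n)%:R / Sig (R_ n))%:E @[n --> \oo] --> ap).

Let a n := (Sig (R_ n))^-1.

Let a0 n : 0 < a n.
Proof. by rewrite invr_gt0; have := Sig1 (RL n); lra. Qed.

Let R0 n : 0 < R_ n.
Proof. exact: lt_le_trans r00 (RL n). Qed.

(** Since c Sig r = r + O(1), Sig is asymptotically linear. This is how the time parameter enters
    the limit: Sig(R) / Sig(sR) tends to 1/s. *)
Lemma ratio_cvg (t : R) : 0 < t -> Sig (t * R_ n) / R_ n @[n --> \oo] --> t / c.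
Proof.
move=> t0; apply/cvgrPdist_le => e e0; near=> n.
have h : r0 <= t * R_ n.
  by rewrite mulrC -ler_pdivrMr//; near: n; move/cvgryPge: Roo => /(_ (r0 / t)).
have h3 := hc h.
have -> : t / c - Sig (t * R_ n) / R_ n = - ((c * Sig (t * R_ n) - t * R_ n) / (c * R_ n)).
  by field; rewrite !lt0r_neq0.
rewrite normrN normrM normfV [`|c * R_ n|]gtr0_norm ?mulr_gt0// ler_pdivrMr ?mulr_gt0//.
apply: (le_trans h3); rewrite mulrA -ler_pdivrMl ?mulr_gt0// mulrC.
by near: n; move/cvgryPge: Roo => /(_ (E3 / (e * c))).
Unshelve. all: by end_near. Qed.

Lemma R_over_Sig : R_ n * a n @[n --> \oo] --> c.
Proof.
have h := ratio_cvg (@ltr01 R); have c1 : 1 / c != 0 by rewrite mul1r invr_eq0 lt0r_neq0.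
have hV : (Sig (1 * R_ n) / R_ n)^-1 @[n --> \oo] --> (1 / c)^-1 by apply: cvgV.
rewrite mul1r invrK in hV; apply: cvg_trans hV; apply: near_eq_cvg; apply: nearW => n.
by rewrite mul1r invfM invrK mulrC.
Qed.

Lemma a_cvg0 : a n @[n --> \oo] --> 0.
Proof.
have h := R_over_Sig; have i : (R_ n)^-1 @[n --> \oo] --> 0 by apply/gtr0_cvgV0 => //; exact: nearW.
have hm : (R_ n)^-1 * (R_ n * a n) @[n --> \oo] --> 0 * c by apply: cvgM.
rewrite mul0r in hm; apply: cvg_trans hm; apply: near_eq_cvg; apply: nearW => n.
by rewrite /= mulrA mulVf ?mul1r// lt0r_neq0.
Qed.

Lemma Sig_ratio (t : R) : 0 < t -> Sig (R_ n) / Sig (t * R_ n) @[n --> \oo] --> t^-1.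
Proof.
move=> t0; have h := ratio_cvg t0; have h1 := ratio_cvg (@ltr01 R).
have tc : t / c != 0 by rewrite mulf_neq0// ?invr_eq0 lt0r_neq0.
have hV : (Sig (t * R_ n) / R_ n)^-1 @[n --> \oo] --> (t / c)^-1 by apply: cvgV.
have hm : Sig (1 * R_ n) / R_ n * (Sig (t * R_ n) / R_ n)^-1 @[n --> \oo] --> 1 / c * (t / c)^-1 by apply: cvgM.
have E : 1 / c * (t / c)^-1 = t^-1 by field; rewrite !lt0r_neq0.
rewrite E in hm; apply: cvg_trans hm; apply: near_eq_cvg; near=> n.
have h2 : r0 <= t * R_ n.
  by rewrite mulrC -ler_pdivrMr//; near: n; move/cvgryPge: Roo => /(_ (r0 / t)).
have S2 := Sig1 h2; have S3 : 0 < Sig (t * R_ n) by lra.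
by rewrite /= mul1r; field; rewrite !lt0r_neq0.
Unshelve. all: by end_near. Qed.

Definition covf (s t : R) : R := \int[leb]_(x in cutset ap) (Phi (x / s) * (1 - Phi (x / t))).

Let int1 (k : R) : 0 < k -> leb.-integrable (cutset ap) (EFin \o (fun x => Phi (k * x))).
Proof.
move=> k0; apply: (@integrableS _ _ _ leb `]0, +oo[%classic).
- exact: measurable_itv.
- exact: cutset_measurable.
- by move=> x [x0 _]; rewrite /= in_itv/= x0.
- exact: (tail_integrable P0 P1 Pm PK k0).
Qed.

Let int2 (k l : R) : 0 < k -> 0 < l -> leb.-integrable (cutset ap) (EFin \o (fun x => Phi (k * x) * Phi (l * x))).
Proof.
move=> k0 l0; have mc := cutset_measurable ap.
apply: (@le_integrable _ _ _ leb _ mc _ (EFin \o (fun x => Phi (k * x)))) => //.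
- apply: (@mono_measurable _ (fun x => Phi (k * x) * Phi (l * x))) => // x y xy.
  by apply: ler_pM => //; apply: Pm; rewrite ler_pM2l.
- by move=> x _; rewrite /= lee_fin !ger0_norm ?mulr_ge0// ler_piMr.
- exact: int1.
Qed.

Lemma covf_integrable (s t : R) : 0 < s -> 0 < t ->
  leb.-integrable (cutset ap) (EFin \o (fun x => Phi (x / s) * (1 - Phi (x / t)))).
Proof.
move=> s0 t0; have s'0 : 0 < s^-1 by rewrite invr_gt0.
have t'0 : 0 < t^-1 by rewrite invr_gt0.
have mc := cutset_measurable ap.
have := @integrableB _ _ _ leb _ mc _ _ (int1 s'0) (int2 s'0 t'0).
congr (integrable _ _ _); apply/funext => x /=; rewrite -EFinB; congr (_%:E).
by rewrite ![x / _]mulrC; ring.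
Qed.

(** The ratio tends to 1/s, so the floor 1/(2s) is eventually inactive; it provides the majorant
    Phi(x / (2s)) valid for all n. *)
Let u (s : R) n := maxr (Sig (R_ n) / Sig (s * R_ n)) (2 * s)^-1.

Let u_cvg (s : R) : 0 < s -> u s n @[n --> \oo] --> s^-1.
Proof.
move=> s0; have h := Sig_ratio s0; have e0 : 0 < s^-1 / 2 by rewrite divr_gt0// invr_gt0.
apply: cvg_trans h; apply: near_eq_cvg; near=> n.
rewrite /u max_l//.
have : `|s^-1 - Sig (R_ n) / Sig (s * R_ n)| < s^-1 / 2.
  by near: n; move/cvgrPdist_lt: (Sig_ratio s0) => /(_ _ e0).
rewrite ltr_norml => /andP[_ h]; rewrite invfM.
have -> : 2^-1 * s^-1 = s^-1 / 2 by rewrite mulrC.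
by lra.
Unshelve. all: by end_near. Qed.

Let u_ge (s : R) n : (2 * s)^-1 <= u s n.
Proof. by rewrite /u le_max lexx orbT. Qed.

Let one_sum (s : R) : 0 < s -> \sum_(j < N_ n) a n * Phi (u s n * (a n * j.+1%:R)) @[n --> \oo] -->
  \int[leb]_(x in cutset ap) Phi (s^-1 * x).
Proof.
move=> s0; have k0 : 0 < (2 * s)^-1 by rewrite invr_gt0 mulr_gt0.
have s'0 : 0 < s^-1 by rewrite invr_gt0.
have un n : 0 < u s n by exact: lt_le_trans (u_ge s n).
apply: (@riemann_cvg _ Phi K P0 P1 Pm PK a N_ (fun n x => Phi (u s n * x)) (fun x => Phi (s^-1 * x)) ap _ k0 a0 a_cvg0) => //.
- by move=> n x y xy; apply: Pm; rewrite ler_pM2l.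
- by move=> x y xy; apply: Pm; rewrite ler_pM2l.
- by move=> n x x0; apply: Pm; rewrite ler_pM2r.
- by move=> x x0; apply: Pm; rewrite ler_pM2r// invfM ler_piMl ?(ltW s'0)// invf_le1// ler1n.
- by move=> x; apply: Pc; apply: cvgMl; exact: u_cvg.
- by move: hap; apply: cvg_trans; apply: near_eq_cvg; apply: nearW => n; rewrite mulrC.
Qed.

Let two_sum (s t : R) : 0 < s -> 0 < t ->
  \sum_(j < N_ n) a n * (Phi (u s n * (a n * j.+1%:R)) * Phi (u t n * (a n * j.+1%:R))) @[n --> \oo] -->
  \int[leb]_(x in cutset ap) (Phi (s^-1 * x) * Phi (t^-1 * x)).
Proof.
move=> s0 t0; have k0 : 0 < (2 * s)^-1 by rewrite invr_gt0 mulr_gt0.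
have s'0 : 0 < s^-1 by rewrite invr_gt0.
have t'0 : 0 < t^-1 by rewrite invr_gt0.
have un n : 0 < u s n by exact: lt_le_trans (u_ge s n).
have vn n : 0 < u t n by apply: lt_le_trans (u_ge t n); rewrite invr_gt0 mulr_gt0.
apply: (@riemann_cvg _ Phi K P0 P1 Pm PK a N_ (fun n x => Phi (u s n * x) * Phi (u t n * x))
  (fun x => Phi (s^-1 * x) * Phi (t^-1 * x)) ap _ k0 a0 a_cvg0) => //.
- by move=> n x y xy; apply: ler_pM => //; apply: Pm; rewrite ler_pM2l.
- by move=> x y xy; apply: ler_pM => //; apply: Pm; rewrite ler_pM2l.
- by move=> n x; rewrite mulr_ge0.
- by move=> n x; rewrite mulr_ile1.
- by move=> x; rewrite mulr_ge0.
- move=> n x x0; apply: (@le_trans _ _ (Phi (u s n * x))); first by rewrite ler_piMr.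
  by apply: Pm; rewrite ler_pM2r.
- move=> x x0; apply: (@le_trans _ _ (Phi (s^-1 * x))); first by rewrite ler_piMr.
  by apply: Pm; rewrite ler_pM2r// invfM ler_piMl ?(ltW s'0)// invf_le1// ler1n.
- by move=> x; apply: cvgM; apply: Pc; apply: cvgMl; exact: u_cvg.
- by move: hap; apply: cvg_trans; apply: near_eq_cvg; apply: nearW => n; rewrite mulrC.
Qed.

(** Replacing the probabilities by values of Phi costs at most 2 E2 in the whole sum, which the
    factor [a n] sends to 0. What remains are two Riemann sums, for Phi(x/s) and for Phi(x/s)
    Phi(x/t). *)
Lemma covf_cvg (s t : R) : 0 < s -> 0 < t ->
  a n * \sum_(j < N_ n) p j (s * R_ n) * (1 - p j (t * R_ n)) @[n --> \oo] --> covf s t.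
Proof.
move=> s0 t0; have s'0 : 0 < s^-1 by rewrite invr_gt0.
have t'0 : 0 < t^-1 by rewrite invr_gt0.
have mc := cutset_measurable ap.
have CE : covf s t = \int[leb]_(x in cutset ap) Phi (s^-1 * x) -
    \int[leb]_(x in cutset ap) (Phi (s^-1 * x) * Phi (t^-1 * x)).
  rewrite -(@RintegralB _ _ _ leb _ _ _ mc (int1 s'0) (int2 s'0 t'0)) /covf; apply: eq_Rintegral => x _.
  by rewrite ![x / _]mulrC; ring.
have uM (r : R) : 0 < r -> \forall n \near \oo, r0 <= r * R_ n /\ u r n = Sig (R_ n) / Sig (r * R_ n).
  move=> rp; have e1 : 0 < r^-1 / 2 by rewrite divr_gt0// invr_gt0.
  near=> m; split.
    by rewrite mulrC -ler_pdivrMr//; near: m; move/cvgryPge: Roo => /(_ (r0 / r)).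
  rewrite /u max_l//.
  have : `|r^-1 - Sig (R_ m) / Sig (r * R_ m)| < r^-1 / 2.
    by near: m; move/cvgrPdist_lt: (Sig_ratio rp) => /(_ _ e1).
  rewrite ltr_norml => /andP[_ h]; rewrite invfM.
  have -> : 2^-1 * r^-1 = r^-1 / 2 by rewrite mulrC.
  by lra.
have cv : \sum_(j < N_ n) a n * Phi (u s n * (a n * j.+1%:R)) -
    \sum_(j < N_ n) a n * (Phi (u s n * (a n * j.+1%:R)) * Phi (u t n * (a n * j.+1%:R))) @[n --> \oo] --> covf s t.
  by rewrite CE; apply: cvgB; [exact: one_sum|exact: two_sum].
have d0 : a n * \sum_(j < N_ n) p j (s * R_ n) * (1 - p j (t * R_ n)) -
   (\sum_(j < N_ n) a n * Phi (u s n * (a n * j.+1%:R)) -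
    \sum_(j < N_ n) a n * (Phi (u s n * (a n * j.+1%:R)) * Phi (u t n * (a n * j.+1%:R)))) @[n --> \oo] --> 0.
  apply/cvgrPdist_le => e e0.
  have : a n * (2 * E2) @[n --> \oo] --> 0 by rewrite -(mul0r (2 * E2)); apply: cvgMl; exact: a_cvg0.
  move=> /cvgr0Pnorm_le/(_ _ e0) hh; near=> n; rewrite sub0r normrN.
  have uE (r : R) j : 0 < r -> r0 <= r * R_ n -> u r n = Sig (R_ n) / Sig (r * R_ n) ->
      u r n * (a n * j.+1%:R) = j.+1%:R / Sig (r * R_ n).
    move=> rp rr ->; have S1 := Sig1 rr; have S2 := Sig1 (RL n).
    by rewrite /a; field; rewrite !lt0r_neq0//; lra.
  have [s1 s2] : r0 <= s * R_ n /\ u s n = Sig (R_ n) / Sig (s * R_ n) by near: n; exact: uM.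
  have [t1 t2] : r0 <= t * R_ n /\ u t n = Sig (R_ n) / Sig (t * R_ n) by near: n; exact: uM.
  under [X in _ - (X - _)]eq_bigr do rewrite uE//.
  under [X in _ - (_ - X)]eq_bigr do rewrite !uE//.
  rewrite -!mulr_sumr -!mulrBr normrM (gtr0_norm (a0 n)) -sumrB -sumrB.
  apply: (@le_trans _ _ (a n * (2 * E2))).
    apply: ler_wpM2l; first exact: ltW.
    apply: le_trans (ler_norm_sum _ _ _) _.
    have := lerD (pPhi (N_ n) s1) (pPhi (N_ n) t1); rewrite -big_split/= => h.
    rewrite mulr_natl mulr2n; apply: le_trans h; apply: ler_sum => j _.
    move: (p0 j (s * R_ n)) (p1 j (s * R_ n)) (p0 j (t * R_ n)) (p1 j (t * R_ n)).
    move: (P0 (j.+1%:R / Sig (s * R_ n))) (P1 (j.+1%:R / Sig (s * R_ n))).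
    move: (P0 (j.+1%:R / Sig (t * R_ n))) (P1 (j.+1%:R / Sig (t * R_ n))).
    move: (p _ _) (p _ _) (Phi _) (Phi _) => y x w z z0 z1 w0 w1 x0 x1 y0 y1.
    (* One factor is changed at a time, the other staying in [0, 1], so the error is at most |x - w|
       + |y - z|. *)
    have -> : x * (1 - y) - (w - w * z) = (x - w) * (1 - y) - w * (y - z) by ring.
    apply: le_trans (ler_normB _ _) _; rewrite !normrM (ger0_norm w0) [`|1 - y|]ger0_norm; last by lra.
    by apply: lerD; [rewrite ler_piMr//; lra|rewrite ler_piMl].
  apply: le_trans (ler_norm _) _.
  by near: n.
pose G n := \sum_(j < N_ n) a n * Phi (u s n * (a n * j.+1%:R)) -
    \sum_(j < N_ n) a n * (Phi (u s n * (a n * j.+1%:R)) * Phi (u t n * (a n * j.+1%:R))).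
have h : (a n * (\sum_(j < N_ n) p j (s * R_ n) * (1 - p j (t * R_ n))) - G n) + G n @[n --> \oo] --> 0 + covf s t.
  by apply: cvgD; [exact: d0|exact: cv].
by move: h; rewrite add0r; under eq_fun do rewrite subrK.
Unshelve. all: by end_near. Qed.

(** Symmetric extension of the integral formula, with value 0 as soon as a time is not positive: the
    process starts at 0. *)
Definition cov (s t : R) : R :=
  if (0 < s) && (0 < t) then covf (minr s t) (maxr s t) else 0.

Lemma cov_sym s t : cov s t = cov t s.
Proof. by rewrite /cov andbC minC maxC. Qed.

Lemma cov0 t : cov 0 t = 0.
Proof. by rewrite /cov ltxx. Qed.

(** Covariance of the indicators that the j-th point is at most s R and at most t R. *)
Definition prec n j (s t : R) : R := p j (minr s t * R_ n) - p j (s * R_ n) * p j (t * R_ n).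

Lemma prec_cvg (s t : R) : 0 <= s -> 0 <= t -> a n * \sum_(j < N_ n) prec n j s t @[n --> \oo] --> cov s t.
Proof.
wlog st : s t / s <= t => [H s0 t0|s0 t0].
  have [st|/ltW ts] := leP s t; first exact: H.
  have -> : (fun n => a n * \sum_(j < N_ n) prec n j s t) = (fun n => a n * \sum_(j < N_ n) prec n j t s).
    by apply/funext => n; congr (_ * _); apply: eq_bigr => j _; rewrite /prec minC [p _ _ * _]mulrC.
  by rewrite cov_sym; exact: H.
have E n : \sum_(j < N_ n) prec n j s t = \sum_(j < N_ n) p j (s * R_ n) * (1 - p j (t * R_ n)).
  by apply: eq_bigr => j _; rewrite /prec min_l//; ring.
under eq_fun do rewrite E.
have [sp|sn] := ltP 0 s.
  have tp : 0 < t by exact: lt_le_trans st.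
  by rewrite /cov sp tp/= min_l// max_r//; exact: covf_cvg.
have {s0 sn}-> : s = 0 by apply/eqP; rewrite eq_le sn s0.
(* At s = 0 the expected number of points at level 0 is at most M, a bounded quantity multiplied by
   [a n]. *)
rewrite cov0; apply: (@squeeze_cvgr _ _ _ _ (fun=> 0) (fun n => a n * M)).
- apply: nearW => n; rewrite mulr_ge0 ?(ltW (a0 n))//=; last first.
    by apply: sumr_ge0 => j _; rewrite mulr_ge0// subr_ge0.
  rewrite ler_wpM2l// ?(ltW (a0 n))//; apply: le_trans (B0 (N_ n)).
  by apply: ler_sum => j _; rewrite mul0r ler_piMr// gerBl.
- exact: cvg_cst.
- by rewrite -(mul0r M); apply: cvgMl; exact: a_cvg0.
Qed.

(** With x and y the probabilities at sR and tR, one point contributes (y - x) - (y - x)^2 <= y - x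
    to the variance of the increment. The sum is at most (t - s) R + M, and R / Sig tends to c. *)
Lemma cov_incr (s t : R) : 0 <= s -> s <= t -> cov s s + cov t t - 2 * cov s t <= c * (t - s).
Proof.
move=> s0 st; have t0 := le_trans s0 st.
have cv : a n * (\sum_(j < N_ n) prec n j s s) + a n * (\sum_(j < N_ n) prec n j t t) -
    2 * (a n * \sum_(j < N_ n) prec n j s t) @[n --> \oo] --> cov s s + cov t t - 2 * cov s t.
  by apply: cvgB; [apply: cvgD|apply: cvgMr]; exact: prec_cvg.
have up : (t - s) * (R_ n * a n) + a n * M @[n --> \oo] --> c * (t - s).
  rewrite (_ : c * (t - s) = (t - s) * c + 0 * M); last by ring.
  apply: cvgD.
    by apply: cvgMr; exact: R_over_Sig.
  by apply: cvgMl; exact: a_cvg0.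
rewrite -(cvg_lim (@Rhausdorff R) cv) -(cvg_lim (@Rhausdorff R) up); apply: ler_lim.
- by apply/cvg_ex; eexists; exact: cv.
- by apply/cvg_ex; eexists; exact: up.
apply: nearW => n /=.
have sR : 0 <= s * R_ n by rewrite mulr_ge0// ltW.
have stR : s * R_ n <= t * R_ n by rewrite ler_pM2r.
have -> : (t - s) * (R_ n * a n) + a n * M = a n * ((t * R_ n - s * R_ n) + M) by ring.
have := ler_wpM2l (ltW (a0 n)) (B3 (N_ n) sR stR); apply: le_trans.
rewrite -!mulrDr (mulrCA 2) -mulrBr ler_wpM2l// ?(ltW (a0 n))//.
rewrite mulr_sumr -big_split/= -sumrB; apply: ler_sum => j _.
rewrite /prec !minxx min_l//.
move: (p j (s * R_ n)) (p j (t * R_ n)) => x y; rewrite -subr_ge0.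
by rewrite (_ : _ - _ = (y - x) ^+ 2) ?sqr_ge0//; ring.
Qed.

End Asymptotics.

(** * Central limit theorem and modulus of continuity *)

Lemma Pr_union_sum {R : realType} {d : measure_display} {T : measurableType d} (P : probability T R)
    (A : nat -> set T) (n : nat) (u : nat -> R) : (forall k, measurable (A k)) ->
  (forall k, (k < n)%N -> Pr P (A k) <= u k) ->
  measurable [set w | exists2 k, (k < n)%N & A k w] /\
  Pr P [set w | exists2 k, (k < n)%N & A k w] <= \sum_(k < n) u k.
Proof.
move=> mA; elim: n => [|n IH] hA.
  have -> : [set w | exists2 k, (k < 0)%N & A k w] = set0 by apply/seteqP; split => w // [].
  by split; [exact: measurable0|rewrite /Pr measure0 big_ord0].
have -> : [set w | exists2 k, (k < n.+1)%N & A k w] = [set w | exists2 k, (k < n)%N & A k w] `|` A n.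
  apply/seteqP; split => w.
    move=> [k]; rewrite ltnS leq_eqVlt => /orP[/eqP ->|kn] Ak; first by right.
    by left; exists k.
  move=> [[k kn Ak]|An]; last by exists n.
  by exists k => //; exact: ltnW.
have [mI hI] := IH (fun k kn => hA k (ltnW kn)).
split; first exact: measurableU.
by rewrite big_ord_recr/=; apply: le_trans (Pr_setU _ _ _) _ => //; apply: lerD => //; exact: hA.
Qed.

Section Counting.
Context {R : realType} {d : measure_display} {T : measurableType d} (P : probability T R).
Variable zeta : nat -> T -> R.
Hypothesis mz : forall i, measurable_fun setT (zeta i).
Hypothesis iz : forall n (B : nat -> set R), (forall i, measurable (B i)) ->
  Pr P [set w | forall i, (i < n)%N -> B i (zeta i w)] = \prod_(i < n) Pr P (zeta i @^-1` B i).

Definition pz j (r : R) := Pr P [set w | zeta j w <= r].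

Definition Xi n (r : R) w : R := \sum_(j < n) (((zeta j w <= r)%R)%:R - pz j r).

Lemma pz_ge0 j r : 0 <= pz j r.
Proof. exact: Pr_ge0. Qed.

Lemma pz_le1 j r : pz j r <= 1.
Proof. by apply: Pr_le1; exact: measurable_le. Qed.

Lemma pz_mono j (r r' : R) : r <= r' -> pz j r <= pz j r'.
Proof. by move=> rr; apply: Pr_le; [exact: measurable_le..|move=> w /= /le_trans; exact]. Qed.

Lemma pz_itv j (a b : R) : a <= b -> Pr P (zeta j @^-1` `]a, b]%classic) = pz j b - pz j a.
Proof.
move=> ab; have -> : zeta j @^-1` `]a, b]%classic = [set w | zeta j w <= b] `\` [set w | zeta j w <= a].
  apply/seteqP; split => w /=; rewrite in_itv/=.
    by move=> /andP[h1 h2]; split => //; apply/negP; rewrite -ltNge.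
  by move=> [h1 /negP]; rewrite -ltNge => ->.
have m1 := measurable_le (mz j) b; have m2 := measurable_le (mz j) a.
apply: EFin_inj; rewrite EFinB -!PrE//; last exact: measurableD.
rewrite measureD//; last exact: le_lt_trans (probability_le1 P m1) (ltry _).
by congr (_ - P _)%E; apply/seteqP; split => w /=; [case|split => //; exact: le_trans ab].
Qed.

Lemma Xi_measurable n r : measurable_fun setT (Xi n r).
Proof.
apply: measurable_sum => j; apply: measurable_funB => //.
have -> : (fun w => ((zeta j w <= r)%R)%:R) = \1_[set w | zeta j w <= r] :> (T -> R).
  apply/funext => w; rewrite indicE; congr (_%:R : R); congr nat_of_bool.
  by apply/idP/idP; rewrite inE.
by apply: measurable_indic; exact: measurable_le.
Qed.

Section Moment.
Variable B : set R.
Hypothesis mB : measurable B.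
Let q j := Pr P (zeta j @^-1` B).
Let phi j (x : R) : R := \1_B x - q j.

Let q01 j : 0 <= q j <= 1.
Proof. by rewrite Pr_ge0/=; apply: Pr_le1; exact: preim_measurable. Qed.

Let bphi j : bmR (phi j).
Proof. by apply: bmfB; [exact: bmf_indic|exact: bmf_cst]. Qed.

Let bI j : bmf (fun w => \1_B (zeta j w) : R).
Proof. exact: (bmR_comp (bmf_indic mB) (mz j)). Qed.

Let EI j : Ex P (fun w => \1_B (zeta j w)) = q j.
Proof. by rewrite /q -Ex_indic//; exact: preim_measurable. Qed.

Lemma count_moment4 n (Q : R) : \sum_(j < n) q j <= Q ->
  Ex P (fun w => (\sum_(j < n) (\1_B (zeta j w) - q j)) ^+ 4) <= 3 * Q ^+ 2 + Q.
Proof.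
move=> hQ; have S0 : 0 <= \sum_(j < n) q j by apply: sumr_ge0 => j _; have /andP[] := q01 j.
have phi0 j : Ex P (fun w => phi j (zeta j w)) = 0.
  by rewrite /phi (ExB P (bI j) (bmf_cst _)) EI Ex_cst subrr.
have ph1 j x : `|phi j x| <= 1.
  have /andP[h0 h1] := q01 j; rewrite /phi indicE; case: (_ \in _) => /=; rewrite ler_norml; apply/andP; split; lra.
have sgq j : Ex P (fun w => phi j (zeta j w) ^+ 2) <= q j.
  have -> : (fun w => phi j (zeta j w) ^+ 2) = (fun w => (1 - 2 * q j) * \1_B (zeta j w) + q j ^+ 2).
    by apply/funext => w; rewrite /phi indicE; case: (_ \in _) => /=; ring.
  rewrite (ExD P (bmfZ _ (bI j)) (bmf_cst _)) (ExZ P _ (bI j)) EI Ex_cst.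
  by have := sqr_ge0 (q j); rewrite expr2; lra.
have := @Ex_psum4 _ _ _ P zeta mz iz phi bphi phi0 q n ph1 sgq.
rewrite /psum /phi => /le_trans; apply.
have : (\sum_(j < n) q j) ^+ 2 <= Q ^+ 2 by rewrite ler_sqr ?nnegrE//; exact: le_trans hQ.
lra.
Qed.

Lemma count_tail n (Q e : R) : \sum_(j < n) q j <= Q -> 0 < e ->
  Pr P [set w | e < `|\sum_(j < n) (\1_B (zeta j w) - q j)|] <= (3 * Q ^+ 2 + Q) / e ^+ 4.
Proof.
move=> hQ e0; apply: le_trans (markov4 P (f := fun w => \sum_(j < n) (\1_B (zeta j w) - q j)) _ e0) _.
  by apply: bmf_sum => j; apply: bmfB; [exact: bI|exact: bmf_cst].
by rewrite ler_pM2r ?invr_gt0 ?exprn_gt0//; exact: count_moment4.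
Qed.

End Moment.

Lemma Xi_itv n (a b : R) w : a <= b ->
  Xi n b w - Xi n a w = \sum_(j < n) (\1_(`]a, b]%classic) (zeta j w) - Pr P (zeta j @^-1` `]a, b]%classic)).
Proof.
move=> ab; rewrite /Xi -sumrB; apply: eq_bigr => j _; rewrite pz_itv//.
have -> : \1_(`]a, b]%classic) (zeta j w) = ((zeta j w <= b)%R)%:R - ((zeta j w <= a)%R)%:R :> R.
  rewrite indicE; have [h|h] := leP (zeta j w) a.
    by rewrite (le_trans h ab) subrr memNset//= in_itv/= ltNge h.
  rewrite subr0; congr (_%:R); congr nat_of_bool.
  by apply/idP/idP; rewrite inE/= in_itv/= h.
by ring.
Qed.

(** Xi is a counting function minus its mean, both nondecreasing in the level; an inner increment is
    therefore controlled by the outer one and the mean count. *)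
Lemma Xi_between n (a b e : R) w : a <= b -> b <= e ->
  `|Xi n b w - Xi n a w| <= `|Xi n e w - Xi n a w| + \sum_(j < n) (pz j e - pz j a).
Proof.
move=> ab be.
have E (x y : R) : Xi n y w - Xi n x w = \sum_(j < n) ((((zeta j w <= y)%R)%:R : R) - ((zeta j w <= x)%R)%:R) -
    \sum_(j < n) (pz j y - pz j x).
  by rewrite /Xi -!sumrB; apply: eq_bigr => j _; ring.
rewrite !E.
have h1 : 0 <= \sum_(j < n) ((((zeta j w <= b)%R)%:R : R) - ((zeta j w <= a)%R)%:R).
  apply: sumr_ge0 => j _; have [h|h] := leP (zeta j w) a; first by rewrite (le_trans h ab) subrr.
  by rewrite subr0.
have h2 : \sum_(j < n) ((((zeta j w <= b)%R)%:R : R) - ((zeta j w <= a)%R)%:R) <=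
    \sum_(j < n) ((((zeta j w <= e)%R)%:R : R) - ((zeta j w <= a)%R)%:R).
  apply: ler_sum => j _; rewrite lerD2r; have [h|h] := leP (zeta j w) b; first by rewrite (le_trans h be).
  by [].
have h3 : 0 <= \sum_(j < n) (pz j b - pz j a) by apply: sumr_ge0 => j _; rewrite subr_ge0 pz_mono.
have h4 : \sum_(j < n) (pz j b - pz j a) <= \sum_(j < n) (pz j e - pz j a).
  by apply: ler_sum => j _; rewrite lerD2r pz_mono.
move: (\sum_(j < n) _) (\sum_(j < n) _) (\sum_(j < n) (pz j b - pz j a)) (\sum_(j < n) _) h1 h2 h3 h4 => x z y u h1 h2 h3 h4.
have h5 := ler_norm (z - x); have h6 := normr_ge0 (z - x).
by rewrite ler_norml; apply/andP; split; lra.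
Qed.

End Counting.

Section Array.
Context {R : realType} {d : measure_display} {T : measurableType d} (P : probability T R).
Variable zeta : nat -> T -> R.
Hypothesis mz : forall i, measurable_fun setT (zeta i).
Hypothesis iz : forall n (B : nat -> set R), (forall i, measurable (B i)) ->
  Pr P [set w | forall i, (i < n)%N -> B i (zeta i w)] = \prod_(i < n) Pr P (zeta i @^-1` B i).
Local Notation p := (pz P zeta).
Variables (R_ Sg : nat -> R) (N_ : nat -> nat).
Hypotheses (R0 : forall n, 0 < R_ n) (S0 : forall n, 0 < Sg n) (Sinv : (Sg n)^-1 @[n --> \oo] --> 0).

Definition arr n w (t : R) : R := Xi P zeta (N_ n) (t * R_ n) w / Num.sqrt (Sg n).

Let sq0 n : 0 < Num.sqrt (Sg n).
Proof. by rewrite sqrtr_gt0. Qed.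

Lemma arr_measurable n t : measurable_fun setT (fun w => arr n w t).
Proof. by apply: measurable_funM => //; exact: Xi_measurable. Qed.

Lemma sqrt_inv_cvg (B : R) : B / Num.sqrt (Sg n) @[n --> \oo] --> 0.
Proof.
apply: (@cvg0_dominated_sqr _ _ (fun n => B ^+ 2 * (Sg n)^-1)).
  by move=> n; rewrite exprMn exprVn sqr_sqrtr// ltW.
by rewrite -(mulr0 (B ^+ 2)); apply: cvgMr.
Qed.

Section CLT.
Variable C : R -> R -> R.
Hypothesis hC : forall s t : R, 0 <= s -> 0 <= t ->
  (Sg n)^-1 * \sum_(j < N_ n) prec p R_ n j s t @[n --> \oo] --> C s t.

Let ind n j (x t : R) : R := ((x <= t * R_ n)%R)%:R - p j (t * R_ n).

Let ind_le1 n j x t : `|ind n j x t| <= 1.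
Proof.
rewrite /ind; have := pz_ge0 P zeta j (t * R_ n); have := pz_le1 P mz j (t * R_ n).
move: (p j _) => y; case: (x <= t * R_ n); rewrite /= ler_norml => h1 h2; apply/andP; split; lra.
Qed.

Let le_indic (a : R) : (fun x : R => ((x <= a)%R)%:R) = \1_(`]-oo, a]%classic) :> (R -> R).
Proof.
apply/funext => x; rewrite indicE; congr (_%:R : R); congr nat_of_bool.
by apply/idP/idP; rewrite inE/= in_itv.
Qed.

Let bind n j t : bmR (fun x => ind n j x t).
Proof.
apply: bmfB; last exact: bmf_cst.
by rewrite le_indic; exact: bmf_indic.
Qed.

Let Ele j (a : R) : Ex P (fun w => (((zeta j w <= a)%R)%:R : R)) = p j a.
Proof.
rewrite /pz -Ex_indic; last exact: measurable_le.
congr Ex; apply/funext => w; rewrite indicE; congr (_%:R : R); congr nat_of_bool.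
by apply/idP/idP; rewrite inE.
Qed.

Let ble j (a : R) : bmf (fun w => (((zeta j w <= a)%R)%:R : R)).
Proof.
by have := @bmR_comp _ _ _ (fun x : R => ((x <= a)%R)%:R) (zeta j); rewrite le_indic; apply => //; exact: bmf_indic.
Qed.

Let E_ind n j (s t : R) : 0 <= s -> 0 <= t ->
  Ex P (fun w => ind n j (zeta j w) s * ind n j (zeta j w) t) = prec p R_ n j s t.
Proof.
move=> s0 t0.
have -> : (fun w => ind n j (zeta j w) s * ind n j (zeta j w) t) =
  (fun w => ((((zeta j w <= minr s t * R_ n)%R)%:R - p j (t * R_ n) * ((zeta j w <= s * R_ n)%R)%:R) -
     p j (s * R_ n) * ((zeta j w <= t * R_ n)%R)%:R) + p j (s * R_ n) * p j (t * R_ n)).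
  apply/funext => w; rewrite /ind.
  have -> : ((zeta j w <= minr s t * R_ n)%R)%:R = ((zeta j w <= s * R_ n)%R)%:R * ((zeta j w <= t * R_ n)%R)%:R :> R.
    have -> : minr s t * R_ n = minr (s * R_ n) (t * R_ n) by rewrite minr_pMl// ltW.
    by rewrite le_min; case: (_ <= _); case: (_ <= _); rewrite /= ?mulr0 ?mulr1.
  by ring.
have b1 := ble j (minr s t * R_ n); have b2 := ble j (s * R_ n); have b3 := ble j (t * R_ n).
rewrite (ExD P (bmfB (bmfB b1 (bmfZ _ b2)) (bmfZ _ b3)) (bmf_cst _)) (ExB P (bmfB b1 (bmfZ _ b2)) (bmfZ _ b3)).
rewrite (ExB P b1 (bmfZ _ b2)) (ExZ P _ b2) (ExZ P _ b3) !Ele Ex_cst /prec; ring.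
Qed.

Let phi n (s : seq (R * R)) j (x : R) : R := lfun s (ind n j x) / Num.sqrt (Sg n).

Let phi_bmf n s j : bmR (phi n s j).
Proof.
apply: bmfM; last exact: bmf_cst.
by rewrite /lfun; apply: bmf_sum => q; apply: bmfZ; exact: bind.
Qed.

Let arr_psum n s w : lfun s (arr n w) = psum zeta (phi n s) (N_ n) w.
Proof.
rewrite /psum /phi /lfun -mulr_suml exchange_big/= mulr_suml; apply: eq_bigr => q _.
by rewrite /arr /Xi mulrA; congr (_ / _); rewrite mulr_sumr.
Qed.

Let phi0 n s j : Ex P (fun w => phi n s j (zeta j w)) = 0.
Proof.
have b t : bmf (fun w => ind n j (zeta j w) t) := bmR_comp (bind n j t) (mz j).
have bb (q : R * R) : bmf (fun w => q.2 * ind n j (zeta j w) q.1) by exact: bmfZ.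
rewrite /phi; under eq_fun do rewrite mulrC.
rewrite ExZ; last by apply: bmf_sum.
rewrite /lfun (Ex_sum P _ _ bb) big1 ?mulr0// => q _.
rewrite (ExZ P _ (b _)) /ind (ExB P (ble j _) (bmf_cst _)) Ele Ex_cst subrr mulr0 //.
Qed.

Let quadV n (s : seq (R * R)) := quad (fun a b => (Sg n)^-1 * \sum_(j < N_ n) prec p R_ n j a b) s.

Let E_phi2 n s j : times_in (fun t => 0 <= t) s ->
  Ex P (fun w => phi n s j (zeta j w) ^+ 2) = (Sg n)^-1 * quad (prec p R_ n j) s.
Proof.
move=> ts; have b t : bmf (fun w => ind n j (zeta j w) t) := bmR_comp (bind n j t) (mz j).
have -> : (fun w => phi n s j (zeta j w) ^+ 2) =
  (fun w => (Sg n)^-1 * quad (fun a b => ind n j (zeta j w) a * ind n j (zeta j w) b) s).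
  by apply/funext => w; rewrite /phi exprMn exprVn sqr_sqrtr ?(ltW (S0 n))// quad_rank1 mulrC.
have bb (q r : R * R) : bmf (fun w => q.2 * r.2 * (ind n j (zeta j w) q.1 * ind n j (zeta j w) r.1)).
  by apply: bmfZ; exact: bmfM.
have bs (q : R * R) : bmf (fun w => \sum_(r <- s) q.2 * r.2 * (ind n j (zeta j w) q.1 * ind n j (zeta j w) r.1)).
  by apply: bmf_sum => r; exact: bb.
rewrite ExZ; last by apply: bmf_sum => q; exact: bs.
congr (_ * _); rewrite /quad (Ex_sum P _ _ bs) big_seq [RHS]big_seq; apply: eq_bigr => q qs.
rewrite (Ex_sum P _ _ (bb q)) big_seq [RHS]big_seq; apply: eq_bigr => r rs.
by rewrite (ExZ P _ (bmfM (b _) (b _))) E_ind//; exact: ts.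
Qed.

Let sum_phi2 n s : times_in (fun t => 0 <= t) s ->
  \sum_(j < N_ n) Ex P (fun w => phi n s j (zeta j w) ^+ 2) = quadV n s.
Proof.
move=> ts; under eq_bigr do rewrite E_phi2//.
rewrite -mulr_sumr /quadV quadZ; congr (_ * _).
rewrite /quad exchange_big/=; apply: eq_bigr => q _; rewrite exchange_big/=; apply: eq_bigr => r _.
by rewrite mulr_sumr.
Qed.

Let quadV_cvg s : times_in (fun t => 0 <= t) s -> quadV n s @[n --> \oo] --> quad C s.
Proof.
move=> ts; apply: cvg_sum_seq => q qs.
apply: (@cvg_sum_seq _ _ _ (fun n r => q.2 * r.2 * ((Sg n)^-1 * \sum_(j < N_ n) prec p R_ n j q.1 r.1))) => r rs.
by apply: cvgMr; apply: hC; exact: ts.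
Qed.

Let quadV_ge0 n s : times_in (fun t => 0 <= t) s -> 0 <= quadV n s.
Proof.
by move=> ts; rewrite -sum_phi2//; apply: sumr_ge0 => j _; apply: Ex_ge0 => w; exact: sqr_ge0.
Qed.

(** The form is a limit of variances of linear combinations of the prelimit process. *)
Lemma clt_nonneg : nonneg_def C.
Proof.
move=> s ts; rewrite -(cvg_lim (@Rhausdorff R) (quadV_cvg ts)).
apply: limr_ge; first by apply/cvg_ex; eexists; exact: quadV_cvg.
by apply: nearW => n; exact: quadV_ge0.
Qed.

(** A linear combination of the coordinates is a sum of independent centred terms bounded by B /
    sqrt(Sig), so [clt_bound] applies with b tending to 0 and converging variances. *)
Lemma clt_fdd s b : times_in (fun t => 0 <= t) s ->
  Ex P (fun w => cos (lfun s (arr n w) + b)) @[n --> \oo] --> expR (- (quad C s / 2)) * cos b.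
Proof.
move=> ts; pose B : R := \sum_(q <- s) `|q.2|.
have B0 : 0 <= B by apply: sumr_ge0.
pose bn n : R := B / Num.sqrt (Sg n).
have bn0 n : 0 <= bn n by rewrite divr_ge0// sqrtr_ge0.
have bC : bn n @[n --> \oo] --> 0 by exact: sqrt_inv_cvg.
have vC := quadV_cvg ts.
have phib n j x : `|phi n s j x| <= bn n.
  rewrite /phi /bn normrM normfV (gtr0_norm (sq0 n)) ler_pM2r ?invr_gt0//.
  apply: le_trans (ler_norm_sum _ _ _) _; apply: ler_sum => q _.
  by rewrite normrM ler_piMr// ind_le1.
have mp n : measurable_fun setT (psum zeta (phi n s) (N_ n)).
  apply: measurable_sum => j; apply: measurableT_comp => //; exact: (phi_bmf n s j).1.
have H : \forall n \near \oo, `|Ex P (fun w => cos (psum zeta (phi n s) (N_ n) w)) - expR (- (quadV n s / 2))| <= 2 * bn n * quadV n s /\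
  `|Ex P (fun w => sin (psum zeta (phi n s) (N_ n) w))| <= bn n * quadV n s.
  near=> n; have b1 : bn n <= 1.
    apply: le_trans (ler_norm _) _; near: n; move/cvgr0Pnorm_le: bC; exact.
  have h01 : 0 <= bn n <= 1 by rewrite bn0.
  have := @clt_bound _ _ _ P zeta mz iz (phi n s) (fun j => (phi_bmf n s j).1) (phi_bmf n s) (phi0 n s) (bn n) (N_ n) h01 (phib n).
  by rewrite /= sum_phi2.
have bv : bn n * quadV n s @[n --> \oo] --> 0 by rewrite -(mul0r (quad C s)); apply: cvgM.
have bv2 : 2 * bn n * quadV n s @[n --> \oo] --> 0.
  by rewrite -(mulr0 2); under eq_fun do rewrite -mulrA; apply: cvgMr.
have c1 : Ex P (fun w => cos (psum zeta (phi n s) (N_ n) w)) @[n --> \oo] --> expR (- (quad C s / 2)).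
  have e1 : expR (- (quadV n s / 2)) @[n --> \oo] --> expR (- (quad C s / 2)).
    by apply: continuous_cvg; [exact: continuous_expR|apply: cvgN; apply: cvgMl].
  have e2 : Ex P (fun w => cos (psum zeta (phi n s) (N_ n) w)) - expR (- (quadV n s / 2)) @[n --> \oo] --> 0.
    apply/cvgr0Pnorm_le => e e0; have /cvgr0Pnorm_le/(_ _ e0) := bv2 => h2.
    near=> n; have [h _] : `|Ex P (fun w => cos (psum zeta (phi n s) (N_ n) w)) - expR (- (quadV n s / 2))| <= 2 * bn n * quadV n s /\
      `|Ex P (fun w => sin (psum zeta (phi n s) (N_ n) w))| <= bn n * quadV n s by near: n.
    by apply: le_trans h _; apply: le_trans (ler_norm _) _; near: n.
  have e3 : (Ex P (fun w => cos (psum zeta (phi n s) (N_ n) w)) - expR (- (quadV n s / 2))) +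
     expR (- (quadV n s / 2)) @[n --> \oo] --> 0 + expR (- (quad C s / 2)) by apply: cvgD.
  by move: e3; rewrite add0r; under eq_fun do rewrite subrK.
have c2 : Ex P (fun w => sin (psum zeta (phi n s) (N_ n) w)) @[n --> \oo] --> 0.
  apply/cvgr0Pnorm_le => e e0; have /cvgr0Pnorm_le/(_ _ e0) := bv => h2.
  near=> n; have [_ h] : `|Ex P (fun w => cos (psum zeta (phi n s) (N_ n) w)) - expR (- (quadV n s / 2))| <= 2 * bn n * quadV n s /\
    `|Ex P (fun w => sin (psum zeta (phi n s) (N_ n) w))| <= bn n * quadV n s by near: n.
  by apply: le_trans h _; apply: le_trans (ler_norm _) _; near: n.
have E n : Ex P (fun w => cos (lfun s (arr n w) + b)) =
    Ex P (fun w => cos (psum zeta (phi n s) (N_ n) w)) * cos b - Ex P (fun w => sin (psum zeta (phi n s) (N_ n) w)) * sin b.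
  have -> : (fun w => cos (lfun s (arr n w) + b)) =
    (fun w => cos b * cos (psum zeta (phi n s) (N_ n) w) - sin b * sin (psum zeta (phi n s) (N_ n) w)).
    by apply/funext => w; rewrite arr_psum cosD; ring.
  have b1 := bmf_cos (mp n); have b2 := bmf_sin (mp n).
  by rewrite (ExB P (bmfZ _ b1) (bmfZ _ b2)) (ExZ P _ b1) (ExZ P _ b2); ring.
under eq_fun do rewrite E.
have -> : expR (- (quad C s / 2)) * cos b = expR (- (quad C s / 2)) * cos b - 0 * sin b by rewrite mul0r subr0.
by apply: cvgB; exact: cvgMl.
Unshelve. all: by end_near. Qed.

End CLT.
End Array.

Lemma dyadic_between {R : realType} (x y : R) : 0 < y -> 2 * y <= x ->
  exists i, y <= x / 2 ^+ i.+1 /\ x / 2 ^+ i.+1 < 2 * y.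
Proof.
move=> y0 yx; have ex : exists i, x / 2 ^+ i < 2 * y.
  have : x * 2 ^- i @[i --> \oo] --> 0 by exact: cvg_half_pow.
  move/cvgr0Pnorm_lt => /(_ (2 * y)); rewrite mulr_gt0// => /(_ isT)[i _ /(_ i (leqnn _))] /= h.
  by exists i; exact: le_lt_trans (ler_norm _) h.
case: (ex_minnP ex) => -[|i]; first by rewrite divr1; lra.
move=> h hmin; exists i; split => //.
have : ~~ (x / 2 ^+ i < 2 * y) by apply/negP => hi; have := hmin i hi; rewrite ltnn.
rewrite -leNgt exprS invfM mulrCA.
by move: (x / 2 ^+ i) => u; lra.
Qed.

(* The chaining step sizes decay like (9/10)^k, which is admissible since 2 * (9/10)^4 > 1. *)
Lemma chain_ratio {R : realType} : exists rho : R,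
  [/\ 0 < rho, rho < 1 & forall k, rho ^+ k = 2 ^- k * ((9 / 10) ^+ k) ^- 4].
Proof.
exists (2^-1 * (9 / 10) ^- 4); split.
- by rewrite mulr_gt0// invr_gt0 exprn_gt0.
- rewrite -invfM invf_lt1; last by rewrite mulr_gt0// exprn_gt0.
  have h : 4 / 5 < (9 / 10) ^+ 2 :> R by rewrite expr2; lra.
  rewrite (exprM _ 2 2); move: ((9 / 10) ^+ 2) h => y h; rewrite expr2.
  have : 4 / 5 * (4 / 5) < y * y by apply: ltr_pM; lra.
  lra.
- by move=> k; rewrite exprMn !exprVn -!exprM mulnC.
Qed.

(** * Tightness of the coordinates and modulus of continuity *)

Section Tightness.
Context {R : realType} {d : measure_display} {T : measurableType d} (P : probability T R).
Variable zeta : nat -> T -> R.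
Hypothesis mz : forall i, measurable_fun setT (zeta i).
Hypothesis iz : forall n (B : nat -> set R), (forall i, measurable (B i)) ->
  Pr P [set w | forall i, (i < n)%N -> B i (zeta i w)] = \prod_(i < n) Pr P (zeta i @^-1` B i).
Local Notation p := (pz P zeta).
Variables (R_ Sg : nat -> R) (N_ : nat -> nat) (c M : R).
Hypotheses (R0 : forall n, 0 < R_ n) (S0 : forall n, 0 < Sg n) (Sinv : (Sg n)^-1 @[n --> \oo] --> 0)
  (RS : R_ n * (Sg n)^-1 @[n --> \oo] --> c) (c0 : 0 < c) (M0 : 0 <= M)
  (B0 : forall n, \sum_(j < n) p j 0 <= M)
  (B3 : forall n (s t : R), 0 <= s -> s <= t -> \sum_(j < n) (p j t - p j s) <= (t - s) + M).
Local Notation X := (arr P zeta R_ Sg N_).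

Let sq0 n : 0 < Num.sqrt (Sg n).
Proof. by rewrite sqrtr_gt0. Qed.

Let sq4 n : Num.sqrt (Sg n) ^+ 4 = Sg n ^+ 2.
Proof. by rewrite (exprM _ 2 2) sqr_sqrtr// ltW. Qed.

Let RS_near : \forall n \near \oo, R_ n * (Sg n)^-1 <= 2 * c.
Proof.
move/cvgrPdist_le: RS => /(_ _ c0); apply: filterS => n; rewrite ler_norml => /andP[h _]; lra.
Qed.

(** Fourth-moment Markov inequality for the count up to level tR. Its mean is at most K Sig, and L
    is chosen with L e = 3 K^2 + K, so the bound is e L / (1 + L)^4 <= e. *)
Lemma arr_tight (t e : R) : 0 <= t -> 0 < e ->
  exists A : R, 0 < A /\ \forall n \near \oo, Pr P [set w | A < `|X n w t|] <= e.
Proof.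
move=> t0 e0; have c0' := c0; have M0' := M0; have [K KE] : exists K : R, K = 2 * c * t + 2 * M + 1 by eexists.
have ct : 0 <= 2 * c * t by apply: mulr_ge0 => //; lra.
have K0 : 0 < K by lra.
have [L LE] : exists L : R, L = (3 * K ^+ 2 + K) / e by eexists.
have L0 : 0 < L by rewrite LE divr_gt0//; have K2 := sqr_ge0 K; lra.
have L1 : 0 < 1 + L by lra.
exists (1 + L); split => //.
have s1 : \forall n \near \oo, (Sg n)^-1 <= 1.
  by move/cvgr0Pnorm_le: Sinv => /(_ 1 ltr01); apply: filterS => n; apply: le_trans (ler_norm _).
near=> n.
have h1 : R_ n * (Sg n)^-1 <= 2 * c by near: n.
have h2 : (Sg n)^-1 <= 1 by near: n.
have i0 : 0 < (Sg n)^-1 by rewrite invr_gt0.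
pose B : set R := `]-oo, (t * R_ n)]%classic.
have mB : measurable B by exact: measurable_itv.
have pE j : Pr P (zeta j @^-1` B) = p j (t * R_ n).
  by congr Pr; apply/seteqP; split => w /=; rewrite /B/= in_itv.
have XE w : X n w t = (\sum_(j < N_ n) (\1_B (zeta j w) - Pr P (zeta j @^-1` B))) / Num.sqrt (Sg n).
  rewrite /arr /Xi; congr (_ / _); apply: eq_bigr => j _; rewrite pE; congr (_ - _).
  by rewrite indicE; congr (_%:R : R); congr nat_of_bool; apply/idP/idP; rewrite inE /B/= in_itv.
have tR : 0 <= t * R_ n by rewrite mulr_ge0// ltW.
have hQ : \sum_(j < N_ n) Pr P (zeta j @^-1` B) <= t * R_ n + 2 * M.
  under eq_bigr do rewrite pE.
  have := B3 (N_ n) (lexx 0) tR; have := B0 (N_ n); rewrite sumrB; lra.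
have -> : [set w | 1 + L < `|X n w t|] =
    [set w | (1 + L) * Num.sqrt (Sg n) < `|\sum_(j < N_ n) (\1_B (zeta j w) - Pr P (zeta j @^-1` B))|].
  apply/seteqP; split => w /=; rewrite XE normrM normfV (gtr0_norm (sq0 n)) ltr_pdivlMr//.
have q0 : 0 < (1 + L) * Num.sqrt (Sg n) by rewrite mulr_gt0.
apply: le_trans (count_tail mz iz mB hQ q0) _.
rewrite [(_ * Num.sqrt _) ^+ 4]exprMn sq4 ler_pdivrMr ?mulr_gt0 ?exprn_gt0//.
have i1 : 0 < Sg n by [].
have Q1 : t * R_ n + 2 * M <= K * Sg n.
  have h3 : R_ n <= 2 * c * Sg n by rewrite -ler_pdivrMr.
  have h4 : 1 <= Sg n by rewrite -[leLHS]invr1 -[leRHS]invrK lef_pV2// posrE ?invr_gt0.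
  have h5 : t * R_ n <= t * (2 * c * Sg n) by rewrite ler_wpM2l.
  have h6 : M * 1 <= M * Sg n by rewrite ler_wpM2l.
  by rewrite KE !mulrDl mul1r; lra.
have Q0 : 0 <= t * R_ n + 2 * M by lra.
have h4 : 1 <= Sg n by rewrite -[leLHS]invr1 -[leRHS]invrK lef_pV2// posrE ?invr_gt0.
have Q2 : 3 * (t * R_ n + 2 * M) ^+ 2 + (t * R_ n + 2 * M) <= (3 * K ^+ 2 + K) * Sg n ^+ 2.
  have : (t * R_ n + 2 * M) ^+ 2 <= (K * Sg n) ^+ 2 by rewrite ler_sqr ?nnegrE// mulr_ge0 ?ltW.
  have : K * Sg n <= K * Sg n ^+ 2.
    apply: ler_wpM2l; first exact: ltW.
    by rewrite expr2 ler_peMl//; exact: ltW.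
  rewrite [(K * Sg n) ^+ 2]exprMn; lra.
apply: (le_trans Q2).
have -> : 3 * K ^+ 2 + K = L * e by rewrite LE divfK// lt0r_neq0.
have L4 : L <= (1 + L) ^+ 4.
  have g1 : 1 <= (1 + L) ^+ 3 by apply: exprn_ege1; lra.
  rewrite exprS; apply: (@le_trans _ _ ((1 + L) * 1)); first lra.
  by rewrite ler_wpM2l//; lra.
by rewrite [X in _ <= X]mulrA ler_pM2r ?exprn_gt0// mulrC ler_pM2l.
Unshelve. all: by end_near. Qed.

Let inc n q k w := X n w (k.+1%:R / 2 ^+ q) - X n w (k%:R / 2 ^+ q).

Let inc_measurable n q k : measurable_fun setT (inc n q k).
Proof. by apply: measurable_funB; exact: arr_measurable. Qed.

(** While x = R / 2^q is at least 1 and M, the mean count of the interval is at most 2 x and 3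
    (2x)^2 + 2x <= 14 x^2; with x <= 2 c 2^-q Sig this gives the constant 14 * 4 = 56. *)
Let inc_tail n q k (e : R) : 0 < e -> R_ n * (Sg n)^-1 <= 2 * c ->
  M <= R_ n / 2 ^+ q -> 1 <= R_ n / 2 ^+ q ->
  Pr P [set w | e < `|inc n q k w|] <= 56 * c ^+ 2 * (2 ^- q) ^+ 2 / e ^+ 4.
Proof.
move=> e0 h1 hM h2.
have k0 : 0 <= k%:R / 2 ^+ q :> R by rewrite divr_ge0// exprn_ge0.
have kE : k.+1%:R / 2 ^+ q - k%:R / 2 ^+ q = 2 ^- q :> R by rewrite -natr1 mulrDl mul1r addrAC subrr add0r.
have p0 : 0 < 2 ^- q :> R by rewrite invr_gt0 exprn_gt0.
have kR : 0 <= k%:R / 2 ^+ q * R_ n by rewrite mulr_ge0// ltW.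
have kk : k%:R / 2 ^+ q * R_ n <= k.+1%:R / 2 ^+ q * R_ n by rewrite ler_pM2r//; lra.
pose B : set R := `](k%:R / 2 ^+ q * R_ n), (k.+1%:R / 2 ^+ q * R_ n)]%classic.
have mB : measurable B by exact: measurable_itv.
have hQ : \sum_(j < N_ n) Pr P (zeta j @^-1` B) <= 2 * (R_ n / 2 ^+ q).
  rewrite (eq_bigr _ (fun (j : 'I_(N_ n)) _ => pz_itv P mz j kk)).
  apply: le_trans (B3 _ kR kk) _; rewrite -mulrBl kE; lra.
have q0 : 0 < e * Num.sqrt (Sg n) by rewrite mulr_gt0.
have -> : [set w | e < `|inc n q k w|] =
    [set w | e * Num.sqrt (Sg n) < `|\sum_(j < N_ n) (\1_B (zeta j w) - Pr P (zeta j @^-1` B))|].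
  apply/seteqP; split => w /=; rewrite /inc /arr -mulrBl (Xi_itv P mz _ _ kk) normrM normfV (gtr0_norm (sq0 n)) ltr_pdivlMr//.
have ct := count_tail mz iz mB hQ q0.
have c0' := c0; apply: (le_trans ct); rewrite [(e * _) ^+ 4]exprMn sq4 ler_pdivrMr ?mulr_gt0 ?exprn_gt0//.
have -> : 56 * c ^+ 2 * (2 ^- q) ^+ 2 / e ^+ 4 * (e ^+ 4 * Sg n ^+ 2) = 14 * (2 * c * 2 ^- q * Sg n) ^+ 2.
  have qn : 2 ^+ q != 0 :> R by rewrite expf_neq0.
  have en : e != 0 by rewrite lt0r_neq0.
  by field; rewrite ?qn ?en.
have x1 : R_ n / 2 ^+ q <= 2 * c * 2 ^- q * Sg n.
  by rewrite mulrAC ler_pM2r// -ler_pdivrMr.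
move: (R_ n / 2 ^+ q) h2 x1 => x h2 x1.
have : x ^+ 2 <= (2 * c * 2 ^- q * Sg n) ^+ 2 by rewrite ler_sqr ?nnegrE//; lra.
have : x <= x ^+ 2 by rewrite expr2 ler_peMl//; lra.
have -> : (2 * x) ^+ 2 = 4 * x ^+ 2 by ring.
move: ((2 * c * 2 ^- q * Sg n) ^+ 2) (x ^+ 2) => u v; lra.
Qed.

(** Chaining runs from level m to the level q where R / 2^q is of order dl sqrt(Sig): the moment
    bound is still quadratic there, and inside one interval of that level the mean count divided by
    sqrt(Sig) is already a fraction of dl. *)
Lemma arr_modulus (j : nat) (dl e : R) : 0 < dl -> 0 < e ->
  exists m0, forall m, (m0 <= m)%N -> \forall n \near \oo, exists A : set T,
    [/\ measurable A, Pr P (~` A) <= e &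
     forall w, A w -> forall t, 0 <= t <= j%:R -> `|X n w t - X n w (pim m t)| <= dl].
Proof.
move=> dl0 e0; have c0' := c0; have M0' := M0.
have [rho [rho0 rho1 rhoX]] := @chain_ratio R.
(* A level has (j + 1) 2^(q+1) intervals of tail 56 c^2 2^(-2q-2) / (9/10)^(4q), in total 28 c^2 (j
   + 1) rho^q; the denominator 1 - rho sums the levels. It is j + 1 because the interval to the
   right of t may leave [0, j]. *)
pose D := 28 * c ^+ 2 * j.+1%:R / (1 - rho).
have D0 : 0 <= D.
  rewrite /D; apply: divr_ge0; last by rewrite subr_ge0 ltW.
  by apply: mulr_ge0 => //; apply: mulr_ge0 => //; exact: sqr_ge0.
have [m1 hm1] : exists m1, forall m, (m1 <= m)%N -> D * rho ^+ m <= e.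
  have : D * rho ^+ m @[m --> \oo] --> 0.
    by rewrite -(mulr0 D); apply: cvgMr; apply: cvg_expr; rewrite (ger0_norm (ltW rho0)).
  move/cvgr0Pnorm_le => /(_ _ e0)[m1 _ h]; exists m1 => m mm; apply: le_trans (ler_norm _) _; exact: h.
have dl4 : 0 < dl / 4 by rewrite divr_gt0.
(* 11 = 10 for the chain of levels plus 1 for the increment over the last interval. *)
have [m2 hm2] : exists m2, forall m, (m2 <= m)%N -> 11 * (9 / 10) ^+ m <= dl / 4.
  have : 11 * (9 / 10) ^+ m @[m --> \oo] --> (0 : R).
    by rewrite -(mulr0 11); apply: cvgMr; apply: cvg_expr; rewrite ger0_norm; lra.
  move/cvgr0Pnorm_le => /(_ _ dl4)[m2 _ h]; exists m2 => m mm; apply: le_trans (ler_norm _) _; exact: h.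
exists (maxn m1 m2) => m; rewrite geq_max => /andP[/hm1 e1 /hm2 e2].
(* The final mesh satisfies R / 2^q < 2 dd sqrt(Sig) = (dl / 4) sqrt(Sig). The term M / sqrt(Sig)
   takes another dl / 4, and the chain at most dl / 4. *)
have [dd ddE] : exists dd : R, dd = dl / 8 by eexists.
have dd0 : 0 < dd by rewrite ddE divr_gt0.
have nearB (B : R) : \forall n \near \oo, B <= dd * Num.sqrt (Sg n).
  have := @sqrt_inv_cvg _ Sg S0 Sinv (B / dd); move/cvgr0Pnorm_le => /(_ 1 ltr01); apply: filterS => n h.
  have := le_trans (ler_norm _) h; rewrite ler_pdivrMr// mul1r ler_pdivrMr// mulrC //.
have nearR : \forall n \near \oo, 2 * (dd * Num.sqrt (Sg n)) <= R_ n / 2 ^+ m.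
  have c2 : 0 < c / 2 by rewrite divr_gt0.
  have cn : \forall n \near \oo, c / 2 <= R_ n * (Sg n)^-1.
    by move/cvgrPdist_le: RS => /(_ _ c2); apply: filterS => n; rewrite ler_norml => /andP[_ h]; lra.
  have := @sqrt_inv_cvg _ Sg S0 Sinv (2 ^+ m * (2 * dd) / (c / 2)); move/cvgr0Pnorm_le => /(_ 1 ltr01) hn.
  near=> n; have h1 : c / 2 <= R_ n * (Sg n)^-1 by near: n.
  have : `|2 ^+ m * (2 * dd) / (c / 2) / Num.sqrt (Sg n)| <= 1 by near: n.
  move=> h; have := le_trans (ler_norm _) h; rewrite ler_pdivrMr// mul1r ler_pdivrMr// => h2.
  have p0 : 0 < 2 ^+ m :> R by rewrite exprn_gt0.
  rewrite ler_pdivlMr//.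
  have sE : Sg n = Num.sqrt (Sg n) * Num.sqrt (Sg n) by rewrite -expr2 sqr_sqrtr// ltW.
  have : c / 2 * Sg n <= R_ n by rewrite -ler_pdivlMr.
  apply: le_trans.
  have -> : c / 2 * Sg n = (Num.sqrt (Sg n) * (c / 2)) * Num.sqrt (Sg n) by rewrite {1}sE; ring.
  have -> : 2 * (dd * Num.sqrt (Sg n)) * 2 ^+ m = (2 ^+ m * (2 * dd)) * Num.sqrt (Sg n) by ring.
  by rewrite ler_pM2r.
near=> n.
have n1 : R_ n * (Sg n)^-1 <= 2 * c by near: n.
have n2 : M <= dd * Num.sqrt (Sg n) by near: n.
have n3 : 1 <= dd * Num.sqrt (Sg n) by near: n.
have n4 : 2 * (dd * Num.sqrt (Sg n)) <= R_ n / 2 ^+ m by near: n.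
have n5 : M / (dl / 4) * dd <= dd * Num.sqrt (Sg n) by near: n.
have y0 : 0 < dd * Num.sqrt (Sg n) by lra.
have [i [i1 i2]] := dyadic_between y0 n4.
have pE k : R_ n / 2 ^+ m / 2 ^+ k = R_ n / 2 ^+ (m + k) by rewrite exprD invfM mulrA.
rewrite pE in i1 i2.
have lev q : (q <= m + i.+1)%N -> dd * Num.sqrt (Sg n) <= R_ n / 2 ^+ q.
  move=> qm; apply: (le_trans i1); rewrite ler_pM2l// lef_pV2 ?posrE ?exprn_gt0//.
  by rewrite ler_eXn2l// ltr1n.
pose bad k := [set w | exists2 l, (l < j.+1 * 2 ^ (m + k).+1)%N & (9 / 10) ^+ (m + k) < `|inc n (m + k).+1 l w|].
have badP k : measurable (bad k) /\ ((k < i.+1)%N -> Pr P (bad k) <= 28 * c ^+ 2 * j.+1%:R * rho ^+ (m + k)).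
  have r0 : 0 < (9 / 10) ^+ (m + k) :> R by rewrite exprn_gt0.
  have mI l := measurable_norm_gt ((9 / 10) ^+ (m + k)) (inc_measurable n (m + k).+1 l).
  have [ki|ki] := ltnP k i.+1; last first.
    split => //; rewrite /bad.
    by have [] := @Pr_union _ _ _ P (fun l => [set w | (9 / 10) ^+ (m + k) < `|inc n (m + k).+1 l w|])
      (j.+1 * 2 ^ (m + k).+1) 1 mI (fun l _ => Pr_le1 P (mI l)).
  have lq : ((m + k).+1 <= m + i.+1)%N by rewrite -addnS leq_add2l.
  have hl := lev _ lq.
  have [mU hU] := @Pr_union _ _ _ P (fun l => [set w | (9 / 10) ^+ (m + k) < `|inc n (m + k).+1 l w|])
      (j.+1 * 2 ^ (m + k).+1) _ mI
      (fun l _ => @inc_tail n (m + k).+1 l _ r0 n1 (le_trans n2 hl) (le_trans n3 hl)).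
  split => // _; apply: (le_trans hU); rewrite le_eqVlt; apply/orP; left; apply/eqP.
  rewrite rhoX.
  have p0 : 2 ^+ (m + k) != 0 :> R by rewrite expf_neq0.
  move: r0; move: ((9 / 10) ^+ (m + k)) => r r0; rewrite natrM natrX exprS.
  by move: (2 ^+ (m + k)) p0 => x p0; field; rewrite p0 lt0r_neq0.
have [mU hU] := @Pr_union_sum _ _ _ P bad i.+1 (fun k => 28 * c ^+ 2 * j.+1%:R * rho ^+ (m + k))
  (fun k => (badP k).1) (fun k => (badP k).2).
exists (~` [set w | exists2 k, (k < i.+1)%N & bad k w]); split.
- exact: measurableC.
- rewrite setCK; apply: (le_trans hU); apply: le_trans e1; rewrite -mulr_sumr /D -[X in _ <= X]mulrA.
  apply: ler_wpM2l; first by apply: mulr_ge0 => //; apply: mulr_ge0 => //; exact: sqr_ge0.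
  have := @geometric_le_lim R i.+1 (rho ^+ m) rho (exprn_ge0 m (ltW rho0)) rho0.
  rewrite (ger0_norm (ltW rho0)) => /(_ rho1); rewrite /series/= big_mkord mulrC.
  by apply: le_trans; rewrite le_eqVlt; apply/orP; left; apply/eqP; apply: eq_bigr => k _; rewrite exprD.
move=> w nbad t tj.
have good k l : (k < i.+1)%N -> (l < j.+1 * 2 ^ (m + k).+1)%N -> `|inc n (m + k).+1 l w| <= (9 / 10) ^+ (m + k).
  move=> ki lj; rewrite leNgt; apply/negP => h; apply: nbad; exists k => //; exists l => //.
have /andP[t0 tj'] := tj.
set q := (m + i.+1)%N.
have c1 : `|X n w (pim q t) - X n w (pim m t)| <= 10 * 1 * ((9 / 10) ^+ m - (9 / 10) ^+ q).
  apply: (@pim_chain _ m j i.+1 (X n w) 1) => // k l /andP[mk ki] lj; rewrite mul1r.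
  have := @good (k - m)%N l; rewrite subnKC// => h; apply: h.
    by rewrite -(ltn_add2r m) subnK// addnC.
  by apply: leq_trans lj _; rewrite leq_mul2r leqnSn orbT.
have p0 : 0 < 2 ^+ q :> R by rewrite exprn_gt0.
set l := Num.truncn (2 ^+ q * t).
have /andP[l1 l2] := truncn_itv (mulr_ge0 (ltW p0) t0); rewrite -/l in l1 l2.
have lE : pim q t = l%:R / 2 ^+ q by [].
have lj : (l < j.+1 * 2 ^ (m + i).+1)%N.
  rewrite -(ltr_nat R) natrM natrX -addnS -/q.
  apply: (le_lt_trans l1); rewrite mulrC ltr_pM2r//; apply: (le_lt_trans tj').
  by rewrite ltr_nat.
have c2 := good i l (ltnSn i) lj; rewrite /inc -addnS -/q in c2.
(* Below the last grid no further randomness is estimated: monotonicity bounds the increment up to t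
   by that over the whole grid interval plus the mean count. *)
have c3 : `|X n w t - X n w (pim q t)| <= `|X n w (l.+1%:R / 2 ^+ q) - X n w (l%:R / 2 ^+ q)| +
    (R_ n / 2 ^+ q + M) / Num.sqrt (Sg n).
  rewrite lE /arr -!mulrBl !normrM normfV (gtr0_norm (sq0 n)) -mulrDl ler_pM2r ?invr_gt0//.
  have a1 : l%:R / 2 ^+ q * R_ n <= t * R_ n by rewrite ler_pM2r// ler_pdivrMr// mulrC.
  have a2 : t * R_ n <= l.+1%:R / 2 ^+ q * R_ n by rewrite ler_pM2r// ler_pdivlMr// mulrC ltW.
  apply: le_trans (Xi_between P mz _ _ a1 a2) _; rewrite lerD2l.
  have a0 : 0 <= l%:R / 2 ^+ q * R_ n by rewrite mulr_ge0 ?(ltW (R0 n))// divr_ge0// ltW.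
  apply: le_trans (B3 _ a0 (le_trans a1 a2)) _; rewrite lerD2r -mulrBl -mulrBl -natr1 addrAC subrr add0r mul1r.
  by rewrite mulrC.
have c4 : (R_ n / 2 ^+ q + M) / Num.sqrt (Sg n) <= dl / 2.
  rewrite ler_pdivrMr//.
  have : M <= dl / 4 * Num.sqrt (Sg n).
    by move: n5; rewrite mulrC ler_pM2l// ler_pdivrMr// mulrC.
  by move: i2; rewrite -/q ddE; move: (R_ n / 2 ^+ q) (Num.sqrt (Sg n)) => u v; lra.
have c5 : (9 / 10) ^+ (m + i) <= (9 / 10) ^+ m :> R.
  by rewrite exprD ler_piMr ?exprn_ge0// exprn_ile1//; lra.
have c6 : 0 <= (9 / 10) ^+ q :> R by rewrite exprn_ge0.
rewrite -(subrKA (X n w (pim q t))); apply: le_trans (ler_normD _ _) _.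
move: ((9 / 10) ^+ m) ((9 / 10) ^+ (m + i)) ((9 / 10) ^+ q) e2 c1 c2 c3 c4 c5 c6 => A B F e2 c1 c2 c3 c4 c5 c6.
lra.
Unshelve. all: by end_near. Qed.

End Tightness.

(** * Skorokhod convergence of the counting process *)

Section Cadlag.
Context {R : realType}.
Implicit Types (x y : R -> R).

(** Locally uniform limits of cadlag paths are cadlag, by the three-epsilon argument on each side of
    t. *)
Lemma cadlag_uniform x : (forall (j : nat) (dl : R), 0 < dl -> exists2 y, cadlag y &
  forall t, 0 <= t <= j%:R -> `|x t - y t| <= dl) -> cadlag x.
Proof.
move=> hx; split => t t0.
  apply/cvgrPdist_le => e e0; have e3 : 0 < e / 3 by rewrite divr_gt0.
  have [y [cy _] hy] := hx (Num.truncn t).+2 _ e3.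
  have /andP[_ h4] := truncn_itv t0.
  have tj : t < (Num.truncn t).+2%:R by rewrite (lt_trans h4)// ltr_nat.
  have /cvgrPdist_le/(_ _ e3) hc := cy t t0.
  near=> u.
  have tu : t < u by near: u; exact: nbhs_right_gt.
  have uj : u <= (Num.truncn t).+2%:R by near: u; exact: nbhs_right_le.
  have h1 : `|y t - y u| <= e / 3 by near: u.
  have h2 : `|x t - y t| <= e / 3 by apply: hy; rewrite t0 ltW.
  have h3 : `|x u - y u| <= e / 3 by apply: hy; rewrite uj (ltW (le_lt_trans t0 tu)).
  have -> : x t - x u = (x t - y t) + (y t - y u) - (x u - y u) by ring.
  apply: le_trans (ler_normB _ _) _; have := ler_normD (x t - y t) (y t - y u); lra.
apply: cauchy_cvg; apply: cauchy_exP => e e0; have e3 : 0 < e / 3 by rewrite divr_gt0.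
have [y [_ cy] hy] := hx (Num.truncn t).+1 _ e3.
have /cvg_ex[l /= cl] := cy t t0.
have /cvgrPdist_le/(_ _ e3) hc := cl.
have /andP[_ h4] := truncn_itv (ltW t0).
exists l; rewrite /nbhs/=; near=> u.
have ut : u < t by near: u; exact: nbhs_left_lt.
have u0 : 0 < u by near: u; exact: nbhs_left_gt.
have h1 : `|l - y u| <= e / 3 by near: u.
have h3 : `|x u - y u| <= e / 3 by apply: hy; rewrite (ltW u0) (ltW (lt_trans ut h4)).
rewrite -ball_normE/=; have -> : l - x u = (l - y u) - (x u - y u) by ring.
apply: le_lt_trans (ler_normB _ _) _; lra.
Unshelve. all: by end_near. Qed.

Lemma cadlagB x y : cadlag x -> cadlag y -> cadlag (fun t => x t - y t).
Proof.
move=> [x1 x2] [y1 y2]; split => t t0; first by apply: cvgB; [exact: x1|exact: y1].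
have /cvg_ex[a /= ca] := x2 t t0; have /cvg_ex[b /= cb] := y2 t t0.
by apply/cvg_ex; exists (a - b); exact: cvgB.
Qed.

Lemma cadlagD x y : cadlag x -> cadlag y -> cadlag (fun t => x t + y t).
Proof.
move=> [x1 x2] [y1 y2]; split => t t0; first by apply: cvgD; [exact: x1|exact: y1].
have /cvg_ex[a /= ca] := x2 t t0; have /cvg_ex[b /= cb] := y2 t t0.
by apply/cvg_ex; exists (a + b); exact: cvgD.
Qed.

Lemma cadlagZ x (c : R) : cadlag x -> cadlag (fun t => x t * c).
Proof.
move=> [x1 x2]; split => t t0; first by apply: cvgMl; exact: x1.
by have /cvg_ex[a /= ca] := x2 t t0; apply/cvg_ex; exists (a * c); exact: cvgMl.
Qed.

Lemma cadlag_sum n (F : nat -> R -> R) : (forall j, cadlag (F j)) -> cadlag (fun t => \sum_(j < n) F j t).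
Proof.
move=> cF; elim: n => [|n IH].
  by under eq_fun do rewrite big_ord0; exact: cadlag_cst.
by under eq_fun do rewrite big_ord_recr/=; exact: cadlagD.
Qed.

Lemma le_scale_right (z r t : R) (u : nat -> R) : 0 < r -> (forall n, t < u n) -> u n @[n --> \oo] --> t ->
  \forall n \near \oo, (z <= u n * r) = (z <= t * r).
Proof.
move=> r0 tu ut; have [h|h] := leP z (t * r).
  by apply: nearW => n; rewrite (le_trans h)// ler_pM2r// ltW.
have e0 : 0 < z / r - t by rewrite subr_gt0 ltr_pdivlMr.
have /cvgrPdist_lt/(_ _ e0) := ut; apply: filterS => n; rewrite ltr_norml => /andP[h1 _].
apply/negbTE; rewrite -ltNge -ltr_pdivlMr//; lra.
Qed.

Lemma le_scale_left (z r t : R) (u : nat -> R) : 0 < r -> (forall n, u n < t) -> u n @[n --> \oo] --> t ->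
  \forall n \near \oo, (z <= u n * r) = (z < t * r).
Proof.
move=> r0 tu ut; have [h|h] := ltP z (t * r); last first.
  by apply: nearW => n; apply/negbTE; rewrite -ltNge (lt_le_trans _ h)// ltr_pM2r.
have e0 : 0 < t - z / r by rewrite subr_gt0 ltr_pdivrMr.
have /cvgrPdist_lt/(_ _ e0) := ut; apply: filterS => n; rewrite ltr_norml => /andP[_ h1].
by rewrite -ler_pdivrMr//; lra.
Qed.

Lemma cadlag_ind (z r : R) : 0 < r -> cadlag (fun t => ((z <= t * r)%R)%:R).
Proof.
move=> r0; split => t t0.
  apply/cvg_at_rightP => u [tu ut]; apply: cvg_near_cst.
  by have := @le_scale_right z r t u r0 tu ut; apply: filterS => n ->.
apply/cvg_ex; exists (((z < t * r)%R)%:R); apply/cvg_at_leftP => u [tu ut]; apply: cvg_near_cst.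
by have := @le_scale_left z r t u r0 tu ut; apply: filterS => n ->.
Qed.

End Cadlag.

Section Paths.
Context {R : realType} {d : measure_display} {T : measurableType d} (P : probability T R).
Variable zeta : nat -> T -> R.
Hypothesis mz : forall i, measurable_fun setT (zeta i).
Local Notation p := (pz P zeta).
Local Notation Xi := (Xi P zeta).

Lemma cadlag_pz j (r : R) : 0 < r -> cadlag (fun t => p j (t * r)).
Proof.
move=> r0; split => t t0.
  apply/cvg_at_rightP => u [tu ut]; apply: Pr_cvg_ae.
  - by move=> n; exact: measurable_le.
  - exact: measurable_le.
  - apply/aeW => w; have := @le_scale_right _ (zeta j w) r t u r0 tu ut; apply: filterS => n h.
    by apply/idP/idP; rewrite !inE/= h.
apply/cvg_ex; exists (Pr P [set w | zeta j w < t * r]); apply/cvg_at_leftP => u [tu ut]; apply: Pr_cvg_ae.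
- by move=> n; exact: measurable_le.
- exact: measurable_lt.
- apply/aeW => w; have := @le_scale_left _ (zeta j w) r t u r0 tu ut; apply: filterS => n h.
  by apply/idP/idP; rewrite !inE/= h.
Qed.

Lemma cadlag_Xi n (r c : R) w : 0 < r -> cadlag (fun t => Xi n (t * r) w / c).
Proof.
move=> r0; apply: cadlagZ.
apply: (@cadlag_sum _ n (fun j t => ((zeta j w <= t * r)%R)%:R - p j (t * r))) => j.
by apply: cadlagB; [exact: cadlag_ind|exact: cadlag_pz].
Qed.

Definition XiLim (r : R) w : R := limn (fun n => Xi n r w).

(** When no point of index at least N lies below the level, the remaining terms are deterministic
    and equal to minus the probabilities, so both convergence and error come from the tail of that
    series. *)
Lemma XiLim_trunc N (r r1 dl : R) w : r <= r1 -> (forall i, (N <= i)%N -> r1 < zeta i w) ->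
  (forall m, \sum_(i < m) p (N + i) r1 <= dl) -> `|XiLim r w - Xi N r w| <= dl.
Proof.
move=> rr hz hd.
have E m : Xi (N + m) r w = Xi N r w - \sum_(i < m) p (N + i) r.
  rewrite /Xi big_split_ord/= -sumrN; congr (_ + _); apply: eq_bigr => i _.
  have -> : (zeta (N + i)%N w <= r) = false by apply/negbTE; rewrite -ltNge (le_lt_trans rr)// hz// leq_addr.
  by rewrite sub0r.
have hd' m : \sum_(i < m) p (N + i) r <= dl.
  by apply: le_trans (hd m); apply: ler_sum => i _; exact: pz_mono.
have nd : {homo (fun m => \sum_(i < m) p (N + i) r) : m n / (m <= n)%N >-> m <= n}.
  move=> m n mn; rewrite -(subnKC mn) big_split_ord/= lerDl sumr_ge0// => i _; exact: pz_ge0.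
have cv : cvgn (fun m => \sum_(i < m) p (N + i) r).
  by apply: nondecreasing_is_cvgn => //; exists dl => _ [m _ <-].
have l1 : limn (fun m => \sum_(i < m) p (N + i) r) <= dl.
  by apply: limr_le => //; apply: nearW.
have l0 : 0 <= limn (fun m => \sum_(i < m) p (N + i) r).
  by apply: limr_ge => //; apply: nearW => m; apply: sumr_ge0 => i _; exact: pz_ge0.
have cX : Xi (m + N) r w @[m --> \oo] --> Xi N r w - limn (fun m => \sum_(i < m) p (N + i) r).
  under eq_fun do rewrite addnC E; apply: cvgB; [exact: cvg_cst|exact: cv].
have -> : XiLim r w = Xi N r w - limn (fun m => \sum_(i < m) p (N + i) r).
  by apply: (cvg_lim (@Rhausdorff R)); move: cX; rewrite (cvg_shiftn N (fun n => Xi n r w)).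
by rewrite addrAC subrr add0r normrN ger0_norm.
Qed.

Hypothesis pbdd : forall r : R, 0 <= r -> exists M : R, forall n, \sum_(j < n) p j r <= M.

Lemma pz_tail (r e : R) : 0 <= r -> 0 < e -> exists N0, forall N m, (N0 <= N)%N -> \sum_(i < m) p (N + i) r <= e.
Proof.
move=> r0 e0; have [M hM] := pbdd r0.
have nd : {homo (fun m => \sum_(i < m) p i r) : m n / (m <= n)%N >-> m <= n}.
  move=> m n mn; rewrite -(subnKC mn) big_split_ord/= lerDl sumr_ge0// => i _; exact: pz_ge0.
have cv : cvgn (fun m => \sum_(i < m) p i r).
  by apply: nondecreasing_is_cvgn => //; exists M => _ [m _ <-].
have up m := nondecreasing_cvgn_le nd cv m.
move/cvgrPdist_le: cv => /(_ _ e0)[N0 _ h]; exists N0 => N m NN.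
have := up (N + m)%N; rewrite big_split_ord/= => h1.
have := h N NN; rewrite /= ler_norml => /andP[_ h2]; lra.
Qed.

Definition locfin := [set w | forall k : nat, exists N, forall i, (N <= i)%N -> (k%:R : R) < zeta i w].

(** Borel-Cantelli at each integer level, the probabilities being summable. *)
Lemma locfin_meas : measurable locfin /\ Pr P (~` locfin) = 0.
Proof.
pose F (k j : nat) := [set w | zeta j w <= (k%:R : R)].
have mF k j : measurable (F k j) by exact: measurable_le.
have ml k : measurable (lim_sup_set (F k)).
  by apply: bigcap_measurable => // n _; apply: bigcup_measurable => m _.
have E : ~` locfin = \bigcup_k lim_sup_set (F k).
  apply/seteqP; split => w.
    move=> /existsNP[k /forallNP hk]; exists k => // N _.
    by have /existsNP[i /not_implyP[Ni /negP hi]] := hk N; exists i => //; rewrite /F/= leNgt.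
  move=> [k _ hk] /(_ k)[N hN]; have [i /= Ni] := hk N I; rewrite /F/= leNgt => /negP; apply; exact: hN.
have mU : measurable (\bigcup_k lim_sup_set (F k)) by exact: bigcup_measurable.
split; first by rewrite -(setCK locfin); apply: measurableC; rewrite E.
rewrite E /Pr (_ : P _ = 0%E)//.
apply/(negligibleP _ mU)/negligible_bigcup => k.
apply/(negligibleP _ (ml k)); apply: lim_sup_set_cvg0 => //.
have [M hM] := pbdd (ler0n R k).
apply: (@le_lt_trans _ _ M%:E); last exact: ltry.
apply: lime_le; first by apply: is_cvg_nneseries => n _ _.
apply: nearW => n; have := hM n; rewrite -lee_fin; apply: le_trans.
rewrite big_mkord -sumEFin; apply: lee_sum => j _.
by have := PrE P (mF k j); rewrite -[X in _ -> (X <= _)%E]/(P (F k j)) => ->.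
Qed.

(** On a locally finite configuration the finite sums converge uniformly on bounded time
    intervals. *)
Lemma cadlag_XiLim (r c : R) w : 0 < r -> locfin w -> cadlag (fun t => XiLim (t * r) w / c).
Proof.
move=> r0 fw; apply: cadlag_uniform => j dl dl0.
pose k := (Num.truncn (j%:R * r)).+1.
have kj : j%:R * r <= k%:R.
  by have /andP[_ /ltW] := truncn_itv (mulr_ge0 (ler0n R j) (ltW r0)).
have [N1 h1] := fw k.
have e0 : 0 < dl / (`|c^-1| + 1) by rewrite divr_gt0// ltr_pwDr.
have [N2 h2] := pz_tail (ler0n R k) e0.
exists (fun t => Xi (maxn N1 N2) (t * r) w / c); first exact: cadlag_Xi.
move=> t /andP[t0 tj]; rewrite -mulrBl normrM.
have h : `|XiLim (t * r) w - Xi (maxn N1 N2) (t * r) w| <= dl / (`|c^-1| + 1).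
  apply: (@XiLim_trunc _ _ k%:R).
  - by apply: le_trans kj; rewrite ler_pM2r.
  - by move=> i Ni; apply: h1; apply: leq_trans Ni; rewrite leq_maxl.
  - by move=> m; apply: h2; rewrite leq_maxr.
have c1 : 0 < `|c^-1| + 1 by rewrite ltr_pwDr.
have := ler_wpM2r (normr_ge0 c^-1) h; move=> /le_trans; apply.
rewrite mulrAC ler_pdivrMr// ler_pM2l// lerDl //.
Qed.

Definition noneb N (r : R) := [set w | forall i, (N <= i)%N -> r < zeta i w].

Lemma noneb_meas N (r e : R) : (forall m, \sum_(i < m) p (N + i) r <= e) ->
  measurable (noneb N r) /\ Pr P (~` noneb N r) <= e.
Proof.
move=> he; pose F i := [set w | zeta (N + i)%N w <= r].
have mF i : measurable (F i) by exact: measurable_le.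
have E : ~` noneb N r = \bigcup_i F i.
  apply/seteqP; split => w.
    move=> /existsNP[i /not_implyP[Ni /negP hi]]; exists (i - N)%N => //.
    by rewrite /F/= subnKC// leNgt.
  by move=> [i _]; rewrite /F/= leNgt => /negP h hn; apply: h; apply: hn; exact: leq_addr.
have mU : measurable (\bigcup_i F i) by exact: bigcup_measurable.
split; first by rewrite -(setCK (noneb N r)); apply: measurableC; rewrite E.
rewrite E -lee_fin -PrE//.
apply: (@le_trans _ _ (\sum_(0 <= i <oo) P (F i))%E).
  exact: (@measure_sigma_subadditive _ _ _ P).
apply: lime_le; first by apply: is_cvg_nneseries => n _ _.
apply: nearW => n; have := he n; rewrite -lee_fin; apply: le_trans.
rewrite big_mkord -sumEFin; apply: lee_sum => j _.
by have := PrE P (mF j); rewrite -[X in _ -> (X <= _)%E]/(P (F j)) => ->.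
Qed.

End Paths.

(** A single pair (P', G) has to serve every sequence of radii tending to infinity; these properties
    depend on the covariance C only, not on the sequence that showed it to be nonnegative
    definite. *)
Definition gauss_for {R : realType} (C : R -> R -> R) (P' : probability R R) (G : R -> R -> R) :=
  [/\ forall t, 0 <= t -> measurable_fun setT (fun w => G w t),
      forall w, cadlag (G w),
      (forall w (j : nat) (dl : R), 0 < dl -> exists m0, forall m, (m0 <= m)%N ->
         forall t, 0 <= t <= j%:R -> `|G w t - G w (pim m t)| <= dl) &
      forall s b, times_in (fun t => 0 <= t) s ->
        Ex P' (fun w => cos (lfun s (G w) + b)) = expR (- (quad C s / 2)) * cos b].

Section Limit.
Context {R : realType} {d : measure_display} {T : measurableType d} (P : probability T R).
Variable zeta : nat -> T -> R.
Hypothesis mz : forall i, measurable_fun setT (zeta i).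
Hypothesis iz : forall n (B : nat -> set R), (forall i, measurable (B i)) ->
  Pr P [set w | forall i, (i < n)%N -> B i (zeta i w)] = \prod_(i < n) Pr P (zeta i @^-1` B i).
Local Notation p := (pz P zeta).
Variables (Sig Phi : R -> R) (K E2 r0 c E3 M : R).
Hypotheses (P0 : forall x, 0 <= Phi x) (P1 : forall x, Phi x <= 1)
  (Pm : forall x y : R, x <= y -> Phi y <= Phi x)
  (Pc : forall (x_ : nat -> R) (x : R), x_ n @[n --> \oo] --> x -> Phi (x_ n) @[n --> \oo] --> Phi x)
  (PK : forall n, \sum_(j < n) Phi j.+1%:R <= K) (r00 : 0 < r0)
  (Sig1 : forall r : R, r0 <= r -> 1 <= Sig r)
  (pPhi : forall (r : R) n, r0 <= r -> \sum_(j < n) `|p j r - Phi (j.+1%:R / Sig r)| <= E2)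
  (c0 : 0 < c) (hc : forall r : R, r0 <= r -> `|c * Sig r - r| <= E3) (M0 : 0 <= M)
  (B0 : forall n, \sum_(j < n) p j 0 <= M)
  (B3 : forall n (s t : R), 0 <= s -> s <= t -> \sum_(j < n) (p j t - p j s) <= (t - s) + M)
  (pbdd : forall r : R, 0 <= r -> exists M : R, forall n, \sum_(j < n) p j r <= M).

Section Sequence.
Variables (R_ : nat -> R) (N_ : nat -> nat) (ap : \bar R).
Hypotheses (RL : forall n, r0 <= R_ n) (Roo : R_ n @[n --> \oo] --> +oo)
  (hap : ((N_ n)%:R / Sig (R_ n))%:E @[n --> \oo] --> ap).
Local Notation C := (cov Phi ap).
Local Notation Sg := (fun n => Sig (R_ n)).

Let R0 n : 0 < R_ n. Proof. exact: lt_le_trans r00 (RL n). Qed.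

Let S0 n : 0 < Sig (R_ n). Proof. exact: lt_le_trans ltr01 (Sig1 (RL n)). Qed.

Let Sinv : (Sig (R_ n))^-1 @[n --> \oo] --> 0.
Proof. exact: (@a_cvg0 _ Sig r0 r00 c E3 R_ c0 hc RL Roo). Qed.

Let RS : R_ n * (Sig (R_ n))^-1 @[n --> \oo] --> c.
Proof. exact: (@R_over_Sig _ Sig r0 r00 c E3 R_ c0 hc RL Roo). Qed.

Let hC (s t : R) : 0 <= s -> 0 <= t ->
  (Sig (R_ n))^-1 * \sum_(j < N_ n) prec p R_ n j s t @[n --> \oo] --> C s t.
Proof.
exact: (prec_cvg P0 P1 Pm Pc PK (pz_ge0 P zeta) (pz_le1 P mz) r00 Sig1 pPhi c0 hc B0 RL Roo hap).
Qed.

Lemma limit_gaussian : nonneg_def C /\ exists (P' : probability R R) (G : R -> R -> R), gauss_for C P' G.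
Proof.
have pC : nonneg_def C by apply: (@clt_nonneg _ _ _ P zeta mz R_ Sg N_ R0 S0 C hC).
split => //; apply: (@exists_gaussian_process _ C c) => //.
- exact: cov_sym.
- exact: ltW.
- exact: cov0.
- move=> s t s0 st.
  exact: (cov_incr P0 P1 Pm Pc PK (pz_ge0 P zeta) (pz_le1 P mz) r00 Sig1 pPhi c0 hc B0 B3 RL Roo hap s0 st).
Qed.

(** Half of the error and half of the probability go to the modulus of the array, the other half to
    the distance between Y and the array. *)
Lemma limit_cvg (P' : probability R R) (G : R -> R -> R) (Y : nat -> T -> R -> R) : gauss_for C P' G ->
  (forall (j : nat) (dl e : R), 0 < dl -> 0 < e -> \forall n \near \oo, exists A : set T,
     [/\ measurable A, Pr P (~` A) <= e & forall w, A w -> cadlag (Y n w) /\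
       forall t, 0 <= t <= j%:R -> `|Y n w t - arr P zeta R_ Sg N_ n w t| <= dl]) ->
  cvg_law_skorokhod \oo P Y P' G.
Proof.
move=> [mG cG pG chG] hY.
apply: (@cvg_law_criterion _ _ _ P _ _ P' (arr P zeta R_ Sg N_) Y G) => //.
- by move=> n t _; exact: arr_measurable.
- move=> s b ts; rewrite chG//.
  exact: (@clt_fdd _ _ _ P zeta mz iz R_ Sg N_ R0 S0 Sinv C hC).
- exact: (@arr_tight _ _ _ P zeta mz iz R_ Sg N_ c M R0 S0 Sinv RS c0 M0 B0 B3).
move=> j dl e dl0 e0; have dl2 : 0 < dl / 2 by rewrite divr_gt0.
have e2 : 0 < e / 2 by rewrite divr_gt0.
have [m0 hm0] := @arr_modulus _ _ _ P zeta mz iz R_ Sg N_ c M R0 S0 Sinv RS c0 M0 B3 j _ _ dl2 e2.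
exists m0 => m mm; have h1 := hm0 m mm; have h2 := hY j _ _ dl2 e2.
near=> n.
have [A1 [mA1 PA1 hA1]] : exists A : set T, [/\ measurable A, Pr P (~` A) <= e / 2 &
     forall w, A w -> forall t, 0 <= t <= j%:R ->
     `|arr P zeta R_ Sg N_ n w t - arr P zeta R_ Sg N_ n w (pim m t)| <= dl / 2] by near: n.
have [A2 [mA2 PA2 hA2]] : exists A : set T,
     [/\ measurable A, Pr P (~` A) <= e / 2 & forall w, A w -> cadlag (Y n w) /\
       forall t, 0 <= t <= j%:R -> `|Y n w t - arr P zeta R_ Sg N_ n w t| <= dl / 2] by near: n.
exists (A1 `&` A2); split; first exact: measurableI.
  rewrite setCI [leRHS]splitr; apply: le_trans (Pr_setU _ _ _) _; [exact: measurableC..|exact: lerD].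
move=> w [w1 w2]; have [cY hYt] := hA2 w w2; split => // t tj.
rewrite -(subrKA (arr P zeta R_ Sg N_ n w t)) [leRHS]splitr.
by apply: le_trans (ler_normD _ _) _; apply: lerD; [exact: hYt|exact: hA1].
Unshelve. all: by end_near. Qed.

Lemma limit_fin (P' : probability R R) (G : R -> R -> R) : gauss_for C P' G ->
  cvg_law_skorokhod \oo P (fun n w t => Xi P zeta (N_ n) (t * R_ n) w / Num.sqrt (Sig (R_ n))) P' G.
Proof.
move=> hG; apply: limit_cvg => // j dl e dl0 e0; apply: nearW => n; exists setT; split => //.
  by rewrite setCT /Pr measure0 ltW.
move=> w _; split; first exact: cadlag_Xi.
by move=> t _; rewrite /arr subrr normr0 ltW.
Qed.

End Sequence.

(** The first requirement forces N_n / Sig(R_n) to infinity, so the cut sums have a^+ = +oo. The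
    second makes the points beyond N_n invisible up to level n R_n, which eventually exceeds j R_n
    for every fixed horizon j. *)
Lemma exists_truncation (R_ : nat -> R) : (forall n, r0 <= R_ n) -> exists N_ : nat -> nat,
  forall n, n%:R * Sig (R_ n) <= (N_ n)%:R /\ forall m, \sum_(i < m) p (N_ n + i) (n%:R * R_ n) <= n.+1%:R^-1.
Proof.
move=> RL; have [N_ hN] : {N_ : nat -> nat & forall n, n%:R * Sig (R_ n) <= (N_ n)%:R /\
    forall m, \sum_(i < m) p (N_ n + i) (n%:R * R_ n) <= n.+1%:R^-1}; last by exists N_.
  apply: (@choice _ _ (fun n N => n%:R * Sig (R_ n) <= N%:R /\
    forall m, \sum_(i < m) p (N + i) (n%:R * R_ n) <= n.+1%:R^-1)) => n.
  have R0 : 0 < R_ n by exact: lt_le_trans r00 (RL n).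
  have S0 : 0 < Sig (R_ n) by exact: lt_le_trans ltr01 (Sig1 (RL n)).
  have nR : 0 <= n%:R * R_ n by rewrite mulr_ge0// ltW.
  have n0 : (0 : R) < n.+1%:R^-1 by rewrite invr_gt0.
  have [N0 hN0] := pz_tail pbdd nR n0.
  exists (maxn N0 (Num.truncn (n%:R * Sig (R_ n))).+1); split => [|m]; last by apply: hN0; rewrite leq_maxl.
  have nS : 0 <= n%:R * Sig (R_ n) by rewrite mulr_ge0// ltW.
  have /andP[_ /ltW h] := truncn_itv nS; apply: (le_trans h); rewrite ler_nat leq_maxr //.
Qed.

Lemma truncation_cvg (R_ : nat -> R) (N_ : nat -> nat) : (forall n, r0 <= R_ n) ->
  (forall n, n%:R * Sig (R_ n) <= (N_ n)%:R) -> ((N_ n)%:R / Sig (R_ n))%:E @[n --> \oo] --> +oo%E.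
Proof.
move=> RL hN; have S1 n : 1 <= Sig (R_ n) by exact: Sig1.
apply/cvgeyPge => A; near=> n; rewrite lee_fin ler_pdivlMr; last exact: lt_le_trans ltr01 (S1 n).
apply: le_trans (hN n); apply: ler_wpM2r; first exact: le_trans ler01 (S1 n).
by near: n; exact: nbhs_infty_ger.
Unshelve. all: by end_near. Qed.

(** The truncated sums form the array. Off an event of probability at most 1/(n+1), no point of
    index at least N_n lies below n R_n, and the infinite sum then differs from the truncated one by
    at most 1/(n+1). *)
Lemma limit_inf (R_ : nat -> R) (P' : probability R R) (G : R -> R -> R) :
  (forall n, r0 <= R_ n) -> R_ n @[n --> \oo] --> +oo -> gauss_for (cov Phi +oo%E) P' G ->
  cvg_law_skorokhod \oo P (fun n w t => XiLim P zeta (t * R_ n) w / Num.sqrt (Sig (R_ n))) P' G.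
Proof.
move=> RL Roo hG; have [N_ hN] := exists_truncation RL.
have S1 n : 1 <= Sig (R_ n) by exact: Sig1.
have hap := truncation_cvg RL (fun n => (hN n).1).
apply: (limit_cvg RL Roo hap hG) => j dl e dl0 e0.
have [mf Pf] := locfin_meas mz pbdd.
have hh : (n.+1%:R^-1 : R) @[n --> \oo] --> (0 : R) by exact: cvg_harmonic.
have hdl : \forall n \near \oo, (n.+1%:R^-1 : R) <= dl.
  by move/cvgr0Pnorm_le: hh => /(_ _ dl0); apply: filterS => n; apply: le_trans (ler_norm _).
have he : \forall n \near \oo, (n.+1%:R^-1 : R) <= e.
  by move/cvgr0Pnorm_le: hh => /(_ _ e0); apply: filterS => n; apply: le_trans (ler_norm _).
near=> n.
have [mn Pn] := noneb_meas mz (hN n).2.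
have R0 : 0 < R_ n by exact: lt_le_trans r00 (RL n).
exists (locfin zeta `&` noneb zeta (N_ n) (n%:R * R_ n)); split; first exact: measurableI.
  rewrite setCI; apply: le_trans (Pr_setU _ _ _) _; [exact: measurableC..|].
  by rewrite Pf add0r (le_trans Pn)//; near: n.
move=> w [w1 w2]; split; first exact: (cadlag_XiLim mz pbdd).
move=> t /andP[t0 tj]; rewrite /arr -mulrBl normrM.
have jn : (j%:R : R) <= n%:R by rewrite ler_nat; near: n; exact: nbhs_infty_ge.
have h : `|XiLim P zeta (t * R_ n) w - Xi P zeta (N_ n) (t * R_ n) w| <= n.+1%:R^-1.
  apply: (XiLim_trunc mz _ w2 (hN n).2); rewrite ler_pM2r//; exact: le_trans jn.
have s1 : `|(Num.sqrt (Sig (R_ n)))^-1| <= 1.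
  rewrite normfV ger0_norm ?sqrtr_ge0// invf_le1; first by rewrite -sqrtr1 ler_wsqrtr.
  by rewrite sqrtr_gt0; exact: lt_le_trans ltr01 (S1 n).
have nd : (n.+1%:R^-1 : R) <= dl by near: n.
by apply: le_trans nd; rewrite -[leRHS]mulr1; apply: ler_pM.
Unshelve. all: by end_near. Qed.

End Limit.

Lemma nneseries_approx {R : realType} (a : nat -> R) : (forall j, 0 <= a j) ->
  (\sum_(0 <= j <oo) (a j)%:E < +oo)%E ->
  (forall n, \sum_(j < n) a j <= fine (\sum_(0 <= j <oo) (a j)%:E)%E) /\
  forall e : R, 0 < e -> exists n, fine (\sum_(0 <= j <oo) (a j)%:E)%E - e <= \sum_(j < n) a j.
Proof.
move=> a0 fin; have a0' (j : nat) : (0 <= (a j)%:E)%E by rewrite lee_fin.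
have S0 : (0 <= \sum_(0 <= j <oo) (a j)%:E)%E by exact: nneseries_ge0.
have fS : (\sum_(0 <= j <oo) (a j)%:E)%E \is a fin_num by rewrite ge0_fin_numE.
have E n : (\sum_(0 <= j < n) (a j)%:E)%E = (\sum_(j < n) a j)%:E by rewrite big_mkord sumEFin.
split=> [n|e e0].
  rewrite -lee_fin fineK// -E; exact: nneseries_lim_ge.
have cv : (\sum_(0 <= j < n) (a j)%:E)%E @[n --> \oo] --> (fine (\sum_(0 <= j <oo) (a j)%:E)%E)%:E.
  by rewrite fineK//; exact: is_cvg_nneseries.
have /fine_cvgP[_ /cvgrPdist_le/(_ _ e0)[n _ /(_ n (leqnn n))]] := cv.
by rewrite /= E/= ler_norml => /andP[_ h]; exists n; lra.
Qed.

Lemma prod_EFin {R : realType} {I : Type} (s : seq I) (f : I -> R) :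
  (\big[*%E/1%E]_(i <- s) (f i)%:E)%E = (\prod_(i <- s) f i)%:E.
Proof. by elim/big_rec2: _ => // i x y _ ->; rewrite EFinM. Qed.

Lemma near_pinfty_ge {R : realType} (Q : R -> Prop) : (\forall r \near +oo, Q r) ->
  exists r0 : R, 0 < r0 /\ forall r : R, r0 <= r -> Q r.
Proof.
move=> [A [_ hA]]; exists (`|A| + 1); split; first by rewrite ltr_wpDl.
by move=> r h; apply: hA; have := ler_norm A; lra.
Qed.

(** The correction terms Psi / Sig form a Riemann sum of mesh 1/Sig, bounded by [sobolev_sum], and
    the remainders theta sum to at most 1 for large r; so the total error stays bounded. *)
Lemma approx_tail {R : realType} (q : nat -> R -> R) (Sig Phi Psi : R -> R) (theta : R -> nat -> R) (C : R) :
  Sig x @[x --> +oo] --> +oo -> W11 Psi -> (forall r k, 0 <= theta r k) ->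
  (fun r => \sum_(1 <= k <oo) (theta r k)%:E)%E x @[x --> +oo] --> 0%E -> 0 < C ->
  (\forall r \near +oo, forall k : nat, (0 < k)%N ->
      `| q k r - Phi (k%:R / Sig r) - (Sig r)^-1 * Psi (k%:R / Sig r) | <= C * theta r k) ->
  exists E2 r0 : R, [/\ 0 <= E2, 0 < r0, forall r : R, r0 <= r -> 1 <= Sig r &
    forall (r : R) n, r0 <= r -> \sum_(j < n) `|q j.+1 r - Phi (j.+1%:R / Sig r)| <= E2].
Proof.
move=> Soo [iPsi [g [ig hg]]] t0 tcv C0 hq.
have [K [K0 hK]] := sobolev_sum iPsi ig hg.
have n1 : \forall r \near +oo, 1 <= Sig r by move/cvgryPge: Soo => /(_ 1).
have n2 : \forall r \near +oo, (\sum_(1 <= k <oo) (theta r k)%:E <= 1)%E.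
  have /fine_cvgP[f1 f2] := tcv.
  have /cvgr0Pnorm_le/(_ _ ltr01) f3 := f2.
  near=> r.
  have h1 : (\sum_(1 <= k <oo) (theta r k)%:E)%E \is a fin_num by near: r.
  rewrite -(fineK h1) lee_fin; apply: le_trans (ler_norm _) _; near: r; exact: f3.
have n3 : \forall r \near +oo, 1 <= Sig r /\ (\sum_(1 <= k <oo) (theta r k)%:E <= 1)%E /\
    forall k : nat, (0 < k)%N ->
      `| q k r - Phi (k%:R / Sig r) - (Sig r)^-1 * Psi (k%:R / Sig r) | <= C * theta r k.
  by near=> r; split; [|split]; near: r.
have [r0 [r00 hr0]] := near_pinfty_ge n3.
exists (K + C), r0; split => //; [by rewrite addr_ge0// ltW|by move=> r /hr0[]|].
move=> r n /hr0[S1 [th hp]].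
have S0 : 0 < Sig r := lt_le_trans ltr01 S1.
have a0 : 0 < (Sig r)^-1 by rewrite invr_gt0.
have a1 : (Sig r)^-1 <= 1 by rewrite invf_le1.
have ht : \sum_(j < n) theta r j.+1 <= 1.
  rewrite -lee_fin; apply: le_trans th; rewrite -sumEFin.
  have := @nneseries_lim_ge R (fun k => (theta r k)%:E) xpredT 1 n.+1; rewrite big_add1/= big_mkord; apply.
  by move=> k _ _; rewrite lee_fin.
have h2 : C * \sum_(j < n) theta r j.+1 <= C by rewrite ler_piMr// ltW.
apply: le_trans (lerD (hK _ n a0 a1) h2).
rewrite mulr_sumr -big_split/=; apply: ler_sum => j _.
have := hp j.+1 isT; rewrite (mulrC (Sig r)^-1 j.+1%:R).
set x := q _ _ - _; set y := Psi _ => h.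
have -> : x = (Sig r)^-1 * y + (x - (Sig r)^-1 * y) by rewrite addrC subrK.
apply: le_trans (ler_normD _ _) _; apply: lerD => //.
by rewrite normrM (gtr0_norm a0).
Unshelve. all: by end_near. Qed.

Section UnfoldedAsymptotics.
Context {R : realType} {d : measure_display} {T : measurableType d} (P : probability T R).
Variables (z : nat -> T -> R) (Tf : R -> R).
Hypothesis mz : forall j, measurable_fun setT (z j).
Let F j (x : R) := Pr P [set w | z j w < x].
Hypothesis T1 : forall n (x : R), \sum_(j < n) F j x <= Tf x.
Hypothesis T2 : forall x e : R, 0 < e -> exists n, Tf x - e <= \sum_(j < n) F j x.
Hypothesis T0 : forall x : R, x <= 0 -> Tf x = 0.
Local Notation p := (pz P (fun j w => Tf (z j w))).
Variables (Sig Phi : R -> R) (K E2 r0 : R).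
Hypotheses (P0 : forall x, 0 <= Phi x) (P1 : forall x, Phi x <= 1)
  (Pm : forall x y : R, x <= y -> Phi y <= Phi x)
  (PK : forall n, \sum_(j < n) Phi j.+1%:R <= K) (E20 : 0 <= E2) (r00 : 0 < r0)
  (Sig1 : forall r : R, r0 <= r -> 1 <= Sig r)
  (pPhi : forall (r : R) n, r0 <= r -> \sum_(j < n) `|p j r - Phi (j.+1%:R / Sig r)| <= E2)
  (Sc : forall r : R, r0 < r -> Sig x @[x --> r^'-] --> Sig r).

(** The sum of the probabilities at level r lies between r and r + M by the unfolding, and within
    O(1) of c Sig r by the expansion; comparing the two gives the linear law. *)
Lemma unfolded_linear : exists c E3 M : R, [/\ 0 < c, 0 <= M,
  forall r : R, r0 <= r -> `|c * Sig r - r| <= E3,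
  forall n, \sum_(j < n) p j 0 <= M &
  forall n (s t : R), 0 <= s -> s <= t -> \sum_(j < n) (p j t - p j s) <= (t - s) + M].
Proof.
have E20' := E20; have r00' := r00.
have pE j r : p j r = unfp P z Tf j r by [].
have mzt := unf_measurable mz T1 T2.
have [c [c0 hc]] := sum_p_bounds P0 P1 Pm PK Sig1 pPhi.
have hu (r : R) n : r0 <= r -> \sum_(j < n) unfp P z Tf j r <= c * Sig r + (E2 + 2).
  by move=> rr; have := (hc r rr).1 n; have := pE; lra.
have hl (r : R) : r0 <= r -> exists n, c * Sig r - (E2 + 2) <= \sum_(j < n) unfp P z Tf j r.
  by move=> rr; exact: (hc r rr).2.
have [M [M0 hM]] := unfp_ub mz T1 T2 T0 c0 (ltW r00) hu hl Sc.
have lb (r e : R) : 0 <= r -> 0 < e -> exists N, forall n, (N <= n)%N -> r - e <= \sum_(j < n) p j r.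
  exact: (unfp_lb mz T1 T2 T0).
have low (r : R) : r0 <= r -> r - 1 <= c * Sig r + E2.
  move=> rr; have [N hN] := lb r 1 (le_trans (ltW r00) rr) ltr01.
  exact: le_trans (hN N (leqnn N)) ((hc r rr).1 N).
(* With c = 0 the sum would stay bounded by E2, although it is at least r - 1 for every large r. *)
have cp : 0 < c.
  rewrite lt_neqAle c0 andbT; apply/eqP => cE.
  by have := low (r0 + E2 + 2); rewrite -cE mul0r; lra.
exists c, (M + E2 + 2), M; split => //.
- move=> r rr; have [n hn] := hl r rr; have := hM r n (le_trans (ltW r00) rr); have := low r rr.
  by rewrite ler_norml => ? ?; apply/andP; split; lra.
- by move=> n; have := hM 0 n (lexx 0); rewrite add0r.
(* The lower bound at s needs many terms; enlarging n only increases a sum of nonnegative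
   increments. *)
- move=> n s t s0 st; apply/ler_addgt0Pr => e e0; have [N hN] := lb s e s0 e0.
  have h1 : \sum_(j < n) (p j t - p j s) <= \sum_(j < maxn n N) (p j t - p j s).
    rewrite -[maxn n N](subnKC (leq_maxl n N)) big_split_ord/= lerDl; apply: sumr_ge0 => i _.
    by rewrite subr_ge0; apply: pz_mono.
  apply: (le_trans h1); rewrite sumrB.
  have := hN _ (leq_maxr n N); have := hM t (maxn n N) (le_trans s0 st).
  rewrite -/(pz _ _); have -> : \sum_(j < maxn n N) unfp P z Tf j t = \sum_(j < maxn n N) p j t by [].
  lra.
Qed.

End UnfoldedAsymptotics.

Section LawTransfer.
Context {R : realType} {d d' : measure_display} {T : measurableType d} {T' : measurableType d'}.
Variables (P : probability T R) (P' : probability T' R) (G : T' -> R -> R).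

Lemma cvg_law_eventually (X Y : nat -> T -> R -> R) : (\forall n \near \oo, X n = Y n) ->
  cvg_law_skorokhod \oo P X P' G -> cvg_law_skorokhod \oo P Y P' G.
Proof.
move=> XY h H bH cH; have := h H bH cH; apply: cvg_trans; apply: near_eq_cvg.
by move: XY; apply: filterS => n ->.
Qed.

(** Convergence along the filter at infinity is tested on sequences; replacing u n by its maximum
    with r0 changes only finitely many terms. *)
Lemma cvg_law_pinfty (X : R -> T -> R -> R) (r0 : R) :
  (forall R_ : nat -> R, (forall n, r0 <= R_ n) -> R_ n @[n --> \oo] --> +oo ->
    cvg_law_skorokhod \oo P (fun n => X (R_ n)) P' G) ->
  cvg_law_skorokhod +oo P X P' G.
Proof.
move=> h H bH cH; apply/cvge_pinftyP => u uoo.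
have um : maxr (u n) r0 @[n --> \oo] --> +oo.
  apply/cvgryPge => A; move/cvgryPge: uoo => /(_ A); apply: filterS => n h1.
  by rewrite le_max h1.
have r0m n : r0 <= maxr (u n) r0 by rewrite le_max lexx orbT.
apply: (@cvg_law_eventually (fun n => X (maxr (u n) r0)) (fun n => X (u n))) => //; last exact: h.
by move/cvgryPge: uoo => /(_ r0); apply: filterS => n h1; rewrite max_l.
Qed.

End LawTransfer.

Lemma gauss_for_covariance {R : realType} (Phi : R -> R) (K : R) (ap : \bar R) (P' : probability R R) (G : R -> R -> R) :
  (forall x, 0 <= Phi x) -> (forall x, Phi x <= 1) -> (forall x y : R, x <= y -> Phi y <= Phi x) ->
  (forall n, \sum_(j < n) Phi j.+1%:R <= K) ->
  nonneg_def (cov Phi ap) -> gauss_for (cov Phi ap) P' G ->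
  centred_gaussian_process P' G /\ covariance_spec P' G Phi ap.
Proof.
move=> P0 P1 Pm PK pC [mG cG _ hG]; have symC := @cov_sym R Phi ap; split.
  exact: (gaussian_process_spec pC mG cG hG).
move=> s t s0 st; have t0 : 0 < t := lt_le_trans s0 st.
rewrite (gaussian_covariance symC pC mG hG (ltW s0) (ltW t0)).
rewrite /cov s0 t0/= min_l// max_r// /covf /Rintegral fineK//.
exact: (@integrable_fin_num _ _ _ (@lebesgue_measure R) _ (cutset_measurable ap) _ (covf_integrable P0 P1 Pm PK ap s0 t0)).
Qed.

(** * The unfolded radii of the rotation-invariant process *)

Section RotationInvariant.
Context {R : realType} (alpha : nat) (mu : {measure set (R * R)%type -> \bar R}) (rho : int -> R -> R).
Context {d : measure_display} {Omega : measurableType d} (P : probability Omega R) (X : int -> Omega -> R).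
Hypotheses (fin : forall r : R, (\sum_(0 <= j <oo) lam mu rho (j%:Z - alpha%:Z) r < +oo)%E)
  (mX : forall k : int, - (alpha%:Z) <= k -> measurable_fun setT (X k))
  (lawX : forall (k : int) (r : R), - (alpha%:Z) <= k -> P [set w | X k w < r] = lam mu rho k r)
  (iX : mutually_independent P [set k : int | - (alpha%:Z) <= k] X).
Local Notation Tf := (Tfun alpha mu rho).

Definition modulus (j : nat) (w : Omega) : R := X (j%:Z - alpha%:Z) w.

Let index_ge (j : nat) : - (alpha%:Z) <= j%:Z - alpha%:Z.
Proof. by rewrite lerDr. Qed.

Lemma modulus_measurable j : measurable_fun setT (modulus j).
Proof. exact: mX. Qed.

Let F j (x : R) := Pr P [set w | modulus j w < x].

Let lamE j (r : R) : lam mu rho (j%:Z - alpha%:Z) r = (F j r)%:E.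
Proof. by rewrite -lawX// /F -PrE//; apply: measurable_lt; exact: modulus_measurable. Qed.

Let TfE (r : R) : Tf r = fine (\sum_(0 <= j <oo) (F j r)%:E)%E.
Proof. by rewrite /Tfun; congr fine; apply: eq_eseriesr => j _; rewrite lamE. Qed.

Let approx (r : R) : (forall n, \sum_(j < n) F j r <= Tf r) /\
  forall e : R, 0 < e -> exists n, Tf r - e <= \sum_(j < n) F j r.
Proof.
rewrite TfE; apply: nneseries_approx => [j|]; first exact: Pr_ge0.
by have := fin r; under eq_eseriesr do rewrite lamE.
Qed.

Lemma Tfun_ub n (r : R) : \sum_(j < n) F j r <= Tf r.
Proof. exact: (approx r).1. Qed.

Lemma Tfun_lb (r e : R) : 0 < e -> exists n, Tf r - e <= \sum_(j < n) F j r.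
Proof. exact: (approx r).2. Qed.

Lemma Tfun_nonpos (r : R) : r <= 0 -> Tf r = 0.
Proof.
move=> r0; rewrite /Tfun eseries0// => j _ _; rewrite /lam.
have -> : [set z | cabs z < r] = set0 by apply/seteqP; split => // z /=; have := sqrtr_ge0 (z.1 ^+ 2 + z.2 ^+ 2); rewrite /cabs; lra.
by rewrite integral_set0.
Qed.

(** Index shift: the unfolded radii are numbered from 1, the moduli here from 0, modulus 0 being the
    one of order -alpha. *)
Lemma GamE j w : Gam alpha mu rho X j.+1 w = Tf (modulus j w).
Proof. by rewrite /Gam /modulus; congr (Tf (X _ w)); lia. Qed.

Lemma Tfun_measurable : measurable_fun setT Tf.
Proof.
apply: nondecreasing_measurable => // x y; exact: (Tf_mono modulus_measurable Tfun_ub Tfun_lb).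
Qed.

(** Independence of the moduli is stated over integer orders k >= -alpha; the sets are transported
    through T and the translation by alpha. *)
Lemma unfolded_independent n (B : nat -> set R) : (forall i, measurable (B i)) ->
  Pr P [set w | forall i, (i < n)%N -> B i (Tf (modulus i w))] =
  \prod_(i < n) Pr P ((fun w => Tf (modulus i w)) @^-1` B i).
Proof.
move=> mB; pose B' (k : int) := Tf @^-1` B (absz (k + alpha%:Z)).
have B'E (j : nat) : B' (j%:Z - alpha%:Z) = Tf @^-1` B j by rewrite /B' subrK absz_nat.
have mB' k : measurable (B' k) by rewrite /B' -[X in measurable X]setTI; apply: Tfun_measurable.
pose S := [seq (j%:Z - alpha%:Z)%R | j <- iota 0 n].
have uS : uniq S by rewrite map_inj_uniq ?iota_uniq// => i j; lia.
have DS i : i \in S -> - (alpha%:Z) <= i by move=> /mapP[j _ ->]; exact: index_ge.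
have PE (j : nat) : P (X (j%:Z - alpha%:Z) @^-1` B' (j%:Z - alpha%:Z)) =
    (Pr P ((fun w => Tf (modulus j w)) @^-1` B j))%:E.
  rewrite B'E -PrE// -[X in measurable X]setTI.
  exact: (measurableT_comp Tfun_measurable (modulus_measurable j)).
have := iX uS DS mB'; rewrite big_map; under eq_bigr do rewrite PE.
rewrite prod_EFin /Pr => h.
have -> : [set w | forall i, (i < n)%N -> B i (Tf (modulus i w))] =
    [set w | forall i, i \in S -> B' i (X i w)].
  apply/seteqP; split => w /= hw i.
    by move=> /mapP[j]; rewrite mem_iota => /andP[_ jn] ->; rewrite B'E; exact: hw.
  move=> ni; have := hw (i%:Z - alpha%:Z); rewrite B'E; apply.
  by apply/mapP; exists i => //; rewrite mem_iota.
rewrite h/= -(big_mkord xpredT (fun i => fine (P ((fun w => Tf (modulus i w)) @^-1` B i)))).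
by rewrite /index_iota subn0.
Qed.

End RotationInvariant.

Theorem theorem1p15 (R : realType) (alpha : nat)
    (mu : {measure set (R * R)%type -> \bar R}) (rho : int -> R -> R)
    (d : measure_display) (Omega : measurableType d) (P : probability Omega R)
    (X : int -> Omega -> R)
    (Sig Phi Psi : R -> R) (theta : R -> nat -> R) :
  radon_on_C mu ->
  (forall k : int, - (alpha%:Z) <= k -> measurable_fun setT (rho k)) ->
  (forall k : int, - (alpha%:Z) <= k -> lam_total mu rho k = 1%E) ->
  (forall r : R, (\sum_(0 <= j <oo) lam mu rho (j%:Z - alpha%:Z) r < +oo)%E) ->
  (forall k : int, - (alpha%:Z) <= k -> measurable_fun setT (X k)) ->
  (forall (k : int) (r : R), - (alpha%:Z) <= k ->
      P [set w | X k w < r] = lam mu rho k r) ->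
  mutually_independent P [set k : int | - (alpha%:Z) <= k] X ->
  assumptionA0 P (Gam alpha mu rho X) Sig Phi Psi theta ->
  (* N = infinity: a^+ = +oo, limit R -> +oo *)
  (exists (d' : measure_display) (Omega' : measurableType d')
          (P' : probability Omega' R) (G : Omega' -> R -> R),
      centred_gaussian_process P' G /\ covariance_spec P' G Phi +oo%E /\
      cvg_law_skorokhod (+oo : set_system R) P
        (fun (r : R) (w : Omega) (t : R) =>
           XiInf P (Gam alpha mu rho X) (t * r) w / Num.sqrt (Sig r))
        P' G)
  /\
  (* N < infinity: R = R(N) -> +oo, a^+ = lim N / Sig_R(N), condition (N) *)
  (forall (RN : nat -> R) (ap : \bar R),
      RN n @[n --> \oo] --> +oo ->
      ((N%:R / Sig (RN N))%:E)%E @[N --> \oo] --> ap ->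
      conditionN Sig Phi RN ap ->
      exists (d' : measure_display) (Omega' : measurableType d')
             (P' : probability Omega' R) (G : Omega' -> R -> R),
        centred_gaussian_process P' G /\ covariance_spec P' G Phi ap /\
        cvg_law_skorokhod (\oo : set_system nat) P
          (fun (N : nat) (w : Omega) (t : R) =>
             XiN P (Gam alpha mu rho X) N (t * RN N) w / Num.sqrt (Sig (RN N)))
          P' G).
Proof.
move=> _ _ _ fin mX lawX iX [_ [_ [Sc [Soo [[muZ [dom [EZ PhiE]]] [wPsi [th0 [thcv [C [C0 hC]]]]]]]]]].
pose z := modulus alpha X; pose zeta j w := Tfun alpha mu rho (z j w).
have mz := modulus_measurable mX.
have T1 := Tfun_ub fin mX lawX.
have T2 := Tfun_lb fin mX lawX.
have T0 := Tfun_nonpos alpha mu rho.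
have mzt : forall j, measurable_fun setT (zeta j) := unf_measurable mz T1 T2.
have iz := unfolded_independent fin mX lawX iX.
have pE j r : prob_le P (Gam alpha mu rho X) j.+1 r = pz P zeta j r.
  by rewrite /prob_le /pz /Pr; congr (fine (P _)); apply/seteqP; split => w /=; rewrite GamE.
have XE n r w : \sum_(1 <= k < n.+1) (((Gam alpha mu rho X k w <= r)%R)%:R - prob_le P (Gam alpha mu rho X) k r)
    = Xi P zeta n r w.
  by rewrite big_add1/= big_mkord; apply: eq_bigr => j _; rewrite pE GamE.
have P0 := Phi_ge0 PhiE; have P1 := Phi_le1 PhiE; have Pm := Phi_mono PhiE; have Pc := Phi_cvg dom PhiE.
have [K [_ PK]] := Phi_sum EZ PhiE.
have [E2 [r0 [E20 r00 Sig1 pPhi']]] := approx_tail Soo wPsi th0 thcv C0 hC.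
have pPhi (r : R) n : r0 <= r -> \sum_(j < n) `|pz P zeta j r - Phi (j.+1%:R / Sig r)| <= E2.
  by move=> rr; have := pPhi' r n rr; under eq_bigr do rewrite pE.
have Scl (r : R) : r0 < r -> Sig x @[x --> r^'-] --> Sig r.
  move=> rr; apply: cvg_at_left_filter; have /continuous_within_itvcyP[h _] := Sc; apply: h.
  by rewrite in_itv/= (lt_trans r00 rr).
have [c [E3 [M [c0 M0 hc B0 B3]]]] := unfolded_linear mz T1 T2 T0 P0 P1 Pm PK E20 r00 Sig1 pPhi Scl.
have pbdd (r : R) : 0 <= r -> exists M : R, forall n, \sum_(j < n) pz P zeta j r <= M.
  exact: (unfp_bdd mz T1 T2 T0).
split.
  (* Any sequence tending to infinity serves to obtain the covariance properties and to build G; the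
     limit theorem is then applied along every other sequence with the same G. *)
  pose R_ n : R := r0 + n%:R.
  have RL n : r0 <= R_ n by rewrite lerDl.
  have Roo : R_ n @[n --> \oo] --> +oo.
    apply/cvgryPge => A; near=> n; have h : A <= n%:R by near: n; exact: nbhs_infty_ger.
    by apply: (le_trans h); rewrite lerDr ltW.
  have [N_ hN] := exists_truncation r00 Sig1 pbdd RL.
  have hap := truncation_cvg Sig1 RL (fun n => (hN n).1).
  have [pC [P' [G hG]]] := limit_gaussian mzt P0 P1 Pm Pc PK r00 Sig1 pPhi c0 hc B0 B3 RL Roo hap.
  have [g1 g2] := gauss_for_covariance P0 P1 Pm PK pC hG.
  exists _, _, P', G; split => //; split => //.
  apply: (@cvg_law_pinfty _ _ _ _ _ _ _ _ _ r0) => R1 RL1 Roo1.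
  have := limit_inf mzt iz P0 P1 Pm Pc PK r00 Sig1 pPhi c0 hc M0 B0 B3 pbdd RL1 Roo1 hG.
  apply: cvg_law_eventually; apply: nearW => n; apply/funext => w; apply/funext => t.
  by congr (_ / _); rewrite /XiInf /XiLim; congr (limn _); apply/funext => m; rewrite XE.
move=> RN ap RNoo hap _.
(* The estimates hold from r0 on; the maximum modifies only finitely many radii. *)
pose R_ n : R := maxr (RN n) r0.
have RL n : r0 <= R_ n by rewrite le_max lexx orbT.
have RE : \forall n \near \oo, R_ n = RN n.
  by move/cvgryPge: RNoo => /(_ r0); apply: filterS => n h1; rewrite /R_ max_l.
have Roo : R_ n @[n --> \oo] --> +oo.
  by apply: cvg_trans RNoo; apply: near_eq_cvg; move: RE; apply: filterS => n ->.
have hap' : (n%:R / Sig (R_ n))%:E @[n --> \oo] --> ap.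
  by apply: cvg_trans hap; apply: near_eq_cvg; move: RE; apply: filterS => n ->.
have [pC [P' [G hG]]] :=
  @limit_gaussian _ _ _ P zeta mzt Sig Phi K E2 r0 c E3 M P0 P1 Pm Pc PK r00 Sig1 pPhi c0 hc B0 B3 R_ id ap RL Roo hap'.
have [g1 g2] := gauss_for_covariance P0 P1 Pm PK pC hG.
exists _, _, P', G; split => //; split => //.
have := @limit_fin _ _ _ P zeta mzt iz Sig Phi K E2 r0 c E3 M P0 P1 Pm Pc PK r00 Sig1 pPhi c0 hc M0 B0 B3 R_ id ap RL Roo hap' P' G hG.
apply: cvg_law_eventually; move: RE; apply: filterS => n ->.
by apply/funext => w; apply/funext => t; rewrite /XiN XE.
Unshelve. all: by end_near. Qed.
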